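(* Let $\psi\in(0,\pi)$ and $\psi_0=\min\{\psi,\pi-\psi\}$. The family $(T(\tau))_{\tau\in\Sigma_{\psi_0}}$ of shifts $(T(\tau)f)(z)=f(z+\tau)$ is a bounded holomorphic $C_0$-semigroup on each of the spaces $H^1(\Sigma_\psi)$ and $\mathcal{H}_\psi$.
   Context: $\Sigma_\psi=\{z\ne0:|\arg z|<\psi\}$. $H^1(\Sigma_\psi)$: holomorphic $f$ on $\Sigma_\psi$ with $\|f\|_{H^1(\Sigma_\psi)}=\sup_{|\varphi|<\psi}\int_0^\infty(|f(te^{i\varphi})|+|f(te^{-i\varphi})|)dt<\infty$ (a Banach space). $\mathcal{H}_\psi=\{f\in\mathrm{Hol}(\Sigma_\psi):f'\in H^1(\Sigma_\psi)\}$ with norm $\|f\|_{\mathcal{H}_\psi}=\sup_{\Sigma_\psi}|f|+\|f'\|_{H^1(\Sigma_\psi)}$ (a Banach algebra). A bounded holomorphic $C_0$-semigroup on the sector means $\tau\mapsto T(\tau)$ is holomorphic on $\Sigma_{\psi_0}$, satisfies the semigroup law, and is bounded and strongly continuous at $0$ on each smaller closed subsector. *)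

(* Defs.v *)
From Stdlib Require Import Reals ClassicalEpsilon.
From Coquelicot Require Import Coquelicot.
Open Scope R_scope.

Definition polar (r phi : R) : C := (r * cos phi, r * sin phi).

Definition sector (psi : R) (z : C) : Prop :=
  exists r phi, 0 < r /\ Rabs phi < psi /\ z = polar r phi.

Definition csector (psi' : R) (z : C) : Prop :=
  exists r phi, 0 < r /\ Rabs phi <= psi' /\ z = polar r phi.

Definition holo_on (psi : R) (f : C -> C) : Prop :=
  forall z, sector psi z -> ex_derive f z.

(* \int_0^\infty g(t) dt for g >= 0 continuous on (0,oo), in [0,+oo]:
   the (improper at both ends) Riemann integral if it converges, +oo otherwise *)
Definition int0inf (g : R -> R) : Rbar :=
  match excluded_middle_informative
          (exists l, is_RInt_gen g (at_right 0) (Rbar_locally p_infty) l) with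
  | left H => Finite (proj1_sig (constructive_indefinite_description _ H))
  | right _ => p_infty
  end.

Definition H1norm_bar (psi : R) (f : C -> C) : Rbar :=
  Lub_Rbar (fun x => exists phi, Rabs phi < psi /\
     Rbar_le (Finite x)
       (int0inf (fun t => Cmod (f (polar t phi)) + Cmod (f (polar t (- phi)))))).

Definition inH1 (psi : R) (f : C -> C) : Prop :=
  holo_on psi f /\ is_finite (H1norm_bar psi f).

Definition H1norm (psi : R) (f : C -> C) : R := real (H1norm_bar psi f).

Definition supnorm_bar (psi : R) (f : C -> C) : Rbar :=
  Lub_Rbar (fun x => exists z, sector psi z /\ x = Cmod (f z)).

Definition inHpsi (psi : R) (f : C -> C) : Prop :=
  holo_on psi f /\ is_finite (supnorm_bar psi f) /\ inH1 psi (C_derive f).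

Definition Hpsinorm (psi : R) (f : C -> C) : R :=
  real (supnorm_bar psi f) + H1norm psi (C_derive f).

Definition shift (tau : C) (f : C -> C) : C -> C := fun z => f (Cplus z tau).

Definition bounded_holo_C0_shift_semigroup (psi0 : R)
    (X : (C -> C) -> Prop) (nrm : (C -> C) -> R) : Prop :=
  (forall tau, sector psi0 tau ->
     (forall f, X f -> X (shift tau f)) /\
     exists M, forall f, X f -> nrm (shift tau f) <= M * nrm f)
  /\
  (forall tau1 tau2 f, sector psi0 tau1 -> sector psi0 tau2 -> X f ->
     shift (Cplus tau1 tau2) f = shift tau1 (shift tau2 f))
  /\
  (forall tau0, sector psi0 tau0 ->
     exists A : (C -> C) -> (C -> C),
       (forall f, X f -> X (A f)) /\
       (forall f g (a : C), X f -> X g ->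
          nrm (fun z => Cminus (A (fun w => Cplus (f w) (Cmult a (g w))) z)
                               (Cplus (A f z) (Cmult a (A g z)))) = 0) /\
       (exists M, forall f, X f -> nrm (A f) <= M * nrm f) /\
       (forall eps, 0 < eps -> exists delta, 0 < delta /\
          forall h : C, 0 < Cmod h < delta -> sector psi0 (Cplus tau0 h) ->
          forall f, X f ->
            nrm (fun z => Cminus
                   (Cdiv (Cminus (shift (Cplus tau0 h) f z) (shift tau0 f z)) h)
                   (A f z)) <= eps * nrm f))
  /\
  (forall psi', 0 < psi' < psi0 ->
     (exists M, forall tau, csector psi' tau -> forall f, X f ->
        nrm (shift tau f) <= M * nrm f) /\
     (forall f, X f -> forall eps, 0 < eps -> exists delta, 0 < delta /\
        forall tau, csector psi' tau -> Cmod tau < delta ->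
          nrm (fun z => Cminus (shift tau f z) (f z)) <= eps)).

(* Main.v *)
(* Write a point of the sector as [t e^(i phi)].  Cauchy's formula over the boundary of the subsector between
   two rays, the arcs being negligible because the rays of an [H^1] function have bounded [L^1] norm, expresses
   [f (z + tau)] through the values of [f] on the two rays.  Taking one of them to be the ray through [z] and
   reflecting the pole in it gives a Poisson kernel on that ray and a kernel of size [|tau| / (s + |tau| + t)^2]
   on the other, hence a bound on the shift that is uniform in [arg z], although [z] may approach the boundary.
   Cauchy estimates on a small square around [tau0], integrated along the rays, give the derivative in [tau].

   For the strong continuity on the rays with [|phi| <= y < psi] one compares the Cauchy kernels at [z] and
   [z + tau] on two outer rays.  Near the boundary this degenerates, and one needs F. Riesz's theorem that
   [e^(i phi) f(t e^(i phi))] converges in [L^1] as [phi -> psi].  In logarithmic coordinates [f] becomes a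
   function [G] on a strip; as [sqrt |G|] is subharmonic, applying the mean value inequality to [G + G(x, y)]
   bounds the integral of a deficit by the gain of the [L^1] norms between two lines, which is small near the
   boundary, and the deficit controls the distance.  A ray near the boundary is then compared with a rotated
   interior one, the difference being shifted with the uniform bound.

   For [f] with [f'] in [H^1], the difference [f (z + tau) - f z] tends to 0 along each ray when [f] is bounded,
   so its supremum is at most the [L^1] norm of its derivative. *)

Require Import Defs.
From Stdlib Require Import Reals Lra Lia Psatz ClassicalEpsilon FunctionalExtensionality Classical.
From Coquelicot Require Import Coquelicot.
Open Scope R_scope.

(** * Continuity and integration *)

(** The half-angle min(psi, pi - psi) has two roles: an argument below psi keeps z + tau in the
    sector, and one below pi - psi keeps the angle between z and tau under pi, so that |z + tau| is
    comparable with |z| + |tau| and every kernel estimate is scale invariant. The reflected pole is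
    forced: the modulus of the Cauchy kernel alone, integrated along a line parallel to the ray,
    depends logarithmically on the distance of the two, whereas the Poisson kernel has mass at most
    2 pi at any distance. The square root is forced too. |G| itself is subharmonic, but |g + b| =
    |g| + |b| holds for every nonnegative multiple g of b, so a deficit built from it would only see
    directions. The strictness of the inequality between geometric and arithmetic mean makes
    equality force g = b. Only a Cauchy criterion is proved near the boundary; no boundary function
    is constructed. *)

Lemma continuous_C_eps (f : C -> C) (z : C) :
  continuous f z <->
  (forall eps, 0 < eps -> exists delta, 0 < delta /\
     forall w, Cmod (w - z) < delta -> Cmod (f w - f z) < eps).
Proof.
  (* Balls of [C_UniformSpace] are those of the product, hence squares; [sqrt 2] compares squares
     with discs. *)
  assert (Hs : 0 < sqrt 2) by (apply sqrt_lt_R0; lra).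
  split.
  - intros H eps Heps.
    assert (He : 0 < eps / sqrt 2) by (apply Rdiv_lt_0_compat; lra).
    destruct (proj1 (filterlim_locally (U := C_UniformSpace) f (f z)) H (mkposreal _ He)) as [d Hd].
    exists d; split; [apply cond_pos|].
    intros w Hw.
    assert (Hb : ball z d w) by (apply C_NormedModule_mixin_compat1; exact Hw).
    generalize (C_NormedModule_mixin_compat2 _ _ _ (Hd _ Hb)); simpl.
    replace (sqrt 2 * (eps / sqrt 2)) with eps by (field; lra).
    exact (fun h => h).
  - intros H. apply (filterlim_locally (U := C_UniformSpace)).
    intros eps. destruct (H eps (cond_pos eps)) as (d & Hd & Hf).
    assert (He : 0 < d / sqrt 2) by (apply Rdiv_lt_0_compat; lra).
    exists (mkposreal _ He). intros w Hw.
    apply C_NormedModule_mixin_compat1. apply Hf.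
    generalize (C_NormedModule_mixin_compat2 _ _ _ Hw); simpl.
    replace (sqrt 2 * (d / sqrt 2)) with d by (field; lra).
    exact (fun h => h).
Qed.

Lemma is_derive_C_eps (f : C -> C) (z l : C) :
  is_derive f z l <->
  (forall eps, 0 < eps -> exists delta, 0 < delta /\
     forall w, Cmod (w - z) < delta -> Cmod (f w - f z - l * (w - z)) <= eps * Cmod (w - z)).
Proof.
  split.
  - intros [_ H] eps Heps.
    destruct (H z (fun P HP => HP) (mkposreal _ Heps)) as [d Hd].
    exists d; split; [apply cond_pos|].
    intros w Hw. generalize (Hd w Hw). simpl.
    replace (f w - f z - l * (w - z))%C with
      (minus (minus (f w) (f z)) (scal (minus w z) l)).
    exact (fun h => h).
    change (f w - f z - (w - z) * l = f w - f z - l * (w - z))%C. ring.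
  - intros H. split. apply (is_linear_scal_l (K := C_AbsRing) (V := C_NormedModule)).
    intros y Hy.
    assert (y = z) as ->.
    { symmetry. apply (is_filter_lim_locally_unique (K := C_AbsRing) (V := AbsRing_NormedModule C_AbsRing)). exact Hy. }
    intros eps. destruct (H eps (cond_pos eps)) as (d & Hd & Hf).
    exists (mkposreal _ Hd). intros w Hw.
    specialize (Hf w Hw).
    replace (f w - f z - l * (w - z))%C with
      (minus (minus (f w) (f z)) (scal (minus w z) l)) in Hf.
    exact Hf.
    change (f w - f z - (w - z) * l = f w - f z - l * (w - z))%C. ring.
Qed.

Lemma ex_derive_C_continuous (f : C -> C) (z : C) :
  ex_derive (K := C_AbsRing) (V := C_NormedModule) f z -> continuous f z.
Proof.
  intros [l Hl]. apply continuous_C_eps. intros eps Heps.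
  destruct (proj1 (is_derive_C_eps f z l) Hl 1 Rlt_0_1) as (d & Hd & Hf).
  assert (Hc : 0 < 1 + Cmod l) by (generalize (Cmod_ge_0 l); lra).
  exists (Rmin d (eps / (1 + Cmod l))). split.
  { apply Rmin_pos; auto. apply Rdiv_lt_0_compat; lra. }
  intros w Hw.
  specialize (Hf w (Rlt_le_trans _ _ _ Hw (Rmin_l _ _))).
  replace (f w - f z)%C with ((f w - f z - l * (w - z)) + l * (w - z))%C by ring.
  eapply Rle_lt_trans; [apply Cmod_triangle|]. rewrite Cmod_mult.
  apply Rle_lt_trans with ((1 + Cmod l) * Cmod (w - z)); [lra|].
  apply Rlt_le_trans with ((1 + Cmod l) * (eps / (1 + Cmod l))).
  - apply Rmult_lt_compat_l; auto.
    apply (Rlt_le_trans _ _ _ Hw (Rmin_r _ _)).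
  - right; field; lra.
Qed.

Lemma continuous_C_pair {X : UniformSpace} (f g : X -> R) (x : X) :
  continuous f x -> continuous g x -> continuous (fun t => (f t, g t) : C) x.
Proof.
  intros Hf Hg.
  apply (filterlim_filter_le_2 (F := locally x) (G := filter_prod (locally (f x)) (locally (g x)))).
  - intros P [eps HP]. exists (ball (f x) eps) (ball (g x) eps).
    apply locally_ball. apply locally_ball.
    intros u v Hu Hv. apply HP. split; assumption.
  - apply filterlim_pair; assumption.
Qed.

Lemma continuous_Re {X : UniformSpace} (f : X -> C) (x : X) :
  continuous f x -> continuous (fun t => Re (f t)) x.
Proof. intros H. apply (continuous_comp f fst x H). apply continuous_fst. Qed.

Lemma continuous_Im {X : UniformSpace} (f : X -> C) (x : X) :
  continuous f x -> continuous (fun t => Im (f t)) x.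
Proof. intros H. apply (continuous_comp f snd x H). apply continuous_snd. Qed.

Lemma continuous_Rplus {X : UniformSpace} (f g : X -> R) (x : X) :
  continuous f x -> continuous g x -> continuous (fun t => f t + g t) x.
Proof. apply (continuous_plus (V := R_NormedModule)). Qed.

Lemma continuous_Rminus {X : UniformSpace} (f g : X -> R) (x : X) :
  continuous f x -> continuous g x -> continuous (fun t => f t - g t) x.
Proof. apply (continuous_minus (V := R_NormedModule)). Qed.

Lemma continuous_Ropp {X : UniformSpace} (f : X -> R) (x : X) :
  continuous f x -> continuous (fun t => - f t) x.
Proof. apply (continuous_opp (V := R_NormedModule)). Qed.

Lemma continuous_Rmult {X : UniformSpace} (f g : X -> R) (x : X) :
  continuous f x -> continuous g x -> continuous (fun t => f t * g t) x.
Proof. apply (continuous_mult (K := R_AbsRing)). Qed.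

Lemma continuous_Rcomp {X : UniformSpace} (h : R -> R) (f : X -> R) (x : X) :
  continuous f x -> continuous h (f x) -> continuous (fun t => h (f t)) x.
Proof. intros. apply (continuous_comp f h x); assumption. Qed.

Lemma continuous_cos_comp {X : UniformSpace} (f : X -> R) (x : X) :
  continuous f x -> continuous (fun t => cos (f t)) x.
Proof.
  intros H. apply (continuous_Rcomp cos); auto. apply continuity_pt_filterlim, continuity_cos.
Qed.

Lemma continuous_sin_comp {X : UniformSpace} (f : X -> R) (x : X) :
  continuous f x -> continuous (fun t => sin (f t)) x.
Proof.
  intros H. apply (continuous_Rcomp sin); auto. apply continuity_pt_filterlim, continuity_sin.
Qed.

Lemma continuous_exp_comp {X : UniformSpace} (f : X -> R) (x : X) :
  continuous f x -> continuous (fun t => exp (f t)) x.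
Proof.
  intros H. apply (continuous_Rcomp exp); auto. apply continuity_pt_filterlim.
  apply derivable_continuous_pt, derivable_pt_exp.
Qed.

Lemma continuous_sqrt_comp {X : UniformSpace} (f : X -> R) (x : X) :
  continuous f x -> continuous (fun t => sqrt (f t)) x.
Proof. intros H. apply (continuous_Rcomp sqrt); auto. apply continuous_sqrt. Qed.

Lemma continuous_Rabs_c {X : UniformSpace} (f : X -> R) (x : X) :
  continuous f x -> continuous (fun t => Rabs (f t)) x.
Proof. intros H. apply (continuous_Rcomp Rabs); auto. apply continuous_Rabs. Qed.

Lemma continuous_Rinv_c {X : UniformSpace} (f : X -> R) (x : X) :
  continuous f x -> f x <> 0 -> continuous (fun t => / f t) x.
Proof. intros H H0. apply (continuous_Rcomp Rinv); auto. apply continuous_Rinv; auto. Qed.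

Lemma continuous_Rdiv_c {X : UniformSpace} (f g : X -> R) (x : X) :
  continuous f x -> continuous g x -> g x <> 0 -> continuous (fun t => f t / g t) x.
Proof. intros. apply continuous_Rmult; auto. apply continuous_Rinv_c; auto. Qed.

Lemma continuous_pow2 {X : UniformSpace} (f : X -> R) (n : nat) (x : X) :
  continuous f x -> continuous (fun t => f t ^ n) x.
Proof.
  intros H. induction n; simpl. apply continuous_const. apply continuous_Rmult; auto.
Qed.

Lemma continuous_Cplus {X : UniformSpace} (f g : X -> C) (x : X) :
  continuous f x -> continuous g x -> continuous (fun t => (f t + g t)%C) x.
Proof.
  intros Hf Hg.
  exact (continuous_C_pair (fun t => Re (f t) + Re (g t)) (fun t => Im (f t) + Im (g t)) x
    (continuous_Rplus _ _ _ (continuous_Re f x Hf) (continuous_Re g x Hg))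
    (continuous_Rplus _ _ _ (continuous_Im f x Hf) (continuous_Im g x Hg))).
Qed.

Lemma continuous_Copp {X : UniformSpace} (f : X -> C) (x : X) :
  continuous f x -> continuous (fun t => (- f t)%C) x.
Proof.
  intros Hf.
  exact (continuous_C_pair (fun t => - Re (f t)) (fun t => - Im (f t)) x
    (continuous_Ropp _ _ (continuous_Re f x Hf)) (continuous_Ropp _ _ (continuous_Im f x Hf))).
Qed.

Lemma continuous_Cminus {X : UniformSpace} (f g : X -> C) (x : X) :
  continuous f x -> continuous g x -> continuous (fun t => (f t - g t)%C) x.
Proof. intros. apply continuous_Cplus; auto. apply continuous_Copp; auto. Qed.

Lemma continuous_Cmult {X : UniformSpace} (f g : X -> C) (x : X) :
  continuous f x -> continuous g x -> continuous (fun t => (f t * g t)%C) x.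
Proof.
  intros Hf Hg.
  pose proof (continuous_Re f x Hf) as Rf. pose proof (continuous_Im f x Hf) as If.
  pose proof (continuous_Re g x Hg) as Rg. pose proof (continuous_Im g x Hg) as Ig.
  exact (continuous_C_pair (fun t => Re (f t) * Re (g t) - Im (f t) * Im (g t))
    (fun t => Re (f t) * Im (g t) + Im (f t) * Re (g t)) x
    (continuous_Rminus _ _ _ (continuous_Rmult _ _ _ Rf Rg) (continuous_Rmult _ _ _ If Ig))
    (continuous_Rplus _ _ _ (continuous_Rmult _ _ _ Rf Ig) (continuous_Rmult _ _ _ If Rg))).
Qed.

Lemma continuous_Cmod {X : UniformSpace} (f : X -> C) (x : X) :
  continuous f x -> continuous (fun t => Cmod (f t)) x.
Proof.
  intros Hf.
  exact (continuous_sqrt_comp (fun t => Re (f t) ^ 2 + Im (f t) ^ 2) x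
    (continuous_Rplus _ _ _ (continuous_pow2 _ 2 _ (continuous_Re f x Hf))
       (continuous_pow2 _ 2 _ (continuous_Im f x Hf)))).
Qed.

Lemma Csqr_norm_neq_0 (z : C) : z <> 0 -> fst z ^ 2 + snd z ^ 2 <> 0.
Proof.
  intros H H0. apply H. destruct z as [a b]; simpl in *.
  assert (a = 0) by nra. assert (b = 0) by nra. subst; reflexivity.
Qed.

Lemma continuous_Cinv {X : UniformSpace} (f : X -> C) (x : X) :
  continuous f x -> f x <> 0 -> continuous (fun t => (/ f t)%C) x.
Proof.
  intros Hf H0. generalize (Csqr_norm_neq_0 _ H0); intros H1.
  pose proof (continuous_Re f x Hf) as Rf. pose proof (continuous_Im f x Hf) as If.
  assert (N : continuous (fun t => Re (f t) ^ 2 + Im (f t) ^ 2) x)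
    by exact (continuous_Rplus _ _ _ (continuous_pow2 _ 2 _ Rf) (continuous_pow2 _ 2 _ If)).
  exact (continuous_C_pair (fun t => Re (f t) / (Re (f t) ^ 2 + Im (f t) ^ 2))
    (fun t => - Im (f t) / (Re (f t) ^ 2 + Im (f t) ^ 2)) x
    (continuous_Rdiv_c _ _ _ Rf N H1)
    (continuous_Rdiv_c _ _ _ (continuous_Ropp _ _ If) N H1)).
Qed.

Lemma continuous_Cdiv {X : UniformSpace} (f g : X -> C) (x : X) :
  continuous f x -> continuous g x -> g x <> 0 -> continuous (fun t => (f t / g t)%C) x.
Proof. intros. apply continuous_Cmult; auto. apply continuous_Cinv; auto. Qed.

Lemma continuous_Cconj {X : UniformSpace} (f : X -> C) (x : X) :
  continuous f x -> continuous (fun t => Cconj (f t)) x.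
Proof.
  intros Hf.
  exact (continuous_C_pair (fun t => Re (f t)) (fun t => - Im (f t)) x
    (continuous_Re f x Hf) (continuous_Ropp _ _ (continuous_Im f x Hf))).
Qed.

Lemma continuous_RtoC {X : UniformSpace} (f : X -> R) (x : X) :
  continuous f x -> continuous (fun t => RtoC (f t)) x.
Proof. intros Hf. apply continuous_C_pair; auto. apply continuous_const. Qed.

Lemma continuous_polar {X : UniformSpace} (f g : X -> R) (x : X) :
  continuous f x -> continuous g x -> continuous (fun t => polar (f t) (g t)) x.
Proof.
  intros. apply continuous_C_pair; apply continuous_Rmult; auto;
  [apply continuous_cos_comp | apply continuous_sin_comp]; auto.
Qed.

Lemma continuous_Ccomp {X : UniformSpace} {Y : UniformSpace} (h : C -> Y) (f : X -> C) (x : X) :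
  continuous f x -> continuous h (f x) -> continuous (fun t => h (f t)) x.
Proof. intros. apply (continuous_comp f h x); assumption. Qed.

Ltac cont1 :=
  lazymatch goal with
  | |- continuous (fun _ => ?c) _ => apply continuous_const
  | |- continuous (fun t => t) _ => apply continuous_id
  | |- continuous (fun t => Cplus (@?f t) (@?g t)) _ => apply (continuous_Cplus f g)
  | |- continuous (fun t => Cminus (@?f t) (@?g t)) _ => apply (continuous_Cminus f g)
  | |- continuous (fun t => Cmult (@?f t) (@?g t)) _ => apply (continuous_Cmult f g)
  | |- continuous (fun t => Cdiv (@?f t) (@?g t)) _ => apply (continuous_Cdiv f g)
  | |- continuous (fun t => Cinv (@?f t)) _ => apply (continuous_Cinv f)
  | |- continuous (fun t => Copp (@?f t)) _ => apply (continuous_Copp f)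
  | |- continuous (fun t => Cconj (@?f t)) _ => apply (continuous_Cconj f)
  | |- continuous (fun t => RtoC (@?f t)) _ => apply (continuous_RtoC f)
  | |- continuous (fun t => Cmod (@?f t)) _ => apply (continuous_Cmod f)
  | |- continuous (fun t => polar (@?f t) (@?g t)) _ => apply (continuous_polar f g)
  | |- continuous (fun t => Re (@?f t)) _ => apply (continuous_Re f)
  | |- continuous (fun t => Im (@?f t)) _ => apply (continuous_Im f)
  | |- continuous (fun t => (@?f t, @?g t)) _ => apply (continuous_C_pair f g)
  | |- continuous (fun t => Rplus (@?f t) (@?g t)) _ => apply (continuous_Rplus f g)
  | |- continuous (fun t => Rminus (@?f t) (@?g t)) _ => apply (continuous_Rminus f g)
  | |- continuous (fun t => Ropp (@?f t)) _ => apply (continuous_Ropp f)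
  | |- continuous (fun t => Rmult (@?f t) (@?g t)) _ => apply (continuous_Rmult f g)
  | |- continuous (fun t => Rdiv (@?f t) (@?g t)) _ => apply (continuous_Rdiv_c f g)
  | |- continuous (fun t => Rinv (@?f t)) _ => apply (continuous_Rinv_c f)
  | |- continuous (fun t => pow (@?f t) ?n) _ => apply (continuous_pow2 f n)
  | |- continuous (fun t => cos (@?f t)) _ => apply (continuous_cos_comp f)
  | |- continuous (fun t => sin (@?f t)) _ => apply (continuous_sin_comp f)
  | |- continuous (fun t => exp (@?f t)) _ => apply (continuous_exp_comp f)
  | |- continuous (fun t => sqrt (@?f t)) _ => apply (continuous_sqrt_comp f)
  | |- continuous (fun t => Rabs (@?f t)) _ => apply (continuous_Rabs_c f)
  | |- continuous (fun t => fst t) _ => apply continuous_fst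
  | |- continuous (fun t => snd t) _ => apply continuous_snd
  | |- continuous fst _ => apply continuous_fst
  | |- continuous snd _ => apply continuous_snd
  end.

Ltac cont := repeat (cbv beta; cont1).

Lemma ex_RInt_cont (f : R -> R) (a b : R) :
  a <= b -> (forall t, a <= t <= b -> continuous f t) -> ex_RInt f a b.
Proof.
  intros Hab H. apply (ex_RInt_continuous (V := R_CompleteNormedModule)).
  intros z. rewrite Rmin_left, Rmax_right by lra. apply H.
Qed.

Lemma RInt_Rplus (f g : R -> R) (a b : R) :
  ex_RInt f a b -> ex_RInt g a b -> RInt (fun t => f t + g t) a b = RInt f a b + RInt g a b :> R.
Proof. apply (RInt_plus (V := R_CompleteNormedModule)). Qed.

Lemma RInt_Rminus (f g : R -> R) (a b : R) :
  ex_RInt f a b -> ex_RInt g a b -> RInt (fun t => f t - g t) a b = RInt f a b - RInt g a b :> R.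
Proof. apply (RInt_minus (V := R_CompleteNormedModule)). Qed.

Lemma RInt_Rscal (f : R -> R) (k a b : R) :
  ex_RInt f a b -> RInt (fun t => k * f t) a b = k * RInt f a b :> R.
Proof. apply (RInt_scal (V := R_CompleteNormedModule)). Qed.

Lemma RInt_Rconst (k a b : R) : RInt (fun _ => k) a b = (b - a) * k :> R.
Proof. apply (RInt_const (V := R_CompleteNormedModule)). Qed.

Lemma ex_RInt_Rplus (f g : R -> R) (a b : R) :
  ex_RInt f a b -> ex_RInt g a b -> ex_RInt (fun t => f t + g t) a b.
Proof. apply (ex_RInt_plus (V := R_NormedModule)). Qed.

Lemma ex_RInt_Rminus (f g : R -> R) (a b : R) :
  ex_RInt f a b -> ex_RInt g a b -> ex_RInt (fun t => f t - g t) a b.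
Proof. apply (ex_RInt_minus (V := R_NormedModule)). Qed.

Lemma ex_RInt_Rscal (f : R -> R) (k a b : R) :
  ex_RInt f a b -> ex_RInt (fun t => k * f t) a b.
Proof. apply (ex_RInt_scal (V := R_NormedModule)). Qed.

Lemma RInt_split (f : R -> R) (a b c : R) :
  ex_RInt f a b -> ex_RInt f b c -> RInt f a c = RInt f a b + RInt f b c :> R.
Proof. intros. symmetry. apply (RInt_Chasles (V := R_CompleteNormedModule)); auto. Qed.

Lemma RInt_eq (f g : R -> R) (a b : R) :
  a <= b -> (forall t, a <= t <= b -> f t = g t) -> RInt f a b = RInt g a b :> R.
Proof.
  intros Hab H. apply RInt_ext. intros t. rewrite Rmin_left, Rmax_right by lra.
  intros; apply H; lra.
Qed.

Lemma RInt_mono (f g : R -> R) (a b : R) :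
  a <= b -> ex_RInt f a b -> ex_RInt g a b ->
  (forall t, a <= t <= b -> f t <= g t) -> RInt f a b <= RInt g a b.
Proof. intros. apply RInt_le; auto. intros; apply H2; lra. Qed.

Lemma RInt_pos (f : R -> R) (a b : R) :
  a <= b -> ex_RInt f a b -> (forall t, a <= t <= b -> 0 <= f t) -> 0 <= RInt f a b.
Proof. intros. apply RInt_ge_0; auto. intros; apply H1; lra. Qed.

(** Truncation to [[a, b]]. Composing with it extends a function continuous on a closed rectangle to
    one continuous on the plane, so that parameter integrals and Fubini need only be proved for
    globally continuous integrands. *)
Definition clamp (a b x : R) : R := Rmax a (Rmin b x).

Lemma clamp_bounds a b x : a <= b -> a <= clamp a b x <= b.
Proof. intros. unfold clamp, Rmax, Rmin. repeat destruct Rle_dec; lra. Qed.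

Lemma clamp_id a b x : a <= x <= b -> clamp a b x = x.
Proof. intros. unfold clamp, Rmax, Rmin. repeat destruct Rle_dec; lra. Qed.

Lemma clamp_lip a b x y : Rabs (clamp a b x - clamp a b y) <= Rabs (x - y).
Proof.
  unfold clamp, Rmax, Rmin, Rabs. repeat destruct Rle_dec; repeat destruct Rcase_abs; lra.
Qed.

Lemma continuous_clamp a b x : continuous (clamp a b) x.
Proof.
  apply continuity_pt_filterlim. intros eps Heps. exists eps; split; auto.
  intros y [_ Hy]. simpl in *. unfold R_dist in *.
  eapply Rle_lt_trans; [apply clamp_lip|auto].
Qed.

Lemma continuous_2d (f : R -> R -> R) x y :
  continuous (fun p : R * R => f (fst p) (snd p)) (x, y) <-> continuity_2d_pt f x y.
Proof. symmetry. apply continuity_2d_pt_filterlim. Qed.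

Lemma continuous_RInt_param (f : R -> R -> R) (c d : R) (x : R) :
  c <= d -> (forall u v, continuity_2d_pt f u v) ->
  continuous (fun u => RInt (fun v => f u v) c d) x.
Proof.
  intros Hcd H. apply continuity_pt_filterlim. intros eps Heps.
  (* The summand 1 keeps the denominator positive when [c = d]. *)
  assert (He : 0 < eps / (2 * (d - c + 1))) by (apply Rdiv_lt_0_compat; lra).
  destruct (uniform_continuity_2d f (x - 1) (x + 1) c d (fun u v _ _ => H u v) (mkposreal _ He)) as [dl Hdl].
  exists (Rmin dl 1). split. apply Rmin_pos; [apply cond_pos|lra].
  intros y [_ Hy]. simpl in Hy. unfold R_dist in Hy. simpl. unfold R_dist.
  assert (Hy1 : Rabs (y - x) < dl) by (eapply Rlt_le_trans; [exact Hy|apply Rmin_l]).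
  assert (Hy2 : Rabs (y - x) < 1) by (eapply Rlt_le_trans; [exact Hy|apply Rmin_r]).
  apply Rabs_def2 in Hy2.
  assert (Hex : forall u, ex_RInt (fun v => f u v) c d).
  { intros u. apply ex_RInt_cont; auto. intros t _.
    apply (continuous_comp_2 (fun _ : R => u) (fun t : R => t) f). apply continuous_const. apply continuous_id.
    apply continuous_2d. apply H. }
  rewrite <- RInt_Rminus; auto.
  eapply Rle_lt_trans.
  - apply (abs_RInt_le_const _ c d (eps / (2 * (d - c + 1)))); auto.
    + apply ex_RInt_Rminus; auto.
    + intros t Ht. left. apply (Hdl x t y t); simpl; try lra.
      rewrite Rminus_diag, Rabs_R0. apply cond_pos.
  - apply Rle_lt_trans with ((d - c + 1) * (eps / (2 * (d - c + 1)))).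
    + apply Rmult_le_compat_r; lra.
    + replace ((d - c + 1) * (eps / (2 * (d - c + 1)))) with (eps / 2) by (field; lra). lra.
Qed.

(** As functions of the upper limit [b], both sides vanish at [a] and have the same derivative, the
    inner integral at [b]. *)
Lemma fubini_global (f : R -> R -> R) (a b c d : R) :
  a <= b -> c <= d -> (forall u v, continuity_2d_pt f u v) ->
  RInt (fun x => RInt (fun y => f x y) c d) a b = RInt (fun y => RInt (fun x => f x y) a b) c d.
Proof.
  intros Hab Hcd H.
  assert (Hc1 : forall y x, continuous (fun x => f x y) x).
  { intros y x. apply (continuous_comp_2 (fun t : R => t) (fun _ : R => y) f).
    apply continuous_id. apply continuous_const. apply continuous_2d. apply H. }
  assert (Hc2 : forall x y, continuous (fun y => f x y) y).
  { intros x y. apply (continuous_comp_2 (fun _ : R => x) (fun t : R => t) f).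
    apply continuous_const. apply continuous_id. apply continuous_2d. apply H. }
  assert (Hcsw : forall u v, continuity_2d_pt (fun y x => f x y) u v).
  { intros u v. apply continuous_2d. apply (continuous_comp_2 (fun p : R*R => snd p) (fun p : R * R=> fst p) f).
    apply continuous_snd. apply continuous_fst. apply continuous_2d. apply H. }
  assert (HE : forall y t, is_derive (fun t => RInt (fun x => f x y) a t) t (f t y)).
  { intros y t. apply (is_derive_RInt (V := R_NormedModule) (fun x => f x y) _ a).
    exists (mkposreal _ Rlt_0_1). intros u _. apply (RInt_correct (V := R_CompleteNormedModule)).
    apply (ex_RInt_continuous (V := R_CompleteNormedModule)). intros; apply Hc1. apply Hc1. }
  set (Phi := fun t => RInt (fun x => RInt (fun y => f x y) c d) a t).
  set (Psi := fun t => RInt (fun y => RInt (fun x => f x y) a t) c d).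
  assert (HPhi : forall t, is_derive Phi t (RInt (fun y => f t y) c d)).
  { intros t. apply (is_derive_RInt (V := R_NormedModule) (fun x => RInt (fun y => f x y) c d) _ a).
    exists (mkposreal _ Rlt_0_1). intros u _. apply (RInt_correct (V := R_CompleteNormedModule)).
    apply (ex_RInt_continuous (V := R_CompleteNormedModule)). intros; apply continuous_RInt_param; auto.
    apply continuous_RInt_param; auto. }
  assert (HD : forall y u, Derive (fun t => RInt (fun x => f x y) a t) u = f u y)
    by (intros; apply is_derive_unique, HE).
  assert (HPsi : forall t, is_derive Psi t (RInt (fun y => f t y) c d)).
  { intros t. unfold Psi.
    rewrite (RInt_ext (fun y => f t y) (fun y => Derive (fun t => RInt (fun x => f x y) a t) t)).
    2: intros; rewrite HD; reflexivity.
    apply (is_derive_RInt_param (fun t y => RInt (fun x => f x y) a t)).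
    - exists (mkposreal _ Rlt_0_1). intros; eexists; apply HE.
    - intros s _. apply (continuity_2d_pt_ext (fun u v => f u v)). intros; symmetry; apply HD. apply H.
    - exists (mkposreal _ Rlt_0_1). intros s _.
      apply ex_RInt_cont; auto. intros y _.
      destruct (Rle_lt_dec a s).
      + apply (continuous_RInt_param (fun y x => f x y)); auto.
      + apply (continuous_ext (fun y => - RInt (fun x => f x y) s a)).
        intros; apply (opp_RInt_swap (V := R_CompleteNormedModule)).
        apply (ex_RInt_continuous (V := R_CompleteNormedModule)); intros; apply Hc1.
        apply continuous_Ropp. apply (continuous_RInt_param (fun y x => f x y)); auto. lra. }
  change (Phi b = Psi b).
  assert (H0 : Phi a = Psi a).
  { unfold Phi, Psi. rewrite RInt_point. 
    rewrite (RInt_ext _ (fun _ => 0)). rewrite RInt_const. symmetry. apply Rmult_0_r.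
    intros; apply (RInt_point (V := R_CompleteNormedModule)). }
  destruct (Rle_lt_or_eq_dec _ _ Hab) as [Hlt|<-]; auto.
  destruct (MVT_gen (fun t => Phi t - Psi t) a b (fun _ => 0)) as (xi & _ & Hxi).
  - intros t _. 
    replace 0 with (minus (RInt (fun y => f t y) c d) (RInt (fun y => f t y) c d))
      by (unfold minus; apply (plus_opp_r (G := R_AbelianGroup))).
    apply (is_derive_minus (V := R_NormedModule)); auto.
  - intros t _. apply continuity_pt_filterlim. apply continuous_Rminus.
    apply (ex_derive_continuous (V := R_NormedModule)); eexists; apply HPhi.
    apply (ex_derive_continuous (V := R_NormedModule)); eexists; apply HPsi.
  - lra.
Qed.

Lemma continuity_2d_clamp (f : R -> R -> R) (a b c d : R) :
  a <= b -> c <= d ->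
  (forall x y, a <= x <= b -> c <= y <= d -> continuity_2d_pt f x y) ->
  forall u v, continuity_2d_pt (fun x y => f (clamp a b x) (clamp c d y)) u v.
Proof.
  intros Hab Hcd H u v. apply continuous_2d.
  apply (continuous_comp_2 (fun p : R*R => clamp a b (fst p)) (fun p : R * R=> clamp c d (snd p)) f).
  apply (continuous_Rcomp (clamp a b)). apply continuous_fst. apply continuous_clamp.
  apply (continuous_Rcomp (clamp c d)). apply continuous_snd. apply continuous_clamp.
  apply continuous_2d. apply H; apply clamp_bounds; auto.
Qed.

Lemma fubini (f : R -> R -> R) (a b c d : R) :
  a <= b -> c <= d ->
  (forall x y, a <= x <= b -> c <= y <= d -> continuity_2d_pt f x y) ->
  ex_RInt (fun x => RInt (fun y => f x y) c d) a b /\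
  ex_RInt (fun y => RInt (fun x => f x y) a b) c d /\
  RInt (fun x => RInt (fun y => f x y) c d) a b = RInt (fun y => RInt (fun x => f x y) a b) c d.
Proof.
  intros Hab Hcd H.
  generalize (continuity_2d_clamp f a b c d Hab Hcd H); intros Hc.
  set (g := fun x y => f (clamp a b x) (clamp c d y)) in *.
  assert (E1 : forall x, a <= x <= b -> RInt (fun y => g x y) c d = RInt (fun y => f x y) c d).
  { intros x Hx. apply RInt_ext. intros y. rewrite Rmin_left, Rmax_right by lra. intros Hy.
    unfold g. rewrite !clamp_id; lra. }
  assert (E2 : forall y, c <= y <= d -> RInt (fun x => g x y) a b = RInt (fun x => f x y) a b).
  { intros x Hx. apply RInt_ext. intros y. rewrite Rmin_left, Rmax_right by lra. intros Hy.
    unfold g. rewrite !clamp_id; lra. }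
  assert (Hcsw : forall u v, continuity_2d_pt (fun y x => g x y) u v).
  { intros u v. apply continuous_2d. apply (continuous_comp_2 (fun p : R*R => snd p) (fun p : R * R=> fst p) g).
    apply continuous_snd. apply continuous_fst. apply continuous_2d. apply Hc. }
  split; [|split].
  - apply (ex_RInt_ext (fun x => RInt (fun y => g x y) c d)).
    intros x. rewrite Rmin_left, Rmax_right by lra. intros; apply E1; lra.
    apply ex_RInt_cont; auto. intros; apply continuous_RInt_param; auto.
  - apply (ex_RInt_ext (fun y => RInt (fun x => g x y) a b)).
    intros x. rewrite Rmin_left, Rmax_right by lra. intros; apply E2; lra.
    apply ex_RInt_cont; auto. intros; apply (continuous_RInt_param (fun y x => g x y)); auto.
  - rewrite <- (RInt_ext (fun x => RInt (fun y => g x y) c d) (fun x => RInt (fun y => f x y) c d)).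
    rewrite <- (RInt_ext (fun y => RInt (fun x => g x y) a b) (fun y => RInt (fun x => f x y) a b)).
    apply fubini_global; auto.
    intros x. rewrite Rmin_left, Rmax_right by lra. intros; apply E2; lra.
    intros x. rewrite Rmin_left, Rmax_right by lra. intros; apply E1; lra.
Qed.

(** * Contour integrals over the boundary of a rectangle *)

Section PathIntegrals.

Definition CInt (f : R -> C) (a b : R) : C :=
  (RInt (fun t => Re (f t)) a b, RInt (fun t => Im (f t)) a b).

Definition cont_on {X : UniformSpace} (f : R -> X) (a b : R) : Prop :=
  forall t, a <= t <= b -> continuous f t.

Lemma cont_on_sub {X : UniformSpace} (f : R -> X) (a b c d : R) :
  a <= c -> d <= b -> cont_on f a b -> cont_on f c d.
Proof. intros Hac Hdb H t Ht. apply H; lra. Qed.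

Lemma ex_RInt_Re (f : R -> C) a b : a <= b -> cont_on f a b -> ex_RInt (fun t => Re (f t)) a b.
Proof. intros Hab H. apply ex_RInt_cont; auto. intros; apply continuous_Re; auto. Qed.

Lemma ex_RInt_Im (f : R -> C) a b : a <= b -> cont_on f a b -> ex_RInt (fun t => Im (f t)) a b.
Proof. intros Hab H. apply ex_RInt_cont; auto. intros; apply continuous_Im; auto. Qed.

Lemma ex_RInt_Cmod (f : R -> C) a b : a <= b -> cont_on f a b -> ex_RInt (fun t => Cmod (f t)) a b.
Proof. intros Hab H. apply ex_RInt_cont; auto. intros; apply continuous_Cmod; auto. Qed.

#[local] Hint Resolve ex_RInt_Re ex_RInt_Im ex_RInt_Cmod : core.

Lemma C_eq (z w : C) : Re z = Re w -> Im z = Im w -> z = w.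
Proof. destruct z, w; simpl; intros; subst; reflexivity. Qed.

Lemma CInt_eq (f g : R -> C) a b :
  a <= b -> (forall t, a <= t <= b -> f t = g t) -> CInt f a b = CInt g a b.
Proof. intros Hab H. apply C_eq; simpl; apply RInt_eq; auto; intros; rewrite H; auto. Qed.

Lemma CInt_minus (f g : R -> C) a b : a <= b -> cont_on f a b -> cont_on g a b ->
  CInt (fun t => (f t - g t)%C) a b = (CInt f a b - CInt g a b)%C.
Proof. intros. apply C_eq; simpl; apply RInt_Rminus; auto. Qed.

Lemma CInt_scal (f : R -> C) (c : C) a b : a <= b -> cont_on f a b ->
  CInt (fun t => (c * f t)%C) a b = (c * CInt f a b)%C.
Proof.
  intros. apply C_eq; simpl.
  - rewrite (RInt_Rminus (fun t => Re c * Re (f t)) (fun t => Im c * Im (f t))); auto using ex_RInt_Rscal.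
    rewrite !RInt_Rscal; auto.
  - rewrite (RInt_Rplus (fun t => Re c * Im (f t)) (fun t => Im c * Re (f t))); auto using ex_RInt_Rscal.
    rewrite !RInt_Rscal; auto.
Qed.

Lemma CInt_split (f : R -> C) a b c : a <= b -> b <= c -> cont_on f a c ->
  CInt f a c = (CInt f a b + CInt f b c)%C.
Proof.
  intros Hab Hbc H.
  assert (H1 : cont_on f a b) by (apply (cont_on_sub _ a c); auto; lra).
  assert (H2 : cont_on f b c) by (apply (cont_on_sub _ a c); auto; lra).
  apply C_eq.
  - exact (RInt_split _ _ _ _ (ex_RInt_Re f a b Hab H1) (ex_RInt_Re f b c Hbc H2)).
  - exact (RInt_split _ _ _ _ (ex_RInt_Im f a b Hab H1) (ex_RInt_Im f b c Hbc H2)).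
Qed.

(** Rotate the integral [c] onto the positive axis: |c|^2 is the integral of the real part of
    [Cconj c * f], which is at most |c| |f|. *)
Lemma Cmod_CInt_le (f : R -> C) a b : a <= b -> cont_on f a b ->
  Cmod (CInt f a b) <= RInt (fun t => Cmod (f t)) a b.
Proof.
  intros Hab H.
  destruct (Req_dec (Cmod (CInt f a b)) 0) as [->|H0].
  { apply RInt_pos; auto. intros; apply Cmod_ge_0. }
  set (c := CInt f a b) in *.
  assert (Hc : 0 < Cmod c) by (generalize (Cmod_ge_0 c); lra).
  apply Rmult_le_reg_l with (Cmod c); auto.
  assert (E : Cmod c * Cmod c = Re (CInt (fun t => (Cconj c * f t)%C) a b)).
  { rewrite CInt_scal; auto. fold c. generalize (Cmod2_alt c). simpl. lra. }
  rewrite E. change (RInt (fun t => Re (Cconj c * f t)%C) a b <= Cmod c * RInt (fun t => Cmod (f t)) a b).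
  rewrite <- RInt_Rscal; auto.
  apply RInt_mono; auto.
  - apply (ex_RInt_Re (fun t => (Cconj c * f t)%C)); auto.
    intros t Ht. cont. auto.
  - apply ex_RInt_Rscal; auto.
  - intros t Ht. rewrite <- Cmod_conj, <- Cmod_mult.
    apply Rle_trans with (1 := Rle_abs _). apply re_le_Cmod.
Qed.

Lemma is_derive_along_line (F : C -> C) (l z0 v : C) (t : R) :
  is_derive F (z0 + t * v)%C l ->
  is_derive (fun t : R => Re (F (z0 + t * v)%C)) t (Re (l * v)) /\
  is_derive (fun t : R => Im (F (z0 + t * v)%C)) t (Im (l * v)).
Proof.
  intros H.
  assert (K : forall eps : posreal, locally t (fun s : R =>
     Cmod (F (z0 + s * v) - F (z0 + t * v) - l * (s * v - t * v))%C <= eps * Rabs (s - t))).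
  { intros eps.
    assert (Hv : 0 < Cmod v + 1) by (generalize (Cmod_ge_0 v); lra).
    assert (He : 0 < eps / (Cmod v + 1)) by (apply Rdiv_lt_0_compat; auto; apply cond_pos).
    destruct (proj1 (is_derive_C_eps _ _ _) H _ He) as (d & Hd & Hf).
    assert (Hd' : 0 < d / (Cmod v + 1)) by (apply Rdiv_lt_0_compat; auto).
    exists (mkposreal _ Hd'). intros s Hs. change (Rabs (s - t) < d / (Cmod v + 1)) in Hs.
    assert (Ew : (z0 + s * v - (z0 + t * v) = (s - t)%R * v)%C) by (rewrite RtoC_minus; ring).
    assert (Em : Cmod (z0 + s * v - (z0 + t * v)) = Rabs (s - t) * Cmod v)
      by (rewrite Ew, Cmod_mult, Cmod_R; reflexivity).
    assert (Hm : Rabs (s - t) * Cmod v <= Rabs (s - t) * (Cmod v + 1)).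
    { apply Rmult_le_compat_l. apply Rabs_pos. lra. }
    replace (s * v - t * v)%C with (z0 + s * v - (z0 + t * v))%C by ring.
    eapply Rle_trans. apply Hf.
    - rewrite Em. apply Rle_lt_trans with (1 := Hm).
      apply Rlt_le_trans with (d / (Cmod v + 1) * (Cmod v + 1)).
      apply Rmult_lt_compat_r; auto. right; field; lra.
    - rewrite Em. apply Rle_trans with (eps / (Cmod v + 1) * (Rabs (s - t) * (Cmod v + 1))).
      apply Rmult_le_compat_l; lra. right; field; lra. }
  split; (split; [apply is_linear_scal_l|]).
  all: intros y Hy; assert (y = t) as -> by (symmetry; apply (is_filter_lim_locally_unique (K := R_AbsRing) (V := R_NormedModule)); exact Hy);
    intros eps; generalize (K eps); apply filter_imp; intros s Hs.
  - change (Rabs (Re (F (z0 + s * v)%C) - Re (F (z0 + t * v)%C) - (s - t) * Re (l * v)) <= eps * Rabs (s - t)).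
    eapply Rle_trans; [|exact Hs]. eapply Rle_trans; [|apply re_le_Cmod].
    right; apply f_equal; unfold Re, Im; simpl; ring.
  - change (Rabs (Im (F (z0 + s * v)%C) - Im (F (z0 + t * v)%C) - (s - t) * Im (l * v)) <= eps * Rabs (s - t)).
    eapply Rle_trans; [|exact Hs]. eapply Rle_trans; [|eapply Rle_trans; [apply Rmax_r|apply Rmax_Cmod]].
    right; apply f_equal; unfold Re, Im; simpl; ring.
Qed.

Lemma RInt_FTC (F f : R -> R) a b : a <= b ->
  (forall t, a <= t <= b -> is_derive F t (f t)) -> (forall t, a <= t <= b -> continuous f t) ->
  RInt f a b = F b - F a :> R.
Proof.
  intros Hab HD Hc. apply is_RInt_unique.
  apply (is_RInt_derive (V := R_CompleteNormedModule) F f);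
  rewrite Rmin_left, Rmax_right by lra; auto.
Qed.

Lemma CInt_FTC_line (F f : C -> C) (z0 v : C) a b : a <= b ->
  (forall t : R, a <= t <= b -> is_derive F (z0 + t * v)%C (f (z0 + t * v)%C)) ->
  (forall t : R, a <= t <= b -> continuous f (z0 + t * v)%C) ->
  (v * CInt (fun t => f (z0 + t * v)%C) a b = F (z0 + b * v) - F (z0 + a * v))%C.
Proof.
  intros Hab HD Hc.
  assert (Hcl : cont_on (fun t : R => f (z0 + t * v)%C) a b).
  { intros t Ht. apply (continuous_Ccomp f (fun t : R => (z0 + t * v)%C)). cont. auto. }
  assert (Hcl' : cont_on (fun t : R => (v * f (z0 + t * v))%C) a b).
  { intros t Ht. apply continuous_Cmult. cont. auto. }
  rewrite <- CInt_scal; auto.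
  apply C_eq; simpl.
  - rewrite (RInt_FTC (fun t : R => Re (F (z0 + t * v)%C)) (fun t => Re (v * f (z0 + t * v))%C)); auto.
    + intros t Ht. rewrite Cmult_comm. apply is_derive_along_line; auto.
    + intros; apply continuous_Re; auto.
  - rewrite (RInt_FTC (fun t : R => Im (F (z0 + t * v)%C)) (fun t => Im (v * f (z0 + t * v))%C)); auto.
    + intros t Ht. rewrite Cmult_comm. apply is_derive_along_line; auto.
    + intros; apply continuous_Im; auto.
Qed.

(** The contour integral of [f] over the boundary of the rectangle, counterclockwise; the factor
    [Ci] comes from dz = i dy on the vertical sides. *)
Definition rect (f : C -> C) (x1 x2 y1 y2 : R) : C :=
  (CInt (fun x => f (x, y1)) x1 x2 + Ci * CInt (fun y => f (x2, y)) y1 y2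
   - CInt (fun x => f (x, y2)) x1 x2 - Ci * CInt (fun y => f (x1, y)) y1 y2)%C.

Definition on_rect (P : C -> Prop) (x1 x2 y1 y2 : R) : Prop :=
  forall x y, x1 <= x <= x2 -> y1 <= y <= y2 -> P (x, y).

Lemma cont_hor (f : C -> C) x1 x2 y1 y2 y : on_rect (continuous f) x1 x2 y1 y2 ->
  y1 <= y <= y2 -> cont_on (fun x => f (x, y)) x1 x2.
Proof.
  intros H Hy t Ht. apply (continuous_Ccomp f (fun x : R => (x, y))). 
  apply continuous_C_pair. apply continuous_id. apply continuous_const. apply H; auto.
Qed.

Lemma cont_ver (f : C -> C) x1 x2 y1 y2 x : on_rect (continuous f) x1 x2 y1 y2 ->
  x1 <= x <= x2 -> cont_on (fun y => f (x, y)) y1 y2.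
Proof.
  intros H Hy t Ht. apply (continuous_Ccomp f (fun y : R => (x, y))). 
  apply continuous_C_pair. apply continuous_const. apply continuous_id. apply H; auto.
Qed.

Lemma rect_split_h (f : C -> C) x1 m x2 y1 y2 : x1 <= m -> m <= x2 -> y1 <= y2 ->
  on_rect (continuous f) x1 x2 y1 y2 ->
  rect f x1 x2 y1 y2 = (rect f x1 m y1 y2 + rect f m x2 y1 y2)%C.
Proof.
  intros H1 H2 H3 Hc. unfold rect.
  rewrite (CInt_split (fun x => f (x, y1)) x1 m x2), (CInt_split (fun x => f (x, y2)) x1 m x2); auto.
  ring. all: eapply cont_hor; eauto; lra.
Qed.

Lemma rect_split_v (f : C -> C) x1 x2 y1 m y2 : x1 <= x2 -> y1 <= m -> m <= y2 ->
  on_rect (continuous f) x1 x2 y1 y2 ->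
  rect f x1 x2 y1 y2 = (rect f x1 x2 y1 m + rect f x1 x2 m y2)%C.
Proof.
  intros H1 H2 H3 Hc. unfold rect.
  rewrite (CInt_split (fun y => f (x1, y)) y1 m y2), (CInt_split (fun y => f (x2, y)) y1 m y2); auto.
  ring. all: eapply cont_ver; eauto; lra.
Qed.

Lemma rect_eq (f g : C -> C) x1 x2 y1 y2 : x1 <= x2 -> y1 <= y2 ->
  (forall x y, x1 <= x <= x2 -> y1 <= y <= y2 -> x = x1 \/ x = x2 \/ y = y1 \/ y = y2 -> f (x, y) = g (x, y)) ->
  rect f x1 x2 y1 y2 = rect g x1 x2 y1 y2.
Proof.
  intros Hx Hy H. unfold rect.
  rewrite (CInt_eq (fun x => f (x, y1)) (fun x => g (x, y1))), (CInt_eq (fun x => f (x, y2)) (fun x => g (x, y2))),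
    (CInt_eq (fun x => f (x1, x)) (fun x => g (x1, x))), (CInt_eq (fun x => f (x2, x)) (fun x => g (x2, x))); auto;
  intros; apply H; try lra; auto.
Qed.

(** Restricting conditions to the boundary matters because the integrands of interest have poles
    inside. *)
Definition on_bd (P : C -> Prop) (x1 x2 y1 y2 : R) : Prop :=
  forall x y, x1 <= x <= x2 -> y1 <= y <= y2 -> x = x1 \/ x = x2 \/ y = y1 \/ y = y2 -> P (x, y).

Lemma cont_bd (f : C -> C) x1 x2 y1 y2 : x1 <= x2 -> y1 <= y2 -> on_bd (continuous f) x1 x2 y1 y2 ->
  cont_on (fun x => f (x, y1)) x1 x2 /\ cont_on (fun x => f (x, y2)) x1 x2 /\
  cont_on (fun y => f (x1, y)) y1 y2 /\ cont_on (fun y => f (x2, y)) y1 y2.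
Proof.
  intros Hx Hy H. repeat split; intros t Ht.
  1,2: apply (continuous_Ccomp f (fun x : R => (x, _))); 
    [apply continuous_C_pair; [apply continuous_id|apply continuous_const] | apply H; try lra; auto].
  1,2: apply (continuous_Ccomp f (fun y : R => (_, y))); 
    [apply continuous_C_pair; [apply continuous_const|apply continuous_id] | apply H; try lra; auto].
Qed.

Lemma rect_minus (f g : C -> C) x1 x2 y1 y2 : x1 <= x2 -> y1 <= y2 ->
  on_bd (continuous f) x1 x2 y1 y2 -> on_bd (continuous g) x1 x2 y1 y2 ->
  rect (fun z => (f z - g z)%C) x1 x2 y1 y2 = (rect f x1 x2 y1 y2 - rect g x1 x2 y1 y2)%C.
Proof.
  intros Hx Hy Hf Hg. apply cont_bd in Hf; auto. apply cont_bd in Hg; auto.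
  destruct Hf as (?&?&?&?), Hg as (?&?&?&?).
  unfold rect. rewrite !CInt_minus; auto. ring.
Qed.

Lemma rect_scal (f : C -> C) (c : C) x1 x2 y1 y2 : x1 <= x2 -> y1 <= y2 ->
  on_bd (continuous f) x1 x2 y1 y2 ->
  rect (fun z => (c * f z)%C) x1 x2 y1 y2 = (c * rect f x1 x2 y1 y2)%C.
Proof.
  intros Hx Hy Hf. apply cont_bd in Hf; auto.
  destruct Hf as (?&?&?&?).
  unfold rect. rewrite !CInt_scal; auto. ring.
Qed.

(** The integral over the same boundary with respect to arc length. *)
Definition arect (f : C -> R) (x1 x2 y1 y2 : R) : R :=
  RInt (fun x => f (x, y1)) x1 x2 + RInt (fun y => f (x2, y)) y1 y2
  + RInt (fun x => f (x, y2)) x1 x2 + RInt (fun y => f (x1, y)) y1 y2.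

Lemma Cmod_rect (f : C -> C) x1 x2 y1 y2 : x1 <= x2 -> y1 <= y2 ->
  on_bd (continuous f) x1 x2 y1 y2 ->
  Cmod (rect f x1 x2 y1 y2) <= arect (fun z => Cmod (f z)) x1 x2 y1 y2.
Proof.
  intros Hx Hy Hf. apply cont_bd in Hf; auto. destruct Hf as (?&?&?&?). unfold rect, arect.
  assert (T : forall a b c d : C, Cmod (a + Ci * b - c - Ci * d) <= Cmod a + Cmod b + Cmod c + Cmod d).
  { intros a b c d. unfold Cminus.
    eapply Rle_trans; [apply Cmod_triangle|]. rewrite Cmod_opp, Cmod_mult, Cmod_Ci, Rmult_1_l.
    apply Rplus_le_compat_r. eapply Rle_trans; [apply Cmod_triangle|]. rewrite Cmod_opp.
    apply Rplus_le_compat_r. eapply Rle_trans; [apply Cmod_triangle|]. rewrite Cmod_mult, Cmod_Ci. lra. }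
  eapply Rle_trans; [apply T|].
  repeat apply Rplus_le_compat; apply Cmod_CInt_le; auto.
Qed.

Lemma Cmod_rect_const (f : C -> C) x1 x2 y1 y2 M : x1 <= x2 -> y1 <= y2 ->
  on_bd (continuous f) x1 x2 y1 y2 -> on_bd (fun z => Cmod (f z) <= M) x1 x2 y1 y2 ->
  Cmod (rect f x1 x2 y1 y2) <= 2 * ((x2 - x1) + (y2 - y1)) * M.
Proof.
  intros Hx Hy Hf HM. eapply Rle_trans; [apply Cmod_rect; auto|].
  apply cont_bd in Hf; auto. destruct Hf as (?&?&?&?). unfold arect.
  replace (2 * ((x2 - x1) + (y2 - y1)) * M) with
    ((x2 - x1) * M + (y2 - y1) * M + (x2 - x1) * M + (y2 - y1) * M) by ring.
  rewrite <- !(RInt_Rconst M).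
  repeat apply Rplus_le_compat; apply RInt_mono; auto; try (apply ex_RInt_cont; auto; intros; apply continuous_const);
  try (intros; apply HM; try lra; auto); apply ex_RInt_cont; auto; intros; apply continuous_Cmod; auto.
Qed.

(** Each side contributes a difference of values of [F] at two corners, and the four differences
    cancel. *)
Lemma rect_primitive (F f : C -> C) x1 x2 y1 y2 : x1 <= x2 -> y1 <= y2 ->
  on_bd (fun z => is_derive F z (f z)) x1 x2 y1 y2 -> on_bd (continuous f) x1 x2 y1 y2 ->
  rect f x1 x2 y1 y2 = 0.
Proof.
  intros Hx Hy HD Hc.
  assert (h : forall y, y = y1 \/ y = y2 -> CInt (fun x => f (x, y)) x1 x2 = (F (x2, y) - F (x1, y))%C).
  { intros y Hyy.
    assert (E : forall x : R, ((0, y) + x * 1)%C = (x, y)) by (intros; apply C_eq; simpl; ring).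
    generalize (CInt_FTC_line F f (0, y) 1 x1 x2 Hx). rewrite !E, Cmult_1_l. intros K. rewrite <- K.
    - apply CInt_eq; auto. intros; rewrite E; reflexivity.
    - intros t Ht; rewrite E. apply HD; destruct Hyy; subst; auto; lra.
    - intros t Ht; rewrite E. apply Hc; destruct Hyy; subst; auto; lra. }
  assert (v : forall x, x = x1 \/ x = x2 -> (Ci * CInt (fun y => f (x, y)) y1 y2 = F (x, y2) - F (x, y1))%C).
  { intros x Hxx.
    assert (E : forall y : R, ((x, 0) + y * Ci)%C = (x, y)) by (intros; apply C_eq; simpl; ring).
    generalize (CInt_FTC_line F f (x, 0) Ci y1 y2 Hy). rewrite !E. intros K. rewrite <- K.
    - f_equal. apply CInt_eq; auto. intros; rewrite E; reflexivity.
    - intros t Ht; rewrite E. apply HD; destruct Hxx; subst; auto; lra.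
    - intros t Ht; rewrite E. apply Hc; destruct Hxx; subst; auto; lra. }
  unfold rect. rewrite !h, !v; auto. ring.
Qed.

End PathIntegrals.

(** * Goursat and residue theorems on rectangles *)

Notation holo := (@ex_derive C_AbsRing C_NormedModule).
Notation cderiv := (@is_derive C_AbsRing C_NormedModule).

Lemma on_rect_sub (P : C -> Prop) x1 x2 y1 y2 a1 a2 b1 b2 :
  on_rect P x1 x2 y1 y2 -> x1 <= a1 -> a2 <= x2 -> y1 <= b1 -> b2 <= y2 -> on_rect P a1 a2 b1 b2.
Proof. intros H ? ? ? ? x y Hx Hy. apply H; lra. Qed.

Lemma on_rect_bd (P : C -> Prop) x1 x2 y1 y2 : on_rect P x1 x2 y1 y2 -> on_bd P x1 x2 y1 y2.
Proof. intros H x y Hx Hy _. apply H; auto. Qed.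

Lemma on_rect_impl (P Q : C -> Prop) x1 x2 y1 y2 :
  (forall z, P z -> Q z) -> on_rect P x1 x2 y1 y2 -> on_rect Q x1 x2 y1 y2.
Proof. intros H HP x y Hx Hy. apply H, HP; auto. Qed.

Lemma rect_quarter (f : C -> C) x y w h : 0 <= w -> 0 <= h ->
  on_rect (continuous f) x (x + w) y (y + h) ->
  exists x' y', x <= x' <= x + w / 2 /\ y <= y' <= y + h / 2 /\
    Cmod (rect f x (x + w) y (y + h)) <= 4 * Cmod (rect f x' (x' + w / 2) y' (y' + h / 2)).
Proof.
  intros Hw Hh Hc.
  assert (E : rect f x (x + w) y (y + h) =
    ((rect f x (x + w / 2) y (y + h / 2) + rect f x (x + w / 2) (y + h / 2) (y + h / 2 + h / 2)) +
     (rect f (x + w / 2) (x + w / 2 + w / 2) y (y + h / 2)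
      + rect f (x + w / 2) (x + w / 2 + w / 2) (y + h / 2) (y + h / 2 + h / 2)))%C).
  { replace (x + w) with (x + w / 2 + w / 2) in * by field.
    replace (y + h) with (y + h / 2 + h / 2) in * by field.
    rewrite (rect_split_h f x (x + w / 2)) by (auto; lra).
    rewrite (rect_split_v f x (x + w / 2) y (y + h / 2)); try lra.
    rewrite (rect_split_v f (x + w / 2) (x + w / 2 + w / 2) y (y + h / 2)); try lra. reflexivity.
    all: eapply on_rect_sub; eauto; lra. }
  set (A := rect f x (x + w / 2) y (y + h / 2)) in *.
  set (B := rect f x (x + w / 2) (y + h / 2) (y + h / 2 + h / 2)) in *.
  set (D := rect f (x + w / 2) (x + w / 2 + w / 2) y (y + h / 2)) in *.
  set (F := rect f (x + w / 2) (x + w / 2 + w / 2) (y + h / 2) (y + h / 2 + h / 2)) in *.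
  set (J := Cmod (rect f x (x + w) y (y + h))) in *.
  assert (HJ : J <= (Cmod A + Cmod B) + (Cmod D + Cmod F)).
  { unfold J. rewrite E. eapply Rle_trans; [apply Cmod_triangle|].
    apply Rplus_le_compat; apply Cmod_triangle. }
  (* Pigeonhole: the four moduli add up to at least [J], so if three quarters fail the last one
     succeeds. *)
  destruct (Rle_dec J (4 * Cmod A)). { exists x, y. repeat split; try lra; auto. }
  destruct (Rle_dec J (4 * Cmod B)). { exists x, (y + h / 2). repeat split; try lra; auto. }
  destruct (Rle_dec J (4 * Cmod D)). { exists (x + w / 2), y. repeat split; try lra; auto. }
  exists (x + w / 2), (y + h / 2). repeat split; try lra. fold F. lra.
Qed.

(** The left end points increase and stay below every right end point, so their supremum lies in all
    the intervals. *)
Lemma nested_point (x : nat -> R) (w : R) : 0 <= w ->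
  (forall n, x n <= x (S n) <= x n + w / 2 ^ n / 2) ->
  exists p, forall n, x n <= p <= x n + w / 2 ^ n.
Proof.
  intros Hw H.
  assert (P2 : forall n, 0 < 2 ^ n) by (intros; apply pow_lt; lra).
  assert (E : forall n, w / 2 ^ S n = w / 2 ^ n / 2) by (intros; simpl; field; generalize (P2 n); lra).
  assert (W : forall n, 0 <= w / 2 ^ n) by (intros; apply Rdiv_le_0_compat; auto).
  assert (I : forall n k, x n <= x (n + k)%nat /\ x (n + k)%nat + w / 2 ^ (n + k) <= x n + w / 2 ^ n).
  { intros n k. induction k. rewrite Nat.add_0_r; lra.
    rewrite Nat.add_succ_r. generalize (H (n + k)%nat) (E (n + k)%nat). lra. }
  assert (B : forall n m, x n <= x m + w / 2 ^ m).
  { intros n m. destruct (Compare_dec.le_ge_dec n m) as [L|L].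
    - generalize (I n (m - n)%nat) (W m). replace (n + (m - n))%nat with m by lia. lra.
    - generalize (I m (n - m)%nat) (W n). replace (m + (n - m))%nat with n by lia. lra. }
  destruct (completeness (fun r => exists n, r = x n)) as [p [Hp1 Hp2]].
  - exists (x O + w / 2 ^ 0). intros r [n ->]. apply B.
  - exists (x O), O. reflexivity.
  - exists p. intros n. split.
    + apply Hp1. exists n; reflexivity.
    + apply Hp2. intros r [m ->]. apply B.
Qed.

Lemma is_derive_C_affine (a l p : C) (z : C) :
  is_derive (fun w => (a * w + l * ((w - p) * (w - p)) / 2)%C) z (a + l * (z - p))%C.
Proof.
  apply is_derive_C_eps. intros eps Heps.
  assert (Hl : 0 < Cmod l + 1) by (generalize (Cmod_ge_0 l); lra).
  exists (eps / (Cmod l + 1)). split. apply Rdiv_lt_0_compat; auto.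
  intros w Hw.
  assert (H2 : RtoC 2 <> 0) by (intros E; apply RtoC_inj in E; lra).
  replace (a * w + l * ((w - p) * (w - p)) / 2 - (a * z + l * ((z - p) * (z - p)) / 2) -
      (a + l * (z - p)) * (w - z))%C with (l / 2 * (w - z) * (w - z))%C by (field; auto).
  rewrite !Cmod_mult. apply Rmult_le_compat_r. apply Cmod_ge_0.
  rewrite Cmod_div, Cmod_R, Rabs_pos_eq by (auto; lra).
  apply Rle_trans with ((Cmod l + 1) * (eps / (Cmod l + 1))).
  - apply Rmult_le_compat; try (generalize (Cmod_ge_0 l); lra). apply Cmod_ge_0.
  - right; field; lra.
Qed.

Lemma rect_affine (c l p : C) x1 x2 y1 y2 : x1 <= x2 -> y1 <= y2 ->
  rect (fun z => (c + l * (z - p))%C) x1 x2 y1 y2 = 0.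
Proof.
  intros. apply (rect_primitive (fun w => (c * w + l * ((w - p) * (w - p)) / 2)%C)); auto.
  - intros x y _ _ _. apply is_derive_C_affine.
  - intros x y _ _ _. cont.
Qed.

Lemma Cmod_le_sum (z : C) : Cmod z <= Rabs (Re z) + Rabs (Im z).
Proof.
  replace z with (RtoC (Re z) + Ci * RtoC (Im z))%C at 1 by (apply C_eq; simpl; ring).
  eapply Rle_trans; [apply Cmod_triangle|]. rewrite Cmod_mult, Cmod_Ci, !Cmod_R. lra.
Qed.

(** Repeated quartering keeps at least the fraction 4^-n of the integral. At the common point [p] of
    the nested rectangles the affine approximation of [f] has a primitive and integrates to 0; the
    remainder is a small multiple of the diameter, and perimeter times diameter is also of order
    4^-n. Continuity of the derivative is never assumed. *)
Lemma goursat (f : C -> C) x1 x2 y1 y2 : x1 <= x2 -> y1 <= y2 ->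
  on_rect (holo f) x1 x2 y1 y2 -> rect f x1 x2 y1 y2 = 0.
Proof.
  intros Hx Hy Hf.
  set (w := x2 - x1). set (h := y2 - y1).
  assert (Hc : on_rect (continuous f) x1 x2 y1 y2)
    by (apply (on_rect_impl (holo f)); auto; apply ex_derive_C_continuous).
  set (I := fun (n : nat) (c : R * R) => x1 <= fst c /\ fst c + w / 2 ^ n <= x2 /\
     y1 <= snd c /\ snd c + h / 2 ^ n <= y2 /\
     Cmod (rect f x1 x2 y1 y2) <= 4 ^ n *
       Cmod (rect f (fst c) (fst c + w / 2 ^ n) (snd c) (snd c + h / 2 ^ n))).
  assert (P2 : forall n, 0 < 2 ^ n) by (intros; apply pow_lt; lra).
  assert (E : forall u n, u / 2 ^ S n = u / 2 ^ n / 2) by (intros; simpl; field; generalize (P2 n); lra).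
  assert (W : forall n, 0 <= w / 2 ^ n) by (intros; apply Rdiv_le_0_compat; auto; unfold w; lra).
  assert (H : forall n, 0 <= h / 2 ^ n) by (intros; apply Rdiv_le_0_compat; auto; unfold h; lra).
  assert (step : forall n c, I n c -> exists c', I (S n) c' /\
     fst c <= fst c' <= fst c + w / 2 ^ n / 2 /\ snd c <= snd c' <= snd c + h / 2 ^ n / 2).
  { intros n [x y] (a1 & a2 & a3 & a4 & a5). simpl in a1, a2, a3, a4, a5.
    destruct (rect_quarter f x y (w / 2 ^ n) (h / 2 ^ n)) as (x' & y' & b1 & b2 & b3); auto.
    { eapply on_rect_sub; eauto. }
    exists (x', y'). unfold I. rewrite !E. cbn [fst snd].
    generalize (W n) (H n); intros.
    repeat split; try lra.
    change (4 ^ S n) with (4 * 4 ^ n).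
    apply Rle_trans with (1 := a5).
    replace (4 * 4 ^ n) with (4 ^ n * 4) by ring. rewrite Rmult_assoc.
    apply Rmult_le_compat_l; auto. apply pow_le; lra. }
  (* Each chosen corner is paired with a proof of the invariant [I n], so that the next choice can
     be made. *)
  set (next := fun (n : nat) (c : {c | I n c}) =>
    let s := constructive_indefinite_description _ (step n (proj1_sig c) (proj2_sig c)) in
    exist (I (S n)) (proj1_sig s) (proj1 (proj2_sig s))).
  assert (I0 : I O (x1, y1)).
  { unfold I; simpl. unfold w, h. rewrite !Rdiv_1_r.
    replace (x1 + (x2 - x1)) with x2 by ring. replace (y1 + (y2 - y1)) with y2 by ring.
    repeat split; lra. }
  set (c := fix c n : {c | I n c} := match n with O => exist _ _ I0 | S n => next n (c n) end).
  assert (Hs : forall n, fst (proj1_sig (c n)) <= fst (proj1_sig (c (S n))) <= fst (proj1_sig (c n)) + w / 2 ^ n / 2 /\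
    snd (proj1_sig (c n)) <= snd (proj1_sig (c (S n))) <= snd (proj1_sig (c n)) + h / 2 ^ n / 2).
  { intros n. simpl. apply (proj2_sig (constructive_indefinite_description _ (step n (proj1_sig (c n)) (proj2_sig (c n))))). }
  destruct (nested_point (fun n => fst (proj1_sig (c n))) w) as [px Hpx]. unfold w; lra. intros; apply Hs.
  destruct (nested_point (fun n => snd (proj1_sig (c n))) h) as [py Hpy]. unfold h; lra. intros; apply Hs.
  set (p := (px, py) : C).
  assert (Hp : holo f p).
  { apply Hf. generalize (Hpx O); simpl. unfold w; rewrite Rdiv_1_r; lra.
    generalize (Hpy O); simpl. unfold h; rewrite Rdiv_1_r; lra. }
  destruct Hp as [l Hl].
  destruct (Req_dec (Cmod (rect f x1 x2 y1 y2)) 0) as [H0|H0]. apply Cmod_eq_0; auto.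
  exfalso.
  assert (HJ : 0 < Cmod (rect f x1 x2 y1 y2)) by (generalize (Cmod_ge_0 (rect f x1 x2 y1 y2)); lra).
  set (J := Cmod (rect f x1 x2 y1 y2)) in *.
  set (S := w + h + 1). assert (HS : 1 <= S) by (unfold S, w, h; lra).
  (* The tolerance is such that the final estimate reads J <= J / 2. *)
  assert (Heps : 0 < J / (4 * (S * S))) by (apply Rdiv_lt_0_compat; nra).
  destruct (proj1 (is_derive_C_eps f p l) Hl _ Heps) as (d & Hd & Hfd).
  assert (HN : exists n, S / 2 ^ n < d).
  { destruct (Pow_x_infinity 2) with (b := S / d + 1) as [N HN]. rewrite Rabs_pos_eq; lra.
    exists N. specialize (HN N (le_n _)). rewrite Rabs_pos_eq in HN by (apply Rlt_le; auto).
    apply Rmult_lt_reg_r with (2 ^ N); auto. unfold Rdiv; rewrite Rmult_assoc, Rinv_l, Rmult_1_r by (generalize (P2 N); lra).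
    apply Rmult_lt_reg_l with (/ d). apply Rinv_0_lt_compat; auto.
    rewrite <- Rmult_assoc, Rinv_l, Rmult_1_l by lra. unfold Rdiv in HN. lra. }
  destruct HN as [n Hn].
  destruct (proj2_sig (c n)) as (a1 & a2 & a3 & a4 & a5).
  specialize (Hpx n); specialize (Hpy n).
  set (x := fst (proj1_sig (c n))) in *. set (y := snd (proj1_sig (c n))) in *. fold J in a5.
  assert (HB : Cmod (rect f x (x + w / 2 ^ n) y (y + h / 2 ^ n)) <=
     2 * ((x + w / 2 ^ n - x) + (y + h / 2 ^ n - y)) * (J / (4 * (S * S)) * (S / 2 ^ n))).
  { generalize (W n) (H n); intros Wn Hnn.
    assert (Q : on_rect (continuous f) x (x + w / 2 ^ n) y (y + h / 2 ^ n)) by (eapply on_rect_sub; eauto).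
    replace (rect f x (x + w / 2 ^ n) y (y + h / 2 ^ n)) with
      (rect (fun z => (f z - (f p + l * (z - p)))%C) x (x + w / 2 ^ n) y (y + h / 2 ^ n)).
    2:{ rewrite rect_minus; try lra. rewrite rect_affine by lra. ring.
        apply on_rect_bd; auto. intros ? ? _ _ _. cont. }
    apply Cmod_rect_const; try lra.
    - apply on_rect_bd. intros u v Hu Hv. apply continuous_Cminus. apply Q; auto. cont.
    - apply on_rect_bd. intros u v Hu Hv.
      assert (HD : Cmod ((u, v) - p) <= (w + h) / 2 ^ n).
      { eapply Rle_trans; [apply Cmod_le_sum|]. simpl.
        replace ((w + h) / 2 ^ n) with (w / 2 ^ n + h / 2 ^ n) by (field; generalize (P2 n); lra).
        apply Rplus_le_compat; apply Rabs_le; lra. }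
      assert (HD' : (w + h) / 2 ^ n <= S / 2 ^ n).
      { apply Rmult_le_compat_r. left; apply Rinv_0_lt_compat; auto. unfold S; lra. }
      replace (f (u, v) - (f p + l * ((u, v) - p)))%C with (f (u, v) - f p - l * ((u, v) - p))%C by ring.
      eapply Rle_trans. apply Hfd. lra.
      apply Rmult_le_compat_l; lra. }
  assert (HB2 : J <= 4 ^ n * (2 * ((x + w / 2 ^ n - x) + (y + h / 2 ^ n - y)) * (J / (4 * (S * S)) * (S / 2 ^ n)))).
  { eapply Rle_trans; [exact a5|]. apply Rmult_le_compat_l; auto. apply pow_le; lra. }
  replace (4 ^ n) with (2 ^ n * 2 ^ n) in HB2 by (rewrite <- Rpow_mult_distr; f_equal; lra).
  replace (2 ^ n * 2 ^ n * (2 * ((x + w / 2 ^ n - x) + (y + h / 2 ^ n - y)) * (J / (4 * (S * S)) * (S / 2 ^ n))))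
    with ((w + h) / S * (J / 2)) in HB2 by (field; generalize (P2 n); lra).
  assert ((w + h) / S <= 1).
  { apply Rmult_le_reg_r with S. lra. unfold Rdiv; rewrite Rmult_assoc, Rinv_l by lra. unfold S; lra. }
  nra.
Qed.

(** The common side cancels algebraically whatever value its integral has, so continuity on the
    outer boundary is enough. *)
Lemma rect_split_h_bd (f : C -> C) x1 m x2 y1 y2 : x1 <= m -> m <= x2 -> y1 <= y2 ->
  on_bd (continuous f) x1 x2 y1 y2 ->
  rect f x1 x2 y1 y2 = (rect f x1 m y1 y2 + rect f m x2 y1 y2)%C.
Proof.
  intros H1 H2 H3 Hc. apply cont_bd in Hc; try lra. destruct Hc as (?&?&?&?). unfold rect.
  rewrite (CInt_split (fun x => f (x, y1)) x1 m x2), (CInt_split (fun x => f (x, y2)) x1 m x2); auto.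
  ring.
Qed.

Lemma rect_split_v_bd (f : C -> C) x1 x2 y1 m y2 : x1 <= x2 -> y1 <= m -> m <= y2 ->
  on_bd (continuous f) x1 x2 y1 y2 ->
  rect f x1 x2 y1 y2 = (rect f x1 x2 y1 m + rect f x1 x2 m y2)%C.
Proof.
  intros H1 H2 H3 Hc. apply cont_bd in Hc; try lra. destruct Hc as (?&?&?&?). unfold rect.
  rewrite (CInt_split (fun y => f (x1, y)) y1 m y2), (CInt_split (fun y => f (x2, y)) y1 m y2); auto.
  ring.
Qed.

(** Two vertical and two horizontal cuts leave the small square and four rectangles that avoid the
    singular point; Goursat removes those four. *)
Lemma rect_shrink (f : C -> C) (u v : R) x1 x2 y1 y2 r : 0 < r ->
  x1 <= u - r -> u + r <= x2 -> y1 <= v - r -> v + r <= y2 ->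
  (forall x y, x1 <= x <= x2 -> y1 <= y <= y2 -> (x, y) <> (u, v) -> holo f (x, y)) ->
  rect f x1 x2 y1 y2 = rect f (u - r) (u + r) (v - r) (v + r).
Proof.
  intros Hr Hx1 Hx2 Hy1 Hy2 Hf.
  assert (Hc : forall x y, x1 <= x <= x2 -> y1 <= y <= y2 -> x <> u \/ y <> v -> continuous f (x, y)).
  { intros x y Hx Hy Hn. apply ex_derive_C_continuous, Hf; auto. intros E; inversion E; tauto. }
  assert (Z : forall a b c d, x1 <= a -> b <= x2 -> y1 <= c -> d <= y2 -> a <= b -> c <= d ->
     (b < u \/ u < a \/ d < v \/ v < c) -> rect f a b c d = 0).
  { intros a b c d ? ? ? ? ? ? Hd. apply goursat; auto. intros x y Hx Hy. apply Hf; try lra.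
    intros E; inversion E; lra. }
  rewrite (rect_split_h_bd f x1 (u - r) x2); try lra.
  2:{ intros x y Hx Hy Hb. apply Hc; lra. }
  rewrite (rect_split_h_bd f (u - r) (u + r) x2); try lra.
  2:{ intros x y Hx Hy Hb. apply Hc; lra. }
  rewrite (rect_split_v_bd f (u - r) (u + r) y1 (v - r) y2); try lra.
  2:{ intros x y Hx Hy Hb. apply Hc; lra. }
  rewrite (rect_split_v_bd f (u - r) (u + r) (v - r) (v + r) y2); try lra.
  2:{ intros x y Hx Hy Hb. apply Hc; lra. }
  rewrite (Z x1 (u - r)), (Z (u + r) x2), (Z (u - r) (u + r) y1 (v - r)), (Z (u - r) (u + r) (v + r) y2); try lra.
  ring.
Qed.

Lemma sqr_sum_pos u r : 0 < r -> forall x, 0 < (x - u) ^ 2 + r ^ 2.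
Proof. intros Hr x. generalize (pow_lt r 2 Hr) (pow2_ge_0 (x - u)). lra. Qed.

Lemma sqr_sum_neq0 u r : 0 < r -> forall x, (x - u) ^ 2 + r ^ 2 <> 0.
Proof. intros Hr x. apply Rgt_not_eq, sqr_sum_pos; auto. Qed.

Lemma RInt_even_kernel u r : 0 < r -> RInt (fun x => r / ((x - u) ^ 2 + r ^ 2)) (u - r) (u + r) = PI / 2 :> R.
Proof.
  intros Hr.
  assert (N := sqr_sum_neq0 u r Hr).
  rewrite (RInt_FTC (fun x => atan ((x - u) / r))); try lra.
  - replace ((u + r - u) / r) with 1 by (field; lra). replace ((u - r - u) / r) with (-1) by (field; lra).
    replace (-1) with (Ropp 1) by ring. rewrite atan_opp, atan_1. lra.
  - intros t _. auto_derive; try lra. field. generalize (N t); simpl; intros; repeat split; try lra; intros E; apply (N t); simpl; lra.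
  - intros t _. cont. apply N.
Qed.

Lemma RInt_odd_kernel u r : 0 < r -> RInt (fun x => (x - u) / ((x - u) ^ 2 + r ^ 2)) (u - r) (u + r) = 0 :> R.
Proof.
  intros Hr.
  assert (N := sqr_sum_pos u r Hr).
  rewrite (RInt_FTC (fun x => ln ((x - u) ^ 2 + r ^ 2) / 2)); try lra.
  - replace (u + r - u) with r by ring. replace (u - r - u) with (- r) by ring.
    replace ((-r) ^ 2) with (r ^ 2) by ring. ring.
  - intros t _. auto_derive. generalize (N t); simpl; lra. field. generalize (N t); simpl; lra.
  - intros t _. cont. generalize (N t); lra.
Qed.

(** On a square centred at the pole each side contributes i pi / 2: one component of the integrand
    is odd about the midpoint of the side and integrates to 0, the other gives the arctangent
    between -1 and 1. *)
Lemma rect_inv_square u v r : 0 < r ->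
  rect (fun z => / (z - (u, v)))%C (u - r) (u + r) (v - r) (v + r) = (2 * PI * Ci)%C.
Proof.
  intros Hr.
  assert (Nu := sqr_sum_neq0 u r Hr).
  assert (Nv := sqr_sum_neq0 v r Hr).
  assert (SH : forall s, s * s = r * r -> CInt (fun x => / ((x, (v + s)%R) - (u, v)))%C (u - r) (u + r) =
     (0, - s / r * (PI / 2))).
  { intros s Hs. assert (s <> 0) by nra.
    apply C_eq; cbn [CInt Re Im fst snd].
    - rewrite <- (RInt_odd_kernel u r Hr). apply RInt_eq; [lra|]. intros t _. simpl.
      replace ((v + s + - v)) with s by ring.
      replace ((t + - u) * ((t + - u) * 1) + s * (s * 1)) with ((t - u) ^ 2 + r ^ 2) by (simpl; rewrite !Rmult_1_r, Hs; ring).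
      replace ((t - u) * ((t - u) * 1) + r * (r * 1)) with ((t - u) ^ 2 + r ^ 2) by ring. reflexivity.
    - rewrite <- (RInt_even_kernel u r Hr), <- RInt_Rscal by (apply ex_RInt_cont; [lra|]; intros; cont; auto).
      apply RInt_eq; [lra|]. intros t _. simpl.
      replace ((v + s + - v)) with s by ring.
      replace ((t + - u) * ((t + - u) * 1) + s * (s * 1)) with ((t - u) ^ 2 + r ^ 2) by (simpl; rewrite !Rmult_1_r, Hs; ring).
      replace ((t - u) * ((t - u) * 1) + r * (r * 1)) with ((t - u) ^ 2 + r ^ 2) by ring.
      field. split; [apply Nu|lra]. }
  assert (SV : forall s, s * s = r * r -> CInt (fun y => / (((u + s)%R, y) - (u, v)))%C (v - r) (v + r) =
     (s / r * (PI / 2), 0)).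
  { intros s Hs. assert (s <> 0) by nra.
    apply C_eq; cbn [CInt Re Im fst snd].
    - rewrite <- (RInt_even_kernel v r Hr), <- RInt_Rscal by (apply ex_RInt_cont; [lra|]; intros; cont; auto).
      apply RInt_eq; [lra|]. intros t _. simpl.
      replace ((u + s + - u)) with s by ring.
      replace (s * (s * 1) + (t + - v) * ((t + - v) * 1)) with ((t - v) ^ 2 + r ^ 2) by (simpl; rewrite !Rmult_1_r, Hs; ring).
      replace ((t - v) * ((t - v) * 1) + r * (r * 1)) with ((t - v) ^ 2 + r ^ 2) by ring.
      field. split; [apply Nv|lra].
    - replace 0 with (- 1 * 0) by ring.
      rewrite <- (RInt_odd_kernel v r Hr), <- RInt_Rscal by (apply ex_RInt_cont; [lra|]; intros; cont; auto).
      apply RInt_eq; [lra|]. intros t _. simpl.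
      replace ((u + s + - u)) with s by ring.
      replace (s * (s * 1) + (t + - v) * ((t + - v) * 1)) with ((t - v) ^ 2 + r ^ 2) by (simpl; rewrite !Rmult_1_r, Hs; ring).
      replace ((t - v) * ((t - v) * 1) + r * (r * 1)) with ((t - v) ^ 2 + r ^ 2) by ring.
      field. apply Nv. }
  unfold rect. unfold Rminus. rewrite !SH, !SV by ring.
  apply C_eq; simpl; field; lra.
Qed.

(** Differentiability through a slope function continuous at the point: product rule, chain rule and
    the cancellation of simple poles become algebra. *)
Lemma caratheodory (f : C -> C) (z l : C) :
  cderiv f z l <->
  exists phi : C -> C, continuous phi z /\ phi z = l /\ forall w, (f w - f z = phi w * (w - z))%C.
Proof.
  split.
  - intros H. rewrite is_derive_C_eps in H.
    set (phi := fun w => match excluded_middle_informative (w = z) with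
      left _ => l | right _ => ((f w - f z) / (w - z))%C end).
    assert (E : phi z = l) by (unfold phi; destruct excluded_middle_informative; tauto).
    exists phi. split; [|split; auto].
    + apply continuous_C_eps. rewrite E. intros eps Heps.
      destruct (H (eps / 2)) as (d & Hd & HD). lra.
      exists d; split; auto. intros w Hw. unfold phi.
      destruct excluded_middle_informative as [->|Hn].
      * replace (l - l)%C with (RtoC 0) by ring. rewrite Cmod_0; auto.
      * assert (N : (w - z)%C <> 0) by (intros K; apply Hn, Ceq_minus; auto).
        replace ((f w - f z) / (w - z) - l)%C with ((f w - f z - l * (w - z)) / (w - z))%C by (field; auto).
        rewrite Cmod_div by auto.
        assert (P : 0 < Cmod (w - z)) by (apply Cmod_gt_0; auto).
        apply Rle_lt_trans with (eps / 2); [|lra].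
        apply Rmult_le_reg_r with (1 := P). unfold Rdiv at 1. rewrite Rmult_assoc, Rinv_l, Rmult_1_r by lra. auto.
    + intros w. unfold phi. destruct excluded_middle_informative as [->|Hn]. ring.
      field. intros K; apply Hn, Ceq_minus; auto.
  - intros (phi & Hc & E & HE). apply is_derive_C_eps. intros eps Heps.
    destruct (proj1 (continuous_C_eps _ _) Hc eps Heps) as (d & Hd & HD).
    exists d; split; auto. intros w Hw. rewrite HE, <- E.
    replace (phi w * (w - z) - phi z * (w - z))%C with ((phi w - phi z) * (w - z))%C by ring.
    rewrite Cmod_mult. apply Rmult_le_compat_r. apply Cmod_ge_0. left; auto.
Qed.

Lemma is_derive_C_continuous (f : C -> C) (z l : C) : cderiv f z l -> continuous f z.
Proof. intros H. apply ex_derive_C_continuous. exists l; auto. Qed.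

Lemma is_derive_Cmult (f g : C -> C) (z lf lg : C) :
  cderiv f z lf -> cderiv g z lg -> cderiv (fun w => (f w * g w)%C) z (lf * g z + f z * lg)%C.
Proof.
  intros Hf Hg. generalize (is_derive_C_continuous g z lg Hg); intros Cg.
  apply caratheodory in Hf. apply caratheodory in Hg. apply caratheodory.
  destruct Hf as (p & Cp & Ep & Hp), Hg as (q & Cq & Eq & Hq).
  exists (fun w => p w * g w + f z * q w)%C. split; [|split].
  - cont; auto.
  - rewrite Ep, Eq; auto.
  - intros w. transitivity ((f w - f z) * g w + f z * (g w - g z))%C. ring. rewrite Hp, Hq. ring.
Qed.

Lemma is_derive_Cplus (f g : C -> C) (z lf lg : C) :
  cderiv f z lf -> cderiv g z lg -> cderiv (fun w => (f w + g w)%C) z (lf + lg)%C.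
Proof. apply (is_derive_plus (K := C_AbsRing) (V := C_NormedModule)). Qed.

Lemma is_derive_Cminus (f g : C -> C) (z lf lg : C) :
  cderiv f z lf -> cderiv g z lg -> cderiv (fun w => (f w - g w)%C) z (lf - lg)%C.
Proof. apply (is_derive_minus (K := C_AbsRing) (V := C_NormedModule)). Qed.

Lemma is_derive_Cconst (c z : C) : cderiv (fun _ => c) z (RtoC 0).
Proof. apply (is_derive_const (K := C_AbsRing) (V := C_NormedModule)). Qed.

Lemma is_derive_Cid (z : C) : cderiv (fun w => w) z (RtoC 1).
Proof.
  apply caratheodory. exists (fun _ => RtoC 1). split. apply continuous_const. split; auto. intros; ring.
Qed.

Lemma is_derive_Ccomp (f g : C -> C) (z lf lg : C) :
  cderiv f (g z) lf -> cderiv g z lg -> cderiv (fun w => f (g w)) z (lf * lg)%C.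
Proof.
  intros Hf Hg. generalize (is_derive_C_continuous g z lg Hg); intros Cg.
  apply caratheodory in Hf. apply caratheodory in Hg. apply caratheodory.
  destruct Hf as (p & Cp & Ep & Hp), Hg as (q & Cq & Eq & Hq).
  exists (fun w => p (g w) * q w)%C. split; [|split].
  - apply continuous_Cmult; auto. apply (continuous_Ccomp p g); auto.
  - rewrite Ep, Eq; auto.
  - intros w. rewrite Hp, Hq. ring.
Qed.

Lemma is_derive_Cinv (z : C) : z <> 0 -> cderiv (fun w => / w)%C z (- / (z * z))%C.
Proof.
  intros Hz. apply is_derive_C_eps. intros eps Heps.
  set (d := Cmod z). assert (Hd : 0 < d) by (apply Cmod_gt_0; auto).
  exists (Rmin (d / 2) (eps * (d * d * d) / 2)).
  split. { apply Rmin_pos. lra. apply Rdiv_lt_0_compat; [|lra]. repeat apply Rmult_lt_0_compat; auto. }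
  intros w Hw.
  assert (Hw1 := Rlt_le_trans _ _ _ Hw (Rmin_l _ _)). assert (Hw2 := Rlt_le_trans _ _ _ Hw (Rmin_r _ _)).
  assert (Hd2 : d / 2 <= Cmod w).
  { unfold d in *. generalize (Cmod_triangle w (- (w - z))). rewrite Cmod_opp.
    replace (w + - (w - z))%C with z by ring. lra. }
  assert (Hw0 : w <> 0) by (apply Cmod_gt_0; lra).
  replace (/ w - / z - - / (z * z) * (w - z))%C with
    (/ w * / (z * z) * (w - z) * (w - z))%C by (field; auto).
  rewrite !Cmod_mult, !Cmod_inv, Cmod_mult by (auto; apply Cmult_neq_0; auto). fold d.
  apply Rmult_le_compat_r. apply Cmod_ge_0.
  apply Rle_trans with (2 / d * / (d * d) * (eps * (d * d * d) / 2)).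
  - apply Rmult_le_compat; try lra. 2: apply Cmod_ge_0.
    + apply Rmult_le_pos; left; apply Rinv_0_lt_compat; nra.
    + apply Rmult_le_compat_r. left; apply Rinv_0_lt_compat; nra.
      replace (2 / d) with (/ (d / 2)) by (field; lra). apply Rinv_le_contravar; lra.
  - right; field; lra.
Qed.

Lemma Cminus_neq_0 (z w : C) : z <> w -> (z - w)%C <> 0.
Proof. intros H E. apply H, Ceq_minus; auto. Qed.

Lemma holo_mult (f g : C -> C) (z : C) : holo f z -> holo g z -> holo (fun w => (f w * g w)%C) z.
Proof. intros [a Ha] [b Hb]. eexists. apply is_derive_Cmult; eauto. Qed.

Lemma holo_plus (f g : C -> C) (z : C) : holo f z -> holo g z -> holo (fun w => (f w + g w)%C) z.
Proof. intros [a Ha] [b Hb]. eexists. apply is_derive_Cplus; eauto. Qed.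

Lemma holo_minus (f g : C -> C) (z : C) : holo f z -> holo g z -> holo (fun w => (f w - g w)%C) z.
Proof. intros [a Ha] [b Hb]. eexists. apply is_derive_Cminus; eauto. Qed.

Lemma holo_const (c z : C) : holo (fun _ => c) z.
Proof. eexists. apply is_derive_Cconst. Qed.

Lemma holo_id (z : C) : holo (fun w => w) z.
Proof. eexists. apply is_derive_Cid. Qed.

Lemma holo_comp (f g : C -> C) (z : C) : holo f (g z) -> holo g z -> holo (fun w => f (g w)) z.
Proof. intros [a Ha] [b Hb]. eexists. apply is_derive_Ccomp; eauto. Qed.

Lemma holo_inv (f : C -> C) (z : C) : holo f z -> f z <> 0 -> holo (fun w => / f w)%C z.
Proof. intros Hf H0. apply (holo_comp Cinv f); auto. eexists. apply is_derive_Cinv; auto. Qed.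

Ltac Holo :=
  repeat (cbv beta;
  lazymatch goal with
  | |- ex_derive (fun _ => ?c) _ => apply holo_const
  | |- ex_derive (fun t => t) _ => apply holo_id
  | |- ex_derive (fun t => Cplus (@?f t) (@?g t)) _ => apply (holo_plus f g)
  | |- ex_derive (fun t => Cminus (@?f t) (@?g t)) _ => apply (holo_minus f g)
  | |- ex_derive (fun t => Cmult (@?f t) (@?g t)) _ => apply (holo_mult f g)
  | |- ex_derive (fun t => Cdiv (@?f t) (@?g t)) _ => apply (holo_mult f (fun t => Cinv (g t)))
  | |- ex_derive (fun t => Cinv (@?f t)) _ => apply (holo_inv f)
  end).

(** The pole is simple, with residue [c] given as a limit. On a square of half side [r] around it,
    [h] differs from c / (w - w0) by at most eps / r, and the perimeter is 8 r, so the error is at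
    most 8 eps for every eps. *)
Lemma residue_rect (h : C -> C) (u v : R) (c : C) x1 x2 y1 y2 :
  x1 < u < x2 -> y1 < v < y2 ->
  (forall x y, x1 <= x <= x2 -> y1 <= y <= y2 -> (x, y) <> (u, v) -> holo h (x, y)) ->
  (forall eps, 0 < eps -> exists d, 0 < d /\
     forall w, w <> (u, v) -> Cmod (w - (u, v)) < d -> Cmod ((w - (u, v)) * h w - c)%C <= eps) ->
  rect h x1 x2 y1 y2 = (2 * PI * Ci * c)%C.
Proof.
  intros Hx Hy Hh Hlim. set (w0 := (u, v) : C) in *.
  assert (Key : forall eps, 0 < eps -> Cmod (rect h x1 x2 y1 y2 - 2 * PI * Ci * c) <= 8 * eps).
  { intros eps Heps. destruct (Hlim eps Heps) as (d & Hd & HD).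
    (* Points of the square are within [r + r] of the centre, hence within [d]. *)
    set (r := Rmin (d / 3) (Rmin (Rmin (u - x1) (x2 - u)) (Rmin (v - y1) (y2 - v)))).
    assert (Hr : 0 < r) by (unfold r; repeat apply Rmin_pos; lra).
    assert (Hrd : r <= d / 3) by apply Rmin_l.
    assert (Hr1 : r <= u - x1 /\ r <= x2 - u /\ r <= v - y1 /\ r <= y2 - v).
    { unfold r, Rmin; repeat destruct Rle_dec; lra. }
    rewrite (rect_shrink h u v x1 x2 y1 y2 r); auto; try lra.
    rewrite <- (rect_inv_square u v r Hr).
    assert (Bd : forall x y, u - r <= x <= u + r -> v - r <= y <= v + r ->
      x = u - r \/ x = u + r \/ y = v - r \/ y = v + r -> ((x, y) : C) <> w0 /\ r <= Cmod ((x, y) - w0) /\ Cmod ((x, y) - w0) < d).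
    { intros x y Hxx Hyy Hb.
      assert (M : r <= Cmod ((x, y) - w0)).
      { eapply Rle_trans; [|apply Rmax_Cmod]. simpl. 
        destruct Hb as [->|[->|[->| ->]]].
        eapply Rle_trans; [|apply Rmax_l]. rewrite Rabs_left; lra.
        eapply Rle_trans; [|apply Rmax_l]. rewrite Rabs_right; lra.
        eapply Rle_trans; [|apply Rmax_r]. rewrite Rabs_left; lra.
        eapply Rle_trans; [|apply Rmax_r]. rewrite Rabs_right; lra. }
      repeat split; auto.
      - intros E. rewrite E in M. replace (w0 - w0)%C with (RtoC 0) in M by ring. rewrite Cmod_0 in M; lra.
      - eapply Rle_lt_trans; [apply Cmod_le_sum|]. simpl.
        apply Rle_lt_trans with (r + r); [|lra]. apply Rplus_le_compat; apply Rabs_le; lra. }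
    assert (Hci : on_bd (continuous (fun z => / (z - w0))%C) (u - r) (u + r) (v - r) (v + r)).
    { intros x y Hxx Hyy Hb. cont. apply Cminus_neq_0, Bd; auto. }
    assert (Hch : on_bd (continuous h) (u - r) (u + r) (v - r) (v + r)).
    { intros x y Hxx Hyy Hb. apply ex_derive_C_continuous. apply Hh; try lra. apply Bd; auto. }
    rewrite Cmult_comm, <- rect_scal by (auto; lra).
    rewrite <- rect_minus; try lra; auto.
    2:{ intros x y Hxx Hyy Hb. apply continuous_Cmult. cont. apply Hci; auto. }
    eapply Rle_trans.
    - apply (Cmod_rect_const _ _ _ _ _ (eps / r)); try lra.
      + intros x y Hxx Hyy Hb. apply continuous_Cminus. apply Hch; auto. apply continuous_Cmult. cont. apply Hci; auto.
      + intros x y Hxx Hyy Hb. destruct (Bd x y Hxx Hyy Hb) as (B1 & B2 & B3).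
        assert (N : ((x, y) - w0)%C <> 0) by (apply Cmod_gt_0; lra).
        change (Cmod (h (x, y) - c * / ((x, y) - w0)) <= eps / r). replace (h (x, y) - c * / ((x, y) - w0))%C with ((((x, y) - w0) * h (x, y) - c) / ((x, y) - w0))%C
          by (field; auto).
        rewrite Cmod_div by auto. unfold Rdiv. apply Rmult_le_compat; try apply Cmod_ge_0.
        left; apply Rinv_0_lt_compat; lra. apply HD; auto. apply Rinv_le_contravar; auto.
    - right; field; lra. }
  apply Ceq_minus, Cmod_eq_0.
  apply Rle_antisym; [|apply Cmod_ge_0].
  apply le_epsilon. intros e He. generalize (Key (e / 8)); lra.
Qed.

(** * Cauchy estimates *)

Lemma RInt_Cmod_scal_le (f g : R -> C) a b B : a <= b -> cont_on f a b -> cont_on g a b ->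
  (forall t, a <= t <= b -> Cmod (g t) <= B * Cmod (f t)) ->
  RInt (fun t => Cmod (g t)) a b <= B * RInt (fun t => Cmod (f t)) a b.
Proof.
  intros Hab Hf Hg H. rewrite <- RInt_Rscal by (apply ex_RInt_Cmod; auto).
  apply RInt_mono; auto. apply ex_RInt_Cmod; auto. apply ex_RInt_Rscal, ex_RInt_Cmod; auto.
Qed.

Lemma Cmod_rect_mul (f K : C -> C) x1 x2 y1 y2 B : x1 <= x2 -> y1 <= y2 ->
  on_bd (continuous f) x1 x2 y1 y2 -> on_bd (continuous K) x1 x2 y1 y2 ->
  on_bd (fun z => Cmod (K z) <= B) x1 x2 y1 y2 ->
  Cmod (rect (fun z => (f z * K z)%C) x1 x2 y1 y2) <= B * arect (fun z => Cmod (f z)) x1 x2 y1 y2.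
Proof.
  intros Hx Hy Hf HK HB.
  assert (HfK : on_bd (continuous (fun z => (f z * K z)%C)) x1 x2 y1 y2).
  { intros x y Hxx Hyy Hb. apply continuous_Cmult. apply Hf; auto. apply HK; auto. }
  eapply Rle_trans; [apply Cmod_rect; auto|].
  apply cont_bd in Hf; auto. apply cont_bd in HfK; auto.
  destruct Hf as (?&?&?&?), HfK as (?&?&?&?). unfold arect.
  assert (T : forall z, Cmod (K z) <= B -> Cmod (f z * K z) <= B * Cmod (f z)).
  { intros z Hz. rewrite Cmod_mult, Rmult_comm. apply Rmult_le_compat_r; auto. apply Cmod_ge_0. }
  rewrite !Rmult_plus_distr_l.
  repeat apply Rplus_le_compat.
  - apply (RInt_Cmod_scal_le (fun t => f (t, y1)) (fun t => f (t, y1) * K (t, y1))%C); auto.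
    intros t Ht; apply T, HB; try lra; auto.
  - apply (RInt_Cmod_scal_le (fun t => f (x2, t)) (fun t => f (x2, t) * K (x2, t))%C); auto.
    intros t Ht; apply T, HB; try lra; auto.
  - apply (RInt_Cmod_scal_le (fun t => f (t, y2)) (fun t => f (t, y2) * K (t, y2))%C); auto.
    intros t Ht; apply T, HB; try lra; auto.
  - apply (RInt_Cmod_scal_le (fun t => f (x1, t)) (fun t => f (x1, t) * K (x1, t))%C); auto.
    intros t Ht; apply T, HB; try lra; auto.
Qed.

Lemma two_pi_i_neq_0 : (2 * PI * Ci)%C <> 0.
Proof.
  intros E. assert (K : Im (2 * PI * Ci)%C = 0) by (rewrite E; reflexivity).
  simpl in K. generalize PI_RGT_0. lra.
Qed.

Lemma Cmod_two_pi_i : Cmod (2 * PI * Ci) = 2 * PI.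
Proof.
  rewrite !Cmod_mult, Cmod_Ci, !Cmod_R, !Rabs_pos_eq. ring. left; apply PI_RGT_0. lra.
Qed.

Definition dist_bd (p : C) (m x1 x2 y1 y2 : R) : Prop :=
  x1 + m <= fst p /\ fst p + m <= x2 /\ y1 + m <= snd p /\ snd p + m <= y2.

Lemma dist_bd_mod (p : C) m x1 x2 y1 y2 : dist_bd p m x1 x2 y1 y2 ->
  on_bd (fun w => m <= Cmod (w - p)) x1 x2 y1 y2.
Proof.
  destruct p as [a b]. unfold dist_bd; simpl. intros H x y Hx Hy Hb.
  eapply Rle_trans; [|apply Rmax_Cmod]. simpl.
  destruct Hb as [->|[->|[->| ->]]].
  - eapply Rle_trans; [|apply Rmax_l]. rewrite <- Rabs_Ropp. eapply Rle_trans; [|apply Rle_abs]. lra.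
  - eapply Rle_trans; [|apply Rmax_l]. eapply Rle_trans; [|apply Rle_abs]. lra.
  - eapply Rle_trans; [|apply Rmax_r]. rewrite <- Rabs_Ropp. eapply Rle_trans; [|apply Rle_abs]. lra.
  - eapply Rle_trans; [|apply Rmax_r]. eapply Rle_trans; [|apply Rle_abs]. lra.
Qed.

Lemma Cmod_Rabs (z : C) : Rabs (fst z) <= Cmod z /\ Rabs (snd z) <= Cmod z.
Proof.
  split; (eapply Rle_trans; [|apply Rmax_Cmod]); [apply Rmax_l|apply Rmax_r].
Qed.

Lemma dist_bd_plus (p k : C) m x1 x2 y1 y2 : dist_bd p m x1 x2 y1 y2 -> Cmod k <= m / 2 ->
  dist_bd (p + k)%C (m / 2) x1 x2 y1 y2.
Proof.
  intros (a & b & c & d) Hk. destruct (Cmod_Rabs k) as [H1 H2].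
  assert (H3 := Rle_trans _ _ _ H1 Hk). assert (H4 := Rle_trans _ _ _ H2 Hk).
  apply Rabs_le_between in H3. apply Rabs_le_between in H4.
  unfold dist_bd; simpl. repeat split; lra.
Qed.

Lemma Cmod_sub_ge (a b : C) : Cmod a - Cmod b <= Cmod (a - b).
Proof.
  generalize (Cmod_triangle (a - b) b). replace (a - b + b)%C with a by ring. lra.
Qed.

Lemma Cmod_pos_neq_0 (z : C) (m : R) : 0 < m -> m <= Cmod z -> z <> 0.
Proof. intros. apply Cmod_gt_0. lra. Qed.

Lemma is_derive_of_quadratic (g : C -> C) (p l : C) (m B : R) : 0 < m -> 0 <= B ->
  (forall k, Cmod k <= m -> Cmod (g (p + k) - g p - k * l)%C <= B * Cmod k * Cmod k) -> cderiv g p l.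
Proof.
  intros Hm HB0 H. apply is_derive_C_eps. intros eps Heps.
  assert (HB : 0 < B + 1) by lra.
  exists (Rmin m (eps / (B + 1))). split. apply Rmin_pos; auto. apply Rdiv_lt_0_compat; auto.
  intros w Hw.
  assert (Hw1 := Rlt_le_trans _ _ _ Hw (Rmin_l _ _)). assert (Hw2 := Rlt_le_trans _ _ _ Hw (Rmin_r _ _)).
  specialize (H (w - p)%C (Rlt_le _ _ Hw1)). replace (p + (w - p))%C with w in H by ring.
  replace (l * (w - p))%C with ((w - p) * l)%C by ring.
  eapply Rle_trans; [exact H|]. apply Rmult_le_compat_r. apply Cmod_ge_0.
  apply Rle_trans with ((B + 1) * (eps / (B + 1))).
  apply Rmult_le_compat; try lra. apply Cmod_ge_0. right; field; lra.
Qed.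

Section Cauchy.

Variables (f : C -> C) (x1 x2 y1 y2 : R).
Hypothesis Hf : on_rect (holo f) x1 x2 y1 y2.

Let A := arect (fun z => Cmod (f z)) x1 x2 y1 y2.

(** Cauchy's integrals for the first and, below, the second derivative. The estimates that follow
    use the L^1 norm [A] of [f] on the contour instead of a supremum, because this norm can
    afterwards be integrated along a ray. *)
Definition cauchy_D1 (p : C) : C :=
  (/ (2 * PI * Ci) * rect (fun w => f w * / ((w - p) * (w - p))) x1 x2 y1 y2)%C.

Definition cauchy_D2 (p : C) : C :=
  (/ (2 * PI * Ci) * rect (fun w => f w * (2 * / ((w - p) * (w - p) * (w - p)))) x1 x2 y1 y2)%C.

Lemma cauchy_formula (p : C) m : 0 < m -> dist_bd p m x1 x2 y1 y2 ->
  f p = (/ (2 * PI * Ci) * rect (fun w => f w * / (w - p)) x1 x2 y1 y2)%C.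
Proof.
  intros Hm Hp. destruct p as [u v]. unfold dist_bd in Hp; simpl in Hp.
  rewrite (residue_rect _ u v (f (u, v))); try lra.
  - field. split; [intros E; injection E; lra|]. intros E. apply RtoC_inj in E. generalize PI_RGT_0; lra.
  - intros x y Hx Hy Hn. Holo. apply Hf; auto. apply Cminus_neq_0; auto.
  - intros eps Heps.
    assert (Hc : continuous f (u, v)) by (apply ex_derive_C_continuous, Hf; lra).
    destruct (proj1 (continuous_C_eps _ _) Hc eps Heps) as (d & Hd & HD).
    exists d; split; auto. intros w Hw Hwd.
    replace ((w - (u, v)) * (f w * / (w - (u, v))) - f (u, v))%C with (f w - f (u, v))%C.
    left; apply HD; auto.
    field. intros E; apply Hw, Ceq_minus; auto.
Qed.

Lemma cont_f_bd : on_bd (continuous f) x1 x2 y1 y2.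
Proof. apply on_rect_bd. apply (on_rect_impl (holo f)); auto. apply ex_derive_C_continuous. Qed.

Lemma cauchy_bound (K : C -> C) B : x1 <= x2 -> y1 <= y2 ->
  on_bd (continuous K) x1 x2 y1 y2 -> on_bd (fun z => Cmod (K z) <= B) x1 x2 y1 y2 ->
  Cmod (/ (2 * PI * Ci) * rect (fun w => f w * K w)%C x1 x2 y1 y2) <= / (2 * PI) * (B * A).
Proof.
  intros. rewrite Cmod_mult, Cmod_inv, Cmod_two_pi_i by apply two_pi_i_neq_0.
  apply Rmult_le_compat_l. left; apply Rinv_0_lt_compat. generalize PI_RGT_0; lra.
  apply Cmod_rect_mul; auto. apply cont_f_bd.
Qed.

Lemma dist_bd_order (p : C) m : 0 < m -> dist_bd p m x1 x2 y1 y2 -> x1 <= x2 /\ y1 <= y2.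
Proof. intros Hm (a & b & c & d). lra. Qed.

Lemma cauchy_lin (K1 K2 K3 : C -> C) (k : C) : x1 <= x2 -> y1 <= y2 ->
  on_bd (continuous K1) x1 x2 y1 y2 -> on_bd (continuous K2) x1 x2 y1 y2 -> on_bd (continuous K3) x1 x2 y1 y2 ->
  (rect (fun w => f w * K1 w) x1 x2 y1 y2 - rect (fun w => f w * K2 w) x1 x2 y1 y2
   - k * rect (fun w => f w * K3 w) x1 x2 y1 y2 =
  rect (fun w => f w * (K1 w - K2 w - k * K3 w)) x1 x2 y1 y2)%C.
Proof.
  intros Hx Hy H1 H2 H3. generalize cont_f_bd; intros Hc.
  rewrite <- rect_scal, <- rect_minus, <- rect_minus; auto.
  - apply rect_eq; auto. intros; ring.
  - intros x y a b c. apply continuous_Cminus; apply continuous_Cmult; auto.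
  - intros x y a b c. apply continuous_Cmult. cont. apply continuous_Cmult; auto.
  - intros x y a b c. apply continuous_Cmult; auto.
  - intros x y a b c. apply continuous_Cmult; auto.
  - intros x y a b c. apply continuous_Cmult; auto.
Qed.

Lemma cauchy_D1_bound (p : C) m : 0 < m -> dist_bd p m x1 x2 y1 y2 ->
  Cmod (cauchy_D1 p) <= / (2 * PI) * (/ (m * m) * A).
Proof.
  intros Hm Hp. destruct (dist_bd_order p m Hm Hp).
  generalize (dist_bd_mod _ _ _ _ _ _ Hp); intros Hd.
  apply cauchy_bound; auto.
  - intros x y a b c. generalize (Cmod_pos_neq_0 _ _ Hm (Hd x y a b c)). intros. cont. apply Cmult_neq_0; auto.
  - intros x y a b c. generalize (Hd x y a b c) (Cmod_pos_neq_0 _ _ Hm (Hd x y a b c)). intros.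
    rewrite Cmod_inv, Cmod_mult by (apply Cmult_neq_0; auto).
    apply Rinv_le_contravar. nra. apply Rmult_le_compat; lra.
Qed.

(** The combination of the three kernels is k^2 / ((w - p)^2 (w - p - k)), and p + k still keeps the
    distance m / 2 from the contour. *)
Lemma cauchy_D1_taylor (p k : C) m : 0 < m -> dist_bd p m x1 x2 y1 y2 -> Cmod k <= m / 2 ->
  Cmod (f (p + k) - f p - k * cauchy_D1 p)%C <= / (2 * PI) * (2 * Cmod k * Cmod k / (m * m * m) * A).
Proof.
  intros Hm Hp Hk. destruct (dist_bd_order p m Hm Hp).
  generalize (dist_bd_mod _ _ _ _ _ _ Hp); intros Hd.
  generalize (dist_bd_mod _ _ _ _ _ _ (dist_bd_plus _ _ _ _ _ _ _ Hp Hk)); intros Hd2.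
  assert (Hm2 : 0 < m / 2) by lra.
  rewrite (cauchy_formula (p + k) (m / 2)), (cauchy_formula p m) by (auto; apply dist_bd_plus; auto).
  unfold cauchy_D1.
  assert (C1 : on_bd (continuous (fun w => / (w - (p + k)))%C) x1 x2 y1 y2).
  { intros x y a b c. generalize (Cmod_pos_neq_0 _ _ Hm2 (Hd2 x y a b c)). intros. cont. auto. }
  assert (C2 : on_bd (continuous (fun w => / (w - p))%C) x1 x2 y1 y2).
  { intros x y a b c. generalize (Cmod_pos_neq_0 _ _ Hm (Hd x y a b c)). intros. cont. auto. }
  assert (C3 : on_bd (continuous (fun w => / ((w - p) * (w - p)))%C) x1 x2 y1 y2).
  { intros x y a b c. generalize (Cmod_pos_neq_0 _ _ Hm (Hd x y a b c)). intros. cont. apply Cmult_neq_0; auto. }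
  match goal with |- Cmod (?i * ?a - ?i * ?b - ?k * (?i * ?c)) <= _ =>
    replace (i * a - i * b - k * (i * c))%C with (i * (a - b - k * c))%C by ring end.
  rewrite cauchy_lin by auto.
  apply cauchy_bound; auto.
  - intros x y a b c. apply continuous_Cminus. apply continuous_Cminus; auto. apply continuous_Cmult. cont. auto.
  - intros x y a b c. generalize (Hd x y a b c) (Hd2 x y a b c). 
    generalize (Cmod_pos_neq_0 _ _ Hm (Hd x y a b c)) (Cmod_pos_neq_0 _ _ Hm2 (Hd2 x y a b c)).
    set (w := (x, y) : C). intros N1 N2 B1 B2.
    replace (/ (w - (p + k)) - / (w - p) - k * / ((w - p) * (w - p)))%C with
      (k * k / ((w - p) * (w - p) * (w - (p + k))))%C by (field; auto).
    rewrite Cmod_div, !Cmod_mult by (repeat apply Cmult_neq_0; auto).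
    replace (2 * Cmod k * Cmod k / (m * m * m)) with (Cmod k * Cmod k / (m * m * (m / 2))) by (field; lra).
    apply Rmult_le_compat_l. apply Rmult_le_pos; apply Cmod_ge_0.
    apply Rinv_le_contravar. repeat apply Rmult_lt_0_compat; lra.
    repeat apply Rmult_le_compat; try lra. nra.
Qed.

Lemma cauchy_D2_taylor (p k : C) m : 0 < m -> dist_bd p m x1 x2 y1 y2 -> Cmod k <= m / 2 ->
  Cmod (cauchy_D1 (p + k) - cauchy_D1 p - k * cauchy_D2 p)%C <=
   / (2 * PI) * (16 * Cmod k * Cmod k / (m * m * (m * m)) * A).
Proof.
  intros Hm Hp Hk. destruct (dist_bd_order p m Hm Hp).
  generalize (dist_bd_mod _ _ _ _ _ _ Hp); intros Hd.
  generalize (dist_bd_mod _ _ _ _ _ _ (dist_bd_plus _ _ _ _ _ _ _ Hp Hk)); intros Hd2.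
  assert (Hm2 : 0 < m / 2) by lra.
  unfold cauchy_D1, cauchy_D2.
  assert (C1 : on_bd (continuous (fun w => / ((w - (p + k)) * (w - (p + k))))%C) x1 x2 y1 y2).
  { intros x y a b c. generalize (Cmod_pos_neq_0 _ _ Hm2 (Hd2 x y a b c)). intros. cont. apply Cmult_neq_0; auto. }
  assert (C2 : on_bd (continuous (fun w => / ((w - p) * (w - p)))%C) x1 x2 y1 y2).
  { intros x y a b c. generalize (Cmod_pos_neq_0 _ _ Hm (Hd x y a b c)). intros. cont. apply Cmult_neq_0; auto. }
  assert (C3 : on_bd (continuous (fun w => 2 * / ((w - p) * (w - p) * (w - p)))%C) x1 x2 y1 y2).
  { intros x y a b c. generalize (Cmod_pos_neq_0 _ _ Hm (Hd x y a b c)). intros. cont. repeat apply Cmult_neq_0; auto. }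
  match goal with |- Cmod (?i * ?a - ?i * ?b - ?k * (?i * ?c)) <= _ =>
    replace (i * a - i * b - k * (i * c))%C with (i * (a - b - k * c))%C by ring end.
  rewrite cauchy_lin by auto.
  apply cauchy_bound; auto.
  - intros x y a b c. apply continuous_Cminus. apply continuous_Cminus; auto. apply continuous_Cmult. cont. auto.
  - intros x y a b c. generalize (Hd x y a b c) (Hd2 x y a b c). 
    generalize (Cmod_pos_neq_0 _ _ Hm (Hd x y a b c)) (Cmod_pos_neq_0 _ _ Hm2 (Hd2 x y a b c)).
    set (w := (x, y) : C). intros N1 N2 B1 B2.
    replace (/ ((w - (p + k)) * (w - (p + k))) - / ((w - p) * (w - p)) - k * (2 * / ((w - p) * (w - p) * (w - p))))%C with
      (k * k * (3 * (w - p) - 2 * k) / ((w - p) * (w - p) * (w - p) * ((w - (p + k)) * (w - (p + k)))))%C by (field; auto).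
    rewrite Cmod_div, !Cmod_mult by (repeat apply Cmult_neq_0; auto).
    set (q := Cmod (w - p)) in *. set (r := Cmod (w - (p + k))) in *. set (s := Cmod k) in *.
    assert (Hs : 0 <= s) by apply Cmod_ge_0.
    (* Here 2 |k| <= m <= q, which turns 3 q + 2 |k| into 4 q. *)
    assert (Hn : Cmod (3 * (w - p) - 2 * k) <= 4 * q).
    { unfold Cminus at 1. eapply Rle_trans; [apply Cmod_triangle|].
      rewrite Cmod_opp, !Cmod_mult, !Cmod_R, !Rabs_pos_eq by lra. fold q s. lra. }
    apply Rle_trans with (s * s * (4 * q) / (q * q * q * (r * r))).
    + apply Rmult_le_compat_r. left; apply Rinv_0_lt_compat; repeat apply Rmult_lt_0_compat; lra.
      apply Rmult_le_compat_l; auto. nra.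
    + replace (s * s * (4 * q) / (q * q * q * (r * r))) with (4 * s * s * / (q * q * (r * r))) by (field; lra).
      replace (16 * s * s / (m * m * (m * m))) with (4 * s * s * / (m * m * (m / 2 * (m / 2)))) by (field; lra).
      apply Rmult_le_compat_l. nra.
      apply Rinv_le_contravar. repeat apply Rmult_lt_0_compat; lra.
      apply Rmult_le_compat; try nra.
Qed.

End Cauchy.

Lemma C_derive_eq (f : C -> C) (z l : C) : cderiv f z l -> C_derive f z = l.
Proof. apply is_C_derive_unique. Qed.

Lemma C_derive_holo (f : C -> C) (z : C) : holo f z -> cderiv f z (C_derive f z).
Proof. apply C_derive_correct. exact z. Qed.

Lemma locally_C_ball (z : C) (P : C -> Prop) (r : R) : 0 < r ->
  (forall w, Cmod (w - z) < r -> P w) -> locally (T := AbsRing_UniformSpace C_AbsRing) z P.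
Proof. intros Hr H. exists (mkposreal r Hr). exact H. Qed.

Lemma cauchy_D1_deriv (f : C -> C) x1 x2 y1 y2 (p : C) m : 0 < m ->
  on_rect (holo f) x1 x2 y1 y2 -> dist_bd p m x1 x2 y1 y2 -> cderiv f p (cauchy_D1 f x1 x2 y1 y2 p).
Proof.
  intros Hm Hf Hp.
  apply (is_derive_of_quadratic f p _ (m / 2) (Rabs (/ (2 * PI) * (2 / (m * m * m) * arect (fun z => Cmod (f z)) x1 x2 y1 y2)))).
  lra. apply Rabs_pos.
  intros k Hk. eapply Rle_trans; [apply (cauchy_D1_taylor f x1 x2 y1 y2 Hf p k m); auto|].
  set (A := arect (fun z => Cmod (f z)) x1 x2 y1 y2).
  replace (/ (2 * PI) * (2 * Cmod k * Cmod k / (m * m * m) * A)) with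
    (/ (2 * PI) * (2 / (m * m * m) * A) * Cmod k * Cmod k) by (generalize PI_RGT_0; intros; field; split; lra).
  repeat apply Rmult_le_compat_r; try apply Cmod_ge_0. apply Rle_abs.
Qed.

(** Near [p] the derivative coincides with the integral [cauchy_D1], and the quadratic estimate
    [cauchy_D2_taylor] differentiates the latter. *)
Lemma holo_C_derive_rect (f : C -> C) x1 x2 y1 y2 (p : C) m : 0 < m ->
  on_rect (holo f) x1 x2 y1 y2 -> dist_bd p m x1 x2 y1 y2 -> holo (C_derive f) p.
Proof.
  intros Hm Hf Hp. exists (cauchy_D2 f x1 x2 y1 y2 p).
  apply (is_derive_ext_loc (cauchy_D1 f x1 x2 y1 y2)).
  - apply (locally_C_ball p _ (m / 2)). lra.
    intros w Hw. symmetry. apply C_derive_eq. apply (cauchy_D1_deriv f _ _ _ _ _ (m / 2)); auto. lra.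
    replace w with (p + (w - p))%C by ring. apply dist_bd_plus; auto. lra.
  - apply (is_derive_of_quadratic _ p _ (m / 2) (Rabs (/ (2 * PI) * (16 / (m * m * (m * m)) * arect (fun z => Cmod (f z)) x1 x2 y1 y2)))).
    lra. apply Rabs_pos.
    intros k Hk. eapply Rle_trans; [apply (cauchy_D2_taylor f x1 x2 y1 y2 Hf p k m); auto|].
    set (A := arect (fun z => Cmod (f z)) x1 x2 y1 y2).
    replace (/ (2 * PI) * (16 * Cmod k * Cmod k / (m * m * (m * m)) * A)) with
      (/ (2 * PI) * (16 / (m * m * (m * m)) * A) * Cmod k * Cmod k) by (generalize PI_RGT_0; intros; field; split; lra).
    repeat apply Rmult_le_compat_r; try apply Cmod_ge_0. apply Rle_abs.
Qed.

Lemma holo_C_derive (f : C -> C) (p : C) r : 0 < r ->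
  (forall w, Cmod (w - p) < r -> holo f w) -> holo (C_derive f) p.
Proof.
  intros Hr H. destruct p as [a b].
  apply (holo_C_derive_rect f (a - r / 3) (a + r / 3) (b - r / 3) (b + r / 3) _ (r / 3)).
  - lra.
  - intros x y Hx Hy. apply H. eapply Rle_lt_trans; [apply Cmod_le_sum|]. simpl.
    apply Rle_lt_trans with (r / 3 + r / 3); [|lra]. apply Rplus_le_compat; apply Rabs_le; lra.
  - unfold dist_bd; simpl; lra.
Qed.

(** * Holomorphy from the Cauchy-Riemann equations: the exponential and the logarithm *)

Lemma cauchy_riemann (u v p q : R -> R -> R) x y :
  locally (x, y) (fun w : R * R => is_derive (fun z => u z (snd w)) (fst w) (p (fst w) (snd w))) ->
  locally (x, y) (fun w : R * R => is_derive (fun z => v z (snd w)) (fst w) (q (fst w) (snd w))) ->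
  is_derive (fun z => u x z) y (- q x y) -> is_derive (fun z => v x z) y (p x y) ->
  continuous (fun w : R * R => p (fst w) (snd w)) (x, y) ->
  continuous (fun w : R * R => q (fst w) (snd w)) (x, y) ->
  cderiv (fun w => (u (fst w) (snd w), v (fst w) (snd w))) (x, y) (p x y, q x y).
Proof.
  intros Hux Hvx Huy Hvy Hp Hq.
  generalize (proj1 (filterdiff_differentiable_pt_lim u x y _ _) (is_derive_filterdiff u x y p _ Hux Huy Hp)); intros Du.
  generalize (proj1 (filterdiff_differentiable_pt_lim v x y _ _) (is_derive_filterdiff v x y q _ Hvx Hvy Hq)); intros Dv.
  apply is_derive_C_eps. intros eps Heps.
  assert (He : 0 < eps / 2) by lra.
  destruct (Du (mkposreal _ He)) as [d1 H1]. destruct (Dv (mkposreal _ He)) as [d2 H2].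
  exists (Rmin d1 d2). split. apply Rmin_pos; apply cond_pos.
  intros [a b] Hw.
  destruct (Cmod_Rabs ((a, b) - (x, y))) as [Ka Kb]. simpl in Ka, Kb.
  assert (Hw1 := Rlt_le_trans _ _ _ Hw (Rmin_l _ _)). assert (Hw2 := Rlt_le_trans _ _ _ Hw (Rmin_r _ _)).
  specialize (H1 a b (Rle_lt_trans _ _ _ Ka Hw1) (Rle_lt_trans _ _ _ Kb Hw1)).
  specialize (H2 a b (Rle_lt_trans _ _ _ Ka Hw2) (Rle_lt_trans _ _ _ Kb Hw2)).
  simpl in H1, H2.
  assert (HM : Rmax (Rabs (a - x)) (Rabs (b - y)) <= Cmod ((a, b) - (x, y))) by (apply Rmax_lub; auto).
  eapply Rle_trans; [apply Cmod_le_sum|]. set (M := Cmod ((a, b) - (x, y))) in *. simpl.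
  replace (u a b + - u x y + - (p x y * (a + - x) - q x y * (b + - y))) with
    (u a b - u x y - (p x y * (a - x) + - q x y * (b - y))) by ring.
  replace (v a b + - v x y + - (p x y * (b + - y) + q x y * (a + - x))) with
    (v a b - v x y - (q x y * (a - x) + p x y * (b - y))) by ring.
  apply Rle_trans with (eps / 2 * M + eps / 2 * M); [|lra].
  apply Rplus_le_compat.
  - eapply Rle_trans; [exact H1|]. apply Rmult_le_compat_l; [lra|exact HM].
  - eapply Rle_trans; [exact H2|]. apply Rmult_le_compat_l; [lra|exact HM].
Qed.

(** Written with [polar], so that horizontal lines map to rays and vertical segments to arcs by
    computation. *)
Definition Cexp (z : C) : C := polar (exp (fst z)) (snd z).

Lemma polar_mult r s a b : polar (r * s) (a + b) = (polar r a * polar s b)%C.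
Proof. unfold polar. rewrite cos_plus, sin_plus. apply C_eq; simpl; ring. Qed.

Lemma Cmod_polar r a : 0 <= r -> Cmod (polar r a) = r.
Proof.
  intros Hr. unfold Cmod, polar; simpl.
  replace (r * cos a * (r * cos a * 1) + r * sin a * (r * sin a * 1)) with (r * r * ((sin a)² + (cos a)²)) by (unfold Rsqr; ring).
  rewrite sin2_cos2, Rmult_1_r. apply sqrt_square; auto.
Qed.

Lemma Cmod_Cexp (z : C) : Cmod (Cexp z) = exp (fst z).
Proof. apply Cmod_polar. left; apply exp_pos. Qed.

Lemma Cexp_neq_0 (z : C) : Cexp z <> 0.
Proof. apply Cmod_gt_0. rewrite Cmod_Cexp. apply exp_pos. Qed.

Lemma cderiv_Cexp (z : C) : cderiv Cexp z (Cexp z).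
Proof.
  destruct z as [x y].
  apply (cauchy_riemann (fun x y => exp x * cos y) (fun x y => exp x * sin y)
    (fun x y => exp x * cos y) (fun x y => exp x * sin y) x y).
  - apply filter_forall. intros [a b]; simpl. auto_derive; auto. ring.
  - apply filter_forall. intros [a b]; simpl. auto_derive; auto. ring.
  - auto_derive; auto. ring.
  - auto_derive; auto. ring.
  - cont.
  - cont.
Qed.

(** The principal logarithm on the right half-plane, where the arctangent of y / x is the
    argument. *)
Definition Clog (z : C) : C := (ln (fst z * fst z + snd z * snd z) / 2, atan (snd z / fst z)).

Lemma cderiv_Clog (z : C) : 0 < fst z -> cderiv Clog z (/ z)%C.
Proof.
  destruct z as [x y]; simpl. intros Hx.
  assert (L : locally ((x, y) : R * R) (fun w : R * R => 0 < fst w)).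
  { exists (mkposreal _ Hx). intros [a b] [Hw _]; simpl in *. unfold ball in Hw; simpl in Hw.
    unfold AbsRing_ball, abs, minus, plus, opp in Hw; simpl in Hw. apply Rabs_def2 in Hw. lra. }
  assert (N : forall a b : R, 0 < a -> 0 < a * a + b * b) by (intros; nra).
  assert (E : (/ (x, y))%C = (x / (x * x + y * y), - y / (x * x + y * y))).
  { apply C_eq; simpl; rewrite !Rmult_1_r; reflexivity. }
  rewrite E.
  apply (cauchy_riemann (fun x y => ln (x * x + y * y) / 2) (fun x y => atan (y / x))
    (fun x y => x / (x * x + y * y)) (fun x y => - y / (x * x + y * y)) x y).
  - revert L. apply filter_imp. intros [a b]; simpl; intros Ha. generalize (N a b Ha); intros.
    auto_derive; auto. field; lra.
  - revert L. apply filter_imp. intros [a b]; simpl; intros Ha. generalize (N a b Ha); intros.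
    auto_derive; try lra. field. lra.
  - generalize (N x y Hx); intros. auto_derive; auto. field; lra.
  - generalize (N x y Hx); intros. auto_derive; try lra. field; lra.
  - generalize (N x y Hx); intros. cont. simpl. lra.
  - generalize (N x y Hx); intros. cont. simpl. lra.
Qed.

(** * The Cauchy formula on sectors *)

Lemma exp_le_exp x y : x <= y -> exp x <= exp y.
Proof. intros [H| ->]; [left; apply exp_increasing; auto|lra]. Qed.

Lemma cos_lt_1 x : Rabs x < 2 * PI -> x <> 0 -> cos x < 1.
Proof.
  intros Hx H0.
  assert (Hs : 0 < (sin (x / 2)) ^ 2).
  { assert (P : forall y, 0 < y < PI -> 0 < sin y ^ 2).
    { intros y Hy. apply pow_lt, sin_gt_0; lra. }
    apply Rabs_def2 in Hx.
    destruct (Rdichotomy _ _ H0).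
    - replace (sin (x / 2) ^ 2) with (sin (- (x / 2)) ^ 2) by (rewrite sin_neg; ring). apply P; lra.
    - apply P; lra. }
  replace x with (2 * (x / 2)) by field. rewrite cos_2a_sin. simpl in Hs. lra.
Qed.

Lemma polar_neq_0 r a : 0 < r -> polar r a <> 0.
Proof. intros. apply Cmod_gt_0. rewrite Cmod_polar; lra. Qed.

Lemma polar_inj r s a b : 0 < r -> 0 < s -> Rabs (a - b) < 2 * PI -> polar r a = polar s b -> r = s /\ a = b.
Proof.
  intros Hr Hs Hab E.
  assert (r = s) by (rewrite <- (Cmod_polar r a), <- (Cmod_polar s b), E; lra). subst s.
  split; auto. destruct (Req_dec (a - b) 0) as [H|H]. lra.
  exfalso. assert (K := cos_lt_1 _ Hab H). rewrite cos_minus in K.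
  injection E; intros E2 E1. apply Rmult_eq_reg_l in E1; [|lra]. apply Rmult_eq_reg_l in E2; [|lra].
  rewrite E1, E2 in K. generalize (sin2_cos2 b). unfold Rsqr. lra.
Qed.

Lemma Cexp_polar x y : Cexp (x, y) = polar (exp x) y.
Proof. reflexivity. Qed.

(** The contour integral of [h] over the boundary of the truncated sector with radii [a], [b] and
    angles [al], [be], pulled back by the exponential to a rectangle so that the residue theorem on
    rectangles applies. *)
Definition Gam (h : C -> C) (a b al be : R) : C :=
  rect (fun w => h (Cexp w) * Cexp w)%C (ln a) (ln b) al be.

Definition in_sec (al be : R) (P : C -> Prop) : Prop :=
  forall r th, 0 < r -> al <= th <= be -> P (polar r th).

(** The holomorphic factor [K], equal to 1 at the pole, leaves the reproduced value unchanged; it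
    gives the freedom to replace the Cauchy kernel by one with a second pole outside the sector. An
    opening below 2 pi makes the exponential injective on the rectangle. *)
Lemma sector_cauchy (f K : C -> C) (a b al be r th : R) :
  0 < a -> a < r < b -> al < th < be -> be - al < 2 * PI ->
  in_sec al be (holo f) -> in_sec al be (holo K) -> K (polar r th) = 1 ->
  Gam (fun z => f z * (K z / (z - polar r th)))%C a b al be = (2 * PI * Ci * f (polar r th))%C.
Proof.
  intros Ha Hr Hth Hbe Hf HK HK1. unfold Gam.
  assert (E0 : Cexp (ln r, th) = polar r th) by (rewrite Cexp_polar, exp_ln by lra; reflexivity).
  set (z0 := polar r th) in *.
  apply (residue_rect _ (ln r) th).
  - split; apply ln_increasing; lra.
  - auto.
  - intros x y Hx Hy Hn.
    assert (hE : holo Cexp (x, y)) by (eexists; apply cderiv_Cexp).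
    Holo; auto.
    + apply (holo_comp f Cexp); auto. apply Hf; auto. apply exp_pos.
    + apply (holo_comp K Cexp); auto. apply HK; auto. apply exp_pos.
    + apply Cminus_neq_0. rewrite Cexp_polar. intros E.
      apply polar_inj in E; try lra. 2: apply exp_pos.
      * destruct E as [E1 E2]. apply Hn. rewrite <- E1, ln_exp, E2. reflexivity.
      * apply Rabs_def1; lra.
  (* With the slope [phi] of the exponential, Cexp w - z0 = phi w (w - w0): the simple pole in z
     becomes a simple pole in w. *)
  - destruct (proj1 (caratheodory _ _ _) (cderiv_Cexp (ln r, th))) as (phi & Cphi & Ephi & Hphi).
    set (w0 := (ln r, th) : C) in *.
    assert (N0 : phi w0 <> 0) by (rewrite Ephi; apply Cexp_neq_0).
    assert (CE : continuous Cexp w0) by (eapply is_derive_C_continuous, cderiv_Cexp).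
    assert (Cg : continuous (fun w => f (Cexp w) * K (Cexp w) * Cexp w / phi w)%C w0).
    { cont; auto.
      - apply (continuous_Ccomp f Cexp); auto. rewrite E0. apply ex_derive_C_continuous, Hf; lra.
      - apply (continuous_Ccomp K Cexp); auto. rewrite E0. apply ex_derive_C_continuous, HK; lra. }
    assert (Eg : (f (Cexp w0) * K (Cexp w0) * Cexp w0 / phi w0)%C = f z0).
    { rewrite Ephi, E0, HK1. field. apply polar_neq_0; lra. }
    intros eps Heps.
    destruct (proj1 (continuous_C_eps _ _) Cg eps Heps) as (d1 & Hd1 & HD1).
    assert (Np : 0 < Cmod (phi w0)) by (apply Cmod_gt_0; auto).
    destruct (proj1 (continuous_C_eps _ _) Cphi _ Np) as (d2 & Hd2 & HD2).
    exists (Rmin d1 d2). split. apply Rmin_pos; auto.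
    intros w Hw Hwd.
    assert (Hw1 := Rlt_le_trans _ _ _ Hwd (Rmin_l _ _)). assert (Hw2 := Rlt_le_trans _ _ _ Hwd (Rmin_r _ _)).
    specialize (HD1 w Hw1). specialize (HD2 w Hw2). rewrite Eg in HD1.
    assert (Nw : phi w <> 0).
    { intros E. rewrite E in HD2. replace (0 - phi w0)%C with (- phi w0)%C in HD2 by ring. rewrite Cmod_opp in HD2. lra. }
    assert (Nm : (w - w0)%C <> 0) by (apply Cminus_neq_0; auto).
    assert (E : (Cexp w - z0 = phi w * (w - w0))%C) by (rewrite <- E0; apply Hphi).
    replace ((w - w0) * (f (Cexp w) * (K (Cexp w) / (Cexp w - z0)) * Cexp w) - f z0)%C with
      (f (Cexp w) * K (Cexp w) * Cexp w / phi w - f z0)%C.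
    left; auto. rewrite E. field. auto.
Qed.

Lemma RInt_exp_subst (g : R -> R) a b : 0 < a -> a <= b -> (forall t, a <= t <= b -> continuous g t) ->
  RInt (fun x => g (exp x) * exp x) (ln a) (ln b) = RInt g a b :> R.
Proof.
  intros Ha Hab Hg.
  assert (Hl : ln a <= ln b).
  { destruct (Rle_lt_or_eq_dec _ _ Hab) as [H|<-]; [left; apply ln_increasing; auto|lra]. }
  assert (Hin : forall x, ln a <= x <= ln b -> a <= exp x <= b).
  { intros x Hx. rewrite <- (exp_ln a), <- (exp_ln b) by lra.
    split; apply exp_le_exp; lra. }
  generalize (RInt_comp (V := R_CompleteNormedModule) g exp exp (ln a) (ln b)).
  rewrite !exp_ln by lra. intros E. rewrite <- E.
  - apply RInt_eq; auto. intros t Ht. apply Rmult_comm.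
  - intros x. rewrite Rmin_left, Rmax_right by lra. intros. apply Hg, Hin; auto.
  - intros x _. split. apply is_derive_exp. apply (continuous_exp_comp (fun x => x)), continuous_id.
Qed.

Lemma Gam_bd_cont (h : C -> C) (a b al be : R) : 0 < a -> a <= b -> al <= be ->
  (forall r th, a <= r <= b -> al <= th <= be -> r = a \/ r = b \/ th = al \/ th = be -> continuous h (polar r th)) ->
  on_bd (continuous (fun w => h (Cexp w) * Cexp w)%C) (ln a) (ln b) al be.
Proof.
  intros Ha Hab Hal Hh x y Hx Hy Hb.
  assert (CE : continuous Cexp (x, y)) by (eapply is_derive_C_continuous, cderiv_Cexp).
  cont; auto. apply (continuous_Ccomp h Cexp); auto.
  rewrite Cexp_polar. apply Hh; auto.
  - rewrite <- (exp_ln a), <- (exp_ln b) by lra. split; apply exp_le_exp; lra.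
  - destruct Hb as [->|[->|[->| ->]]]; auto; rewrite exp_ln by lra; auto.
Qed.

Lemma Gam_bound (h : C -> C) (a b al be : R) : 0 < a -> a <= b -> al <= be ->
  (forall r th, a <= r <= b -> al <= th <= be -> r = a \/ r = b \/ th = al \/ th = be -> continuous h (polar r th)) ->
  Cmod (Gam h a b al be) <=
    RInt (fun t => Cmod (h (polar t al))) a b + RInt (fun t => Cmod (h (polar t be))) a b
    + a * RInt (fun th => Cmod (h (polar a th))) al be + b * RInt (fun th => Cmod (h (polar b th))) al be.
Proof.
  intros Ha Hab Hal Hh.
  assert (Hl : ln a <= ln b).
  { destruct (Rle_lt_or_eq_dec _ _ Hab) as [H|<-]; [left; apply ln_increasing; auto|lra]. }
  unfold Gam. eapply Rle_trans; [apply Cmod_rect; auto; apply Gam_bd_cont; auto|].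
  unfold arect.
  assert (H1 : forall th, th = al \/ th = be ->
    RInt (fun x => Cmod (h (Cexp (x, th)) * Cexp (x, th))) (ln a) (ln b) = RInt (fun t => Cmod (h (polar t th))) a b).
  { intros th Hth. rewrite <- (RInt_exp_subst (fun t => Cmod (h (polar t th))) a b); auto.
    - apply RInt_eq; auto. intros t Ht. rewrite Cmod_mult, Cmod_Cexp. reflexivity.
    - intros t Ht. cont. apply (continuous_Ccomp h (fun t => polar t th)). cont. apply Hh; auto; destruct Hth; subst; auto; lra. }
  assert (H2 : forall r, r = a \/ r = b ->
    RInt (fun y => Cmod (h (Cexp (ln r, y)) * Cexp (ln r, y))) al be = r * RInt (fun th => Cmod (h (polar r th))) al be).
  { intros r Hr. assert (0 < r) by (destruct Hr; subst; lra).
    rewrite <- RInt_Rscal.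
    - apply RInt_eq; auto. intros t Ht. rewrite Cmod_mult, Cmod_Cexp, Cexp_polar. simpl. rewrite exp_ln by auto. ring.
    - apply ex_RInt_cont; auto. intros t Ht. cont.
      apply (continuous_Ccomp h (fun t => polar r t)). cont. apply Hh; auto; destruct Hr; subst; auto; lra. }
  rewrite !H1, !H2 by auto. lra.
Qed.

(** Stated for all truncated integrals, so that estimates along rays involve proper integrals
    only. *)
Definition rayL1 (f : C -> C) (th B : R) : Prop :=
  forall a b, 0 < a -> a <= b -> RInt (fun t => Cmod (f (polar t th))) a b <= B.

Lemma continuous_ray (f : C -> C) (r th : R) : continuous f (polar r th) ->
  continuous (fun t => f (polar t th)) r /\ continuous (fun s => f (polar r s)) th.
Proof.
  intros H. split.
  - apply (continuous_Ccomp f (fun t => polar t th)); auto. cont.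
  - apply (continuous_Ccomp f (fun s => polar r s)); auto. cont.
Qed.

Lemma continuous_2d_polar (f : C -> C) (r th : R) : continuous f (polar r th) ->
  continuity_2d_pt (fun r th => Cmod (f (polar r th))) r th.
Proof.
  intros H. apply continuous_2d. cont.
  apply (continuous_Ccomp f (fun p : R * R => polar (fst p) (snd p))); auto. cont.
Qed.

Definition arcint (f : C -> C) (al be r : R) : R := RInt (fun th => Cmod (f (polar r th))) al be.

Lemma arcint_total (f : C -> C) (al be B a b : R) : 0 < a -> a <= b -> al <= be ->
  in_sec al be (continuous f) -> (forall th, al <= th <= be -> rayL1 f th B) ->
  ex_RInt (arcint f al be) a b /\ RInt (arcint f al be) a b <= (be - al) * B.
Proof.
  intros Ha Hab Hal Hc HB.
  destruct (fubini (fun r th => Cmod (f (polar r th))) a b al be) as (F1 & F2 & F3); auto.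
  { intros r th Hr Hth. apply continuous_2d_polar. apply Hc; lra. }
  split; auto. unfold arcint. rewrite F3. rewrite <- RInt_Rconst.
  apply RInt_mono; auto. apply ex_RInt_const.
  intros th Hth. apply HB; auto.
Qed.

Lemma RInt_inv a b : 0 < a -> a <= b -> RInt (fun t => / t) a b = ln b - ln a :> R.
Proof.
  intros Ha Hab. apply (RInt_FTC ln); auto.
  - intros t Ht. apply is_derive_ln; lra.
  - intros t Ht. cont. lra.
Qed.

(** If r times the arc integral exceeded [eps] on the whole of [a, b], integrating eps / r would
    give more than eps (ln b - ln a), against the total mass of at most (be - al) B in the truncated
    sector. *)
Lemma exists_small_arc (f : C -> C) (al be B a b eps : R) : 0 < a -> a <= b -> al <= be -> 0 < eps ->
  in_sec al be (continuous f) -> (forall th, al <= th <= be -> rayL1 f th B) ->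
  (be - al) * B < eps * (ln b - ln a) ->
  exists r, a <= r <= b /\ r * arcint f al be r <= eps.
Proof.
  intros Ha Hab Hal Heps Hc HB Hlt.
  destruct (arcint_total f al be B a b) as [H1 H2]; auto.
  apply NNPP. intros Hn.
  assert (H : forall r, a <= r <= b -> eps * / r <= arcint f al be r).
  { intros r Hr. apply Rnot_lt_le. intros K. apply Hn. exists r. split; auto.
    left. apply Rmult_lt_compat_l with (r := r) in K; [|lra].
    replace (r * (eps * / r)) with eps in K by (field; lra). auto. }
  assert (K : RInt (fun t => eps * / t) a b <= RInt (arcint f al be) a b).
  { apply RInt_mono; auto. apply ex_RInt_cont; auto. intros; cont; lra. }
  rewrite (RInt_Rscal (fun t => / t)), RInt_inv in K by (auto; apply ex_RInt_cont; auto; intros; cont; lra).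
  assert (K2 := Rle_trans _ _ _ K H2). lra.
Qed.

Lemma exists_arcs (f : C -> C) (al be B a0 b0 eps : R) : 0 < a0 -> 0 < b0 -> al <= be -> 0 < eps ->
  in_sec al be (continuous f) -> (forall th, al <= th <= be -> rayL1 f th B) ->
  exists a b, 0 < a <= a0 /\ b0 <= b /\ a * arcint f al be a <= eps /\ b * arcint f al be b <= eps.
Proof.
  intros Ha0 Hb0 Hal Heps Hc HB.
  (* Logarithmic length of the intervals in which the two radii are searched, one below [a0] and one
     above [b0]. *)
  set (L := Rabs ((be - al) * B) / eps + 1).
  assert (HL : (be - al) * B < eps * L).
  { unfold L. replace (eps * (Rabs ((be - al) * B) / eps + 1)) with (Rabs ((be - al) * B) + eps) by (field; lra).
    generalize (Rle_abs ((be - al) * B)). lra. }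
  assert (HLp : 0 < L). { unfold L. apply Rle_lt_0_plus_1. apply Rdiv_le_0_compat; auto. apply Rabs_pos. }
  assert (HeL : 1 < exp L) by (rewrite <- exp_0; apply exp_increasing; auto).
  destruct (exists_small_arc f al be B (a0 * exp (- L)) a0 eps) as (a & Ha & Hae); auto.
  { apply Rmult_lt_0_compat; auto. apply exp_pos. }
  { rewrite <- (Rmult_1_r a0) at 2. apply Rmult_le_compat_l. lra. rewrite <- exp_0. apply exp_le_exp. lra. }
  { rewrite ln_mult, ln_exp by (auto; apply exp_pos). lra. }
  destruct (exists_small_arc f al be B b0 (b0 * exp L) eps) as (b & Hb & Hbe); auto.
  { rewrite <- (Rmult_1_r b0) at 1. apply Rmult_le_compat_l; lra. }
  { rewrite ln_mult, ln_exp by (auto; apply exp_pos). lra. }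
  exists a, b. repeat split; try lra.
  apply Rlt_le_trans with (2 := proj1 Ha). apply Rmult_lt_0_compat; auto. apply exp_pos.
Qed.

Lemma Cmod_polar_sub s r a th :
  Cmod (polar s a - polar r th) = sqrt (s * s + r * r - 2 * s * r * cos (a - th)).
Proof.
  unfold Cmod. f_equal. unfold polar; simpl. rewrite cos_minus.
  generalize (sin2_cos2 a) (sin2_cos2 th). unfold Rsqr. intros H1 H2.
  replace (s * s) with (s * s * (sin a * sin a + cos a * cos a)) by (rewrite H1; ring).
  replace (r * r) with (r * r * (sin th * sin th + cos th * cos th)) by (rewrite H2; ring).
  ring.
Qed.

(** This is |sin (dl / 2)|, the best constant in |z - w| >= gap dl (|z| + |w|) for points whose
    directions differ by at least [dl]. *)
Definition gap (dl : R) : R := sqrt ((1 - cos dl) / 2).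

Lemma gap_pos dl : 0 < dl <= PI -> 0 < gap dl.
Proof.
  intros H. apply sqrt_lt_R0. generalize PI_RGT_0; intros.
  assert (cos dl < 1). { apply cos_lt_1; [rewrite Rabs_pos_eq; lra|lra]. } lra.
Qed.

Lemma cos_le_gap dl x : 0 < dl <= PI -> dl <= Rabs x <= 2 * PI - dl -> cos x <= cos dl.
Proof.
  intros Hd Hx. replace (cos x) with (cos (Rabs x)).
  2:{ unfold Rabs. destruct Rcase_abs; auto. apply cos_neg. }
  destruct (Rle_lt_dec (Rabs x) PI).
  - apply cos_decr_1; lra.
  - replace (cos (Rabs x)) with (cos (2 * PI - Rabs x)).
    apply cos_decr_1; lra.
    rewrite cos_minus, cos_2PI, sin_2PI. ring.
Qed.

Lemma dist_rays s r a th dl : 0 <= s -> 0 <= r -> 0 < dl <= PI -> dl <= Rabs (a - th) <= 2 * PI - dl ->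
  gap dl * (s + r) <= Cmod (polar s a - polar r th).
Proof.
  intros Hs Hr Hd Ha. rewrite Cmod_polar_sub.
  generalize (cos_le_gap dl _ Hd Ha); intros Hc. generalize (COS_bound dl); intros Hb.
  unfold gap. rewrite <- (sqrt_Rsqr (s + r)) by lra. rewrite <- sqrt_mult by (try apply Rle_0_sqr; lra).
  apply sqrt_le_1_alt. unfold Rsqr.
  assert (0 <= s * r) by (apply Rmult_le_pos; auto).
  assert (s * r * cos (a - th) <= s * r * cos dl) by (apply Rmult_le_compat_l; auto).
  (* At angle exactly [dl], the squared distance minus (gap dl (s + r))^2 equals (1 + cos dl) (s -
     r)^2 / 2. *)
  assert (0 <= (1 + cos dl) * ((s - r) * (s - r))) by (apply Rmult_le_pos; [lra|apply Rle_0_sqr]).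
  nra.
Qed.

Section KernelBound.

Variables (f : C -> C) (K : R -> C -> C) (val : R -> C).
Variables (al be B t1 t2 a0 b0 CK : R) (kal kbe : R -> R -> R) (wal wbe : R -> R).
Hypotheses (Hal : al <= be) (Ha0 : 0 < a0) (Hb0 : a0 <= b0) (Ht : t1 <= t2) (HCK : 0 <= CK).
Hypotheses (Hfc : in_sec al be (continuous f)) (HfB : forall th, al <= th <= be -> rayL1 f th B).
(** Reproduction by the kernel is required for all inner radii up to [a0] and all outer radii from
    [b0] on, so that the radii of negligible arcs can be chosen afterwards. *)
Hypothesis Hval : forall t, t1 <= t <= t2 -> forall a b, 0 < a <= a0 -> b0 <= b ->
  Gam (fun z => f z * K t z)%C a b al be = (2 * PI * Ci * val t)%C.
Hypothesis HKc : forall t, t1 <= t <= t2 -> forall r th, 0 < r -> al <= th <= be ->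
  r <= a0 \/ b0 <= r \/ th = al \/ th = be -> continuous (K t) (polar r th).
Hypothesis HKb : forall t, t1 <= t <= t2 -> forall r th, 0 < r -> al <= th <= be ->
  r <= a0 \/ b0 <= r -> Cmod (K t (polar r th)) <= CK.
Hypothesis Hkal : forall s t, 0 < s -> t1 <= t <= t2 ->
  continuity_2d_pt kal s t /\ Cmod (K t (polar s al)) <= kal s t.
Hypothesis Hkbe : forall s t, 0 < s -> t1 <= t <= t2 ->
  continuity_2d_pt kbe s t /\ Cmod (K t (polar s be)) <= kbe s t.
Hypothesis Hwal : forall s, 0 < s -> continuous wal s /\ RInt (fun t => kal s t) t1 t2 <= wal s.
Hypothesis Hwbe : forall s, 0 < s -> continuous wbe s /\ RInt (fun t => kbe s t) t1 t2 <= wbe s.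
Hypothesis Hvc : cont_on val t1 t2.

Lemma ray_kernel_fubini (th : R) (k : R -> R -> R) (w : R -> R) a b : 0 < a -> a <= b -> al <= th <= be ->
  (forall s t, 0 < s -> t1 <= t <= t2 -> continuity_2d_pt k s t) ->
  (forall s, 0 < s -> continuous w s /\ RInt (fun t => k s t) t1 t2 <= w s) ->
  ex_RInt (fun t => RInt (fun s => Cmod (f (polar s th)) * k s t) a b) t1 t2 /\
  RInt (fun t => RInt (fun s => Cmod (f (polar s th)) * k s t) a b) t1 t2 <=
  RInt (fun s => Cmod (f (polar s th)) * w s) a b.
Proof.
  intros Ha Hab Hth Hk Hw.
  assert (Cf : forall s, 0 < s -> continuous (fun s => Cmod (f (polar s th))) s).
  { intros s Hs. cont. apply continuous_ray. apply Hfc; auto. }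
  destruct (fubini (fun t s => Cmod (f (polar s th)) * k s t) t1 t2 a b) as (F1 & F2 & F3); auto.
  { intros t s Htt Hs. apply continuous_2d.
    apply continuous_Rmult.
    - apply (continuous_Rcomp (fun s => Cmod (f (polar s th))) (fun p : R * R => snd p)). cont. apply Cf; simpl; lra.
    - apply (continuous_comp_2 (fun p : R * R => snd p) (fun p : R * R => fst p) k); try cont.
      apply continuous_2d, Hk; simpl; lra. }
  split; auto. rewrite F3.
  apply RInt_mono; auto.
  - apply ex_RInt_cont; auto. intros s Hs. apply continuous_Rmult. apply Cf; lra. apply Hw; lra.
  - intros s Hs.
    assert (Ks : ex_RInt (fun t => k s t) t1 t2).
    { apply ex_RInt_cont; auto. intros t Htt.
      apply (continuous_comp_2 (fun _ : R => s) (fun t : R => t) k); try cont. apply continuous_2d, Hk; lra. }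
    rewrite RInt_Rscal by auto. apply Rmult_le_compat_l. apply Cmod_ge_0. apply Hw; lra.
Qed.

(** A Schur test: take moduli in the reproducing formula, integrate over [t], and exchange the
    integrals; on each ray only the integral of the kernel in [t] remains, bounded by [wal] or
    [wbe]. One choice of radii makes the arcs negligible for all [t] at once, since the kernel is
    bounded by [CK] there. *)
Lemma sector_kernel_bound (eps : R) : 0 < eps -> exists a b, 0 < a /\ a <= b /\
  2 * PI * RInt (fun t => Cmod (val t)) t1 t2 <=
    RInt (fun s => Cmod (f (polar s al)) * wal s) a b + RInt (fun s => Cmod (f (polar s be)) * wbe s) a b + eps.
Proof.
  intros Heps.
  (* Two arcs, each with kernel at most [CK], integrated over a length [t2 - t1], then cost at most
     [eps]; the added ones avoid zero denominators. *)
  set (e := eps / (2 * (CK + 1) * (t2 - t1 + 1))).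
  assert (He : 0 < e) by (apply Rdiv_lt_0_compat; nra).
  destruct (exists_arcs f al be B a0 b0 e) as (a & b & Ha & Hb & Ea & Eb); auto; try lra.
  exists a, b. split; [lra|]. split; [lra|].
  assert (Hab : a <= b) by lra.
  destruct (ray_kernel_fubini al kal wal a b) as [Fal1 Fal2]; try lra; auto.
  { intros; apply Hkal; auto. }
  destruct (ray_kernel_fubini be kbe wbe a b) as [Fbe1 Fbe2]; try lra; auto.
  { intros; apply Hkbe; auto. }
  assert (Hfc' : forall r th, 0 < r -> al <= th <= be -> continuous (fun s => f (polar s th)) r /\ continuous (fun s => f (polar r s)) th).
  { intros; apply continuous_ray, Hfc; auto. }
  assert (P : forall t, t1 <= t <= t2 -> 2 * PI * Cmod (val t) <=
     RInt (fun s => Cmod (f (polar s al)) * kal s t) a b + RInt (fun s => Cmod (f (polar s be)) * kbe s t) a b + 2 * (CK * e)).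
  { intros t Htt.
    replace (2 * PI * Cmod (val t)) with (Cmod (2 * PI * Ci * val t)) by (rewrite Cmod_mult, Cmod_two_pi_i; reflexivity).
    rewrite <- (Hval t Htt a b) by lra.
    assert (HC : forall r th, a <= r <= b -> al <= th <= be -> r = a \/ r = b \/ th = al \/ th = be ->
       continuous (fun z => f z * K t z)%C (polar r th)).
    { intros r th Hr Hth Hbd. apply continuous_Cmult. apply Hfc; lra. apply HKc; auto; lra. }
    eapply Rle_trans; [apply Gam_bound; auto; lra|].
    assert (RAY : forall th k, th = al \/ th = be ->
        (forall s, 0 < s -> continuity_2d_pt k s t /\ Cmod (K t (polar s th)) <= k s t) ->
        RInt (fun s => Cmod (f (polar s th) * K t (polar s th))) a b <= RInt (fun s => Cmod (f (polar s th)) * k s t) a b).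
    { intros th k Hth Hk. assert (al <= th <= be) by (destruct Hth; subst; lra).
      apply RInt_mono; auto.
      - apply ex_RInt_cont; auto. intros s Hs.
        apply (continuous_Cmod (fun s => f (polar s th) * K t (polar s th))%C).
        apply (proj1 (continuous_ray (fun z => f z * K t z)%C s th (HC s th Hs H (or_intror (or_intror Hth))))).
      - apply ex_RInt_cont; auto. intros s Hs. cont. apply Hfc'; lra.
        apply (continuous_comp_2 (fun s : R => s) (fun _ : R => t) k); try cont. apply continuous_2d, Hk; lra.
      - intros s Hs. rewrite Cmod_mult. apply Rmult_le_compat_l. apply Cmod_ge_0. apply Hk; lra. }
    assert (ARC : forall r, 0 < r -> r <= a0 \/ b0 <= r -> a <= r <= b -> r = a \/ r = b -> r * arcint f al be r <= e ->
        r * RInt (fun th => Cmod (f (polar r th) * K t (polar r th))) al be <= CK * e).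
    { intros r Hr Hr1 Hr2 Hr3 Hre.
      apply Rle_trans with (r * (CK * arcint f al be r)).
      - apply Rmult_le_compat_l; [lra|]. apply (RInt_Cmod_scal_le (fun th => f (polar r th)) (fun th => f (polar r th) * K t (polar r th))%C); auto.
        + intros th Hth. apply Hfc'; auto.
        + intros th Hth. apply (proj2 (continuous_ray (fun z => f z * K t z)%C r th (HC r th Hr2 Hth ltac:(tauto)))).
        + intros th Hth. rewrite Cmod_mult, Rmult_comm. apply Rmult_le_compat_r. apply Cmod_ge_0. apply HKb; auto.
      - replace (r * (CK * arcint f al be r)) with (CK * (r * arcint f al be r)) by ring.
        apply Rmult_le_compat_l; auto. }
    generalize (RAY al kal (or_introl eq_refl) (fun s Hs => Hkal s t Hs Htt)).
    generalize (RAY be kbe (or_intror eq_refl) (fun s Hs => Hkbe s t Hs Htt)).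
    assert (A1 := ARC a (proj1 Ha) (or_introl (proj2 Ha)) (conj (Rle_refl a) Hab) (or_introl eq_refl) Ea).
    assert (A2 := ARC b (Rlt_le_trans _ _ _ (proj1 Ha) Hab) (or_intror Hb) (conj Hab (Rle_refl b)) (or_intror eq_refl) Eb).
    intros R1 R2.
    apply Rle_trans with (RInt (fun s : R => Cmod (f (polar s al)) * kal s t) a b +
      RInt (fun s : R => Cmod (f (polar s be)) * kbe s t) a b + CK * e + CK * e); [|right; ring].
    apply Rplus_le_compat; [|exact A2]. apply Rplus_le_compat; [|exact A1]. apply Rplus_le_compat; assumption. }
  assert (Vx : ex_RInt (fun t => Cmod (val t)) t1 t2) by (apply ex_RInt_Cmod; auto).
  rewrite <- RInt_Rscal by auto.
  eapply Rle_trans.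
  { apply RInt_mono; [auto| | |exact P]. apply ex_RInt_Rscal; auto.
    apply ex_RInt_Rplus. apply ex_RInt_Rplus; auto. apply ex_RInt_const. }
  rewrite RInt_Rplus, RInt_Rplus, RInt_Rconst; auto.
  2: apply ex_RInt_Rplus; auto. 2: apply ex_RInt_const.
  apply Rplus_le_compat. apply Rplus_le_compat; assumption.
  unfold e. apply Rle_trans with (eps * ((CK / (CK + 1)) * ((t2 - t1) / (t2 - t1 + 1)))).
  right; field; lra.
  rewrite <- (Rmult_1_r eps) at 2. apply Rmult_le_compat_l; [lra|].
  assert (Q : forall x, 0 <= x -> 0 <= x / (x + 1) <= 1).
  { intros x Hx. split. apply Rdiv_le_0_compat; lra. apply Rmult_le_reg_r with (x + 1). lra.
    unfold Rdiv. rewrite Rmult_assoc, Rinv_l by lra. lra. }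
  generalize (Q CK HCK) (Q (t2 - t1) ltac:(lra)). intros. 
  apply Rle_trans with (1 * 1); [|lra]. apply Rmult_le_compat; lra.
Qed.

End KernelBound.

(** * Boundedness of the shifts *)

Lemma gap_le_1 dl : gap dl <= 1.
Proof.
  unfold gap. apply Rle_trans with (sqrt 1); [|rewrite sqrt_1; lra].
  apply sqrt_le_1_alt. generalize (COS_bound dl). lra.
Qed.

Lemma polar_conj r a : Cconj (polar r a) = polar r (- a).
Proof. unfold polar, Cconj; simpl. rewrite cos_neg, sin_neg. apply C_eq; simpl; ring. Qed.

(** The arccosine parametrises an open half-plane by arguments in one interval of length pi; the
    upper half-plane is reached by conjugation. *)
Lemma polar_of_lower (x y : R) : y < 0 -> exists th, - PI < th < 0 /\ (x, y) = polar (Cmod (x, y)) th.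
Proof.
  intros Hy. set (r := Cmod (x, y)).
  assert (Hr2 : r * r = x * x + y * y).
  { unfold r, Cmod; simpl. rewrite sqrt_sqrt by nra. ring. }
  assert (Hr : 0 < r). { apply Cmod_gt_0. intros E. injection E; lra. }
  assert (Hu : -1 < x / r < 1).
  { split.
    - apply Rmult_lt_reg_r with r; auto. unfold Rdiv. rewrite Rmult_assoc, Rinv_l by lra. nra.
    - apply Rmult_lt_reg_r with r; auto. unfold Rdiv. rewrite Rmult_assoc, Rinv_l by lra. nra. }
  exists (- acos (x / r)). split.
  - generalize (acos_bound_lt _ Hu). lra.
  - unfold polar. rewrite cos_neg, sin_neg, cos_acos, sin_acos by lra. f_equal. field; lra.
    assert (E : 1 - (x / r)² = (y / r) * (y / r)).
    { unfold Rsqr. replace (y / r * (y / r)) with (y * y / (r * r)) by (field; lra).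
      replace (y * y) with (r * r - x * x) by lra. field; lra. }
    rewrite E. 
    replace (y / r * (y / r)) with ((- y / r) * (- y / r)) by (field; lra).
    rewrite sqrt_square. field; lra. apply Rdiv_le_0_compat; lra.
Qed.

Lemma polar_add (t rho th : R) : 0 <= t -> 0 < rho -> - PI < th < 0 ->
  exists r th', 0 < r /\ th <= th' < 0 /\ (t + polar rho th)%C = polar r th'.
Proof.
  intros Ht Hrho Hth.
  assert (Hs : sin th < 0) by (apply sin_lt_0_var; lra).
  assert (E : (t + polar rho th)%C = (t + rho * cos th, rho * sin th)) by (apply C_eq; simpl; ring).
  assert (Hy : rho * sin th < 0) by nra.
  destruct (polar_of_lower (t + rho * cos th) (rho * sin th) Hy) as (th' & Hth' & E').
  rewrite E. set (r := Cmod (t + rho * cos th, rho * sin th)) in *.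
  assert (Hr : 0 < r). { apply Cmod_gt_0. intros K. injection K; lra. }
  exists r, th'. split; auto. split; auto. split; [|lra].
  injection E'; intros E2 E1.
  (* th' < th would force cos th' < cos th, but cos th * r <= t + rho * cos th *)
  apply Rnot_lt_le. intros Hlt.
  assert (Hc : cos th' < cos th).
  { rewrite <- (cos_neg th), <- (cos_neg th'). apply cos_decreasing_1; lra. }
  set (c := cos th) in *. set (s := sin th) in *.
  assert (Hsc : s * s + c * c = 1) by (generalize (sin2_cos2 th); unfold Rsqr; auto).
  assert (Hr2 : r * r = t * t + 2 * t * rho * c + rho * rho).
  { assert (r * r = (t + rho * c) * (t + rho * c) + rho * s * (rho * s)).
    { unfold r, Cmod; simpl. rewrite sqrt_sqrt by nra. ring. }
    rewrite H. replace (rho * s * (rho * s)) with (rho * rho * (s * s)) by ring.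
    replace (s * s) with (1 - c * c) by lra. ring. }
  assert (Hrc : r * cos th' < r * c) by (apply Rmult_lt_compat_l; auto).
  rewrite <- E1 in Hrc.
  assert (Hrt : r <= t + rho).
  { apply Rsqr_incr_0_var; [|lra]. unfold Rsqr. rewrite Hr2. assert (c <= 1) by apply COS_bound. 
    assert (0 <= t * rho) by (apply Rmult_le_pos; lra). nra. }
  destruct (Rle_lt_dec 0 c).
  - assert (c <= 1) by apply COS_bound. nra.
  - destruct (Rle_lt_dec 0 (t + rho * c)). nra.
    assert ((t + rho * c) * (t + rho * c) <= (r * c) * (r * c)).
    { replace ((r * c) * (r * c)) with (r * r * (c * c)) by ring. rewrite Hr2.
      assert (K : 0 <= s * s * t * (- t - 2 * rho * c)).
      { apply Rmult_le_pos; [|lra]. apply Rmult_le_pos; auto. nra. }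
      replace (s * s) with (1 - c * c) in K by lra. nra. }
    assert (r * c < 0) by nra. nra.
Qed.

(** The sum is the difference with the opposite point, at angle th + pi, so [dist_rays] applies. *)
Lemma Cmod_add_polar (t rho th dl : R) : 0 <= t -> 0 <= rho -> 0 < dl <= PI -> dl - PI <= th <= PI - dl ->
  gap dl * (t + rho) <= Cmod (t + polar rho th).
Proof.
  intros Ht Hrho Hd Hth.
  replace (t + polar rho th)%C with (polar t 0 - polar rho (th + PI))%C.
  - apply dist_rays; auto. generalize PI_RGT_0; intros.
    rewrite <- Rabs_Ropp, Rabs_pos_eq; lra.
  - unfold polar. rewrite neg_cos, neg_sin, cos_0, sin_0. apply C_eq; simpl; ring.
Qed.

Lemma RInt_cauchy_kernel (q c t1 t2 : R) : 0 < q -> t1 <= t2 ->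
  RInt (fun t => 2 * q / ((t - c) ^ 2 + q ^ 2)) t1 t2 <= 2 * PI.
Proof.
  intros Hq Ht. assert (N := sqr_sum_neq0 c q Hq).
  rewrite (RInt_FTC (fun t => 2 * atan ((t - c) / q))); auto.
  - generalize (atan_bound ((t2 - c) / q)) (atan_bound ((t1 - c) / q)). lra.
  - intros t _. auto_derive; try lra. field.
    generalize (N t); simpl; intros; repeat split; try lra; intros E; apply (N t); simpl; lra.
  - intros t _. cont. apply N.
Qed.

Lemma RInt_inv_sqr (C0 c t1 t2 : R) : 0 <= C0 -> 0 < c -> 0 <= t1 -> t1 <= t2 ->
  RInt (fun t => C0 / ((c + t) * (c + t))) t1 t2 <= C0 / (c + t1).
Proof.
  intros HC Hc Ht1 Ht.
  rewrite (RInt_FTC (fun t => - (C0 / (c + t)))); auto.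
  - assert (0 <= C0 / (c + t2)) by (apply Rdiv_le_0_compat; lra). lra.
  - intros t H. auto_derive. lra. field. lra.
  - intros t H. cont. apply Rmult_integral_contrapositive_currified; lra.
Qed.

(* Reflecting [z = t + tau] in the ray carrying the integration turns the Cauchy kernel into the
   Poisson kernel there, whose integral along the parallel line is at most [2 * PI]. *)
Lemma shift_bound_below (f : C -> C) (al B rho th dl t1 t2 eps : R) :
  0 < dl -> al + dl <= th -> th < 0 -> dl - PI <= th -> dl - 2 * PI <= al + th -> 0 < rho ->
  0 <= t1 <= t2 -> 0 < eps ->
  in_sec al 0 (holo f) -> (forall a, al <= a <= 0 -> rayL1 f a B) ->
  exists a b, 0 < a /\ a <= b /\
    2 * PI * RInt (fun t => Cmod (f (t + polar rho th)%C)) t1 t2 <=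
    RInt (fun s => Cmod (f (polar s al)) * (2 / (gap dl ^ 4) * (rho / (s + rho)))) a b
    + RInt (fun s => Cmod (f (polar s 0)) * (2 * PI)) a b + eps.
Proof.
  intros Hdl Hal Hth0 Hth Halth Hrho Ht Heps Hf HB.
  assert (HPI := PI_RGT_0).
  assert (Hdl2 : 0 < dl <= PI) by lra.
  assert (Hg := gap_pos dl Hdl2). assert (Hg1 := gap_le_1 dl). set (g := gap dl) in *.
  set (tau := polar rho th).
  (* Thus tau = p - i q, and [q] is the distance of the line t + tau from the real ray. *)
  set (q := - rho * sin th). set (p := rho * cos th).
  assert (Hs : sin th < 0) by (apply sin_lt_0_var; lra).
  assert (Hq : 0 < q) by (unfold q; nra).
  assert (Hqr : q <= rho). { unfold q. generalize (SIN_bound th). nra. }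
  assert (Etau : tau = (p, - q)) by (unfold tau, polar, p, q; f_equal; ring).
  set (z := fun t : R => (t + tau)%C).
  (* The added factor is 1 at w = z. For real [w] the distances to z and to its conjugate agree, so
     |K| = 2 q / |w - z|^2 there. The argument of the conjugate lies in (0, - th], and
     [dl - 2 * PI <= al + th] keeps it out of the sector modulo 2 pi. *)
  set (K := fun (t : R) (w : C) => ((z t - Cconj (z t)) / (w - Cconj (z t)) / (w - z t))%C).
  assert (Ez : forall t, z t = (t + p, - q)) by (intros; unfold z; rewrite Etau; apply C_eq; simpl; ring).
  assert (Ezc : forall t, Cconj (z t) = (t + p, q)) by (intros; rewrite Ez; apply C_eq; simpl; ring).
  assert (Ed : forall t, (z t - Cconj (z t))%C = (0, - (2 * q))) by (intros; rewrite Ezc, Ez; apply C_eq; simpl; ring).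
  assert (Emd : forall t, Cmod (z t - Cconj (z t)) = 2 * q).
  { intros t. rewrite Ed. unfold Cmod; simpl.
    replace (0 * (0 * 1) + - (2 * q) * (- (2 * q) * 1)) with (2 * q * (2 * q)) by ring. apply sqrt_square; lra. }
  assert (Pz : forall t, 0 <= t -> exists r th', 0 < r /\ th <= th' < 0 /\ z t = polar r th' /\ g * (t + rho) <= r <= t + rho).
  { intros t Htt. destruct (polar_add t rho th) as (r & th' & Hr & Hth' & E); auto; try lra.
    exists r, th'. split; auto. split; auto. split; auto.
    assert (Er : r = Cmod (z t)) by (unfold z, tau; rewrite E, Cmod_polar; lra).
    rewrite Er. split. apply Cmod_add_polar; lra.
    eapply Rle_trans; [apply Cmod_triangle|]. rewrite Cmod_R, Rabs_pos_eq by auto. unfold tau. rewrite Cmod_polar; lra. }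
  assert (Kmod : forall t w, w <> z t -> w <> Cconj (z t) ->
     Cmod (K t w) = 2 * q / (Cmod (w - Cconj (z t)) * Cmod (w - z t))).
  { intros t w H1 H2. unfold K. rewrite !Cmod_div, Emd by (apply Cminus_neq_0; auto).
    field. split; apply Rgt_not_eq, Cmod_gt_0, Cminus_neq_0; auto. }
  assert (Kcont : forall t w, w <> z t -> w <> Cconj (z t) -> continuous (K t) w).
  { intros t w H1 H2. unfold K. cont; apply Cminus_neq_0; auto. }
  assert (Far : forall t, t1 <= t <= t2 -> forall r a, 0 < r -> r <= g * rho / 2 \/ 2 * (t2 + rho) <= r ->
     g * rho / 2 <= Cmod (polar r a - z t) /\ g * rho / 2 <= Cmod (polar r a - Cconj (z t))).
  { intros t Htt r a Hr Hra. destruct (Pz t) as (r' & th' & Hr' & _ & E & Hr'b). lra.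
    assert (Mz : Cmod (z t) = r') by (rewrite E, Cmod_polar; lra).
    assert (G : forall w, Cmod w = r' -> g * rho / 2 <= Cmod (polar r a - w)).
    { intros w Hw.
      generalize (Cmod_sub_ge (polar r a) w) (Cmod_sub_ge w (polar r a)).
      replace (w - polar r a)%C with (- (polar r a - w))%C by ring. rewrite Cmod_opp, Hw, Cmod_polar by lra.
      destruct Hra; intros; nra. }
    split; apply G; auto. rewrite Cmod_conj; auto. }
  assert (Ne : forall t, t1 <= t <= t2 -> forall w, 0 < Cmod (w - z t) -> 0 < Cmod (w - Cconj (z t)) -> w <> z t /\ w <> Cconj (z t)).
  { intros t Htt w H1 H2. split; intros E; apply Cmod_gt_0 in H1; apply Cmod_gt_0 in H2; rewrite E in *;
    [apply H1|apply H2]; ring. }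
  assert (Hgr : 0 < g * rho / 2) by nra.
  (* Seen from the ray [al], both poles are at an angle of at least [dl]; as q <= rho, the kernel is
     at most a multiple of rho / (s + rho + t)^2. *)
  assert (Dal : forall s t, 0 < s -> t1 <= t <= t2 ->
     g * g * (s + rho + t) <= Cmod (polar s al - z t) /\ g * g * (s + rho + t) <= Cmod (polar s al - Cconj (z t))).
  { intros s t Hs1 Htt. destruct (Pz t) as (r' & th' & Hr' & Hth' & E & Hr'b). lra.
    assert (LE : g * g * (s + rho + t) <= g * (s + r')).
    { rewrite Rmult_assoc. apply Rmult_le_compat_l; nra. }
    split; (eapply Rle_trans; [exact LE|]).
    - rewrite E. apply dist_rays; try lra. rewrite <- Rabs_Ropp, Rabs_pos_eq; lra.
    - rewrite E, polar_conj. apply dist_rays; try lra. rewrite <- Rabs_Ropp, Rabs_pos_eq; lra. }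
  (* On the real ray the two distances multiply to the Poisson denominator, a translate in [t],
     whose total mass does not depend on [s]. *)
  assert (D0 : forall s t, Cmod (polar s 0 - Cconj (z t)) * Cmod (polar s 0 - z t) = (t - (s - p)) ^ 2 + q ^ 2 /\
      polar s 0 <> z t /\ polar s 0 <> Cconj (z t)).
  { intros s t.
    assert (E0 : polar s 0 = (s, 0)) by (unfold polar; rewrite cos_0, sin_0; f_equal; ring).
    assert (N : forall x, q * q = x * x -> Cmod (s + - (t + p), 0 + - x) = sqrt ((t - (s - p)) ^ 2 + q ^ 2)).
    { intros x Hx. unfold Cmod; cbn [fst snd]. f_equal.
      replace ((0 + - x) ^ 2) with (x * x) by ring. rewrite <- Hx. ring. }
    split; [|split].
    - rewrite E0, Ezc, Ez. unfold Cminus, Cplus, Copp; cbn [fst snd].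
      rewrite !N by ring. apply sqrt_sqrt. generalize (sqr_sum_pos (s - p) q Hq t). lra.
    - rewrite E0, Ez. intros E; injection E; lra.
    - rewrite E0, Ezc. intros E; injection E; lra. }
  assert (Gg : 0 < g * g) by nra.
  apply (sector_kernel_bound f K (fun t => f (z t)) al 0 B t1 t2 (g * rho / 2) (2 * (t2 + rho))
    (2 * q / (g * rho / 2 * (g * rho / 2)))
    (fun s t => 2 * rho / (g ^ 4) / ((s + rho + t) * (s + rho + t)))
    (fun s t => 2 * q / ((t - (s - p)) ^ 2 + q ^ 2))
    (fun s => 2 / (g ^ 4) * (rho / (s + rho))) (fun _ => 2 * PI)); auto; try lra.
  - nra.
  - apply Rdiv_le_0_compat. lra. nra.
  - intros r a Hr Ha. apply ex_derive_C_continuous. apply Hf; auto.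
  - intros t Htt a b Ha Hb. destruct (Pz t) as (r' & th' & Hr' & Hth' & E & Hr'b). lra.
    unfold K. rewrite E.
    rewrite (sector_cauchy f (fun w => (polar r' th' - Cconj (polar r' th')) / (w - Cconj (polar r' th')))%C); auto; try lra.
    + split; nra.
    + intros r a' Hr Ha'. Holo. rewrite polar_conj. apply Cminus_neq_0. intros E'.
      apply polar_inj in E'; try lra. apply Rabs_def1; lra.
    + field. rewrite <- E, Ed. intros E'. injection E'; lra.
  - intros t Htt r a Hr Ha Hor.
    assert (H : polar r a <> z t /\ polar r a <> Cconj (z t)).
    { assert (Q : r <= g * rho / 2 \/ 2 * (t2 + rho) <= r \/ a = al \/ a = 0) by exact Hor.
      destruct Q as [Q|[Q|[->| ->]]].
      - destruct (Far t Htt r a Hr (or_introl Q)). apply Ne; auto; lra.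
      - destruct (Far t Htt r a Hr (or_intror Q)). apply Ne; auto; lra.
      - destruct (Dal r t Hr Htt). assert (0 < g * g * (r + rho + t)) by (apply Rmult_lt_0_compat; lra).
        apply Ne; auto; lra.
      - apply D0. }
    apply Kcont; tauto.
  - intros t Htt r a Hr Ha Hor. destruct (Far t Htt r a Hr Hor) as [F1 F2].
    destruct (Ne t Htt (polar r a)); try lra.
    rewrite Kmod by auto. unfold Rdiv at 1 3. apply Rmult_le_compat_l. lra.
    apply Rinv_le_contravar. nra. apply Rmult_le_compat; lra.
  - intros s t Hs1 Htt. split.
    + apply continuous_2d. cont; simpl. apply Rmult_integral_contrapositive_currified; lra.
    + destruct (Dal s t Hs1 Htt) as [F1 F2]. assert (0 < g * g * (s + rho + t)) by (apply Rmult_lt_0_compat; lra).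
      destruct (Ne t Htt (polar s al)); try lra.
      rewrite Kmod by auto.
      replace (2 * rho / g ^ 4 / ((s + rho + t) * (s + rho + t))) with
        (2 * rho * / (g * g * (s + rho + t) * (g * g * (s + rho + t)))) by (field; split; lra).
      unfold Rdiv. apply Rmult_le_compat; try lra. left; apply Rinv_0_lt_compat; nra.
      apply Rinv_le_contravar. nra. apply Rmult_le_compat; lra.
  - intros s t Hs1 Htt. destruct (D0 s t) as (F1 & F2 & F3). split.
    + apply continuous_2d. cont; simpl. generalize (sqr_sum_pos (s - p) q Hq t); simpl; lra.
    + rewrite Kmod, F1 by auto. lra.
  - intros s Hs1. split. cont; lra.
    eapply Rle_trans.
    apply (RInt_inv_sqr (2 * rho / g ^ 4) (s + rho) t1 t2); try lra.
    apply Rdiv_le_0_compat; [lra|apply pow_lt; lra].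
    replace (2 / g ^ 4 * (rho / (s + rho))) with (2 * rho / g ^ 4 * / (s + rho)) by (field; split; lra).
    apply Rmult_le_compat_l. apply Rdiv_le_0_compat; [lra|apply pow_lt; lra].
    apply Rinv_le_contravar; lra.
  - intros s Hs1. split. cont. apply RInt_cauchy_kernel; lra.
  - intros t Htt. apply (continuous_Ccomp f z). unfold z. cont.
    destruct (Pz t) as (r' & th' & Hr' & Hth' & E & Hr'b). lra.
    rewrite E. apply ex_derive_C_continuous, Hf; lra.
Qed.

Lemma RInt_sub_le (g : R -> R) a' a b b' : a' <= a -> a <= b -> b <= b' ->
  (forall t, a' <= t <= b' -> continuous g t) -> (forall t, a' <= t <= b' -> 0 <= g t) ->
  RInt g a b <= RInt g a' b'.
Proof.
  intros H1 H2 H3 Hc Hp.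
  assert (E : forall u v, a' <= u -> u <= v -> v <= b' -> ex_RInt g u v).
  { intros u v ? ? ?. apply ex_RInt_cont; auto. intros; apply Hc; lra. }
  rewrite (RInt_split g a' a b') by (apply E; lra).
  rewrite (RInt_split g a b b') by (apply E; lra).
  assert (0 <= RInt g a' a) by (apply RInt_pos; auto; [apply E; lra|intros; apply Hp; lra]).
  assert (0 <= RInt g b b') by (apply RInt_pos; auto; [apply E; lra|intros; apply Hp; lra]).
  lra.
Qed.

(** * Improper integrals of nonnegative functions and the norm of H^1 *)

Section Int0inf.

Variable g : R -> R.
Hypotheses (Hc : forall t, 0 < t -> continuous g t) (Hp : forall t, 0 < t -> 0 <= g t).

Lemma is_RInt_gen_upper (l : R) : is_RInt_gen g (at_right 0) (Rbar_locally p_infty) l ->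
  forall a b, 0 < a -> a <= b -> RInt g a b <= l.
Proof.
  intros Hl a b Ha Hab. apply le_epsilon. intros e He.
  destruct (Hl (fun y => y < l + e)) as [Q R0 HQ HR Hf].
  - exists (mkposreal e He). intros y Hy. unfold ball in Hy; simpl in Hy.
    unfold AbsRing_ball, abs, minus, plus, opp in Hy; simpl in Hy. apply Rabs_def2 in Hy. lra.
  - destruct HQ as [d HQ]. destruct HR as [M HR].
    set (a' := Rmin (a / 2) (d / 2)). set (b' := Rmax b M + 1).
    assert (Ha' : 0 < a' /\ a' <= a / 2 /\ a' <= d / 2).
    { unfold a'. split. apply Rmin_pos; generalize (cond_pos d); lra. split; [apply Rmin_l|apply Rmin_r]. }
    assert (Hb' : b < b' /\ M < b') by (unfold b'; generalize (Rmax_l b M) (Rmax_r b M); lra).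
    destruct (Hf a' b') as (v & Hv & Hvl).
    + apply HQ; [|lra]. unfold ball; simpl. unfold AbsRing_ball, abs, minus, plus, opp; simpl.
      rewrite Rabs_pos_eq; generalize (cond_pos d); lra.
    + apply HR; lra.
    + simpl in Hv. apply (is_RInt_unique (V := R_CompleteNormedModule)) in Hv. rewrite <- Hv in Hvl.
      left. eapply Rle_lt_trans; [|exact Hvl].
      apply RInt_sub_le; try lra; intros; [apply Hc|apply Hp]; lra.
Qed.

(** Truncated integrals of a nonnegative function grow with the interval, so they converge to their
    supremum. *)
Lemma is_RInt_gen_of_bounded (B : R) : (forall a b, 0 < a -> a <= b -> RInt g a b <= B) ->
  exists l, is_RInt_gen g (at_right 0) (Rbar_locally p_infty) l /\ 0 <= l <= B.
Proof.
  intros HB.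
  destruct (completeness (fun x => exists a b, 0 < a /\ a <= b /\ x = RInt g a b)) as [l [Hl1 Hl2]].
  - exists B. intros x (a & b & Ha & Hab & ->). auto.
  - exists (RInt g 1 1), 1, 1. repeat split; lra.
  - exists l. split.
    + intros P [e HP].
      assert (H : exists a b, 0 < a /\ a <= b /\ l - e < RInt g a b).
      { apply NNPP. intros Hn. assert (l <= l - e).
        { apply Hl2. intros x (a & b & Ha & Hab & ->). apply Rnot_lt_le. intros K. apply Hn. exists a, b; auto. }
        generalize (cond_pos e); lra. }
      destruct H as (a0 & b0 & Ha0 & Hab0 & H).
      apply (Filter_prod _ _ _ (fun a => 0 < a < a0) (fun b => b0 < b)).
      * exists (mkposreal a0 Ha0). intros y Hy Hy0. unfold ball in Hy; simpl in Hy.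
        unfold AbsRing_ball, abs, minus, plus, opp in Hy; simpl in Hy. apply Rabs_def2 in Hy. lra.
      * exists b0. auto.
      * intros a b Ha Hb. exists (RInt g a b). simpl. split.
        { apply (RInt_correct (V := R_CompleteNormedModule)). apply ex_RInt_cont; [lra|]. intros; apply Hc; lra. }
        apply HP. unfold ball; simpl. unfold AbsRing_ball, abs, minus, plus, opp; simpl.
        assert (RInt g a b <= l) by (apply Hl1; exists a, b; repeat split; lra).
        assert (RInt g a0 b0 <= RInt g a b) by (apply RInt_sub_le; try lra; intros; [apply Hc|apply Hp]; lra).
        apply Rabs_def1; generalize (cond_pos e); lra.
    + split.
      * apply Hl1. exists 1, 1. repeat split; try lra. rewrite RInt_point. reflexivity.
      * apply Hl2. intros x (a & b & Ha & Hab & ->). auto.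
Qed.

Lemma int0inf_upper (B : R) : Rbar_le (int0inf g) (Finite B) -> forall a b, 0 < a -> a <= b -> RInt g a b <= B.
Proof.
  unfold int0inf. destruct excluded_middle_informative as [H|H]; [|simpl; tauto].
  destruct constructive_indefinite_description as [l Hl]; simpl. intros HlB a b Ha Hab.
  eapply Rle_trans; [apply is_RInt_gen_upper; eauto|exact HlB].
Qed.

Lemma int0inf_bounded (B : R) : (forall a b, 0 < a -> a <= b -> RInt g a b <= B) ->
  exists l, int0inf g = Finite l /\ 0 <= l <= B.
Proof.
  intros HB. destruct (is_RInt_gen_of_bounded B HB) as (l & Hl & HlB).
  unfold int0inf. destruct excluded_middle_informative as [H|H]; [|exfalso; apply H; exists l; auto].
  (* The selected value is known only as some limit of the truncated integrals, so its bounds are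
     derived from convergence. *)
  destruct constructive_indefinite_description as [l' Hl']; simpl. exists l'. split; auto. split.
  - generalize (is_RInt_gen_upper l' Hl' 1 1 Rlt_0_1 (Rle_refl 1)). rewrite RInt_point. auto.
  - apply le_epsilon. intros e He.
    destruct (Hl' (fun y => l' - e < y)) as [Q R0 HQ HR Hf].
    + exists (mkposreal e He). intros y Hy. unfold ball in Hy; simpl in Hy.
      unfold AbsRing_ball, abs, minus, plus, opp in Hy; simpl in Hy. apply Rabs_def2 in Hy. lra.
    + destruct HQ as [d HQ]. destruct HR as [M HR].
      set (a' := Rmin 1 (d / 2)). set (b' := Rmax 1 M + 1).
      assert (Ha' : 0 < a' /\ a' <= 1 /\ a' <= d / 2).
      { unfold a'. split. apply Rmin_pos; generalize (cond_pos d); lra. split; [apply Rmin_l|apply Rmin_r]. }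
      assert (Hb' : 1 < b' /\ M < b') by (unfold b'; generalize (Rmax_l 1 M) (Rmax_r 1 M); lra).
      destruct (Hf a' b') as (v & Hv & Hvl).
      * apply HQ; [|lra]. unfold ball; simpl. unfold AbsRing_ball, abs, minus, plus, opp; simpl.
        rewrite Rabs_pos_eq; generalize (cond_pos d); lra.
      * apply HR; lra.
      * simpl in Hv. apply (is_RInt_unique (V := R_CompleteNormedModule)) in Hv. rewrite <- Hv in Hvl.
        generalize (HB a' b'). lra.
Qed.

End Int0inf.

Definition pair_ray (f : C -> C) (phi t : R) : R := Cmod (f (polar t phi)) + Cmod (f (polar t (- phi))).

Lemma sector_polar psi r phi : 0 < r -> Rabs phi < psi -> sector psi (polar r phi).
Proof. intros. exists r, phi. auto. Qed.

Lemma continuous_on_sector_ray psi (f : C -> C) phi : (forall z, sector psi z -> continuous f z) ->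
  Rabs phi < psi -> forall t, 0 < t -> continuous (fun t => f (polar t phi)) t.
Proof.
  intros Hf Hphi t Ht. apply continuous_ray. apply Hf, sector_polar; auto.
Qed.

Lemma continuous_pair_ray psi (f : C -> C) phi : (forall z, sector psi z -> continuous f z) ->
  Rabs phi < psi -> forall t, 0 < t -> continuous (pair_ray f phi) t.
Proof.
  intros Hf Hphi t Ht. unfold pair_ray.
  assert (Rabs (- phi) < psi) by (rewrite Rabs_Ropp; auto).
  cont; apply (continuous_on_sector_ray psi); auto.
Qed.

Lemma pair_ray_pos f phi t : 0 <= pair_ray f phi t.
Proof. apply Rplus_le_le_0_compat; apply Cmod_ge_0. Qed.

Lemma holo_on_continuous psi f : holo_on psi f -> forall z, sector psi z -> continuous f z.
Proof. intros H z Hz. apply ex_derive_C_continuous. apply H; auto. Qed.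

Lemma H1_bounded psi (f : C -> C) (B : R) : 0 < psi -> (forall z, sector psi z -> continuous f z) ->
  (forall phi a b, Rabs phi < psi -> 0 < a -> a <= b -> RInt (pair_ray f phi) a b <= B) ->
  is_finite (H1norm_bar psi f) /\ 0 <= H1norm psi f <= B.
Proof.
  intros Hpsi Hc HB.
  assert (K : forall phi, Rabs phi < psi -> exists l, int0inf (pair_ray f phi) = Finite l /\ 0 <= l <= B).
  { intros phi Hphi. apply int0inf_bounded.
    - apply (continuous_pair_ray psi); auto.
    - intros; apply pair_ray_pos.
    - intros; apply HB; auto. }
  unfold H1norm, H1norm_bar, Lub_Rbar. destruct ex_lub_Rbar as [l [Hl1 Hl2]]; simpl.
  assert (U : Rbar_le l (Finite B)).
  { apply Hl2. intros x (phi & Hphi & Hx). destruct (K phi Hphi) as (l0 & E & Hl0).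
    change (Rbar_le x (int0inf (pair_ray f phi))) in Hx. rewrite E in Hx. simpl in *. lra. }
  assert (L : Rbar_le (Finite 0) l).
  { apply Hl1. exists 0. rewrite Rabs_R0. split; auto.
    destruct (K 0) as (l0 & E & Hl0). rewrite Rabs_R0; auto.
    change (Rbar_le 0 (int0inf (pair_ray f 0))). rewrite E. simpl; lra. }
  destruct l; simpl in *; try tauto. split; [reflexivity|lra].
Qed.

Lemma H1_pair_ray psi f phi a b : holo_on psi f -> is_finite (H1norm_bar psi f) -> Rabs phi < psi -> 0 < a -> a <= b ->
  RInt (pair_ray f phi) a b <= H1norm psi f.
Proof.
  intros Hf Hfin Hphi Ha Hab.
  apply int0inf_upper; auto.
  - apply (continuous_pair_ray psi); auto. apply holo_on_continuous; auto.
  - intros; apply pair_ray_pos.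
  - revert Hfin. unfold H1norm, H1norm_bar, Lub_Rbar. destruct ex_lub_Rbar as [l [Hl1 Hl2]]; simpl.
    intros Hfin. rewrite <- Hfin in Hl1 |- *. simpl. 
    destruct (int0inf (pair_ray f phi)) as [v| |] eqn:E; simpl; auto.
    + apply (Hl1 v). exists phi. split; auto. change (Rbar_le v (int0inf (pair_ray f phi))). rewrite E. simpl; lra.
    (* An infinite integral at one angle would put every real number below the finite supremum. *)
    + assert (Q : Rbar_le (real l + 1) (real l)).
      { apply Hl1. exists phi. split; auto. change (Rbar_le (real l + 1) (int0inf (pair_ray f phi))). rewrite E. exact I. }
      simpl in Q. lra.
Qed.

Lemma H1_ray psi f phi : holo_on psi f -> is_finite (H1norm_bar psi f) -> Rabs phi < psi ->
  rayL1 f phi (H1norm psi f).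
Proof.
  intros Hf Hfin Hphi a b Ha Hab.
  eapply Rle_trans; [|apply (H1_pair_ray psi f phi a b); auto].
  assert (C := holo_on_continuous psi f Hf).
  apply RInt_mono; auto.
  - apply ex_RInt_cont; auto. intros t Ht. cont. apply (continuous_on_sector_ray psi); auto; lra.
  - apply ex_RInt_cont; auto. intros t Ht. apply (continuous_pair_ray psi); auto; lra.
  - intros t Ht. unfold pair_ray. generalize (Cmod_ge_0 (f (polar t (- phi)))). lra.
Qed.

(** The norm adds the rays at [phi] and [- phi]; this is the factor 2 that recurs in the constants
    of the semigroup estimates. *)
Lemma H1norm_of_rays psi (f : C -> C) (B : R) : 0 < psi -> (forall z, sector psi z -> continuous f z) ->
  (forall phi, Rabs phi < psi -> rayL1 f phi B) ->
  is_finite (H1norm_bar psi f) /\ 0 <= H1norm psi f <= 2 * B.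
Proof.
  intros Hpsi Hc HB. apply H1_bounded; auto. intros phi a b Hphi Ha Hab.
  assert (Hphi' : Rabs (- phi) < psi) by (rewrite Rabs_Ropp; auto).
  unfold pair_ray. rewrite RInt_Rplus.
  - generalize (HB phi Hphi a b Ha Hab) (HB (- phi) Hphi' a b Ha Hab). lra.
  - apply ex_RInt_cont; auto. intros t Ht. cont. apply (continuous_on_sector_ray psi); auto; lra.
  - apply ex_RInt_cont; auto. intros t Ht. cont. apply (continuous_on_sector_ray psi); auto; lra.
Qed.

Ltac Csolve := apply C_eq; unfold polar, Cconj, Re, Im; simpl; unfold Re, Im; ring.

Lemma polar_rotate t a b : (polar t a * polar 1 b)%C = polar t (a + b).
Proof. rewrite <- polar_mult, Rmult_1_r. reflexivity. Qed.

(** Schwarz reflection. It exchanges the rays at [phi] and [- phi] and preserves holomorphy, so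
    one-sided estimates need only be proved on one side. *)
Definition mirror (f : C -> C) : C -> C := fun z => Cconj (f (Cconj z)).

Lemma cderiv_mirror (f : C -> C) (z l : C) : cderiv f (Cconj z) l -> cderiv (mirror f) z (Cconj l).
Proof.
  intros H. apply is_derive_C_eps. intros eps Heps.
  destruct (proj1 (is_derive_C_eps _ _ _) H eps Heps) as (d & Hd & HD).
  exists d; split; auto. intros w Hw.
  assert (E : Cmod (w - z) = Cmod (Cconj w - Cconj z)).
  { rewrite <- Cmod_conj. apply f_equal. Csolve. }
  rewrite E in Hw |- *. specialize (HD _ Hw).
  rewrite <- Cmod_conj. unfold mirror.
  replace (Cconj (Cconj (f (Cconj w)) - Cconj (f (Cconj z)) - Cconj l * (w - z)))
    with (f (Cconj w) - f (Cconj z) - l * (Cconj w - Cconj z))%C; auto.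
  Csolve.
Qed.

Lemma holo_mirror (f : C -> C) (z : C) : holo f (Cconj z) -> holo (mirror f) z.
Proof. intros [l Hl]. eexists. apply cderiv_mirror; eauto. Qed.

Lemma mirror_polar (f : C -> C) r a : Cmod (mirror f (polar r a)) = Cmod (f (polar r (- a))).
Proof. unfold mirror. rewrite Cmod_conj, polar_conj. reflexivity. Qed.

Lemma rayL1_mirror (f : C -> C) a B : rayL1 f (- a) B -> rayL1 (mirror f) a B.
Proof.
  intros H u v Hu Huv. erewrite RInt_eq; [apply (H u v); auto| auto |].
  intros t Ht. apply mirror_polar.
Qed.

(** The weight with which the outer ray enters. It is bounded, which gives boundedness of the shift,
    and for fixed [s] it tends to 0 with [rho], which later gives continuity. *)
Definition shift_weight (dl rho s : R) : R := 2 / (gap dl ^ 4) * (rho / (s + rho)).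

(** Rotating by [- phi] makes the ray of integration the positive real axis of
    [shift_bound_below]. *)
Lemma shift_ray_below (f : C -> C) (al phi B rho th dl t1 t2 eps : R) :
  0 < dl -> al + dl <= th -> th < phi -> phi - th <= PI - dl -> (phi - al) + (phi - th) <= 2 * PI - dl -> 0 < rho ->
  0 <= t1 <= t2 -> 0 < eps ->
  in_sec al phi (holo f) -> (forall a, al <= a <= phi -> rayL1 f a B) ->
  exists a b, 0 < a /\ a <= b /\
    2 * PI * RInt (fun t => Cmod (f (polar t phi + polar rho th)%C)) t1 t2 <=
    RInt (fun s => Cmod (f (polar s al)) * shift_weight dl rho s) a b
    + RInt (fun s => Cmod (f (polar s phi)) * (2 * PI)) a b + eps.
Proof.
  intros Hdl Hal Hth Hd1 Hd2 Hrho Ht Heps Hf HB.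
  set (g := fun z => f (z * polar 1 phi)%C).
  assert (Eg : forall r a, g (polar r a) = f (polar r (a + phi))) by (intros; unfold g; rewrite polar_rotate; auto).
  destruct (shift_bound_below g (al - phi) B rho (th - phi) dl t1 t2 eps) as (a & b & Ha & Hab & H); auto; try lra.
  - intros r a Hr Ha. unfold g. apply (holo_comp f (fun z => z * polar 1 phi)%C).
    rewrite polar_rotate. apply Hf; lra. Holo.
  - intros a Ha u v Hu Huv. erewrite RInt_eq; [apply (HB (a + phi)); eauto; lra|auto|].
    intros t _. cbv beta. rewrite Eg. reflexivity.
  - exists a, b. split; auto. split; auto.
    rewrite (RInt_eq (fun s => Cmod (g (polar s (al - phi))) * (2 / gap dl ^ 4 * (rho / (s + rho)))) (fun s => Cmod (f (polar s al)) * shift_weight dl rho s)) in H; auto.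
    2:{ intros t _. rewrite Eg. replace (al - phi + phi) with al by ring. reflexivity. }
    rewrite (RInt_eq (fun s => Cmod (g (polar s 0)) * (2 * PI)) (fun s => Cmod (f (polar s phi)) * (2 * PI))) in H; auto.
    2:{ intros t _. rewrite Eg. replace (0 + phi) with phi by ring. reflexivity. }
    rewrite (RInt_eq (fun t => Cmod (f (polar t phi + polar rho th)%C)) (fun t => Cmod (g (t + polar rho (th - phi))%C))); [exact H|lra|].
    intros t _. unfold g. apply f_equal, f_equal.
    rewrite Cmult_plus_distr_r, polar_rotate. replace (th - phi + phi) with th by ring.
    apply f_equal2; auto. Csolve.
Qed.

Lemma shift_ray_above (f : C -> C) (be phi B rho th dl t1 t2 eps : R) :
  0 < dl -> th + dl <= be -> phi < th -> th - phi <= PI - dl -> (be - phi) + (th - phi) <= 2 * PI - dl -> 0 < rho ->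
  0 <= t1 <= t2 -> 0 < eps ->
  in_sec phi be (holo f) -> (forall a, phi <= a <= be -> rayL1 f a B) ->
  exists a b, 0 < a /\ a <= b /\
    2 * PI * RInt (fun t => Cmod (f (polar t phi + polar rho th)%C)) t1 t2 <=
    RInt (fun s => Cmod (f (polar s be)) * shift_weight dl rho s) a b
    + RInt (fun s => Cmod (f (polar s phi)) * (2 * PI)) a b + eps.
Proof.
  intros Hdl Hal Hth Hd1 Hd2 Hrho Ht Heps Hf HB.
  destruct (shift_ray_below (mirror f) (- be) (- phi) B rho (- th) dl t1 t2 eps) as (a & b & Ha & Hab & H); auto; try lra.
  - intros r a Hr Ha. apply holo_mirror. rewrite polar_conj. apply Hf; lra.
  - intros a Ha. apply rayL1_mirror, HB; lra.
  - exists a, b. split; auto. split; auto.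
    rewrite (RInt_eq (fun s => Cmod (mirror f (polar s (- be))) * shift_weight dl rho s) (fun s => Cmod (f (polar s be)) * shift_weight dl rho s)) in H; auto.
    2:{ intros t _. rewrite mirror_polar, Ropp_involutive. reflexivity. }
    rewrite (RInt_eq (fun s => Cmod (mirror f (polar s (- phi))) * (2 * PI)) (fun s => Cmod (f (polar s phi)) * (2 * PI))) in H; auto.
    2:{ intros t _. rewrite mirror_polar, Ropp_involutive. reflexivity. }
    rewrite (RInt_eq (fun t => Cmod (f (polar t phi + polar rho th)%C)) (fun t => Cmod (mirror f (polar t (- phi) + polar rho (- th))%C))); [exact H|lra|].
    intros t _. unfold mirror. rewrite Cmod_conj. apply f_equal, f_equal. rewrite <- !polar_conj.
    Csolve.
Qed.

Lemma RInt_translate (g : R -> R) (c a b : R) : a <= b -> (forall t, a + c <= t <= b + c -> continuous g t) ->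
  RInt (fun t => g (t + c)) a b = RInt g (a + c) (b + c) :> R.
Proof.
  intros Hab Hc.
  generalize (RInt_comp_lin (V := R_CompleteNormedModule) g 1 c a b). rewrite !Rmult_1_l. intros E.
  rewrite <- E.
  - apply RInt_eq; auto. intros t _. change (g (t + c) = 1 * g (1 * t + c)). rewrite !Rmult_1_l. reflexivity.
  - apply ex_RInt_cont; auto. lra.
Qed.

Lemma shift_weight_bounds dl rho s : 0 < dl <= PI -> 0 < rho -> 0 < s ->
  0 <= shift_weight dl rho s <= 2 / gap dl ^ 4 /\ shift_weight dl rho s <= 2 / gap dl ^ 4 * (rho / s).
Proof.
  intros Hdl Hrho Hs. assert (Hg := gap_pos dl Hdl). assert (Hg4 : 0 < gap dl ^ 4) by (apply pow_lt; auto).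
  assert (H2 : 0 < 2 / gap dl ^ 4) by (apply Rdiv_lt_0_compat; lra).
  assert (Hq : 0 <= rho / (s + rho) <= 1).
  { split. apply Rdiv_le_0_compat; lra. apply Rmult_le_reg_r with (s + rho). lra.
    unfold Rdiv. rewrite Rmult_assoc, Rinv_l by lra. lra. }
  unfold shift_weight. split; [split|].
  - apply Rmult_le_pos; lra.
  - rewrite <- (Rmult_1_r (2 / gap dl ^ 4)) at 2. apply Rmult_le_compat_l; lra.
  - apply Rmult_le_compat_l; [lra|]. apply Rmult_le_compat_l; [lra|]. apply Rinv_le_contravar; lra.
Qed.

Section ShiftOnSector.

Variables (psi psi' : R).
Hypothesis Hpsi : 0 < psi < PI.
Hypothesis Hpsi' : 0 <= psi' < Rmin psi (PI - psi).

Let psi0 := Rmin psi (PI - psi).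
(** The outer rays are at angles [gam] and [- gam], with [gam] halfway between psi' and psi0: inside
    the sector, yet at angle [dl] from every admissible tau. From psi0 <= pi - psi, the reflected
    pole keeps a margin as well. *)
Let dl := (psi0 - psi') / 2.
Let gam := psi' + dl.

Lemma shift_params : 0 < dl <= PI /\ psi' < gam < psi /\ psi0 <= psi /\ psi0 <= PI - psi /\ gam = psi0 - dl /\ psi' = psi0 - 2 * dl.
Proof.
  unfold gam, dl. fold psi0 in Hpsi'. assert (psi0 <= psi) by apply Rmin_l. assert (psi0 <= PI - psi) by apply Rmin_r.
  repeat split; lra.
Qed.

(** The outer ray is taken on the side of the ray [phi] on which tau points; when the argument of
    tau is [phi] itself the shift is a translation along the ray. *)
Lemma shift_ray (f : C -> C) (B rho th phi t1 t2 eps : R) :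
  holo_on psi f -> (forall a, Rabs a < psi -> rayL1 f a B) ->
  0 < rho -> Rabs th <= psi' -> Rabs phi < psi -> 0 <= t1 <= t2 -> 0 < eps ->
  exists sg a b, Rabs sg = gam /\ 0 < a /\ a <= b /\
    2 * PI * RInt (fun t => Cmod (f (polar t phi + polar rho th)%C)) t1 t2 <=
    RInt (fun s => Cmod (f (polar s sg)) * shift_weight dl rho s) a b
    + RInt (fun s => Cmod (f (polar s phi)) * (2 * PI)) a b + eps.
Proof.
  intros Hf HB Hrho Hth Hphi Ht Heps.
  destruct shift_params as (P1 & P2 & P3 & P4 & P5 & P6).
  apply Rabs_le_between in Hth. apply Rabs_def2 in Hphi.
  assert (Hsec : forall al be, - psi < al -> be < psi -> in_sec al be (holo f)).
  { intros al be Hal Hbe r a Hr Ha. apply Hf. exists r, a. repeat split; auto. apply Rabs_def1; lra. }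
  assert (HB' : forall a, - psi < a < psi -> rayL1 f a B) by (intros; apply HB, Rabs_def1; lra).
  destruct (Rtotal_order th phi) as [Hlt|[Heq|Hgt]].
  - destruct (shift_ray_below f (- gam) phi B rho th dl t1 t2 eps) as (a & b & Ha & Hab & H); auto; try lra.
    + apply Hsec; lra.
    + intros; apply HB'; lra.
    + exists (- gam), a, b. rewrite Rabs_Ropp, Rabs_pos_eq by lra. auto.
  - subst th.
    exists gam, (t1 + rho), (t2 + rho). rewrite Rabs_pos_eq by lra. split; auto. split; [lra|]. split; [lra|].
    assert (Cr : forall a, - psi < a < psi -> forall t, 0 < t -> continuous (fun t => f (polar t a)) t).
    { intros a Ha t Htt. apply continuous_ray, ex_derive_C_continuous, Hf, sector_polar; auto. apply Rabs_def1; lra. }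
    rewrite (RInt_eq (fun t => Cmod (f (polar t phi + polar rho phi)%C)) (fun t => Cmod (f (polar (t + rho) phi)))); try lra.
    2:{ intros t _. apply f_equal, f_equal. Csolve. }
    rewrite (RInt_translate (fun t => Cmod (f (polar t phi))) rho t1 t2) by (try lra; intros; cont; apply Cr; lra).
    rewrite (RInt_eq (fun s => Cmod (f (polar s phi)) * (2 * PI)) (fun s => (2 * PI) * Cmod (f (polar s phi)))) by (try lra; intros; ring).
    rewrite RInt_Rscal by (apply ex_RInt_cont; try lra; intros; cont; apply Cr; lra).
    assert (0 <= RInt (fun s : R => Cmod (f (polar s gam)) * shift_weight dl rho s) (t1 + rho) (t2 + rho)); [|lra].
    apply RInt_pos; try lra.
    + apply ex_RInt_cont; try lra. intros t Htt. unfold shift_weight. cont. apply Cr; lra. lra.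
    + intros t Htt. apply Rmult_le_pos. apply Cmod_ge_0. apply shift_weight_bounds; lra.
  - destruct (shift_ray_above f gam phi B rho th dl t1 t2 eps) as (a & b & Ha & Hab & H); auto; try lra.
    + apply Hsec; lra.
    + intros; apply HB'; lra.
    + exists gam, a, b. rewrite Rabs_pos_eq by lra. auto.
Qed.

(** Times 2 pi, this is the supremum 2 / gap^4 of [shift_weight] plus the mass 2 pi of the Poisson
    kernel. *)
Definition shift_const : R := / (PI * gap dl ^ 4) + 1.

Lemma shift_const_pos : 0 < shift_const.
Proof.
  destruct shift_params as (P1 & _). unfold shift_const.
  assert (0 < / (PI * gap dl ^ 4)). { apply Rinv_0_lt_compat, Rmult_lt_0_compat. apply PI_RGT_0. apply pow_lt, gap_pos; auto. }
  lra.
Qed.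

Lemma shift_bounded (f : C -> C) (B : R) (tau : C) phi :
  holo_on psi f -> (forall a, Rabs a < psi -> rayL1 f a B) -> csector psi' tau -> Rabs phi < psi ->
  rayL1 (shift tau f) phi (shift_const * B).
Proof.
  intros Hf HB (rho & th & Hrho & Hth & ->) Hphi t1 t2 Ht1 Ht.
  destruct shift_params as (P1 & P2 & P3 & P4 & P5 & P6).
  assert (Hg4 : 0 < gap dl ^ 4) by (apply pow_lt, gap_pos; auto).
  assert (HPI := PI_RGT_0).
  apply Rmult_le_reg_l with (2 * PI). lra.
  apply le_epsilon. intros eps Heps.
  destruct (shift_ray f B rho th phi t1 t2 eps) as (sg & a & b & Hsg & Ha & Hab & H); auto; try lra.
  unfold shift. eapply Rle_trans; [exact H|]. apply Rplus_le_compat_r.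
  assert (Cr : forall a, Rabs a < psi -> forall t, 0 < t -> continuous (fun t => f (polar t a)) t).
  { intros c Hc t Htt. apply continuous_ray, ex_derive_C_continuous, Hf, sector_polar; auto. }
  assert (Hsg' : Rabs sg < psi) by lra.
  replace (2 * PI * (shift_const * B)) with (2 / gap dl ^ 4 * B + 2 * PI * B) by (unfold shift_const; assert (0 < gap dl) by (apply gap_pos; auto); field; split; lra).
  apply Rplus_le_compat.
  - apply Rle_trans with (2 / gap dl ^ 4 * RInt (fun s => Cmod (f (polar s sg))) a b).
    + rewrite <- RInt_Rscal by (apply ex_RInt_cont; auto; intros; cont; apply Cr; auto; lra).
      apply RInt_mono; auto.
      * apply ex_RInt_cont; auto. intros; unfold shift_weight; cont. apply Cr; auto; lra. lra.
      * apply ex_RInt_Rscal, ex_RInt_cont; auto; intros; cont; apply Cr; auto; lra.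
      * intros t Htt. rewrite Rmult_comm. apply Rmult_le_compat_r. apply Cmod_ge_0. apply shift_weight_bounds; lra.
    + apply Rmult_le_compat_l. apply Rdiv_le_0_compat; lra. apply HB; auto.
  - rewrite (RInt_eq (fun s => Cmod (f (polar s phi)) * (2 * PI)) (fun s => (2 * PI) * Cmod (f (polar s phi)))) by (try lra; intros; ring).
    rewrite RInt_Rscal by (apply ex_RInt_cont; auto; intros; cont; apply Cr; auto; lra).
    apply Rmult_le_compat_l. lra. apply HB; auto.
Qed.

End ShiftOnSector.

(** * Differentiability in the shift *)

Lemma cos_Rabs x : cos (Rabs x) = cos x.
Proof. unfold Rabs. destruct Rcase_abs; auto. apply cos_neg. Qed.

(** A description without angles, by a Lipschitz function of z, from which openness of the sector is
    immediate. *)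
Lemma sector_iff psi (z : C) : 0 < psi < PI -> sector psi z <-> Cmod z * cos psi < Re z.
Proof.
  intros Hpsi. split.
  - intros (r & phi & Hr & Hphi & ->). rewrite Cmod_polar by lra. simpl. 
    apply Rmult_lt_compat_l; auto.
    rewrite <- (cos_Rabs phi). apply cos_decreasing_1; try lra. apply Rabs_pos.
  - intros H.
    assert (G : forall x y : R, y < 0 -> Cmod (x, y) * cos psi < x -> sector psi (x, y)).
    { intros x y Hy Hxy. destruct (polar_of_lower x y Hy) as (th & Hth & E).
      set (r := Cmod (x, y)) in *.
      assert (Hr : 0 < r). { apply Cmod_gt_0. intros K. injection K; lra. }
      exists r, th. repeat split; auto.
      rewrite Rabs_left by lra.
      injection E; intros _ E1. rewrite E1 in Hxy. apply Rmult_lt_reg_l in Hxy; auto.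
      rewrite <- (cos_neg th) in Hxy. apply cos_decreasing_0 in Hxy; lra. }
    destruct z as [x y]. simpl in H. destruct (Rtotal_order y 0) as [Hy|[->|Hy]].
    + apply G; auto.
    + assert (E : Cmod (x, 0) = Rabs x) by apply Cmod_R. rewrite E in H.
      assert (Hc : -1 < cos psi < 1).
      { split. rewrite <- cos_PI. apply cos_decreasing_1; lra. rewrite <- cos_0. apply cos_decreasing_1; lra. }
      assert (0 < x). { apply Rnot_le_lt. intros K. rewrite Rabs_left1 in H by auto. nra. }
      exists x, 0. rewrite Rabs_R0. repeat split; try lra. unfold polar. rewrite cos_0, sin_0. f_equal; ring.
    + destruct (G x (- y)) as (r & th & Hr & Hth & E).
      * lra.
      * replace (Cmod (x, - y)) with (Cmod (x, y)); auto. apply (eq_sym (Cmod_conj (x, y))).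
      * exists r, (- th). rewrite Rabs_Ropp. repeat split; auto.
        rewrite <- polar_conj, <- E. unfold Cconj; simpl. rewrite Ropp_involutive. reflexivity.
Qed.

Lemma sector_open psi (z : C) : 0 < psi < PI -> sector psi z ->
  exists r, 0 < r /\ forall w, Cmod (w - z) < r -> sector psi w.
Proof.
  intros Hpsi Hz. apply sector_iff in Hz; auto.
  exists ((Re z - Cmod z * cos psi) / 2). split. lra.
  intros w Hw. apply sector_iff; auto.
  destruct (Cmod_Rabs (w - z)) as [H1 _].
  assert (H2 : Re z - Cmod (w - z) <= Re w).
  { apply Rabs_le_between in H1. unfold Re in *. simpl in *. lra. }
  assert (H3 := Cmod_sub_ge w z). assert (H4 := Cmod_sub_ge z w).
  replace (z - w)%C with (- (w - z))%C in H4 by ring. rewrite Cmod_opp in H4.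
  generalize (COS_bound psi). intros. 
  assert (Rabs (Cmod w - Cmod z) <= Cmod (w - z)) by (apply Rabs_le; lra).
  assert ((Cmod w - Cmod z) * cos psi <= Cmod (w - z)).
  { eapply Rle_trans; [apply Rle_abs|]. rewrite Rabs_mult. 
    assert (Rabs (cos psi) <= 1) by (apply Rabs_le; lra).
    generalize (Rabs_pos (cos psi)) (Rabs_pos (Cmod w - Cmod z)). nra. }
  lra.
Qed.

(** Rotating so that one of the two directions becomes the positive real axis reduces this to
    [polar_add]. *)
Lemma polar_add_between r phi rho th : 0 < r -> 0 < rho -> Rabs (th - phi) < PI ->
  exists r' th', 0 < r' /\ Rmin th phi <= th' <= Rmax th phi /\ (polar r phi + polar rho th)%C = polar r' th'.
Proof.
  intros Hr Hrho Hd. apply Rabs_def2 in Hd.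
  assert (G : forall r phi rho th, 0 < r -> 0 < rho -> - PI < th - phi < 0 ->
    exists r' th', 0 < r' /\ th <= th' <= phi /\ (polar r phi + polar rho th)%C = polar r' th').
  { clear. intros r phi rho th Hr Hrho Hd.
    destruct (polar_add r rho (th - phi)) as (r' & th' & Hr' & Hth' & E); try lra.
    exists r', (th' + phi). split; auto. split. lra.
    rewrite <- polar_rotate, <- E, Cmult_plus_distr_r, polar_rotate.
    replace (th - phi + phi) with th by ring. apply f_equal2; auto. Csolve. }
  destruct (Rtotal_order th phi) as [H|[->|H]].
  - destruct (G r phi rho th) as (r' & th' & H1 & H2 & H3); try lra.
    exists r', th'. rewrite Rmin_left, Rmax_right by lra. auto.
  - exists (r + rho), phi. rewrite Rmin_left, Rmax_left by lra. repeat split; try lra. Csolve.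
  - destruct (G rho th r phi) as (r' & th' & H1 & H2 & H3); try lra.
    exists r', th'. rewrite Rmin_right, Rmax_left by lra. rewrite Cplus_comm. auto.
Qed.

(** Both bounds on the argument of tau enter here: pi - psi makes the angle between z and tau less
    than pi, so the sum points between them, and psi keeps that direction in the sector. *)
Lemma sector_plus psi (z tau : C) : 0 < psi < PI -> sector psi z -> sector (Rmin psi (PI - psi)) tau -> sector psi (z + tau).
Proof.
  intros Hpsi (r & phi & Hr & Hphi & ->) (rho & th & Hrho & Hth & ->).
  assert (H1 := Rlt_le_trans _ _ _ Hth (Rmin_l _ _)). assert (H2 := Rlt_le_trans _ _ _ Hth (Rmin_r _ _)).
  destruct (polar_add_between r phi rho th) as (r' & th' & Hr' & Hth' & E); auto.
  - apply Rabs_def2 in Hphi. apply Rabs_def2 in H2. apply Rabs_def1; lra.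
  - exists r', th'. repeat split; auto. apply Rabs_def2 in Hphi. apply Rabs_def2 in H1.
    revert Hth'. unfold Rmin, Rmax. intros. apply Rabs_def1; repeat destruct Rle_dec; lra.
Qed.

Lemma csector_sector psi' psi (z : C) : psi' < psi -> csector psi' z -> sector psi z.
Proof. intros H (r & phi & Hr & Hphi & ->). exists r, phi. repeat split; auto; lra. Qed.

Lemma sector_csector psi (z : C) : sector psi z -> csector psi z.
Proof. intros (r & phi & Hr & Hphi & ->). exists r, phi. repeat split; auto; lra. Qed.

(** Provides a disc of shifts around a given one that obey a common bound. *)
Lemma sector_margin psi (z : C) : 0 < psi < PI -> sector psi z ->
  exists psi' r, 0 <= psi' < psi /\ 0 < r /\ forall w, Cmod (w - z) < r -> csector psi' w.
Proof.
  intros Hpsi (r & phi & Hr & Hphi & ->).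
  generalize (Rabs_pos phi); intros Hp.
  destruct (sector_open ((Rabs phi + psi) / 2) (polar r phi)) as (d & Hd & H). lra.
  apply sector_polar; auto. lra.
  exists ((Rabs phi + psi) / 2), d. repeat split; try lra. intros w Hw. apply sector_csector; auto.
Qed.

Lemma cderiv_shift (f : C -> C) (tau z l : C) : cderiv f (z + tau)%C l -> cderiv (shift tau f) z l.
Proof.
  intros H. unfold shift. replace l with (l * 1)%C by ring.
  apply (is_derive_Ccomp f (fun z => z + tau)%C); auto.
  replace (RtoC 1) with (1 + 0)%C by ring. apply is_derive_Cplus. apply is_derive_Cid. apply is_derive_Cconst.
Qed.

Lemma cderiv_shift_inv (f : C -> C) (z p : C) : holo f (z + p)%C -> cderiv (fun w => f (z + w)%C) p (C_derive f (z + p)%C).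
Proof.
  intros H. replace (C_derive f (z + p)%C) with (C_derive f (z + p)%C * 1)%C by ring.
  apply (is_derive_Ccomp f (fun w => z + w)%C). apply C_derive_holo; auto.
  replace (RtoC 1) with (0 + 1)%C by ring. apply is_derive_Cplus. apply is_derive_Cconst. apply is_derive_Cid.
Qed.

Section SectorFunctions.

Variable psi : R.
Hypothesis Hpsi : 0 < psi < PI.
Let psi0 := Rmin psi (PI - psi).

Lemma psi0_bounds : 0 < psi0 < PI /\ psi0 <= psi.
Proof.
  unfold psi0. split; [split|apply Rmin_l]. apply Rmin_pos; lra.
  apply Rle_lt_trans with psi. apply Rmin_l. lra.
Qed.

Lemma holo_on_shift f tau : holo_on psi f -> sector psi0 tau -> holo_on psi (shift tau f).
Proof.
  intros Hf Ht z Hz. exists (C_derive f (z + tau)%C). apply cderiv_shift, C_derive_holo, Hf.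
  apply sector_plus; auto.
Qed.

Lemma holo_on_derive f : holo_on psi f -> holo_on psi (C_derive f).
Proof.
  intros Hf z Hz. destruct (sector_open psi z Hpsi Hz) as (r & Hr & H).
  apply (holo_C_derive f z r Hr). intros w Hw. apply Hf, H, Hw.
Qed.

Lemma path_fubini f B psi' (gm : R -> C) c d phi t1 t2 :
  holo_on psi f -> (forall a, Rabs a < psi -> rayL1 f a B) -> 0 <= psi' < psi0 -> Rabs phi < psi ->
  c <= d -> 0 < t1 -> t1 <= t2 -> (forall x, c <= x <= d -> csector psi' (gm x)) -> cont_on gm c d ->
  ex_RInt (fun t => RInt (fun x => Cmod (f (polar t phi + gm x)%C)) c d) t1 t2 /\
  RInt (fun t => RInt (fun x => Cmod (f (polar t phi + gm x)%C)) c d) t1 t2 <= (d - c) * (shift_const psi psi' * B).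
Proof.
  intros Hf HB Hpsi' Hphi Hcd Ht1 Ht Hgm Hcg.
  destruct (fubini (fun t x => Cmod (f (polar t phi + gm x)%C)) t1 t2 c d) as (F1 & F2 & F3); auto.
  { intros t x Ht' Hx. apply continuous_2d. cont.
    apply (continuous_Ccomp f (fun p : R * R => (polar (fst p) phi + gm (snd p))%C)).
    - cont. apply (continuous_comp (fun p : R * R => snd p) gm). cont. apply Hcg; auto.
    - apply ex_derive_C_continuous, Hf. simpl. apply sector_plus; auto. apply sector_polar; auto; lra.
      apply (csector_sector psi'); auto. apply Hpsi'. }
  split; auto. rewrite F3. rewrite <- RInt_Rconst. apply RInt_mono; auto. apply ex_RInt_const.
  intros x Hx. apply (shift_bounded psi psi' Hpsi Hpsi' f B (gm x) phi); auto.
Qed.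

(** [A t] is the contour norm of the function w -> f (z + w) over a square, at z = polar t phi.
    Every point of the square is an admissible shift, so [shift_bounded] integrated over the
    perimeter 8 l bounds its integral along the ray. *)
Lemma square_fubini f B psi' u v l phi t1 t2 :
  holo_on psi f -> (forall a, Rabs a < psi -> rayL1 f a B) -> 0 <= psi' < psi0 -> Rabs phi < psi ->
  0 < l -> (forall w, Cmod (w - (u, v)) <= 2 * l -> csector psi' w) -> 0 < t1 -> t1 <= t2 ->
  let A := fun t => arect (fun w => Cmod (f (polar t phi + w)%C)) (u - l) (u + l) (v - l) (v + l) in
  ex_RInt A t1 t2 /\ RInt A t1 t2 <= 8 * l * (shift_const psi psi' * B).
Proof.
  intros Hf HB Hpsi' Hphi Hl Hsq Ht1 Ht A.
  assert (Q : forall x y, u - l <= x <= u + l -> v - l <= y <= v + l -> csector psi' (x, y)).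
  { intros x y Hx Hy. apply Hsq. eapply Rle_trans; [apply Cmod_le_sum|]. simpl.
    apply Rle_trans with (l + l); [|lra]. apply Rplus_le_compat; apply Rabs_le; lra. }
  destruct (path_fubini f B psi' (fun x => (x, v - l)) (u - l) (u + l) phi t1 t2) as [E1 I1]; auto; try lra.
  { intros; apply Q; lra. } { intros x Hx; cont. }
  destruct (path_fubini f B psi' (fun y => (u + l, y)) (v - l) (v + l) phi t1 t2) as [E2 I2]; auto; try lra.
  { intros; apply Q; lra. } { intros x Hx; cont. }
  destruct (path_fubini f B psi' (fun x => (x, v + l)) (u - l) (u + l) phi t1 t2) as [E3 I3]; auto; try lra.
  { intros; apply Q; lra. } { intros x Hx; cont. }
  destruct (path_fubini f B psi' (fun y => (u - l, y)) (v - l) (v + l) phi t1 t2) as [E4 I4]; auto; try lra.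
  { intros; apply Q; lra. } { intros x Hx; cont. }
  assert (X12 := ex_RInt_Rplus _ _ _ _ E1 E2).
  assert (X123 := ex_RInt_Rplus _ _ _ _ X12 E3).
  assert (X := ex_RInt_Rplus _ _ _ _ X123 E4).
  split. exact X.
  unfold A, arect. rewrite (RInt_Rplus _ _ _ _ X123 E4), (RInt_Rplus _ _ _ _ X12 E3), (RInt_Rplus _ _ _ _ E1 E2). lra.
Qed.

(** For fixed z, the function w -> f (z + w) is holomorphic on a disc around tau0 whose radius does
    not depend on z, even if z is close to the boundary. Cauchy's estimates on one fixed square are
    therefore uniform in z. *)
Lemma shift_quotient_bound tau0 : sector psi0 tau0 -> exists C0 d, 0 < C0 /\ 0 < d /\
  (forall h, Cmod h < d -> sector psi0 (tau0 + h)%C) /\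
  forall f B, holo_on psi f -> (forall a, Rabs a < psi -> rayL1 f a B) -> forall phi, Rabs phi < psi ->
    rayL1 (shift tau0 (C_derive f)) phi (C0 * B) /\
    forall h, 0 < Cmod h < d ->
      rayL1 (fun z => (shift (tau0 + h) f z - shift tau0 f z) / h - shift tau0 (C_derive f) z)%C phi (C0 * Cmod h * B).
Proof.
  intros Htau. destruct psi0_bounds as [B0 B1].
  destruct (sector_margin psi0 tau0 B0 Htau) as (psi' & r & Hpsi' & Hr & Hball).
  set (l := r / 4). assert (Hl : 0 < l) by (unfold l; lra).
  destruct tau0 as [u v]. set (tau0 := (u, v) : C) in *.
  assert (HPI := PI_RGT_0).
  assert (HM := shift_const_pos psi psi' Hpsi Hpsi'). set (M := shift_const psi psi') in *.
  (* The first summand comes from the bound on the derivative, the second from the Taylor remainder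
     of the quotient. *)
  set (C0 := 4 * M / (PI * l) + 8 * M / (PI * (l * l))).
  assert (Hc1 : 0 < 4 * M / (PI * l)) by (apply Rdiv_lt_0_compat; nra).
  assert (Hc2 : 0 < 8 * M / (PI * (l * l))). { apply Rdiv_lt_0_compat. nra. apply Rmult_lt_0_compat; nra. }
  exists C0, (l / 2). split. unfold C0; lra. split. lra.
  assert (Hsec : forall h, Cmod h < r -> sector psi0 (tau0 + h)%C).
  { intros h Hh. apply (csector_sector psi'). apply Hpsi'. apply Hball.
    replace (tau0 + h - tau0)%C with h by ring. auto. }
  split. { intros h Hh. apply Hsec. unfold l in *; lra. }
  intros f B Hf HB phi Hphi.
  assert (HB0 : 0 <= B).
  { generalize (HB 0 ltac:(rewrite Rabs_R0; lra) 1 1 Rlt_0_1 (Rle_refl 1)). rewrite RInt_point. auto. }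
  assert (Hol : forall z, sector psi z -> on_rect (holo (fun w => f (z + w)%C)) (u - l) (u + l) (v - l) (v + l)).
  { intros z Hz x y Hx Hy. eexists. apply cderiv_shift_inv. apply Hf. apply sector_plus; auto.
    apply (csector_sector psi'). apply Hpsi'. apply Hball.
    eapply Rle_lt_trans; [apply Cmod_le_sum|]. simpl.
    apply Rle_lt_trans with (l + l); [|unfold l; lra]. apply Rplus_le_compat; apply Rabs_le; lra. }
  assert (Hd : dist_bd tau0 l (u - l) (u + l) (v - l) (v + l)) by (unfold dist_bd, tau0; simpl; lra).
  set (A := fun z => arect (fun w => Cmod (f (z + w)%C)) (u - l) (u + l) (v - l) (v + l)).
  assert (HD : forall z, sector psi z -> cauchy_D1 (fun w => f (z + w)%C) (u - l) (u + l) (v - l) (v + l) tau0 = C_derive f (z + tau0)%C).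
  { intros z Hz. rewrite <- (C_derive_eq (fun w => f (z + w)%C) tau0 (C_derive f (z + tau0)%C)).
    - symmetry. apply C_derive_eq. apply (cauchy_D1_deriv _ _ _ _ _ _ l); auto.
    - apply cderiv_shift_inv, Hf, sector_plus; auto. }
  assert (P1 : forall z, sector psi z -> Cmod (shift tau0 (C_derive f) z) <= / (2 * PI) * / (l * l) * A z).
  { intros z Hz. unfold shift. rewrite <- HD by auto. rewrite Rmult_assoc. apply cauchy_D1_bound; auto. }
  assert (P2 : forall z h, sector psi z -> 0 < Cmod h < l / 2 ->
     Cmod ((shift (tau0 + h) f z - shift tau0 f z) / h - shift tau0 (C_derive f) z) <= Cmod h / (PI * (l * l * l)) * A z).
  { intros z h Hz Hh. unfold shift. rewrite <- HD by auto.
    assert (Nh : h <> 0) by (apply Cmod_gt_0; lra).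
    generalize (cauchy_D1_taylor _ _ _ _ _ (Hol z Hz) tau0 h l Hl Hd ltac:(lra)). fold (A z). intros T.
    replace ((f (z + (tau0 + h)) - f (z + tau0)) / h - cauchy_D1 (fun w => f (z + w)) (u - l) (u + l) (v - l) (v + l) tau0)%C
      with ((f (z + (tau0 + h)) - f (z + tau0) - h * cauchy_D1 (fun w => f (z + w)) (u - l) (u + l) (v - l) (v + l) tau0) / h)%C
      by (field; auto).
    rewrite Cmod_div by auto. apply Rmult_le_reg_r with (Cmod h). lra.
    unfold Rdiv at 1. rewrite Rmult_assoc, Rinv_l, Rmult_1_r by lra.
    eapply Rle_trans; [exact T|]. right. field. lra. }
  assert (INT : forall (g : C -> C) k, 0 <= k -> (forall z, sector psi z -> continuous g z) ->
     (forall z, sector psi z -> Cmod (g z) <= k * A z) -> rayL1 g phi (k * (8 * l * (M * B)))).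
  { intros g k Hk Hgc Hg t1 t2 Ht1 Ht.
    destruct (square_fubini f B psi' u v l phi t1 t2) as [S1 S2]; auto.
    { intros w Hw. apply Hball. unfold tau0. unfold l in *; lra. }
    eapply Rle_trans; [|apply Rmult_le_compat_l; [exact Hk|exact S2]].
    rewrite <- RInt_Rscal by auto. apply RInt_mono; auto.
    - apply ex_RInt_cont; auto. intros t Htt. cont. apply (continuous_on_sector_ray psi); auto; lra.
    - apply ex_RInt_Rscal; auto.
    - intros t Htt. apply (Hg (polar t phi)). apply sector_polar; auto; lra. }
  assert (Cd : forall z, sector psi z -> continuous (shift tau0 (C_derive f)) z).
  { intros z Hz. apply ex_derive_C_continuous. apply (holo_on_shift (C_derive f)); auto. apply holo_on_derive; auto. }
  assert (Cf : forall tau z, sector psi0 tau -> sector psi z -> continuous (shift tau f) z).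
  { intros tau z Ht Hz. apply ex_derive_C_continuous. apply (holo_on_shift f); auto. }
  split.
  - intros t1 t2 Ht1 Ht.
    eapply Rle_trans; [apply (INT (shift tau0 (C_derive f)) (/ (2 * PI) * / (l * l))); auto|].
    + left; apply Rmult_lt_0_compat; apply Rinv_0_lt_compat; nra.
    + unfold C0. rewrite Rmult_plus_distr_r.
      replace (/ (2 * PI) * / (l * l) * (8 * l * (M * B))) with (4 * M / (PI * l) * B) by (field; lra).
      assert (0 <= 8 * M / (PI * (l * l)) * B) by (apply Rmult_le_pos; lra). lra.
  - intros h Hh t1 t2 Ht1 Ht.
    eapply Rle_trans; [apply (INT (fun z => (shift (tau0 + h) f z - shift tau0 f z) / h - shift tau0 (C_derive f) z)%C (Cmod h / (PI * (l * l * l)))); auto|].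
    + apply Rdiv_le_0_compat. lra. apply Rmult_lt_0_compat; [lra|]. apply Rmult_lt_0_compat; [nra|lra].
    + intros z Hz. assert (Nh : h <> 0) by (apply Cmod_gt_0; lra). 
      apply (continuous_Cminus (fun z => (shift (tau0 + h) f z - shift tau0 f z) / h)%C (shift tau0 (C_derive f))); auto.
      apply (continuous_Cdiv (fun z => shift (tau0 + h) f z - shift tau0 f z)%C (fun _ => h)); auto.
      apply (continuous_Cminus (shift (tau0 + h) f) (shift tau0 f)); auto.
      apply Cf; auto. apply Hsec. unfold l in *; lra. apply continuous_const.
    + unfold C0. replace (Cmod h / (PI * (l * l * l)) * (8 * l * (M * B))) with (8 * M / (PI * (l * l)) * Cmod h * B) by (field; lra).
      apply Rmult_le_compat_r; auto. apply Rmult_le_compat_r; lra.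
Qed.

End SectorFunctions.

(** * Subharmonicity of the square root of the modulus *)

Lemma is_derive_congr (f g : R -> R) (t l l' : R) :
  is_derive f t l -> (forall s, f s = g s) -> l = l' -> is_derive g t l'.
Proof. intros H E <-. apply (is_derive_ext f g t l E H). Qed.

Lemma cderiv_partials (H : C -> C) (x y : R) (l : C) : cderiv H (x, y) l ->
  is_derive (fun t => Re (H (t, y))) x (Re l) /\ is_derive (fun t => Im (H (t, y))) x (Im l) /\
  is_derive (fun t => Re (H (x, t))) y (- Im l) /\ is_derive (fun t => Im (H (x, t))) y (Re l).
Proof.
  intros HD.
  assert (E1 : forall t : R, ((0, y) + t * 1)%C = (t, y)) by (intros; apply C_eq; simpl; ring).
  assert (E2 : forall t : R, ((x, 0) + t * Ci)%C = (x, t)) by (intros; apply C_eq; simpl; ring).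
  destruct (is_derive_along_line H l (0, y) 1 x) as [A1 A2]. rewrite E1; auto.
  destruct (is_derive_along_line H l (x, 0) Ci y) as [A3 A4]. rewrite E2; auto.
  split; [|split; [|split]].
  - apply (is_derive_congr _ _ _ _ _ A1). intros; rewrite E1; auto. simpl; unfold Re; ring.
  - apply (is_derive_congr _ _ _ _ _ A2). intros; rewrite E1; auto. simpl; unfold Im; ring.
  - apply (is_derive_congr _ _ _ _ _ A3). intros; rewrite E2; auto. simpl; unfold Re, Im; ring.
  - apply (is_derive_congr _ _ _ _ _ A4). intros; rewrite E2; auto. simpl; unfold Re, Im; ring.
Qed.

(** The regularised root (|H|^2 + e)^(1/4) of H = a + i b; a positive [e] makes it smooth across
    zeros of H. *)
Definition root4 (e a b : R) : R := sqrt (sqrt (a * a + b * b + e)).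

Lemma root4_pos e a b : 0 < e -> 0 < root4 e a b.
Proof. intros. apply sqrt_lt_R0, sqrt_lt_R0. nra. Qed.

Lemma root4_pow e a b : 0 < e -> root4 e a b ^ 4 = a * a + b * b + e.
Proof.
  intros. unfold root4. replace 4%nat with (2 * 2)%nat by reflexivity.
  rewrite pow_mult. rewrite pow2_sqrt by apply sqrt_pos. apply pow2_sqrt. nra.
Qed.

Lemma is_derive_root4 e (a b : R -> R) (t a' b' : R) : 0 < e -> is_derive a t a' -> is_derive b t b' ->
  is_derive (fun t => root4 e (a t) (b t)) t ((a t * a' + b t * b') / (2 * root4 e (a t) (b t) ^ 3)).
Proof.
  intros He Ha Hb.
  assert (P : 0 < a t * a t + b t * b t + e) by nra.
  assert (P2 := sqrt_lt_R0 _ P). assert (P3 := sqrt_lt_R0 _ P2).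
  unfold root4. auto_derive.
  - repeat split; try (eexists; eassumption); auto.
  - rewrite (is_derive_unique (fun t : R => a t) _ _ Ha), (is_derive_unique (fun t : R => b t) _ _ Hb).
    set (n := a t * a t + b t * b t + e) in *.
    assert (E : sqrt n = sqrt (sqrt n) * sqrt (sqrt n)) by (symmetry; apply sqrt_sqrt; lra).
    set (r := sqrt (sqrt n)) in *. rewrite E. field. lra.
Qed.

(** First and, below, second derivative of the regularised root along a curve, in terms of those of
    the two components. *)
Definition root4_D (e a b a' b' : R) : R := (a * a' + b * b') / (2 * root4 e a b ^ 3).
Definition root4_D2 (e a b a' b' a'' b'' : R) : R :=
  (a' * a' + b' * b' + a * a'' + b * b'') / (2 * root4 e a b ^ 3)
  - 3 * (a * a' + b * b') ^ 2 / (4 * root4 e a b ^ 7).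

Lemma is_derive_root4_D e (a b da db : R -> R) (t a'' b'' : R) : 0 < e ->
  is_derive a t (da t) -> is_derive b t (db t) -> is_derive da t a'' -> is_derive db t b'' ->
  is_derive (fun t => root4_D e (a t) (b t) (da t) (db t)) t (root4_D2 e (a t) (b t) (da t) (db t) a'' b'').
Proof.
  intros He Ha Hb Hda Hdb.
  assert (P := root4_pos e (a t) (b t) He).
  assert (HV := is_derive_root4 e a b t _ _ He Ha Hb).
  unfold root4_D, root4_D2.
  set (V := fun t => root4 e (a t) (b t)) in *.
  change (is_derive (fun t => (a t * da t + b t * db t) / (2 * V t ^ 3)) t
    ((da t * da t + db t * db t + a t * a'' + b t * b'') / (2 * V t ^ 3) - 3 * (a t * da t + b t * db t) ^ 2 / (4 * V t ^ 7))).
  change (0 < V t) in P.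
  auto_derive.
  - repeat split; try (eexists; eassumption). generalize (pow_lt _ 3 P). simpl. lra.
  - rewrite (is_derive_unique (fun t : R => a t) _ _ Ha), (is_derive_unique (fun t : R => b t) _ _ Hb),
      (is_derive_unique (fun t : R => da t) _ _ Hda), (is_derive_unique (fun t : R => db t) _ _ Hdb),
      (is_derive_unique (fun t : R => V t) _ _ HV).
    change (root4 e (a t) (b t)) with (V t). field. lra.
Qed.

(* The Laplacian of [(|H|^2 + e)^(1/4)] for holomorphic [H], with [H' = p + iq] and [H'' = P + iQ]. *)
Lemma root4_laplacian e u v p q P Q : 0 < e ->
  0 <= root4_D2 e u v p q P Q + root4_D2 e u v (- q) p (- P) (- Q).
Proof.
  intros He. unfold root4_D2.
  assert (HP := root4_pos e u v He). assert (H4 := root4_pow e u v He).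
  set (r := root4 e u v) in *.
  replace ((p * p + q * q + u * P + v * Q) / (2 * r ^ 3) - 3 * (u * p + v * q) ^ 2 / (4 * r ^ 7) +
    ((- q * - q + p * p + u * - P + v * - Q) / (2 * r ^ 3) - 3 * (u * - q + v * p) ^ 2 / (4 * r ^ 7)))
  with ((p * p + q * q) * (4 * r ^ 4 - 3 * (u * u + v * v)) / (4 * r ^ 7)) by (field; lra).
  rewrite H4. apply Rdiv_le_0_compat.
  - apply Rmult_le_pos; nra.
  - generalize (pow_lt r 7 HP). lra.
Qed.

Lemma continuous_root4 {X : UniformSpace} e (a b : X -> R) x : continuous a x -> continuous b x ->
  continuous (fun t => root4 e (a t) (b t)) x.
Proof. intros. unfold root4. cont; auto. Qed.

Lemma continuous_root4_D {X : UniformSpace} e (a b a' b' : X -> R) x : 0 < e -> continuous a x -> continuous b x ->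
  continuous a' x -> continuous b' x -> continuous (fun t => root4_D e (a t) (b t) (a' t) (b' t)) x.
Proof.
  intros He Ha Hb Ha' Hb'. generalize (pow_lt _ 3 (root4_pos e (a x) (b x) He)); intros HP. unfold root4_D.
  cont; auto. apply continuous_root4; auto. lra.
Qed.

Lemma continuous_root4_D2 {X : UniformSpace} e (a b a' b' a'' b'' : X -> R) x : 0 < e -> continuous a x -> continuous b x ->
  continuous a' x -> continuous b' x -> continuous a'' x -> continuous b'' x ->
  continuous (fun t => root4_D2 e (a t) (b t) (a' t) (b' t) (a'' t) (b'' t)) x.
Proof.
  intros He Ha Hb Ha' Hb' Ha'' Hb''.
  generalize (pow_lt _ 3 (root4_pos e (a x) (b x) He)) (pow_lt _ 7 (root4_pos e (a x) (b x) He)); intros HP HP7. unfold root4_D2.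
  cont; auto; try (apply continuous_root4; auto); lra.
Qed.

Lemma is_derive_RInt_2d (f df : R -> R -> R) c d x r : 0 < r -> c <= d ->
  (forall u y, Rabs (u - x) < r -> c <= y <= d -> is_derive (fun t => f t y) u (df u y)) ->
  (forall u y, Rabs (u - x) < r -> continuity_2d_pt df u y) ->
  (forall u y, Rabs (u - x) < r -> continuity_2d_pt f u y) ->
  (forall u y, Rabs (u - x) < r -> is_derive (fun t => f t y) u (df u y)) ->
  is_derive (fun u => RInt (fun y => f u y) c d) x (RInt (fun y => df x y) c d).
Proof.
  intros Hr Hcd Hd Hdf Hf Hd'.
  assert (Hx : Rabs (x - x) < r) by (rewrite Rminus_diag, Rabs_R0; auto).
  rewrite (RInt_eq (fun y => df x y) (fun y => Derive (fun t => f t y) x)); auto.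
  2:{ intros y Hy. symmetry. apply is_derive_unique, Hd; auto. }
  apply is_derive_RInt_param.
  - exists (mkposreal r Hr). intros u Hu y Hy. eexists. apply Hd'. exact Hu.
  - intros y Hy. apply (continuity_2d_pt_ext_loc df).
    + exists (mkposreal r Hr). intros u v Hu Hv. symmetry. apply is_derive_unique, Hd'. exact Hu.
    + apply Hdf; auto.
  - exists (mkposreal r Hr). intros u Hu. apply ex_RInt_cont; auto. intros y Hy.
    apply (continuous_comp_2 (fun _ : R => u) (fun t : R => t) f). apply continuous_const. apply continuous_id.
    apply continuous_2d, Hf. exact Hu.
Qed.

Lemma sqrt_plus_le a b : 0 <= a -> 0 <= b -> sqrt (a + b) <= sqrt a + sqrt b.
Proof.
  intros Ha Hb. apply Rsqr_incr_0_var.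
  - unfold Rsqr. rewrite sqrt_sqrt by lra.
    generalize (sqrt_sqrt a Ha) (sqrt_sqrt b Hb) (sqrt_pos a) (sqrt_pos b). nra.
  - generalize (sqrt_pos a) (sqrt_pos b). lra.
Qed.

(** Subadditivity of the square root, used twice: regularising with e^4 costs at most e, uniformly
    in z. *)
Lemma root4_Cmod e (z : C) : 0 <= e ->
  sqrt (Cmod z) <= root4 (e ^ 4) (Re z) (Im z) <= sqrt (Cmod z) + e.
Proof.
  intros He.
  assert (E : Cmod z = sqrt (Re z * Re z + Im z * Im z)).
  { unfold Cmod. f_equal. unfold Re, Im. ring. }
  assert (He4 : 0 <= e ^ 4) by (apply pow_le; auto).
  assert (P : 0 <= Re z * Re z + Im z * Im z) by nra.
  unfold root4. split.
  - rewrite E. apply sqrt_le_1_alt, sqrt_le_1_alt. lra.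
  - apply Rle_trans with (sqrt (Cmod z + e ^ 2)).
    + apply sqrt_le_1_alt. rewrite E. eapply Rle_trans; [apply sqrt_plus_le; auto|].
      replace (e ^ 4) with (e ^ 2 * e ^ 2) by ring. rewrite sqrt_square by (apply pow_le; auto). lra.
    + eapply Rle_trans; [apply sqrt_plus_le; [apply Cmod_ge_0|apply pow_le; auto]|].
      replace (e ^ 2) with (e * e) by ring. rewrite sqrt_square by auto. lra.
Qed.

(** * Circular means of the regularised root are monotone in the radius *)

Section CircleMean.

Variables (F : C -> C) (rho : R).
Hypotheses (Hrho : 0 < rho) (HF : forall w, Cmod w < rho -> holo F w).

(** [F] in logarithmic polar coordinates, followed by its first two derivatives: circles about 0
    become vertical segments, and the angular variable makes everything periodic. *)
Let H (z : C) : C := F (Cexp z).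
Let H1 (z : C) : C := (C_derive F (Cexp z) * Cexp z)%C.
Let H2 (z : C) : C := ((C_derive (C_derive F) (Cexp z) * Cexp z) * Cexp z + C_derive F (Cexp z) * Cexp z)%C.

Lemma holo_disc_derive (G : C -> C) : (forall w, Cmod w < rho -> holo G w) -> forall w, Cmod w < rho -> holo (C_derive G) w.
Proof.
  intros HG w Hw. apply (holo_C_derive G w (rho - Cmod w)). lra.
  intros w' Hw'. apply HG. replace w' with ((w' - w) + w)%C by ring.
  eapply Rle_lt_trans; [apply Cmod_triangle|]. lra.
Qed.

Lemma disc_mod x y : x < ln rho -> Cmod (Cexp (x, y)) < rho.
Proof. intros Hx. rewrite Cmod_Cexp. simpl. rewrite <- (exp_ln rho) by auto. apply exp_increasing; auto. Qed.

Lemma cderiv_H x y : x < ln rho -> cderiv H (x, y) (H1 (x, y)).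
Proof.
  intros Hx. apply (is_derive_Ccomp F Cexp). apply C_derive_holo, HF, disc_mod; auto. apply cderiv_Cexp.
Qed.

Lemma cderiv_H1 x y : x < ln rho -> cderiv H1 (x, y) (H2 (x, y)).
Proof.
  intros Hx. unfold H1, H2. apply (is_derive_Cmult (fun z => C_derive F (Cexp z)) Cexp).
  - apply (is_derive_Ccomp (C_derive F) Cexp). apply C_derive_holo. apply holo_disc_derive; auto. apply disc_mod; auto. apply cderiv_Cexp.
  - apply cderiv_Cexp.
Qed.

Lemma continuous_H2 x y : x < ln rho -> continuous H2 (x, y).
Proof.
  intros Hx. unfold H2.
  assert (CE : continuous Cexp (x, y)) by (eapply is_derive_C_continuous, cderiv_Cexp).
  assert (CE1 : continuous (fun z => C_derive F (Cexp z)) (x, y)).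
  { apply (continuous_Ccomp (C_derive F) Cexp); auto. apply ex_derive_C_continuous, holo_disc_derive; auto. apply disc_mod; auto. }
  assert (CE2 : continuous (fun z => C_derive (C_derive F) (Cexp z)) (x, y)).
  { apply (continuous_Ccomp (C_derive (C_derive F)) Cexp); auto. apply ex_derive_C_continuous. 
    apply holo_disc_derive. apply holo_disc_derive; auto. apply disc_mod; auto. }
  cont; auto.
Qed.

Variable e : R.
Hypothesis He : 0 < e.

Let V x y := root4 e (Re (H (x, y))) (Im (H (x, y))).
Let Vx x y := root4_D e (Re (H (x, y))) (Im (H (x, y))) (Re (H1 (x, y))) (Im (H1 (x, y))).
Let Vxx x y := root4_D2 e (Re (H (x, y))) (Im (H (x, y))) (Re (H1 (x, y))) (Im (H1 (x, y))) (Re (H2 (x, y))) (Im (H2 (x, y))).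
Let Vy x y := root4_D e (Re (H (x, y))) (Im (H (x, y))) (- Im (H1 (x, y))) (Re (H1 (x, y))).
Let Vyy x y := root4_D2 e (Re (H (x, y))) (Im (H (x, y))) (- Im (H1 (x, y))) (Re (H1 (x, y))) (- Re (H2 (x, y))) (- Im (H2 (x, y))).

Lemma cont_HHH x y : x < ln rho -> continuous H (x, y) /\ continuous H1 (x, y) /\ continuous H2 (x, y).
Proof.
  intros Hx. split; [|split].
  - eapply is_derive_C_continuous, cderiv_H; auto.
  - eapply is_derive_C_continuous, cderiv_H1; auto.
  - apply continuous_H2; auto.
Qed.

Lemma C_pair_eta (p : R * R) : ((fst p, snd p) : C) = p.
Proof. destruct p; reflexivity. Qed.

Lemma continuous_pt2 (G : C -> C) (g : C -> R) x y :
  (continuous G (x, y) -> continuous (fun z => g (G z)) (x, y)) -> continuous G (x, y) ->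
  continuous (fun p : R * R => g (G (fst p, snd p))) (x, y).
Proof.
  intros Hg HG. apply (continuous_ext (fun z => g (G z))). intros p. rewrite C_pair_eta. reflexivity. auto.
Qed.

Lemma cont_V x y : x < ln rho -> continuity_2d_pt V x y /\ continuity_2d_pt Vx x y /\ continuity_2d_pt Vxx x y /\ continuity_2d_pt Vyy x y.
Proof.
  intros Hx. destruct (cont_HHH x y Hx) as (C0 & C1 & C2).
  assert (R0 : continuous (fun p : R * R => Re (H (fst p, snd p))) (x, y)) by (apply continuous_pt2; auto; apply continuous_Re).
  assert (I0 : continuous (fun p : R * R => Im (H (fst p, snd p))) (x, y)) by (apply continuous_pt2; auto; apply continuous_Im).
  assert (R1 : continuous (fun p : R * R => Re (H1 (fst p, snd p))) (x, y)) by (apply continuous_pt2; auto; apply continuous_Re).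
  assert (I1 : continuous (fun p : R * R => Im (H1 (fst p, snd p))) (x, y)) by (apply continuous_pt2; auto; apply continuous_Im).
  assert (R2 : continuous (fun p : R * R => Re (H2 (fst p, snd p))) (x, y)) by (apply continuous_pt2; auto; apply continuous_Re).
  assert (I2 : continuous (fun p : R * R => Im (H2 (fst p, snd p))) (x, y)) by (apply continuous_pt2; auto; apply continuous_Im).
  split; [|split; [|split]]; apply continuous_2d.
  - apply continuous_root4; auto.
  - apply continuous_root4_D; auto.
  - apply continuous_root4_D2; auto.
  - apply continuous_root4_D2; auto; apply continuous_Ropp; auto.
Qed.

Lemma deriv_Vx x y : x < ln rho -> is_derive (fun t => V t y) x (Vx x y).
Proof.
  intros Hx. destruct (cderiv_partials H x y _ (cderiv_H x y Hx)) as (A & B & _).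
  apply is_derive_root4; auto.
Qed.

Lemma deriv_Vxx x y : x < ln rho -> is_derive (fun t => Vx t y) x (Vxx x y).
Proof.
  intros Hx. destruct (cderiv_partials H x y _ (cderiv_H x y Hx)) as (A & B & _).
  destruct (cderiv_partials H1 x y _ (cderiv_H1 x y Hx)) as (A1 & B1 & _).
  apply (is_derive_root4_D e (fun t => Re (H (t, y))) (fun t => Im (H (t, y))) (fun t => Re (H1 (t, y))) (fun t => Im (H1 (t, y)))); auto.
Qed.

Lemma deriv_Vyy x y : x < ln rho -> is_derive (fun t => Vy x t) y (Vyy x y).
Proof.
  intros Hx. destruct (cderiv_partials H x y _ (cderiv_H x y Hx)) as (_ & _ & A & B).
  destruct (cderiv_partials H1 x y _ (cderiv_H1 x y Hx)) as (_ & _ & A1 & B1).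
  apply (is_derive_root4_D e (fun t => Re (H (x, t))) (fun t => Im (H (x, t))) (fun t => - Im (H1 (x, t))) (fun t => Re (H1 (x, t)))); auto.
  apply (is_derive_opp (V := R_NormedModule) (fun t => Im (H1 (x, t)))); auto.
Qed.

Let M (x : R) : R := RInt (fun y => V x y) 0 (2 * PI).
Let M1 (x : R) : R := RInt (fun y => Vx x y) 0 (2 * PI).
Let M2 (x : R) : R := RInt (fun y => Vxx x y) 0 (2 * PI).

Lemma two_PI_pos : 0 < 2 * PI.
Proof. generalize PI_RGT_0; lra. Qed.

Lemma near_lt x u : Rabs (u - x) < ln rho - x -> u < ln rho.
Proof. intros Hu. apply Rabs_def2 in Hu. lra. Qed.

Lemma deriv_M x : x < ln rho -> is_derive M x (M1 x).
Proof.
  intros Hx. unfold M, M1. apply (is_derive_RInt_2d V Vx 0 (2 * PI) x (ln rho - x)). lra. generalize two_PI_pos; lra.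
  all: intros u y Hu; try intros _; apply near_lt in Hu.
  apply deriv_Vx; auto. apply cont_V; auto. apply cont_V; auto. apply deriv_Vx; auto.
Qed.

Lemma deriv_M1 x : x < ln rho -> is_derive M1 x (M2 x).
Proof.
  intros Hx. unfold M1, M2. apply (is_derive_RInt_2d Vx Vxx 0 (2 * PI) x (ln rho - x)). lra. generalize two_PI_pos; lra.
  all: intros u y Hu; try intros _; apply near_lt in Hu.
  apply deriv_Vxx; auto. apply cont_V; auto. apply cont_V; auto. apply deriv_Vxx; auto.
Qed.

Lemma slice_y (f : R -> R -> R) x y : continuity_2d_pt f x y -> continuous (fun t => f x t) y.
Proof.
  intros Hf. apply (continuous_comp_2 (fun _ : R => x) (fun t : R => t) f). apply continuous_const. apply continuous_id.
  apply continuous_2d, Hf.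
Qed.

(** The second derivative in the angle integrates to 0 over a period, so the second derivative of
    the mean is the integral of the Laplacian. *)
Lemma M2_pos x : x < ln rho -> 0 <= M2 x.
Proof.
  intros Hx. assert (HPI := two_PI_pos).
  assert (X1 : ex_RInt (fun y => Vxx x y) 0 (2 * PI)).
  { apply ex_RInt_cont; [lra|]. intros t _. apply slice_y, cont_V; auto. }
  assert (X2 : ex_RInt (fun y => Vyy x y) 0 (2 * PI)).
  { apply ex_RInt_cont; [lra|]. intros t _. apply slice_y, cont_V; auto. }
  assert (Z : RInt (fun y => Vyy x y) 0 (2 * PI) = 0 :> R).
  { rewrite (RInt_FTC (fun t => Vy x t)); try lra.
    - unfold Vy, H, H1. replace (Cexp (x, 2 * PI)) with (Cexp (x, 0)). ring.
      rewrite !Cexp_polar. unfold polar. rewrite cos_2PI, sin_2PI, cos_0, sin_0. reflexivity.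
    - intros t _. apply deriv_Vyy; auto.
    - intros t _. apply slice_y, cont_V; auto. }
  unfold M2. replace (RInt (fun y => Vxx x y) 0 (2 * PI)) with (RInt (fun y => Vxx x y + Vyy x y) 0 (2 * PI)).
  - apply RInt_pos. lra. apply ex_RInt_Rplus; auto. intros t _. apply root4_laplacian; auto.
  - rewrite (RInt_Rplus (fun y => Vxx x y) (fun y => Vyy x y)) by auto. rewrite Z. apply Rplus_0_r.
Qed.

Lemma mono_of_deriv (f df : R -> R) a b : a <= b -> (forall t, a <= t <= b -> is_derive f t (df t)) ->
  (forall t, a <= t <= b -> 0 <= df t) -> f a <= f b.
Proof.
  intros Hab Hd Hp. destruct (Rle_lt_or_eq_dec _ _ Hab) as [Hlt|<-]; [|lra].
  destruct (MVT_gen f a b df) as (c & Hc & E).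
  - intros t. rewrite Rmin_left, Rmax_right by lra. intros; apply Hd; lra.
  - intros t. rewrite Rmin_left, Rmax_right by lra. intros. apply continuity_pt_filterlim.
    apply (ex_derive_continuous (V := R_NormedModule)). eexists. apply Hd; lra.
  - rewrite Rmin_left, Rmax_right in Hc by lra. assert (0 <= df c * (b - a)) by (apply Rmult_le_pos; [apply Hp; lra|lra]). lra.
Qed.

Lemma M_bounded : exists x0 B, x0 < ln rho /\ forall x, x <= x0 -> M x <= B.
Proof.
  assert (C0 : continuous F (RtoC 0)) by (apply ex_derive_C_continuous, HF; rewrite Cmod_0; auto).
  destruct (proj1 (continuous_C_eps _ _) C0 1 Rlt_0_1) as (d & Hd & HD).
  set (d' := Rmin d rho / 2).
  assert (Hd' : 0 < d' /\ d' < d /\ d' < rho).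
  { unfold d'. assert (0 < Rmin d rho) by (apply Rmin_pos; auto). generalize (Rmin_l d rho) (Rmin_r d rho). lra. }
  set (K := Cmod (F 0) + 1).
  exists (ln d'), (2 * PI * root4 e (K * 2) (K * 2)). split. apply ln_increasing; lra.
  intros x Hx. assert (HPI := two_PI_pos).
  assert (Hxr : x < ln rho) by (apply Rle_lt_trans with (1 := Hx), ln_increasing; lra).
  replace (2 * PI) with (2 * PI - 0) at 1 by ring. rewrite <- RInt_Rconst.
  apply RInt_mono. lra.
  - apply ex_RInt_cont; [lra|]. intros t _. apply slice_y, cont_V; auto.
  - apply ex_RInt_const.
  - intros t _. unfold V, root4. apply sqrt_le_1_alt, sqrt_le_1_alt.
    assert (Hm : Cmod (H (x, t)) <= K).
    { unfold H. specialize (HD (Cexp (x, t))).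
      assert (Q : Cmod (F (Cexp (x, t)) - F 0) < 1).
      { apply HD. replace (Cexp (x, t) - 0)%C with (Cexp (x, t)) by ring. rewrite Cmod_Cexp. simpl.
        apply Rle_lt_trans with d'; [|lra]. rewrite <- (exp_ln d') by lra. apply exp_le_exp; auto. }
      generalize (Cmod_sub_ge (F (Cexp (x, t))) (F 0)). unfold K. lra. }
    destruct (Cmod_Rabs (H (x, t))) as [Q1 Q2].
    assert (HK : 0 <= K) by (unfold K; generalize (Cmod_ge_0 (F 0)); lra).
    assert (S1 : Re (H (x, t)) * Re (H (x, t)) <= K * K).
    { apply (Rsqr_le_abs_1 (Re (H (x, t))) K). rewrite (Rabs_pos_eq K HK). exact (Rle_trans _ _ _ Q1 Hm). }
    assert (S2 : Im (H (x, t)) * Im (H (x, t)) <= K * K).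
    { apply (Rsqr_le_abs_1 (Im (H (x, t))) K). rewrite (Rabs_pos_eq K HK). exact (Rle_trans _ _ _ Q2 Hm). }
    nra.
Qed.

(** The mean is convex in the logarithm of the radius and bounded as the radius tends to 0; a
    negative slope at [x] would make it grow linearly to the left. *)
Lemma M1_pos x : x < ln rho -> 0 <= M1 x.
Proof.
  intros Hx. apply Rnot_lt_le. intros Hneg.
  destruct M_bounded as (x0 & B & Hx0 & HB).
  assert (Hmono : forall y, y <= x -> M1 y <= M1 x).
  { intros y Hy. apply (mono_of_deriv M1 M2); auto; intros t Ht; [apply deriv_M1|apply M2_pos]; lra. }
  set (c := - M1 x) in *. assert (Hc : 0 < c) by (unfold c; lra).
  set (y := Rmin (Rmin x x0) (x - (B - M x + 1) / c)).
  assert (Hy1 : y <= x) by (eapply Rle_trans; [apply Rmin_l|apply Rmin_l]).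
  assert (Hy2 : y <= x0) by (eapply Rle_trans; [apply Rmin_l|apply Rmin_r]).
  assert (Hy3 : y <= x - (B - M x + 1) / c) by apply Rmin_r.
  assert (G : M x + c * x <= M y + c * y).
  { assert (- (M y + c * y) <= - (M x + c * x)); [|lra].
    apply (mono_of_deriv (fun t => - (M t + c * t)) (fun t => - (M1 t + c))); auto.
    - intros t Ht. assert (HM := deriv_M t ltac:(lra)). auto_derive. eexists; eauto.
      rewrite (is_derive_unique (fun t : R => M t) _ _ HM). ring.
    - intros t Ht. generalize (Hmono t ltac:(lra)). unfold c. lra. }
  specialize (HB y Hy2).
  assert (K : B - M x + 1 <= c * (x - y)).
  { apply Rmult_le_reg_l with (/ c). apply Rinv_0_lt_compat; auto.
    rewrite <- Rmult_assoc, Rinv_l, Rmult_1_l by lra. unfold Rdiv in Hy3. lra. }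
  lra.
Qed.

Lemma M_mono x y : x <= y -> y < ln rho -> M x <= M y.
Proof.
  intros Hxy Hy. apply (mono_of_deriv M M1); auto; intros t Ht; [apply deriv_M|apply M1_pos]; lra.
Qed.

End CircleMean.

(** By monotonicity the mean at radius [r] dominates the one at a tiny radius [s], which by
    continuity is close to the value at the centre; then the regularisation is removed. *)
Lemma circle_submean (F : C -> C) rho r : 0 < r < rho -> (forall w, Cmod w < rho -> holo F w) ->
  2 * PI * sqrt (Cmod (F 0)) <= RInt (fun t => sqrt (Cmod (F (polar r t)))) 0 (2 * PI).
Proof.
  intros Hr HF. assert (HPI := two_PI_pos).
  assert (CF : forall s t, 0 < s < rho -> continuous (fun t => F (polar s t)) t).
  { intros s t Hs. apply continuous_ray, ex_derive_C_continuous, HF. rewrite Cmod_polar; lra. }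
  apply le_epsilon. intros d Hd.
  (* A loss of 2 pi e at each of the two radii adds up to [d]. The continuity tolerance is e^2,
     which becomes [e] under the root. *)
  set (e := d / (4 * PI)). assert (He : 0 < e) by (apply Rdiv_lt_0_compat; lra).
  assert (He4 : 0 < e ^ 4) by (apply pow_lt; auto).
  assert (C0 : continuous F (RtoC 0)) by (apply ex_derive_C_continuous, HF; rewrite Cmod_0; lra).
  destruct (proj1 (continuous_C_eps _ _) C0 (e * e)) as (k & Hk & HD). nra.
  set (s := Rmin r (k / 2)).
  assert (Hs : 0 < s /\ s <= r /\ s < k).
  { unfold s. split. apply Rmin_pos; lra. generalize (Rmin_l r (k / 2)) (Rmin_r r (k / 2)). lra. }
  assert (Hmono := M_mono F rho ltac:(lra) HF (e ^ 4) He4 (ln s) (ln r)).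
  assert (L1 : ln s <= ln r) by (destruct (Rle_lt_or_eq_dec s r) as [K| ->]; [lra|left; apply ln_increasing; lra|lra]).
  specialize (Hmono L1 ltac:(apply ln_increasing; lra)). cbv beta in Hmono.
  assert (CR : forall s t, 0 < s < rho -> continuous (fun t => root4 (e ^ 4) (Re (F (polar s t))) (Im (F (polar s t)))) t).
  { intros. apply continuous_root4; cont; apply CF; auto. }
  rewrite (RInt_eq _ (fun t => root4 (e ^ 4) (Re (F (polar s t))) (Im (F (polar s t))))) in Hmono by
    (try lra; intros t _; rewrite Cexp_polar, exp_ln by lra; reflexivity).
  rewrite (RInt_eq (fun y => root4 (e ^ 4) (Re (F (Cexp (ln r, y)))) (Im (F (Cexp (ln r, y)))))
     (fun t => root4 (e ^ 4) (Re (F (polar r t))) (Im (F (polar r t))))) in Hmono by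
    (try lra; intros t _; rewrite Cexp_polar, exp_ln by lra; reflexivity).
  assert (LOW : 2 * PI * (sqrt (Cmod (F 0)) - e) <= RInt (fun t => root4 (e ^ 4) (Re (F (polar s t))) (Im (F (polar s t)))) 0 (2 * PI)).
  { replace (2 * PI) with (2 * PI - 0) at 1 by ring. rewrite <- RInt_Rconst.
    apply RInt_mono. lra. apply ex_RInt_const. apply ex_RInt_cont; [lra|]. intros; apply CR; lra.
    intros t _. eapply Rle_trans; [|apply (root4_Cmod e); lra].
    assert (Q : Cmod (F 0) <= Cmod (F (polar s t)) + e * e).
    { specialize (HD (polar s t)). replace (polar s t - 0)%C with (polar s t) in HD by ring. rewrite Cmod_polar in HD by lra.
      generalize (HD ltac:(lra)) (Cmod_sub_ge (F 0) (F (polar s t))).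
      replace (F 0 - F (polar s t))%C with (- (F (polar s t) - F 0))%C by ring. rewrite Cmod_opp. lra. }
    assert (Q2 : sqrt (Cmod (F 0)) <= sqrt (Cmod (F (polar s t))) + e); [|lra].
    eapply Rle_trans; [apply sqrt_le_1_alt; exact Q|].
    eapply Rle_trans; [apply sqrt_plus_le; [apply Cmod_ge_0|nra]|]. rewrite sqrt_square; lra. }
  assert (UP : RInt (fun t => root4 (e ^ 4) (Re (F (polar r t))) (Im (F (polar r t)))) 0 (2 * PI) <=
     RInt (fun t => sqrt (Cmod (F (polar r t)))) 0 (2 * PI) + 2 * PI * e).
  { assert (X : ex_RInt (fun t => sqrt (Cmod (F (polar r t)))) 0 (2 * PI)) by (apply ex_RInt_cont; [lra|]; intros; cont; apply CF; lra).
    replace (2 * PI * e) with ((2 * PI - 0) * e) by ring. rewrite <- RInt_Rconst.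
    rewrite <- RInt_Rplus; auto; [|apply ex_RInt_const].
    apply RInt_mono. lra. apply ex_RInt_cont; [lra|]. intros; apply CR; lra.
    apply ex_RInt_Rplus; auto; apply ex_RInt_const.
    intros t _. apply root4_Cmod; lra. }
  assert (E : 4 * PI * e = d) by (unfold e; field; lra).
  lra.
Qed.

(** * The mean value inequality on a strip *)

Section Strip.

Variables (h : C -> C) (b b' K : R).
Hypotheses (Hb : 0 < b < b') (Hh : forall w, Rabs (Im w) < b' -> holo h w).
Hypothesis HK : forall w, Rabs (Im w) <= b -> Cmod (h w) <= K.

Definition cayley (z : C) : C := ((1 + z) / (1 - z))%C.

(* The conformal map of the unit disc onto the strip [|Im w| < b]. *)
Definition strip_map (z : C) : C := ((2 * b / PI)%R * Clog (cayley z))%C.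

Lemma one_minus_neq_0 (z : C) : Cmod z < 1 -> (1 - z)%C <> 0.
Proof.
  intros Hz. apply Cmod_gt_0. generalize (Cmod_sub_ge 1 z). rewrite Cmod_1. lra.
Qed.

Lemma cayley_Re (z : C) : Cmod z < 1 -> 0 < fst (cayley z).
Proof.
  intros Hz. assert (N := one_minus_neq_0 z Hz).
  assert (P : fst (1 - z)%C ^ 2 + snd (1 - z)%C ^ 2 <> 0) by (apply Csqr_norm_neq_0; auto).
  destruct z as [x y]. simpl in P.
  assert (Hz2 : x * x + y * y < 1).
  { assert (Q : Cmod (x, y) ^ 2 < 1 ^ 2) by (generalize (Cmod_ge_0 (x, y)); nra).
    rewrite Cmod2_alt in Q. simpl in Q. lra. }
  unfold cayley; simpl.
  set (D := (1 + - x) * ((1 + - x) * 1) + (0 + - y) * ((0 + - y) * 1)) in *.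
  assert (HD : 0 < D). { assert (0 <= D) by (unfold D; nra). unfold D in *; lra. }
  replace ((1 + x) * ((1 + - x) / D) - (0 + y) * (- (0 + - y) / D)) with ((1 - (x * x + y * y)) / D) by (field; lra).
  apply Rdiv_lt_0_compat; lra.
Qed.

Lemma strip_map_Im (z : C) : Rabs (Im (strip_map z)) < b.
Proof.
  assert (HPI := PI_RGT_0).
  unfold strip_map. rewrite im_scal_l. unfold Clog. cbn [Im snd].
  assert (A := atan_bound (snd (cayley z) / fst (cayley z))).
  set (a := atan (snd (cayley z) / fst (cayley z))) in *.
  rewrite Rabs_mult, Rabs_pos_eq by (apply Rdiv_le_0_compat; lra).
  apply Rlt_le_trans with (2 * b / PI * (PI / 2)).
  - apply Rmult_lt_compat_l. apply Rdiv_lt_0_compat; lra. apply Rabs_def1; lra.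
  - right; field; lra.
Qed.

Lemma holo_strip_map (z : C) : Cmod z < 1 -> holo strip_map z.
Proof.
  intros Hz. unfold strip_map. Holo.
  apply (holo_comp Clog cayley). eexists. apply cderiv_Clog, cayley_Re; auto.
  unfold cayley. Holo. apply one_minus_neq_0; auto.
Qed.

Lemma strip_map_0 : strip_map 0 = 0.
Proof.
  unfold strip_map, Clog, cayley. apply C_eq; simpl.
  - replace ((1 + 0) * ((1 + - 0) / ((1 + - 0) * ((1 + - 0) * 1) + (0 + - 0) * ((0 + - 0) * 1))) -
     (0 + 0) * (- (0 + - 0) / ((1 + - 0) * ((1 + - 0) * 1) + (0 + - 0) * ((0 + - 0) * 1)))) with 1 by field.
    match goal with |- _ * (ln (1 * 1 + ?a * ?a) / 2) - _ = _ => replace a with 0 by field end.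
    replace (1 * 1 + 0 * 0) with 1 by ring. rewrite ln_1. field. apply PI_neq0.
  - match goal with |- _ * atan (?a / ?d) + _ = _ => replace a with 0 by field end.
    unfold Rdiv at 2. rewrite Rmult_0_l, atan_0. field. apply PI_neq0.
Qed.

(** The image of the upper half of the circle of radius [r] under [strip_map]. The arctangent of the
    reciprocal is used so that the formula stays continuous up to r = 1, where the Cayley transform
    reaches the imaginary axis. *)
Definition strip_curve (r th : R) : C :=
  (b / PI * ln ((1 + 2 * r * cos th + r * r) / (1 - 2 * r * cos th + r * r)),
   2 * b / PI * (PI / 2 - atan ((1 - r * r) / (2 * r * sin th)))).

Lemma strip_denom r th : 0 < r -> 0 < sin th -> 0 < 1 - 2 * r * cos th + r * r /\ 0 < 1 + 2 * r * cos th + r * r.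
Proof.
  intros Hr Hs. assert (Hc : -1 < cos th < 1).
  { generalize (sin2_cos2 th). unfold Rsqr. intros.
    assert (0 < sin th * sin th) by (apply Rmult_lt_0_compat; auto). split; nra. }
  assert (0 < r * (1 - cos th)) by (apply Rmult_lt_0_compat; lra).
  assert (0 < r * (1 + cos th)) by (apply Rmult_lt_0_compat; lra).
  generalize (Rle_0_sqr (1 - r)). unfold Rsqr. split; lra.
Qed.

Lemma cayley_polar r th : 0 < r < 1 -> 0 < sin th ->
  cayley (polar r th) = ((1 - r * r) / (1 - 2 * r * cos th + r * r), 2 * r * sin th / (1 - 2 * r * cos th + r * r)).
Proof.
  intros Hr Hs. destruct (strip_denom r th) as [D1 _]; try lra.
  assert (E := sin2_cos2 th). unfold Rsqr in E.
  unfold cayley, polar. set (c := cos th) in *. set (s := sin th) in *.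
  assert (ED : (1 + - (r * c)) * ((1 + - (r * c)) * 1) + (0 + - (r * s)) * ((0 + - (r * s)) * 1) = 1 - 2 * r * c + r * r).
  { replace (r * r) with (r * r * (s * s + c * c)) at 1 by (rewrite E; ring). ring. }
  apply C_eq; simpl; rewrite ED.
  - replace (1 - r * r) with (1 - r * r * (s * s + c * c)) by (rewrite E; ring). field. lra.
  - field. lra.
Qed.

Lemma strip_map_upper r th : 0 < r < 1 -> 0 < sin th -> strip_map (polar r th) = strip_curve r th.
Proof.
  intros Hr Hs. assert (HPI := PI_RGT_0). destruct (strip_denom r th) as [D1 D2]; try lra.
  unfold strip_map. rewrite cayley_polar by auto. unfold Clog, strip_curve. cbn [fst snd].
  assert (E := sin2_cos2 th). unfold Rsqr in E.
  set (c := cos th) in *. set (s := sin th) in *. set (D := 1 - 2 * r * c + r * r) in *.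
  replace ((1 - r * r) / D * ((1 - r * r) / D) + 2 * r * s / D * (2 * r * s / D)) with ((1 + 2 * r * c + r * r) / D).
  2:{ apply Rmult_eq_reg_r with (D * D); [|nra].
      replace ((1 + 2 * r * c + r * r) / D * (D * D)) with ((1 + 2 * r * c + r * r) * D) by (field; lra).
      replace (((1 - r * r) / D * ((1 - r * r) / D) + 2 * r * s / D * (2 * r * s / D)) * (D * D))
        with ((1 - r * r) * (1 - r * r) + 4 * (r * r) * (s * s)) by (field; lra).
      replace (s * s) with (1 - c * c) by lra. unfold D. ring. }
  replace (2 * r * s / D / ((1 - r * r) / D)) with (/ ((1 - r * r) / (2 * r * s))) by (field; repeat split; nra).
  rewrite atan_inv by (apply Rdiv_lt_0_compat; nra).
  apply C_eq; simpl; field; lra.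
Qed.

Lemma cayley_conj (z : C) : Cmod z < 1 -> cayley (Cconj z) = Cconj (cayley z).
Proof.
  intros Hz. unfold cayley. rewrite Cdiv_conj by (apply one_minus_neq_0; auto).
  f_equal; apply C_eq; simpl; ring.
Qed.

Lemma Clog_conj (z : C) : Clog (Cconj z) = Cconj (Clog z).
Proof.
  unfold Clog, Cconj; simpl. f_equal. f_equal. f_equal. ring.
  rewrite <- atan_opp. f_equal. unfold Rdiv. ring.
Qed.

Lemma strip_map_lower r th : 0 < r < 1 -> 0 < sin th -> strip_map (polar r (2 * PI - th)) = Cconj (strip_curve r th).
Proof.
  intros Hr Hs. rewrite <- strip_map_upper by auto.
  replace (polar r (2 * PI - th)) with (Cconj (polar r th)).
  - unfold strip_map. rewrite cayley_conj by (rewrite Cmod_polar; lra). rewrite Clog_conj.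
    apply C_eq; simpl; ring.
  - rewrite polar_conj. unfold polar. rewrite cos_minus, sin_minus, cos_2PI, sin_2PI, cos_neg, sin_neg. f_equal; ring.
Qed.

Lemma strip_curve_Im r th : 1 / 2 <= r <= 1 -> 0 < sin th -> 0 <= Im (strip_curve r th) <= b.
Proof.
  intros Hr Hs. assert (HPI := PI_RGT_0). unfold strip_curve; simpl.
  assert (A : 0 <= atan ((1 - r * r) / (2 * r * sin th)) < PI / 2).
  { split; [|apply atan_bound]. rewrite <- atan_0.
    assert (P : 0 <= (1 - r * r) / (2 * r * sin th)) by (apply Rdiv_le_0_compat; nra).
    destruct P as [P| <-]; [left; apply atan_increasing; auto|lra]. }
  set (a := atan ((1 - r * r) / (2 * r * sin th))) in *.
  assert (B : 0 < 2 * b / PI) by (apply Rdiv_lt_0_compat; lra).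
  split. apply Rmult_le_pos; lra.
  apply Rle_trans with (2 * b / PI * (PI / 2)). apply Rmult_le_compat_l; lra. right; field; lra.
Qed.

Definition strip_pair (r th : R) : R :=
  sqrt (Cmod (h (strip_curve r th))) + sqrt (Cmod (h (Cconj (strip_curve r th)))).

Lemma continuous_strip_pair r th : 1 / 2 <= r <= 1 -> 0 < sin th -> continuity_2d_pt strip_pair r th.
Proof.
  intros Hr Hs. destruct (strip_denom r th) as [D1 D2]; try lra.
  assert (HI := strip_curve_Im r th Hr Hs).
  assert (CC : continuous (fun p : R * R => strip_curve (fst p) (snd p)) (r, th)).
  { unfold strip_curve. apply continuous_C_pair.
    - cont. apply (continuous_Rcomp ln). cont; simpl; lra.
      simpl. apply continuity_pt_filterlim, derivable_continuous_pt. exists (/ ((1 + 2 * r * cos th + r * r) / (1 - 2 * r * cos th + r * r))).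
      apply derivable_pt_lim_ln. apply Rdiv_lt_0_compat; lra.
    - cont. apply (continuous_Rcomp atan). cont; simpl. nra. apply continuous_atan. }
  apply continuous_2d. unfold strip_pair. cont.
  - apply (continuous_Ccomp h (fun p : R * R => strip_curve (fst p) (snd p))); auto.
    apply ex_derive_C_continuous, Hh. simpl fst. simpl snd. rewrite Rabs_pos_eq by lra. lra.
  - apply (continuous_Ccomp h (fun p : R * R => Cconj (strip_curve (fst p) (snd p)))). cont; auto.
    apply ex_derive_C_continuous, Hh. simpl fst. simpl snd.
    replace (Im (Cconj (strip_curve r th))) with (- Im (strip_curve r th)) by reflexivity.
    rewrite Rabs_Ropp, Rabs_pos_eq by lra. lra.
Qed.

(** The circle mean of h composed with [strip_map], folded onto the upper half circle. Arcs of total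
    length 4 eta around the angles 0 and pi, whose images run off to infinity as r tends to 1, are
    cut off at the cost of the bound [K]. *)
Lemma strip_submean_r eta r : 0 < eta < PI / 2 -> 1 / 2 <= r < 1 ->
  2 * PI * sqrt (Cmod (h 0)) <= RInt (fun th => strip_pair r th) eta (PI - eta) + 4 * eta * sqrt K.
Proof.
  intros Heta Hr. assert (HPI := PI_RGT_0).
  set (F := fun z => h (strip_map z)).
  assert (HF : forall w, Cmod w < 1 -> holo F w).
  { intros w Hw. apply (holo_comp h strip_map). apply Hh. eapply Rlt_trans; [apply strip_map_Im|lra]. apply holo_strip_map; auto. }
  generalize (circle_submean F 1 r ltac:(lra) HF). unfold F at 1. rewrite strip_map_0. intros HC.
  eapply Rle_trans; [exact HC|].
  set (g := fun t => sqrt (Cmod (F (polar r t)))).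
  assert (Cg : forall t, continuous g t).
  { intros t. unfold g. cont. apply continuous_ray, ex_derive_C_continuous, HF. rewrite Cmod_polar; lra. }
  assert (Xg : forall u v, u <= v -> ex_RInt g u v) by (intros; apply ex_RInt_cont; auto).
  assert (Gb : forall u v, u <= v -> RInt g u v <= (v - u) * sqrt K).
  { intros u v Huv. rewrite <- RInt_Rconst. apply RInt_mono; auto. apply ex_RInt_const.
    intros t _. apply sqrt_le_1_alt. apply HK. left; apply strip_map_Im. }
  assert (SP : forall th, eta <= th <= PI - eta -> 0 < sin th) by (intros; apply sin_gt_0; lra).
  change (RInt g 0 (2 * PI) <= RInt (fun th => strip_pair r th) eta (PI - eta) + 4 * eta * sqrt K).
  rewrite (RInt_split g 0 eta (2 * PI)) by (apply Xg; lra).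
  rewrite (RInt_split g eta (PI - eta) (2 * PI)) by (apply Xg; lra).
  rewrite (RInt_split g (PI - eta) (PI + eta) (2 * PI)) by (apply Xg; lra).
  rewrite (RInt_split g (PI + eta) (2 * PI - eta) (2 * PI)) by (apply Xg; lra).
  assert (E : RInt g (PI + eta) (2 * PI - eta) = RInt (fun t => g (2 * PI - t)) eta (PI - eta) :> R).
  { generalize (RInt_comp_lin (V := R_CompleteNormedModule) g (-1) (2 * PI) eta (PI - eta)).
    replace (-1 * eta + 2 * PI) with (2 * PI - eta) by ring.
    replace (-1 * (PI - eta) + 2 * PI) with (PI + eta) by ring.
    intros E. rewrite <- (opp_RInt_swap (V := R_CompleteNormedModule)) by (apply (ex_RInt_swap (V := R_NormedModule)), Xg; lra).
    rewrite <- E by (apply (ex_RInt_swap (V := R_NormedModule)), Xg; lra).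
    rewrite <- (RInt_opp (V := R_CompleteNormedModule)).
    - apply RInt_eq; [lra|]. intros t _. change (- (-1 * g (-1 * t + 2 * PI)) = g (2 * PI - t)).
      replace (-1 * t + 2 * PI) with (2 * PI - t) by ring. ring.
    - apply ex_RInt_cont; [lra|]. intros t _. 
      apply (continuous_Rmult (fun _ : R => -1) (fun y : R => g (-1 * y + 2 * PI))). cont.
      apply (continuous_Rcomp g (fun y => -1 * y + 2 * PI)). cont. apply Cg. }
  rewrite E.
  assert (E2 : RInt (fun th => strip_pair r th) eta (PI - eta) =
     RInt g eta (PI - eta) + RInt (fun t => g (2 * PI - t)) eta (PI - eta)).
  { rewrite <- RInt_Rplus; auto.
    - apply RInt_eq; [lra|]. intros t Ht. unfold strip_pair, g, F.
      rewrite strip_map_upper, strip_map_lower by (auto; lra). reflexivity.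
    - apply Xg; lra.
    - apply ex_RInt_cont; [lra|]. intros t _. apply (continuous_Rcomp g (fun t => 2 * PI - t)). cont. apply Cg. }
  rewrite E2.
  assert (G1 := Gb 0 eta ltac:(lra)). assert (G2 := Gb (PI - eta) (PI + eta) ltac:(lra)).
  assert (G3 := Gb (2 * PI - eta) (2 * PI) ltac:(lra)). lra.
Qed.

(** Boundary points of the strip, parametrised by the angle on the unit circle. In this parameter
    harmonic measure at 0 is uniform on both edges, so no Poisson density of the strip appears. *)
Definition strip_abscissa (th : R) : R := b / PI * ln ((1 + cos th) / (1 - cos th)).

Lemma strip_curve_1 th : 0 < sin th -> strip_curve 1 th = (strip_abscissa th, b).
Proof.
  intros Hs. assert (HPI := PI_RGT_0). destruct (strip_denom 1 th) as [D1 D2]; try lra.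
  unfold strip_curve, strip_abscissa. f_equal.
  - f_equal. f_equal. field. lra.
  - replace ((1 - 1 * 1) / (2 * 1 * sin th)) with 0 by (field; lra). rewrite atan_0. field. lra.
Qed.

(** The limit r -> 1 of [strip_submean_r]; with [eta] fixed the curves stay in a compact set. *)
Lemma strip_submean eta : 0 < eta < PI / 2 ->
  2 * PI * sqrt (Cmod (h 0)) <= RInt (fun th => sqrt (Cmod (h (strip_abscissa th, b)))
     + sqrt (Cmod (h (strip_abscissa th, - b)))) eta (PI - eta) + 4 * eta * sqrt K.
Proof.
  intros Heta. assert (HPI := PI_RGT_0).
  assert (SP : forall th, eta <= th <= PI - eta -> 0 < sin th) by (intros; apply sin_gt_0; lra).
  assert (Hc : forall r th, 1 / 2 <= r <= 1 -> eta <= th <= PI - eta -> continuity_2d_pt strip_pair r th).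
  { intros r th Hr Hth. apply continuous_strip_pair; auto. }
  (* Clamping makes the integrand continuous on both sides of r = 1, as [continuous_RInt_param]
     needs at that end point. *)
  generalize (continuity_2d_clamp strip_pair (1 / 2) 1 eta (PI - eta) ltac:(lra) ltac:(lra) Hc). intros HG.
  set (G := fun r th => strip_pair (clamp (1 / 2) 1 r) (clamp eta (PI - eta) th)) in *.
  set (I := fun r => RInt (fun th => G r th) eta (PI - eta)).
  assert (CI : continuous I 1) by (apply continuous_RInt_param; auto; lra).
  assert (EI : forall r, 1 / 2 <= r <= 1 -> I r = RInt (fun th => strip_pair r th) eta (PI - eta) :> R).
  { intros r Hr. apply RInt_eq; [lra|]. intros t Ht. unfold G. rewrite !clamp_id; auto. }
  replace (RInt (fun th => sqrt (Cmod (h (strip_abscissa th, b))) + sqrt (Cmod (h (strip_abscissa th, - b)))) eta (PI - eta)) with (I 1).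
  2:{ rewrite EI by lra. apply RInt_eq; [lra|]. intros t Ht. unfold strip_pair. rewrite strip_curve_1 by auto. reflexivity. }
  apply le_epsilon. intros e He.
  destruct (proj1 (filterlim_locally (U := R_UniformSpace) I (I 1)) CI (mkposreal e He)) as [d Hd].
  set (r := Rmax (1 / 2) (1 - d / 2)).
  assert (Hr : 1 / 2 <= r < 1 /\ 1 - d / 2 <= r).
  { unfold r. generalize (cond_pos d). intros. split; [split|]. apply Rmax_l. apply Rmax_lub_lt; lra. apply Rmax_r. }
  assert (HB : Rabs (I r - I 1) < e).
  { apply Hd. change (Rabs (r - 1) < d). generalize (cond_pos d). intros. rewrite Rabs_left; lra. }
  generalize (strip_submean_r eta r Heta ltac:(lra)). rewrite <- EI by lra.
  apply Rabs_def2 in HB. lra.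
Qed.

End Strip.

(** * Convergence towards the boundary of a strip *)

(* The case [d = b] is the equality case of [sqrt (2 |b| |g + b|) <= (3 |b| + |g|) / 2]; the deficit
   controls the square of the distance.  Here p^2 = |g| + |b|, q^2 = 2 |b|, r^2 = |g + b|. *)
Lemma deficit_ineq p q r : 0 <= r <= p -> 0 <= q -> q * q <= 2 * (p * p) ->
  2 * p ^ 4 - 2 * (p * p) * (q * q) + q ^ 4 - r ^ 4 <= 28 * (p * p) * ((p * p + q * q) / 2 - q * r).
Proof.
  intros Hr Hq Hqp.
  (* For q <= p / 7 the deficit is already of order p^2. Otherwise it is split as (p - q)^2 / 2 + q
     (p - r), and the two parts bound (p^2 - q^2)^2 and p^4 - r^4 separately. *)
  destruct (Rle_lt_dec (7 * q) p) as [Hs|Hs].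
  - assert (q * r <= p * p / 7) by nra.
    assert (0 <= r ^ 4) by (apply pow_le; lra).
    assert (A : 28 * (p * p) * (p * p / 2 - p * p / 7) <= 28 * (p * p) * ((p * p + q * q) / 2 - q * r)).
    { apply Rmult_le_compat_l. nra. nra. }
    assert (B : 2 * p ^ 4 - 2 * (p * p) * (q * q) + q ^ 4 <= 2 * (p * p) * (p * p)).
    { replace (q ^ 4) with ((q * q) * (q * q)) by ring. replace (p ^ 4) with ((p * p) * (p * p)) by ring.
      assert (q * q <= p * p) by nra.
      assert ((q * q) * (q * q) <= (q * q) * (p * p)) by (apply Rmult_le_compat_l; nra).
      assert (0 <= (p * p) * (q * q)) by (apply Rmult_le_pos; nra). lra. }
    assert (0 <= (p * p) * (p * p)) by (apply Rmult_le_pos; nra). lra.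
  - assert (E : 2 * p ^ 4 - 2 * (p * p) * (q * q) + q ^ 4 - r ^ 4 =
      (p * p - q * q) * (p * p - q * q) + (p ^ 4 - r ^ 4)) by ring.
    rewrite E.
    assert (A1 : (p * p - q * q) * (p * p - q * q) <= 6 * (p * p) * ((p - q) * (p - q))).
    { replace ((p * p - q * q) * (p * p - q * q)) with ((p + q) * (p + q) * ((p - q) * (p - q))) by ring.
      apply Rmult_le_compat_r. apply Rle_0_sqr. nra. }
    assert (A2 : p ^ 4 - r ^ 4 <= 4 * (p * p) * (p * (p - r))).
    { replace (p ^ 4 - r ^ 4) with ((p - r) * ((p + r) * (p * p + r * r))) by ring.
      replace (4 * (p * p) * (p * (p - r))) with ((p - r) * (4 * p * (p * p))) by ring.
      apply Rmult_le_compat_l. lra. apply Rle_trans with ((2 * p) * (2 * (p * p))); [|right; ring].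
      apply Rmult_le_compat; nra. }
    assert (A3 : 4 * (p * p) * (p * (p - r)) <= 28 * (p * p) * (q * (p - r))).
    { replace (28 * (p * p) * (q * (p - r))) with (4 * (p * p) * (7 * q * (p - r))) by ring.
      apply Rmult_le_compat_l. nra. apply Rmult_le_compat_r; lra. }
    assert (A4 : 6 * (p * p) * ((p - q) * (p - q)) <= 14 * (p * p) * ((p - q) * (p - q))).
    { apply Rmult_le_compat_r. apply Rle_0_sqr. nra. }
    nra.
Qed.

Definition deficit (g b : C) : R := (3 * Cmod b + Cmod g) / 2 - sqrt (2 * Cmod b) * sqrt (Cmod (g + b)).

(** Arithmetic and geometric mean of 2 |b| and |g + b|, followed by the triangle inequality. *)
Lemma deficit_pos g b : 0 <= deficit g b.
Proof.
  unfold deficit.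
  assert (H1 := sqrt_sqrt (2 * Cmod b) ltac:(generalize (Cmod_ge_0 b); lra)).
  assert (H2 := sqrt_sqrt (Cmod (g + b)) (Cmod_ge_0 _)).
  assert (H3 := Cmod_triangle g b).
  set (q := sqrt (2 * Cmod b)) in *. set (r := sqrt (Cmod (g + b))) in *.
  assert (0 <= (q - r) * (q - r)) by apply Rle_0_sqr. nra.
Qed.

(** By the parallelogram law the left side of [deficit_ineq] is |g - b|^2, so |g - b|^2 <= 28 (|g| +
    |b|) times the deficit. Splitting this product with a free parameter [lam] gives a bound linear
    in both quantities, which can be integrated. *)
Lemma deficit_dist g b lam : 0 < lam ->
  Cmod (g - b) <= lam * (Cmod g + Cmod b) + 28 / lam * deficit g b.
Proof.
  intros Hl.
  set (D := deficit g b). assert (HD : 0 <= D) by apply deficit_pos.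
  set (S := Cmod g + Cmod b). assert (HS : 0 <= S) by (unfold S; generalize (Cmod_ge_0 g) (Cmod_ge_0 b); lra).
  assert (SQ : Cmod (g - b) * Cmod (g - b) <= 28 * S * D).
  { assert (P1 := sqrt_sqrt S HS).
    assert (P2 := sqrt_sqrt (2 * Cmod b) ltac:(generalize (Cmod_ge_0 b); lra)).
    assert (P3 := sqrt_sqrt (Cmod (g + b)) (Cmod_ge_0 _)).
    unfold D, deficit.
    assert (Hr : sqrt (Cmod (g + b)) <= sqrt S) by (apply sqrt_le_1_alt, Cmod_triangle).
    assert (PAR : Cmod (g - b) ^ 2 + Cmod (g + b) ^ 2 = 2 * Cmod g ^ 2 + 2 * Cmod b ^ 2).
    { rewrite !Cmod2_alt. destruct g, b; simpl; ring. }
    generalize (deficit_ineq (sqrt S) (sqrt (2 * Cmod b)) (sqrt (Cmod (g + b)))).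
    generalize (sqrt_pos S) (sqrt_pos (2 * Cmod b)) (sqrt_pos (Cmod (g + b))).
    set (p := sqrt S) in *. set (q := sqrt (2 * Cmod b)) in *. set (r := sqrt (Cmod (g + b))) in *.
    intros Hp Hq Hr0 Key.
    assert (Hb0 := Cmod_ge_0 b). assert (Hg0 := Cmod_ge_0 g).
    assert (Q : q * q <= 2 * (p * p)) by (rewrite P1, P2; unfold S; lra).
    specialize (Key (conj Hr0 Hr) Hq Q).
    replace (2 * p ^ 4 - 2 * (p * p) * (q * q) + q ^ 4 - r ^ 4) with
      (2 * (p * p) * (p * p) - 2 * (p * p) * (q * q) + (q * q) * (q * q) - (r * r) * (r * r)) in Key by ring.
    rewrite P1, P2, P3 in Key.
    replace ((3 * Cmod b + Cmod g) / 2 - q * r) with ((S + 2 * Cmod b) / 2 - q * r) by (unfold S; field).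
    eapply Rle_trans; [|exact Key]. simpl in PAR. unfold S. nra. }
  assert (HT : 0 <= 28 / lam * D) by (apply Rmult_le_pos; auto; apply Rdiv_le_0_compat; lra).
  assert (HlS : 0 <= lam * S) by (apply Rmult_le_pos; lra).
  apply Rsqr_incr_0_var; [|lra]. unfold Rsqr.
  eapply Rle_trans; [exact SQ|].
  replace (28 * S * D) with (lam * S * (28 / lam * D)) by (field; lra).
  nra.
Qed.

Lemma continuous_deficit {X : UniformSpace} (g b : X -> C) x : continuous g x -> continuous b x ->
  continuous (fun t => deficit (g t) (b t)) x.
Proof. intros Hg Hb. unfold deficit. cont; auto. Qed.

Section Riesz.

Variables (G : C -> C) (psi B0 : R).
Hypotheses (Hpsi : 0 < psi) (HG : forall w, Rabs (Im w) < psi -> holo G w).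
Hypothesis HB : forall y X, Rabs y < psi -> 0 <= X -> RInt (fun x => Cmod (G (x, y))) (- X) X <= B0.
Hypothesis HBd : forall y, 0 <= y < psi -> exists K, forall w, Rabs (Im w) <= y -> Cmod (G w) <= K.

Lemma cont_G x y : Rabs y < psi -> continuous G (x, y).
Proof. intros Hy. apply ex_derive_C_continuous, HG. exact Hy. Qed.

Lemma cont_line y x : Rabs y < psi -> continuous (fun t => G (t, y)) x.
Proof.
  intros Hy. apply (continuous_Ccomp G (fun t : R => (t, y))). cont. apply cont_G; auto.
Qed.

Lemma cont_line_comp {X : UniformSpace} (u : X -> R) (y : R) (x : X) : Rabs y < psi -> continuous u x ->
  continuous (fun t => G (u t, y)) x.
Proof.
  intros Hy Hu. apply (continuous_comp u (fun t => G (t, y))); auto. apply cont_line; auto.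
Qed.

Lemma ex_line y a b : Rabs y < psi -> a <= b -> ex_RInt (fun x => Cmod (G (x, y))) a b.
Proof. intros Hy Hab. apply ex_RInt_cont; auto. intros; cont. apply cont_line; auto. Qed.

Lemma line_window y a b X : Rabs y < psi -> - X <= a -> a <= b -> b <= X ->
  RInt (fun x => Cmod (G (x, y))) a b <= RInt (fun x => Cmod (G (x, y))) (- X) X.
Proof.
  intros Hy Ha Hab Hb. apply RInt_sub_le; auto.
  - intros; cont. apply cont_line; auto.
  - intros; apply Cmod_ge_0.
Qed.

(** [N1] is the upper limit of the line norms towards the top edge. The height [y] nearly attains it
    and is so high that every line between y and the edge, as well as its reflection in the line at
    [y], has norm at most N1 + eps. *)
Lemma near_top (eps : R) : 0 < eps -> exists N1 y X0, 0 <= N1 <= B0 /\ 0 < y < psi /\ 0 < 2 * y - psi /\ 0 <= X0 /\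
  (forall eta X, 2 * y - psi < eta < psi -> 0 <= X -> RInt (fun x => Cmod (G (x, eta))) (- X) X <= N1 + eps) /\
  (forall X, X0 <= X -> N1 - eps <= RInt (fun x => Cmod (G (x, y))) (- X) X).
Proof.
  intros Heps.
  set (E := fun m => forall y, 0 < y < psi -> exists eta X, y < eta < psi /\ 0 <= X /\ m <= RInt (fun x => Cmod (G (x, eta))) (- X) X).
  destruct (completeness E) as [N1 [U1 U2]].
  - exists B0. intros m Hm. destruct (Hm (psi / 2)) as (eta & X & H1 & H2 & H3). lra.
    eapply Rle_trans; [exact H3|]. apply HB; auto. apply Rabs_def1; lra.
  - exists 0. intros y Hy. exists ((y + psi) / 2), 0. split. lra. split. lra.
    rewrite Ropp_0, RInt_point. apply Rle_refl.
  - assert (HN0 : 0 <= N1).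
    { apply U1. intros y Hy. exists ((y + psi) / 2), 0. split. lra. split. lra.
      rewrite Ropp_0, RInt_point. apply Rle_refl. }
    assert (HNB : N1 <= B0).
    { apply U2. intros m Hm. destruct (Hm (psi / 2)) as (eta & X & H1 & H2 & H3). lra.
      eapply Rle_trans; [exact H3|]. apply HB; auto. apply Rabs_def1; lra. }
    assert (Hn : ~ E (N1 + eps)) by (intros K; apply U1 in K; lra).
    apply not_all_ex_not in Hn. destruct Hn as [ys Hys]. apply imply_to_and in Hys. destruct Hys as [Hys Hn].
    assert (Hm : exists m, E m /\ N1 - eps < m).
    { apply NNPP. intros K. assert (N1 <= N1 - eps); [|lra]. apply U2. intros m Hm.
      apply Rnot_lt_le. intros L. apply K. exists m; auto. }
    (* Starting from (ys + psi) / 2 gives 2 y - psi > ys. *)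
    destruct Hm as (m & Hm & Hlt). destruct (Hm ((ys + psi) / 2)) as (y & X0 & H1 & H2 & H3). lra.
    exists N1, y, X0. repeat split; try lra.
    + intros eta X Heta HX. apply Rnot_lt_le. intros K. apply Hn. exists eta, X. split. lra. split. exact HX. left; exact K.
    + intros X HX. apply Rle_trans with m. lra. eapply Rle_trans; [exact H3|]. apply line_window; try lra. apply Rabs_def1; lra.
Qed.

Lemma shift_window y u a b : Rabs y < psi -> a <= b ->
  RInt (fun x => Cmod (G (x + u, y))) a b = RInt (fun x => Cmod (G (x, y))) (a + u) (b + u) :> R.
Proof.
  intros Hy Hab. apply (RInt_translate (fun x => Cmod (G (x, y)))); auto.
  intros; cont. apply cont_line; auto.
Qed.

Lemma diff_le_sum y y' u a b : Rabs y < psi -> Rabs y' < psi -> a <= b ->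
  ex_RInt (fun x => Cmod (G (x + u, y) - G (x, y'))) a b /\
  RInt (fun x => Cmod (G (x + u, y) - G (x, y'))) a b <=
  RInt (fun x => Cmod (G (x, y))) (a + u) (b + u) + RInt (fun x => Cmod (G (x, y'))) a b.
Proof.
  intros Hy Hy' Hab.
  assert (X : ex_RInt (fun x => Cmod (G (x + u, y) - G (x, y'))) a b).
  { apply ex_RInt_cont; auto. intros; cont. apply cont_line_comp; auto; cont. apply cont_line; auto. }
  split; auto.
  assert (X1 : ex_RInt (fun x => Cmod (G (x + u, y))) a b).
  { apply ex_RInt_cont; auto. intros; cont. apply cont_line_comp; auto; cont. }
  rewrite <- shift_window by auto. rewrite <- RInt_Rplus by (auto; apply ex_line; auto).
  apply RInt_mono; auto. apply ex_RInt_Rplus; auto. apply ex_line; auto.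
  intros t _. eapply Rle_trans; [apply Cmod_triangle|]. rewrite Cmod_opp. lra.
Qed.

(** Outside a bounded window the function and its translates have small mass; on the window the
    integral is continuous in [u] and vanishes at 0. *)
Lemma translation_continuity y eps : Rabs y < psi -> 0 < eps ->
  exists d, 0 < d /\ forall u R0, Rabs u <= d -> 0 <= R0 ->
    RInt (fun x => Cmod (G (x + u, y) - G (x, y))) (- R0) R0 <= eps.
Proof.
  intros Hy Heps. set (e := eps / 5).
  destruct (completeness (fun m => exists X, 0 <= X /\ m = RInt (fun x => Cmod (G (x, y))) (- X) X)) as [L [L1 L2]].
  { exists B0. intros m (X & HX & ->). apply HB; auto. }
  { eexists. exists 0. split. lra. reflexivity. }
  assert (HX : exists X, 0 <= X /\ L - e < RInt (fun x => Cmod (G (x, y))) (- X) X).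
  { apply NNPP. intros K. assert (L <= L - e); [|unfold e in *; lra]. apply L2. intros m (X & HX & ->).
    apply Rnot_lt_le. intros Q. apply K. exists X; auto. }
  destruct HX as (X1 & HX1 & HL).
  assert (TAIL : forall a b, a <= b -> X1 <= a \/ b <= - X1 -> RInt (fun x => Cmod (G (x, y))) a b <= e).
  { intros a b Hab Hor. set (X := Rmax (Rabs a) (Rabs b)).
    assert (Ha := Rle_trans _ _ _ (Rle_abs a) (Rmax_l (Rabs a) (Rabs b))).
    assert (Hb := Rle_trans _ _ _ (Rle_abs b) (Rmax_r (Rabs a) (Rabs b))).
    assert (Ha' := Rle_trans _ _ _ (Rle_abs (- a)) (Rle_trans _ _ _ (Req_le _ _ (Rabs_Ropp a)) (Rmax_l (Rabs a) (Rabs b)))).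
    assert (Hb' := Rle_trans _ _ _ (Rle_abs (- b)) (Rle_trans _ _ _ (Req_le _ _ (Rabs_Ropp b)) (Rmax_r (Rabs a) (Rabs b)))).
    fold X in Ha, Hb, Ha', Hb'.
    assert (HXL : RInt (fun x => Cmod (G (x, y))) (- X) X <= L) by (apply L1; exists X; split; auto; lra).
    assert (NN : forall u v, u <= v -> 0 <= RInt (fun x => Cmod (G (x, y))) u v).
    { intros; apply RInt_pos; auto. apply ex_line; auto. intros; apply Cmod_ge_0. }
    destruct Hor as [Hor|Hor].
    - rewrite (RInt_split _ (- X) (- X1) X) in HXL by (apply ex_line; auto; lra).
      rewrite (RInt_split _ (- X1) X1 X) in HXL by (apply ex_line; auto; lra).
      rewrite (RInt_split _ X1 a X) in HXL by (apply ex_line; auto; lra).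
      rewrite (RInt_split _ a b X) in HXL by (apply ex_line; auto; lra).
      generalize (NN (- X) (- X1) ltac:(lra)) (NN X1 a ltac:(lra)) (NN b X ltac:(lra)). lra.
    - rewrite (RInt_split _ (- X) X1 X) in HXL by (apply ex_line; auto; lra).
      rewrite (RInt_split _ (- X) (- X1) X1) in HXL by (apply ex_line; auto; lra).
      rewrite (RInt_split _ (- X) a (- X1)) in HXL by (apply ex_line; auto; lra).
      rewrite (RInt_split _ a b (- X1)) in HXL by (apply ex_line; auto; lra).
      generalize (NN (- X) a ltac:(lra)) (NN b (- X1) ltac:(lra)) (NN X1 X ltac:(lra)). lra. }
  (* As |u| <= 1, the translated tails still lie beyond [X1]. *)
  set (X2 := X1 + 1).
  set (m := fun u => RInt (fun x => Cmod (G (x + u, y) - G (x, y))) (- X2) X2).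
  assert (Cm : continuous m 0).
  { apply (continuous_RInt_param (fun u x => Cmod (G (x + u, y) - G (x, y)))). unfold X2; lra.
    intros u v. apply continuous_2d. cont; apply cont_line_comp; auto; cont. }
  assert (m0 : m 0 = 0).
  { unfold m. rewrite (RInt_eq _ (fun _ => 0)) by (try (unfold X2; lra); intros; rewrite Rplus_0_r;
      replace (G (t, y) - G (t, y))%C with (RtoC 0) by ring; apply Cmod_0).
    rewrite RInt_Rconst. apply Rmult_0_r. }
  assert (He : 0 < e) by (unfold e; lra).
  destruct (proj1 (filterlim_locally (U := R_UniformSpace) m (m 0)) Cm (mkposreal e He)) as [d Hd].
  exists (Rmin (d / 2) 1). split. { apply Rmin_pos. generalize (cond_pos d); lra. lra. }
  intros u R0 Hu HR0.
  assert (Hu1 := Rle_trans _ _ _ Hu (Rmin_l _ _)). assert (Hu2 := Rle_trans _ _ _ Hu (Rmin_r _ _)).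
  apply Rabs_le_between in Hu2.
  assert (Hm : m u < e).
  { assert (Q : Rabs (m u - m 0) < e). { apply Hd. change (Rabs (u - 0) < d). rewrite Rminus_0_r. generalize (cond_pos d); lra. }
    rewrite m0, Rminus_0_r in Q. apply Rle_lt_trans with (1 := Rle_abs _) (2 := Q). }
  set (R1 := Rmax R0 X2). assert (HR1 : R0 <= R1 /\ X2 <= R1) by (split; [apply Rmax_l|apply Rmax_r]).
  assert (X2p : 1 <= X2) by (unfold X2; lra).
  apply Rle_trans with (RInt (fun x => Cmod (G (x + u, y) - G (x, y))) (- R1) R1).
  { apply RInt_sub_le; try lra. intros; cont. apply cont_line_comp; auto; cont. apply cont_line; auto. intros; apply Cmod_ge_0. }
  assert (XD : forall a b, a <= b -> ex_RInt (fun x => Cmod (G (x + u, y) - G (x, y))) a b) by (intros; apply diff_le_sum; auto).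
  rewrite (RInt_split _ (- R1) (- X2) R1) by (apply XD; lra).
  rewrite (RInt_split _ (- X2) X2 R1) by (apply XD; lra).
  fold (m u).
  destruct (diff_le_sum y y u (- R1) (- X2)) as [_ T1]; auto; try lra.
  destruct (diff_le_sum y y u X2 R1) as [_ T2]; auto; try lra.
  generalize (TAIL (- R1 + u) (- X2 + u) ltac:(lra) ltac:(right; unfold X2; lra)) (TAIL (- R1) (- X2) ltac:(lra) ltac:(right; unfold X2; lra)).
  generalize (TAIL (X2 + u) (R1 + u) ltac:(lra) ltac:(left; unfold X2; lra)) (TAIL X2 R1 ltac:(lra) ltac:(left; unfold X2; lra)).
  unfold e in *. lra.
Qed.

(** The bound is linear in [b]: for angles away from 0 and pi, the horizontal displacement
    disappears as the strip gets thin. *)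
Lemma strip_abscissa_bound eta b th : 0 <= b -> 0 < eta < PI / 2 -> eta <= th <= PI - eta ->
  Rabs (strip_abscissa b th) <= b * (/ PI * ln ((1 + cos eta) / (1 - cos eta))).
Proof.
  intros Hb Heta Hth. assert (HPI := PI_RGT_0).
  assert (C1 : cos th <= cos eta) by (apply cos_decr_1; lra).
  assert (C2 : - cos eta <= cos th).
  { rewrite <- (Ropp_involutive (cos th)). apply Ropp_le_contravar. rewrite <- Rtrigo_facts.cos_pi_minus. apply cos_decr_1; lra. }
  assert (C3 : cos eta < 1) by (rewrite <- cos_0; apply cos_decreasing_1; lra).
  assert (C4 : 0 < cos eta) by (apply cos_gt_0; lra).
  assert (P : 0 < (1 + cos th) / (1 - cos th)) by (apply Rdiv_lt_0_compat; lra).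
  assert (L : forall c d, -1 < c < 1 -> -1 < d < 1 -> c <= d -> ln ((1 + c) / (1 - c)) <= ln ((1 + d) / (1 - d))).
  { intros c d Hc Hd Hcd. destruct (Rle_lt_or_eq_dec c d Hcd) as [Hlt| ->]; [|lra].
    left. apply ln_increasing. apply Rdiv_lt_0_compat; lra.
    apply Rmult_lt_reg_r with ((1 - c) * (1 - d)). nra.
    replace ((1 + c) / (1 - c) * ((1 - c) * (1 - d))) with ((1 + c) * (1 - d)) by (field; lra).
    replace ((1 + d) / (1 - d) * ((1 - c) * (1 - d))) with ((1 + d) * (1 - c)) by (field; lra). nra. }
  assert (L1 := L (cos th) (cos eta) ltac:(lra) ltac:(lra) C1).
  assert (L2 := L (- cos eta) (cos th) ltac:(lra) ltac:(lra) C2).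
  replace ((1 + - cos eta) / (1 - - cos eta)) with (/ ((1 + cos eta) / (1 - cos eta))) in L2 by (field; lra).
  rewrite ln_Rinv in L2 by (apply Rdiv_lt_0_compat; lra).
  unfold strip_abscissa. unfold Rdiv at 1. rewrite Rmult_assoc, Rabs_mult, (Rabs_pos_eq b) by auto.
  apply Rmult_le_compat_l; auto. rewrite Rabs_mult, Rabs_pos_eq by (left; apply Rinv_0_lt_compat; lra).
  apply Rmult_le_compat_l. left; apply Rinv_0_lt_compat; lra. apply Rabs_le; lra.
Qed.

Lemma continuous_strip_abscissa b th : 0 < th < PI -> continuous (strip_abscissa b) th.
Proof.
  intros Hth. assert (Hs := sin_gt_0 th ltac:(lra) ltac:(lra)).
  assert (Hc : -1 < cos th < 1).
  { rewrite <- cos_PI, <- cos_0. split; apply cos_decreasing_1; lra. }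
  unfold strip_abscissa. cont. apply (continuous_Rcomp ln). cont; lra.
  apply continuity_pt_filterlim, derivable_continuous_pt. exists (/ ((1 + cos th) / (1 - cos th))).
  apply derivable_pt_lim_ln. apply Rdiv_lt_0_compat; lra.
Qed.

Lemma line_translate_le N y R0 s : Rabs y < psi -> 0 <= R0 ->
  (forall X, 0 <= X -> RInt (fun x => Cmod (G (x, y))) (- X) X <= N) ->
  RInt (fun x => Cmod (G (x + s, y))) (- R0) R0 <= N.
Proof.
  intros Hy HR HN. rewrite shift_window by (auto; lra).
  eapply Rle_trans; [|apply (HN (R0 + Rabs s))]; [|generalize (Rabs_pos s); lra].
  assert (A := Rle_abs s). assert (A' := Rle_abs (- s)). rewrite Rabs_Ropp in A'.
  apply line_window; auto; lra.
Qed.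

Lemma continuity_2d_abscissa b y x th : Rabs y < psi -> 0 < th < PI ->
  continuous (fun p : R * R => G (fst p + strip_abscissa b (snd p), y)) (x, th).
Proof.
  intros Hy Hth. apply (cont_line_comp (fun p : R * R => fst p + strip_abscissa b (snd p))); auto.
  cont. apply (continuous_Rcomp (strip_abscissa b)). cont. apply continuous_strip_abscissa; auto.
Qed.

Lemma pair_line_fubini N b y R0 eta : Rabs y < psi -> 0 <= R0 -> 0 < eta < PI / 2 ->
  (forall X, 0 <= X -> RInt (fun x => Cmod (G (x, y))) (- X) X <= N) ->
  ex_RInt (fun x => RInt (fun th => Cmod (G (x + strip_abscissa b th, y))) eta (PI - eta)) (- R0) R0 /\
  RInt (fun x => RInt (fun th => Cmod (G (x + strip_abscissa b th, y))) eta (PI - eta)) (- R0) R0 <= (PI - 2 * eta) * N.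
Proof.
  intros Hy HR Heta HN.
  destruct (fubini (fun x th => Cmod (G (x + strip_abscissa b th, y))) (- R0) R0 eta (PI - eta)) as (F1 & F2 & F3); try lra.
  { intros x th _ Hth. apply continuous_2d. cont. apply continuity_2d_abscissa; auto; lra. }
  split; auto. rewrite F3. replace (PI - 2 * eta) with (PI - eta - eta) by ring. rewrite <- RInt_Rconst.
  apply RInt_mono; auto. lra. apply ex_RInt_const.
  intros th Hth. apply line_translate_le; auto.
Qed.

(** The mean value inequality is applied to h w = G ((x, y) + w) + G (x, y) and multiplied by m =
    sqrt (2 |G (x, y)|), so that the centre yields 4 pi |G (x, y)| and the products of roots on the
    edges are those in [deficit]. The deficit on the lower edge is nonnegative and dropped. *)
Lemma strip_deficit x y b eta K : 0 < b -> Rabs y + b < psi -> 0 < eta < PI / 2 ->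
  (forall w, Rabs (Im w) <= Rabs y + b -> Cmod (G w) <= K) ->
  let gp := fun th => G (x + strip_abscissa b th, y + b) in
  let gm := fun th => G (x + strip_abscissa b th, y - b) in
  RInt (fun th => deficit (gp th) (G (x, y))) eta (PI - eta) <=
  / 2 * RInt (fun th => Cmod (gp th)) eta (PI - eta) + / 2 * RInt (fun th => Cmod (gm th)) eta (PI - eta)
    - PI * Cmod (G (x, y)) + 8 * eta * K.
Proof.
  intros Hb Hyb Heta HK gp gm. assert (HPI := PI_RGT_0).
  set (g0 := G (x, y)). set (h := fun w => (G ((x, y) + w) + g0)%C).
  assert (Yb : forall w : C, Rabs (Im ((x, y) + w)%C) <= Rabs y + Rabs (Im w)).
  { intros w. apply Rabs_triang. }
  assert (Hh : forall w, Rabs (Im w) < psi - Rabs y -> holo h w).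
  { intros w Hw. unfold h. Holo. apply (holo_comp G (fun w => (x, y) + w)%C). apply HG. generalize (Yb w); lra. Holo. }
  assert (HKh : forall w, Rabs (Im w) <= b -> Cmod (h w) <= 2 * K).
  { intros w Hw. unfold h. eapply Rle_trans; [apply Cmod_triangle|].
    assert (Cmod (G ((x, y) + w)) <= K) by (apply HK; generalize (Yb w); lra).
    assert (Cmod g0 <= K) by (apply HK; simpl; lra). lra. }
  assert (H := strip_submean h b (psi - Rabs y) (2 * K) ltac:(lra) Hh HKh eta Heta).
  assert (Hyp : Rabs (y + b) < psi) by (eapply Rle_lt_trans; [apply Rabs_triang|]; rewrite (Rabs_pos_eq b); lra).
  assert (Hym : Rabs (y - b) < psi) by (unfold Rminus; eapply Rle_lt_trans; [apply Rabs_triang|]; rewrite Rabs_Ropp, (Rabs_pos_eq b); lra).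
  assert (Cp : forall th, eta <= th <= PI - eta -> continuous gp th).
  { intros th Hth. apply cont_line_comp; auto. cont. apply continuous_strip_abscissa; lra. }
  assert (Cm : forall th, eta <= th <= PI - eta -> continuous gm th).
  { intros th Hth. apply cont_line_comp; auto. cont. apply continuous_strip_abscissa; lra. }
  set (m := sqrt (2 * Cmod g0)).
  assert (Hm : 0 <= m) by apply sqrt_pos.
  assert (Hm2 : m * m = 2 * Cmod g0) by (apply sqrt_sqrt; generalize (Cmod_ge_0 g0); lra).
  assert (HK0 : Cmod g0 <= K) by (apply HK; simpl; lra).
  assert (HmK : m * sqrt (2 * K) <= 2 * K).
  { unfold m. rewrite <- sqrt_mult by (generalize (Cmod_ge_0 g0); lra).
    rewrite <- (sqrt_square (2 * K)) at 2 by (generalize (Cmod_ge_0 g0); lra).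
    apply sqrt_le_1_alt. apply Rmult_le_compat_r; generalize (Cmod_ge_0 g0); lra. }
  assert (E0 : sqrt (Cmod (h 0)) = m).
  { assert (Eh0 : h 0 = (2 * g0)%C).
    { unfold h. replace ((x, y) + 0)%C with ((x, y) : C) by (apply C_eq; simpl; ring). fold g0. ring. }
    unfold m. rewrite Eh0, Cmod_mult, Cmod_R, Rabs_pos_eq by lra. reflexivity. }
  rewrite E0 in H.
  assert (Eh : forall th, h (strip_abscissa b th, b) = (gp th + g0)%C /\ h (strip_abscissa b th, - b) = (gm th + g0)%C).
  { intros th. split; unfold h, gp, gm; reflexivity. }
  rewrite (RInt_eq _ (fun th => sqrt (Cmod (gp th + g0)) + sqrt (Cmod (gm th + g0)))) in H
    by (try lra; intros th _; destruct (Eh th) as [-> ->]; reflexivity).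
  assert (Xp : ex_RInt (fun th => Cmod (gp th)) eta (PI - eta)) by (apply ex_RInt_cont; [lra|]; intros; cont; auto).
  assert (Xm : ex_RInt (fun th => Cmod (gm th)) eta (PI - eta)) by (apply ex_RInt_cont; [lra|]; intros; cont; auto).
  assert (Xs : ex_RInt (fun th => sqrt (Cmod (gp th + g0)) + sqrt (Cmod (gm th + g0))) eta (PI - eta))
    by (apply ex_RInt_cont; [lra|]; intros; cont; auto).
  set (A := RInt (fun th => sqrt (Cmod (gp th + g0)) + sqrt (Cmod (gm th + g0))) eta (PI - eta)) in *.
  assert (HA : 4 * PI * Cmod g0 <= m * A + 8 * eta * K).
  { assert (Q : m * (2 * PI * m) <= m * (A + 4 * eta * sqrt (2 * K))) by (apply Rmult_le_compat_l; auto).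
    assert (4 * eta * (m * sqrt (2 * K)) <= 4 * eta * (2 * K)) by (apply Rmult_le_compat_l; lra).
    replace (m * (2 * PI * m)) with (2 * PI * (m * m)) in Q by ring. rewrite Hm2 in Q. lra. }
  apply Rle_trans with (RInt (fun th => (/ 2 * Cmod (gp th) + / 2 * Cmod (gm th)) + (3 * Cmod g0 - m * (sqrt (Cmod (gp th + g0)) + sqrt (Cmod (gm th + g0))))) eta (PI - eta)).
  - apply RInt_mono; try lra.
    + apply ex_RInt_cont; [lra|]. intros th Hth. apply continuous_deficit; auto. apply continuous_const.
    + apply ex_RInt_cont; [lra|]. intros; cont; auto.
    + intros th _. generalize (deficit_pos (gm th) g0). unfold deficit. fold g0 m. lra.
  - assert (Yp := ex_RInt_Rscal _ (/ 2) _ _ Xp). assert (Ym := ex_RInt_Rscal _ (/ 2) _ _ Xm).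
    assert (Ys := ex_RInt_Rscal _ m _ _ Xs).
    assert (Yc : ex_RInt (fun _ => 3 * Cmod g0) eta (PI - eta)) by apply ex_RInt_const.
    rewrite (RInt_Rplus _ _ _ _ (ex_RInt_Rplus _ _ _ _ Yp Ym) (ex_RInt_Rminus _ _ _ _ Yc Ys)),
      (RInt_Rplus _ _ _ _ Yp Ym), (RInt_Rminus _ _ _ _ Yc Ys), (RInt_Rscal _ _ _ _ Xp), (RInt_Rscal _ _ _ _ Xm),
      (RInt_Rscal _ _ _ _ Xs), RInt_Rconst.
    fold A. clearbody A. assert (0 <= 6 * eta * Cmod g0) by (apply Rmult_le_pos; [lra|apply Cmod_ge_0]). lra.
Qed.

(** Integrated over x, the two edges in [strip_deficit] contribute at most pi (N1 + eps) together,
    while the centre line takes away at least pi (N1 - eps). *)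
Lemma deficit_small eps : 0 < eps -> exists y X0, 0 < y < psi /\ 0 < 2 * y - psi /\ 0 <= X0 /\
  (forall y' R0, y < y' < psi -> X0 <= R0 ->
    RInt (fun x => RInt (fun th => deficit (G (x + strip_abscissa (y' - y) th, y')) (G (x, y))) (PI / 4) (PI - PI / 4)) (- R0) R0
      <= 2 * PI * eps).
Proof.
  intros Heps. assert (HPI := PI_RGT_0).
  destruct (near_top eps Heps) as (N1 & y & X0 & HN1 & Hy & Hy2 & HX0 & HU & HL).
  exists y, X0. split; auto. split; auto. split; auto.
  intros y' R0 Hy' HR0. set (b := y' - y). assert (Hb : 0 < b) by (unfold b; lra).
  destruct (HBd y') as [K HK]. lra.
  assert (Ey : y' = y + b) by (unfold b; ring).
  assert (Hyb : Rabs y + b = y') by (rewrite Rabs_pos_eq by lra; lra).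
  assert (Ay : Rabs y < psi) by (apply Rabs_def1; lra). assert (Ay' : Rabs y' < psi) by (apply Rabs_def1; lra).
  assert (Aym : Rabs (y - b) < psi) by (apply Rabs_def1; lra).
  apply le_epsilon. intros e He.
  assert (HK0 : 0 <= K) by (eapply Rle_trans; [apply (Cmod_ge_0 (G (0, 0)))|apply HK; simpl; rewrite Rabs_R0; lra]).
  (* The term 8 eta K of [strip_deficit], integrated over a window of length 2 R0, must not exceed
     [e]. *)
  set (eta := Rmin (PI / 4) (e / (16 * R0 * K + 1))).
  assert (Hq : 0 <= 16 * R0 * K) by (apply Rmult_le_pos; lra).
  assert (Heta : 0 < eta <= PI / 4) by (split; [apply Rmin_pos; [lra|apply Rdiv_lt_0_compat; lra]|apply Rmin_l]).
  assert (Heta2 : 16 * R0 * K * eta <= e).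
  { apply Rle_trans with (16 * R0 * K * (e / (16 * R0 * K + 1))). apply Rmult_le_compat_l; auto. apply Rmin_r.
    apply Rle_trans with ((16 * R0 * K + 1) * (e / (16 * R0 * K + 1))).
    apply Rmult_le_compat_r. apply Rdiv_le_0_compat; lra. lra. right; field; lra. }
  destruct (pair_line_fubini (N1 + eps) b y' R0 eta) as [Xp Ip]; auto; try lra. { intros; apply HU; lra. }
  destruct (pair_line_fubini (N1 + eps) b (y - b) R0 eta) as [Xm Imm]; auto; try lra. { intros; apply HU; lra. }
  assert (Cd : forall x th, 0 < th < PI -> continuity_2d_pt (fun x th => deficit (G (x + strip_abscissa b th, y')) (G (x, y))) x th).
  { intros x th Hth. apply continuous_2d. apply continuous_deficit. apply continuity_2d_abscissa; auto.
    apply (cont_line_comp (fun p : R * R => fst p)); auto. cont. }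
  destruct (fubini (fun x th => deficit (G (x + strip_abscissa b th, y')) (G (x, y))) (- R0) R0 (PI / 4) (PI - PI / 4)) as (F1 & _ & _); try lra.
  { intros; apply Cd; lra. }
  set (Ap := fun x => RInt (fun th => Cmod (G (x + strip_abscissa b th, y'))) eta (PI - eta)) in *.
  set (Am := fun x => RInt (fun th => Cmod (G (x + strip_abscissa b th, y - b))) eta (PI - eta)) in *.
  assert (X0' : ex_RInt (fun x => Cmod (G (x, y))) (- R0) R0) by (apply ex_line; auto; lra).
  apply Rle_trans with (RInt (fun x => (/ 2 * Ap x + / 2 * Am x) + (8 * eta * K - PI * Cmod (G (x, y)))) (- R0) R0).
  - apply RInt_mono; auto. lra.
    + apply ex_RInt_Rplus. apply ex_RInt_Rplus; apply ex_RInt_Rscal; auto.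
      apply ex_RInt_Rminus. apply ex_RInt_const. apply ex_RInt_Rscal; auto.
    + intros x _.
      assert (Q := strip_deficit x y b eta K Hb ltac:(lra) ltac:(lra) ltac:(intros w Hw; apply HK; lra)).
      cbv beta zeta in Q. rewrite <- Ey in Q. fold (Ap x) (Am x) in Q.
      (* Since the deficit is nonnegative, the angular range may be cut to a fixed one, independent
         of [eta]. *)
      apply Rle_trans with (RInt (fun th => deficit (G (x + strip_abscissa b th, y')) (G (x, y))) eta (PI - eta)); [|lra].
      apply RInt_sub_le; try lra.
      * intros th Hth. apply (slice_y (fun x th => deficit (G (x + strip_abscissa b th, y')) (G (x, y))) x th), Cd. lra.
      * intros; apply deficit_pos.
  - assert (Yp := ex_RInt_Rscal _ (/ 2) _ _ Xp). assert (Ym := ex_RInt_Rscal _ (/ 2) _ _ Xm).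
    assert (Ys := ex_RInt_Rscal _ PI _ _ X0').
    assert (Yc : ex_RInt (fun _ => 8 * eta * K) (- R0) R0) by apply ex_RInt_const.
    rewrite (RInt_Rplus _ _ _ _ (ex_RInt_Rplus _ _ _ _ Yp Ym) (ex_RInt_Rminus _ _ _ _ Yc Ys)),
      (RInt_Rplus _ _ _ _ Yp Ym), (RInt_Rminus _ _ _ _ Yc Ys), (RInt_Rscal _ _ _ _ Xp), (RInt_Rscal _ _ _ _ Xm),
      (RInt_Rscal _ _ _ _ X0'), RInt_Rconst.
    specialize (HL R0 HR0). 
    assert (PI * (N1 - eps) <= PI * RInt (fun x => Cmod (G (x, y))) (- R0) R0) by (apply Rmult_le_compat_l; lra).
    assert ((PI - 2 * eta) * (N1 + eps) <= PI * (N1 + eps)) by (apply Rmult_le_compat_r; lra).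
    assert (T1 := Rle_trans _ _ _ Ip H0). assert (T2 := Rle_trans _ _ _ Imm H0).
    set (I1 := RInt Ap (- R0) R0) in *. set (I2 := RInt Am (- R0) R0) in *.
    set (I3 := RInt (fun x => Cmod (G (x, y))) (- R0) R0) in *.
    clearbody I1 I2 I3. lra.
Qed.

(** Integrates [deficit_dist] over x and th. The translate of the higher line varies with th, so
    closeness is obtained only on average over the displacements. *)
Lemma line_close lam : 0 < lam -> exists y X0, 0 < y < psi /\ 0 <= X0 /\
  (forall y' R0, y < y' < psi -> X0 <= R0 ->
    ex_RInt (fun th => RInt (fun x => Cmod (G (x + strip_abscissa (y' - y) th, y') - G (x, y))) (- R0) R0) (PI / 4) (PI - PI / 4) /\
    RInt (fun th => RInt (fun x => Cmod (G (x + strip_abscissa (y' - y) th, y') - G (x, y))) (- R0) R0) (PI / 4) (PI - PI / 4)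
      <= lam * (PI * (B0 + 56))).
Proof.
  intros Hlam. assert (HPI := PI_RGT_0).
  (* A square, to compensate the factor 28 / lam of [deficit_dist]; the deficit term then amounts to
     56 pi lam. *)
  destruct (deficit_small (lam * lam) ltac:(nra)) as (y & X0 & Hy & Hy2 & HX0 & HD).
  exists y, X0. split; auto. split; auto. intros y' R0 Hy' HR0. specialize (HD y' R0 Hy' HR0).
  set (b := y' - y) in *.
  assert (Ay : Rabs y < psi) by (apply Rabs_def1; lra). assert (Ay' : Rabs y' < psi) by (apply Rabs_def1; lra).
  set (g := fun x th => G (x + strip_abscissa b th, y')). set (g0 := fun x => G (x, y)).
  assert (Cg : forall x th, 0 < th < PI -> continuous (fun p : R * R => g (fst p) (snd p)) (x, th)).
  { intros x th Hth. apply continuity_2d_abscissa; auto. }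
  assert (Cg0 : forall x th, continuous (fun p : R * R => g0 (fst p)) (x, th)).
  { intros x th. apply (cont_line_comp (fun p : R * R => fst p)); auto. cont. }
  destruct (fubini (fun x th => Cmod (g x th - g0 x)) (- R0) R0 (PI / 4) (PI - PI / 4)) as (F1 & F2 & F3); try lra.
  { intros x th _ Hth. apply continuous_2d. cont. apply Cg; lra. apply Cg0. }
  destruct (fubini (fun x th => deficit (g x th) (g0 x)) (- R0) R0 (PI / 4) (PI - PI / 4)) as (D1 & _ & _); try lra.
  { intros x th _ Hth. apply continuous_2d. apply continuous_deficit. apply Cg; lra. apply Cg0. }
  destruct (pair_line_fubini B0 b y' R0 (PI / 4)) as [X1 I1]; auto; try lra.
  split. exact F2.
  change (RInt (fun th => RInt (fun x => Cmod (g x th - g0 x)) (- R0) R0) (PI / 4) (PI - PI / 4) <= lam * (PI * (B0 + 56))).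
  rewrite <- F3.
  set (P := fun x => RInt (fun th => Cmod (g x th)) (PI / 4) (PI - PI / 4)).
  set (Q := fun x => RInt (fun th => deficit (g x th) (g0 x)) (PI / 4) (PI - PI / 4)).
  change (ex_RInt P (- R0) R0) in X1. change (RInt P (- R0) R0 <= (PI - 2 * (PI / 4)) * B0) in I1.
  change (ex_RInt Q (- R0) R0) in D1. change (RInt Q (- R0) R0 <= 2 * PI * (lam * lam)) in HD.
  assert (X2 : ex_RInt (fun x => Cmod (g0 x)) (- R0) R0) by (apply ex_line; auto; lra).
  assert (I2 : RInt (fun x => Cmod (g0 x)) (- R0) R0 <= B0) by (apply HB; auto; lra).
  assert (Y1 := ex_RInt_Rscal _ lam _ _ X1). assert (Y2 := ex_RInt_Rscal _ (lam * (PI / 2)) _ _ X2).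
  assert (Y3 := ex_RInt_Rscal _ (28 / lam) _ _ D1).
  apply Rle_trans with (RInt (fun x => lam * P x + lam * (PI / 2) * Cmod (g0 x) + 28 / lam * Q x) (- R0) R0).
  - apply RInt_mono; auto. lra. apply ex_RInt_Rplus; auto. apply ex_RInt_Rplus; auto.
    intros x _.
    assert (S1 : forall th, PI / 4 <= th <= PI - PI / 4 -> continuous (fun th => g x th) th).
    { intros th Hth. apply (continuous_comp_2 (fun _ : R => x) (fun t : R => t) g).
      apply continuous_const. apply continuous_id. apply Cg. lra. }
    assert (Z1 : ex_RInt (fun th => Cmod (g x th)) (PI / 4) (PI - PI / 4)) by (apply ex_RInt_cont; [lra|]; intros; cont; auto).
    assert (Z2 : ex_RInt (fun th => deficit (g x th) (g0 x)) (PI / 4) (PI - PI / 4)).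
    { apply ex_RInt_cont; [lra|]; intros. apply continuous_deficit; auto. apply continuous_const. }
    assert (Z3 : ex_RInt (fun _ => lam * Cmod (g0 x)) (PI / 4) (PI - PI / 4)) by apply ex_RInt_const.
    assert (Z1' := ex_RInt_Rscal _ lam _ _ Z1). assert (Z2' := ex_RInt_Rscal _ (28 / lam) _ _ Z2).
    replace (lam * P x + lam * (PI / 2) * Cmod (g0 x) + 28 / lam * Q x) with
      (RInt (fun th => lam * Cmod (g x th) + lam * Cmod (g0 x) + 28 / lam * deficit (g x th) (g0 x)) (PI / 4) (PI - PI / 4)).
    + apply RInt_mono; [lra| | |].
      * apply ex_RInt_cont; [lra|]. intros; cont; auto.
      * exact (ex_RInt_Rplus _ _ _ _ (ex_RInt_Rplus _ _ _ _ Z1' Z3) Z2').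
      * intros th _. eapply Rle_trans; [apply (deficit_dist _ _ lam Hlam)|]. lra.
    + rewrite (RInt_Rplus _ _ _ _ (ex_RInt_Rplus _ _ _ _ Z1' Z3) Z2'), (RInt_Rplus _ _ _ _ Z1' Z3),
        (RInt_Rscal _ _ _ _ Z1), (RInt_Rscal _ _ _ _ Z2), RInt_Rconst. unfold P, Q. lra.
  - rewrite (RInt_Rplus _ _ _ _ (ex_RInt_Rplus _ _ _ _ Y1 Y2) Y3), (RInt_Rplus _ _ _ _ Y1 Y2),
      (RInt_Rscal _ _ _ _ X1), (RInt_Rscal _ _ _ _ X2), (RInt_Rscal _ _ _ _ D1).
    assert (L1 : lam * RInt P (- R0) R0 <= lam * ((PI - 2 * (PI / 4)) * B0)) by (apply Rmult_le_compat_l; lra).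
    assert (L2 : lam * (PI / 2) * RInt (fun x => Cmod (g0 x)) (- R0) R0 <= lam * (PI / 2) * B0).
    { apply Rmult_le_compat_l; auto. apply Rmult_le_pos; lra. }
    assert (L3 : 28 / lam * RInt Q (- R0) R0 <= 28 / lam * (2 * PI * (lam * lam))).
    { apply Rmult_le_compat_l; auto. apply Rdiv_le_0_compat; lra. }
    replace (28 / lam * (2 * PI * (lam * lam))) with (56 * PI * lam) in L3 by (field; lra).
    eapply Rle_trans; [apply Rplus_le_compat; [apply Rplus_le_compat; [exact L1|exact L2]|exact L3]|]. right; field.
Qed.

Lemma diff_window y y' s u1 u2 a b X : Rabs y < psi -> Rabs y' < psi -> a <= b -> - X <= a - s -> b - s <= X -> u1 = u2 + s ->
  RInt (fun x => Cmod (G (x + u2, y) - G (x - s, y'))) a b <= RInt (fun x => Cmod (G (x + u1, y) - G (x, y'))) (- X) X.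
Proof.
  intros Hy Hy' Hab Ha Hb ->.
  assert (C1 : forall t, continuous (fun x => Cmod (G (x + (u2 + s), y) - G (x, y'))) t).
  { intros t. cont. apply cont_line_comp; auto; cont. apply cont_line; auto. }
  rewrite (RInt_eq _ (fun x => (fun x => Cmod (G (x + (u2 + s), y) - G (x, y'))) (x + - s))).
  - rewrite (RInt_translate (fun x => Cmod (G (x + (u2 + s), y) - G (x, y'))) (- s) a b Hab) by (intros; apply C1).
    apply RInt_sub_le; try lra; auto. intros; apply Cmod_ge_0.
  - auto.
  - intros t _. replace (t + - s + (u2 + s)) with (t + u2) by ring. reflexivity.
Qed.

(** For each angle th, the lines at y' and at y1 are compared with the line at [y] translated by s
    and by s1. The displacements differ by at most (psi - y1) sg, so the two translates are close by
    [translation_continuity]. Averaging over th then allows [line_close] to be used. *)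
Lemma riesz_convergence eps : 0 < eps -> exists y1, 0 < y1 < psi /\
  forall y' R0, y1 <= y' < psi -> 0 <= R0 -> RInt (fun x => Cmod (G (x, y') - G (x, y1))) (- R0) R0 <= eps.
Proof.
  intros Heps. assert (HPI := PI_RGT_0).
  assert (HB0 : 0 <= B0).
  { eapply Rle_trans; [|apply (HB 0 0)]; try lra; [|rewrite Rabs_R0; lra]. rewrite Ropp_0, RInt_point. apply Rle_refl. }
  (* Two uses of [line_close] and one translation over an angular range of length pi / 2 add up to
     (pi / 2) lam M. *)
  set (M := 4 * (B0 + 56) + 1). assert (HM : 0 < M) by (unfold M; lra).
  set (lam := eps / M). assert (Hlam : 0 < lam) by (apply Rdiv_lt_0_compat; auto).
  destruct (line_close lam Hlam) as (y & X0 & Hy & HX0 & HC).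
  assert (Ay : Rabs y < psi) by (apply Rabs_def1; lra).
  destruct (translation_continuity y lam Ay Hlam) as (d & Hd & HT).
  set (sg := / PI * ln ((1 + cos (PI / 4)) / (1 - cos (PI / 4)))).
  assert (SB : forall b th, 0 <= b -> PI / 4 <= th <= PI - PI / 4 -> Rabs (strip_abscissa b th) <= b * sg).
  { intros b th Hb Hth. apply (strip_abscissa_bound (PI / 4)); auto. lra. }
  assert (Hsg : 0 <= sg).
  { assert (Q := SB 1 (PI / 2) ltac:(lra) ltac:(lra)). generalize (Rabs_pos (strip_abscissa 1 (PI / 2))). lra. }
  (* High enough that (psi - y1) sg <= d; the added 1 avoids division by zero. *)
  set (y1 := Rmax ((y + psi) / 2) (psi - d / (sg + 1))).
  assert (Hdsg : 0 < d / (sg + 1)) by (apply Rdiv_lt_0_compat; lra).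
  assert (Hy1 : y < y1 < psi /\ psi - d / (sg + 1) <= y1).
  { unfold y1. split; [split|apply Rmax_r]. apply Rlt_le_trans with ((y + psi) / 2). lra. apply Rmax_l. apply Rmax_lub_lt; lra. }
  assert (Hw : (psi - y1) * sg <= d).
  { apply Rle_trans with (d / (sg + 1) * sg). apply Rmult_le_compat_r; lra.
    apply Rle_trans with (d / (sg + 1) * (sg + 1)). apply Rmult_le_compat_l; lra. right; field; lra. }
  exists y1. split. lra. intros y' R0 Hy' HR0.
  (* Contains the window of half length [R0] after displacement by at most psi sg, and exceeds the
     threshold [X0]. *)
  set (R' := R0 + psi * sg + X0).
  assert (Hpsg : 0 <= psi * sg) by (apply Rmult_le_pos; lra).
  assert (Ay' : Rabs y' < psi) by (apply Rabs_def1; lra). assert (Ay1 : Rabs y1 < psi) by (apply Rabs_def1; lra).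
  destruct (HC y' R' ltac:(lra) ltac:(unfold R'; lra)) as [X1 I1].
  destruct (HC y1 R' ltac:(lra) ltac:(unfold R'; lra)) as [X2 I2].
  set (q := fun th => RInt (fun x => Cmod (G (x + strip_abscissa (y' - y) th, y') - G (x, y))) (- R') R') in *.
  set (q1 := fun th => RInt (fun x => Cmod (G (x + strip_abscissa (y1 - y) th, y1) - G (x, y))) (- R') R') in *.
  set (D := RInt (fun x => Cmod (G (x, y') - G (x, y1))) (- R0) R0).
  assert (HDth : forall th, PI / 4 <= th <= PI - PI / 4 -> D <= q th + q1 th + lam).
  { intros th Hth.
    set (s := strip_abscissa (y' - y) th). set (s1 := strip_abscissa (y1 - y) th).
    assert (Bs : Rabs s <= psi * sg).
    { eapply Rle_trans; [apply SB; auto; lra|]. apply Rmult_le_compat_r; lra. }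
    assert (Bs1 : Rabs s1 <= psi * sg).
    { eapply Rle_trans; [apply SB; auto; lra|]. apply Rmult_le_compat_r; lra. }
    assert (Bd : Rabs (s1 - s) <= d).
    { replace (s1 - s) with (- strip_abscissa (y' - y1) th) by (unfold s1, s, strip_abscissa; field; lra).
      rewrite Rabs_Ropp. eapply Rle_trans; [apply SB; auto; lra|].
      eapply Rle_trans; [|exact Hw]. apply Rmult_le_compat_r; lra. }
    apply Rabs_le_between in Bs. apply Rabs_le_between in Bs1.
    assert (W1 := diff_window y' y s s 0 (- R0) R0 R' Ay' Ay ltac:(lra) ltac:(unfold R'; lra) ltac:(unfold R'; lra) ltac:(ring)).
    assert (W2 := diff_window y1 y s1 s1 0 (- R0) R0 R' Ay1 Ay ltac:(lra) ltac:(unfold R'; lra) ltac:(unfold R'; lra) ltac:(ring)).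
    assert (W3 := diff_window y y s1 (s1 - s) (- s) (- R0) R0 R' Ay Ay ltac:(lra) ltac:(unfold R'; lra) ltac:(unfold R'; lra) ltac:(ring)).
    assert (W4 := HT (s1 - s) R' Bd ltac:(unfold R'; lra)).
    fold (q th) in W1. fold (q1 th) in W2.
    assert (XX : forall u v w z, Rabs w < psi -> Rabs z < psi -> ex_RInt (fun x => Cmod (G (x + u, w) - G (x - v, z))) (- R0) R0).
    { intros u v w z Hw' Hz'. apply ex_RInt_cont; [lra|]. intros; cont; apply cont_line_comp; auto; cont. }
    assert (E1 := XX 0 s y' y Ay' Ay). assert (E2 := XX 0 s1 y1 y Ay1 Ay). assert (E3 := XX (- s) s1 y y Ay Ay).
    apply Rle_trans with (RInt (fun x => Cmod (G (x + 0, y') - G (x - s, y)) + Cmod (G (x + 0, y1) - G (x - s1, y))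
       + Cmod (G (x + - s, y) - G (x - s1, y))) (- R0) R0).
    - apply RInt_mono. lra.
      + apply ex_RInt_cont; [lra|]. intros; cont; apply cont_line; auto.
      + exact (ex_RInt_Rplus _ _ _ _ (ex_RInt_Rplus _ _ _ _ E1 E2) E3).
      + intros x _. rewrite Rplus_0_r. change (x + - s) with (x - s).
        generalize (G (x, y')) (G (x, y1)) (G (x - s, y)) (G (x - s1, y)). intros z1 z2 z3 z4.
        replace (z1 - z2)%C with ((z1 - z3) + - (z2 - z4) + (z3 - z4))%C by ring.
        eapply Rle_trans; [apply Cmod_triangle|]. apply Rplus_le_compat_r.
        eapply Rle_trans; [apply Cmod_triangle|]. rewrite Cmod_opp. lra.
    - rewrite (RInt_Rplus _ _ _ _ (ex_RInt_Rplus _ _ _ _ E1 E2) E3), (RInt_Rplus _ _ _ _ E1 E2).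
      assert (W5 := Rle_trans _ _ _ W3 W4). apply Rplus_le_compat; auto. apply Rplus_le_compat; auto. }
  assert (HI : RInt (fun _ => D) (PI / 4) (PI - PI / 4) <= RInt (fun th => q th + q1 th + lam) (PI / 4) (PI - PI / 4)).
  { apply RInt_mono; auto. lra. apply ex_RInt_const. apply ex_RInt_Rplus. apply ex_RInt_Rplus; auto. apply ex_RInt_const. }
  assert (Xc : ex_RInt (fun _ => lam) (PI / 4) (PI - PI / 4)) by apply ex_RInt_const.
  rewrite (RInt_Rplus _ _ _ _ (ex_RInt_Rplus _ _ _ _ X1 X2) Xc), (RInt_Rplus _ _ _ _ X1 X2), !RInt_Rconst in HI.
  assert (HF : PI / 2 * D <= PI / 2 * (lam * M)).
  { replace (PI / 2 * (lam * M)) with (lam * (PI * (B0 + 56)) + lam * (PI * (B0 + 56)) + (PI - PI / 4 - PI / 4) * lam) by (unfold M; field).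
    replace (PI / 2 * D) with ((PI - PI / 4 - PI / 4) * D) by field.
    eapply Rle_trans; [exact HI|]. apply Rplus_le_compat_r. apply Rplus_le_compat; auto. }
  apply Rmult_le_reg_l in HF; [|lra]. replace (lam * M) with eps in HF by (unfold lam; field; lra). exact HF.
Qed.

End Riesz.

(** * Convergence towards the boundary of a sector *)

Lemma exp_1_ge_2 : 2 <= exp 1.
Proof. generalize (exp_ineq1 1 ltac:(lra)); lra. Qed.

Lemma Cmod_minus_sym (a b : C) : Cmod (a - b) = Cmod (b - a).
Proof. rewrite <- Cmod_opp. apply f_equal. ring. Qed.

(** Cauchy's formula on a truncated sector whose radii are comparable with r, so that by scale
    invariance K does not depend on r. In logarithmic coordinates this is the boundedness on smaller
    strips assumed for the boundary convergence. *)
Lemma pointwise_bound (psi : R) (f : C -> C) (B y : R) : 0 < psi < PI -> 0 <= y < psi -> holo_on psi f ->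
  (forall a, Rabs a < psi -> rayL1 f a B) ->
  exists K, forall r th, 0 < r -> Rabs th <= y -> r * Cmod (f (polar r th)) <= K.
Proof.
  intros Hpsi Hy Hf HB. assert (HPI := PI_RGT_0).
  set (be := (y + psi) / 2). assert (Hbe : y < be < psi) by (unfold be; lra).
  assert (HB0 : 0 <= B).
  { eapply Rle_trans; [|apply (HB 0 ltac:(rewrite Rabs_R0; lra) 1 1); lra]. rewrite RInt_point. apply Rle_refl. }
  assert (Hg := gap_pos (be - y) ltac:(lra)). set (g := gap (be - y)) in *.
  (* The radii are searched in intervals of logarithmic length 1, so [e] must exceed the total mass
     2 be B. *)
  set (e := 2 * be * B + 1). assert (He : 0 < e) by (unfold e; nra).
  assert (S : forall r th, 0 < r -> - be <= th <= be -> sector psi (polar r th)).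
  { intros. apply sector_polar; auto. apply Rabs_def1; lra. }
  assert (Sf : in_sec (- be) be (continuous f)) by (intros r th Hr Hth; apply (holo_on_continuous psi f Hf), S; auto).
  exists (B * / g + B * / g + e * 2 + e * 2). intros r th Hr Hth. apply Rabs_le_between in Hth.
  assert (E1 := exp_1_ge_2). assert (X1 := exp_pos (-1)). assert (X2 := exp_pos (-2)).
  assert (E2 : exp 1 * exp (-1) = 1) by (rewrite <- exp_plus, Rplus_opp_r; apply exp_0).
  assert (E3 : exp (-1) <= 1 / 2) by nra.
  assert (Lr : forall u, ln (r * exp u) = ln r + u) by (intros; rewrite ln_mult by (auto; apply exp_pos); rewrite ln_exp; auto).
  destruct (exists_small_arc f (- be) be B (r * exp (-2)) (r * exp (-1)) e) as (a & Ha & Ea); auto; try lra.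
  { nra. } { apply Rmult_le_compat_l; [lra|]. apply exp_le_exp; lra. } { intros; apply HB, Rabs_def1; lra. }
  { rewrite !Lr. unfold e; lra. }
  destruct (exists_small_arc f (- be) be B (r * exp 1) (r * exp 2) e) as (b & Hb & Eb); auto; try lra.
  { nra. } { apply Rmult_le_compat_l; [lra|]. apply exp_le_exp; lra. } { intros; apply HB, Rabs_def1; lra. }
  { rewrite !Lr. unfold e; lra. }
  assert (Ha0 : 0 < a) by nra. assert (Ha1 : a <= r * (1 / 2)) by nra. assert (Hb1 : r * 2 <= b) by nra.
  set (p := polar r th).
  assert (Dp : forall s c, 0 < s -> s = a \/ s = b \/ c = - be \/ c = be -> 
     (Cmod (polar s c - p) >= / 2 * r /\ (s = a \/ s = b)) \/ (Cmod (polar s c - p) >= g * r /\ (c = - be \/ c = be))).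
  { intros s c Hs [ -> | [ -> | Hc]].
    - left. split; auto. generalize (Cmod_sub_ge p (polar a c)). rewrite Cmod_minus_sym. unfold p; rewrite !Cmod_polar by lra. lra.
    - left. split; auto. generalize (Cmod_sub_ge (polar b c) p). unfold p; rewrite !Cmod_polar by lra. lra.
    - right. split; auto. apply Rle_ge. apply Rle_trans with (g * (s + r)). apply Rmult_le_compat_l; lra.
      apply dist_rays; try lra. destruct Hc; subst c; [rewrite Rabs_left1|rewrite Rabs_pos_eq]; lra. }
  assert (Dpos : forall s c, 0 < s -> s = a \/ s = b \/ c = - be \/ c = be -> 0 < Cmod (polar s c - p)).
  { intros s c Hs Hsc. assert (0 < g * r) by nra. destruct (Dp s c Hs Hsc); lra. }
  set (h := fun z => (f z * (1 / (z - p)))%C).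
  assert (EC := sector_cauchy f (fun _ => 1%C) a b (- be) be r th ltac:(lra) ltac:(lra) ltac:(lra) ltac:(lra)).
  specialize (EC ltac:(intros s c Hs Hc; apply Hf, S; auto) ltac:(intros s c _ _; Holo) eq_refl). change (Gam h a b (- be) be = (2 * PI * Ci * f p)%C) in EC.
  assert (Hc : forall s c, a <= s <= b -> - be <= c <= be -> s = a \/ s = b \/ c = - be \/ c = be -> continuous h (polar s c)).
  { intros s c Hs Hc Hsc. unfold h. assert (Q := Dpos s c ltac:(lra) Hsc). cont. apply Sf; auto; lra.
    intros E. rewrite E, Cmod_0 in Q. lra. }
  assert (HG := Gam_bound h a b (- be) be ltac:(lra) ltac:(lra) ltac:(lra) Hc).
  rewrite EC, Cmod_mult, Cmod_two_pi_i in HG.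
  assert (Mh : forall s c m, 0 < m -> m <= Cmod (polar s c - p) -> Cmod (h (polar s c)) <= / m * Cmod (f (polar s c))).
  { intros s c m Hm Hle. unfold h. rewrite Cmod_mult, Cmod_div, Cmod_1, Rmult_comm. 
    2:{ intros E. rewrite E, Cmod_0 in Hle. lra. }
    apply Rmult_le_compat_r. apply Cmod_ge_0. unfold Rdiv; rewrite Rmult_1_l. apply Rinv_le_contravar; lra. }
  assert (RY : forall c, c = - be \/ c = be -> RInt (fun t => Cmod (h (polar t c))) a b <= / (g * r) * B).
  { intros c Hcc. assert (- be <= c <= be) by (destruct Hcc; lra).
    eapply Rle_trans. apply (RInt_Cmod_scal_le (fun t => f (polar t c)) (fun t => h (polar t c)) a b (/ (g * r))); try lra.
    - intros t Ht. apply continuous_ray, Sf; lra.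
    - intros t Ht. apply (continuous_ray h t c), Hc; auto.
    - intros t Ht. apply Mh. nra. destruct (Dp t c ltac:(lra) ltac:(auto)) as [[D _]|[D _]]; [|lra].
      apply Rle_trans with (g * (t + r)). apply Rmult_le_compat_l; lra.
      apply dist_rays; try lra. destruct Hcc; subst c; [rewrite Rabs_left1|rewrite Rabs_pos_eq]; lra.
    - apply Rmult_le_compat_l. left; apply Rinv_0_lt_compat; nra. apply HB; try lra. apply Rabs_def1; lra. }
  assert (AR : forall s, s = a \/ s = b -> 0 < s -> s * arcint f (- be) be s <= e ->
     s * RInt (fun c => Cmod (h (polar s c))) (- be) be <= / (/ 2 * r) * e).
  { intros s Hs Hs0 Hse. assert (a <= s <= b) by (destruct Hs; lra).
    apply Rle_trans with (s * (/ (/ 2 * r) * arcint f (- be) be s)).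
    - apply Rmult_le_compat_l; [lra|].
      apply (RInt_Cmod_scal_le (fun c => f (polar s c)) (fun c => h (polar s c)) (- be) be (/ (/ 2 * r))); try lra.
      + intros c Hcc. apply continuous_ray, Sf; lra.
      + intros c Hcc. apply (continuous_ray h s c), Hc; auto; tauto.
      + intros c Hcc. apply Mh. nra. destruct Hs; subst s.
        * generalize (Cmod_sub_ge p (polar a c)). rewrite Cmod_minus_sym. unfold p; rewrite !Cmod_polar by lra. lra.
        * generalize (Cmod_sub_ge (polar b c) p). unfold p; rewrite !Cmod_polar by lra. lra.
    - replace (s * (/ (/ 2 * r) * arcint f (- be) be s)) with (/ (/ 2 * r) * (s * arcint f (- be) be s)) by ring.
      apply Rmult_le_compat_l; auto. left; apply Rinv_0_lt_compat; nra. }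
  assert (R1 := RY (- be) ltac:(auto)). assert (R2 := RY be ltac:(auto)).
  assert (A1 := AR a ltac:(auto) ltac:(lra) Ea). assert (A2 := AR b ltac:(auto) ltac:(lra) Eb).
  set (F := Cmod (f p)) in *.
  assert (HF : F <= / (g * r) * B + / (g * r) * B + / (/ 2 * r) * e + / (/ 2 * r) * e).
  { assert (0 <= F) by apply Cmod_ge_0. assert (F <= 2 * PI * F) by (generalize PI2_1; nra). lra. }
  apply Rle_trans with (r * (/ (g * r) * B + / (g * r) * B + / (/ 2 * r) * e + / (/ 2 * r) * e)).
  apply Rmult_le_compat_l; lra. right; field; lra.
Qed.

(** The factor Cexp w in [G] is the Jacobian that turns line integrals of |G| into ray integrals of
    |f|; its direction is the factor [polar 1 phi] in the conclusion. *)
Lemma boundary_convergence (psi : R) (f : C -> C) (B eps : R) : 0 < psi < PI -> holo_on psi f ->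
  (forall a, Rabs a < psi -> rayL1 f a B) -> 0 < eps ->
  exists y1, 0 < y1 < psi /\ forall phi a b, y1 <= phi < psi -> 0 < a -> a <= b ->
    RInt (fun t => Cmod (polar 1 phi * f (polar t phi) - polar 1 y1 * f (polar t y1))) a b <= eps.
Proof.
  intros Hpsi Hf HB Heps.
  set (G := fun w : C => (f (Cexp w) * Cexp w)%C).
  assert (EG : forall x y, G (x, y) = (RtoC (exp x) * (polar 1 y * f (polar (exp x) y)))%C).
  { intros x y. unfold G, Cexp; simpl fst; simpl snd. generalize (f (polar (exp x) y)). intros z.
    replace (polar (exp x) y) with (RtoC (exp x) * polar 1 y)%C by Csolve. ring. }
  assert (MG : forall x y y', Cmod (G (x, y) - G (x, y')) = Cmod (polar 1 y * f (polar (exp x) y) - polar 1 y' * f (polar (exp x) y')) * exp x).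
  { intros. rewrite !EG. replace (RtoC (exp x) * (polar 1 y * f (polar (exp x) y)) - RtoC (exp x) * (polar 1 y' * f (polar (exp x) y')))%C
      with (RtoC (exp x) * (polar 1 y * f (polar (exp x) y) - polar 1 y' * f (polar (exp x) y')))%C by ring.
    rewrite Cmod_mult, Cmod_R, Rabs_pos_eq by (left; apply exp_pos). apply Rmult_comm. }
  assert (Sec : forall w, Rabs (Im w) < psi -> sector psi (Cexp w)).
  { intros w Hw. apply sector_polar; auto. apply exp_pos. }
  assert (Cr : forall a, Rabs a < psi -> forall t, 0 < t -> continuous (fun t => f (polar t a)) t).
  { intros c Hc t Ht. apply continuous_ray, (holo_on_continuous psi); auto. apply sector_polar; auto. }
  destruct (riesz_convergence G psi B ltac:(lra)) with (eps := eps) as (y1 & Hy1 & H); auto.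
  - intros w Hw. unfold G. apply holo_mult. apply holo_comp. apply Hf, Sec; auto. exists (Cexp w). apply cderiv_Cexp. exists (Cexp w). apply cderiv_Cexp.
  - intros y X Hy HX. 
    assert (E0 := RInt_exp_subst (fun t => Cmod (f (polar t y))) (exp (- X)) (exp X) (exp_pos _)).
    rewrite !ln_exp in E0. 
    rewrite (RInt_eq (fun x => Cmod (G (x, y))) (fun x => Cmod (f (polar (exp x) y)) * exp x)); try lra.
    2:{ intros x _. unfold G. rewrite Cmod_mult. unfold Cexp; simpl. rewrite (Cmod_polar (exp x)) by (left; apply exp_pos). auto. }
    assert (exp (- X) <= exp X) by (apply exp_le_exp; lra).
    rewrite E0; auto. apply HB; auto. apply exp_pos.
    intros t Ht. cont. apply Cr; auto. generalize (exp_pos (- X)); lra.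
  - intros y Hy. destruct (pointwise_bound psi f B y) as [K HK]; auto. exists K. intros w Hw.
    unfold G. rewrite Cmod_mult. unfold Cexp at 2. rewrite Cmod_polar by (left; apply exp_pos).
    rewrite Rmult_comm. apply HK; auto. apply exp_pos.
  - exists y1. split; auto. intros phi a b Hphi Ha Hab.
    set (D := fun t => Cmod (polar 1 phi * f (polar t phi) - polar 1 y1 * f (polar t y1))).
    assert (CD : forall t, 0 < t -> continuous D t).
    { intros t Ht. unfold D. cont; apply Cr; auto; apply Rabs_def1; lra. }
    set (R0 := Rmax (- ln a) (ln b)).
    assert (HL : ln a <= ln b) by (destruct Hab as [Hab | ->]; [left; apply ln_increasing; auto | lra]).
    assert (- ln a <= R0) by apply Rmax_l. assert (ln b <= R0) by apply Rmax_r.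
    rewrite <- (RInt_exp_subst D a b); auto. 2: intros; apply CD; lra.
    eapply Rle_trans; [|apply (H phi R0); lra].
    rewrite (RInt_eq (fun x => Cmod (G (x, phi) - G (x, y1))) (fun x => D (exp x) * exp x)); try lra.
    2:{ intros x _. apply MG. }
    apply RInt_sub_le; try lra.
    + intros t _. assert (Ce := continuous_exp_comp (fun x : R => x) t (continuous_id t)).
      apply (continuous_Rmult (fun t => D (exp t)) exp); auto. apply (continuous_Rcomp D exp); auto. apply CD, exp_pos.
    + intros t _. apply Rmult_le_pos. apply Cmod_ge_0. left; apply exp_pos.
Qed.

(** * Strong continuity *)

Lemma RInt_inv_sqr_eq (C0 c t1 t2 : R) : 0 < c + t1 -> t1 <= t2 ->
  RInt (fun t => C0 / ((c + t) * (c + t))) t1 t2 = C0 / (c + t1) - C0 / (c + t2) :> R.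
Proof.
  intros Hc Ht.
  rewrite (RInt_FTC (fun t => - (C0 / (c + t)))); auto.
  - lra.
  - intros t H. auto_derive. lra. field. lra.
  - intros t H. cont. apply Rmult_integral_contrapositive_currified; lra.
Qed.

(** The form of [shift_weight] with an arbitrary constant. *)
Definition rise_weight (c r s : R) : R := c * (r / (s + r)).

Lemma rise_weight_bounds c r s : 0 <= c -> 0 < r -> 0 < s ->
  0 <= rise_weight c r s <= c /\ rise_weight c r s <= c * (r / s) /\ continuous (rise_weight c r) s.
Proof.
  intros Hc Hr Hs. unfold rise_weight.
  assert (Hq : 0 <= r / (s + r) <= 1).
  { split. apply Rdiv_le_0_compat; lra. apply Rmult_le_reg_r with (s + r). lra.
    unfold Rdiv. rewrite Rmult_assoc, Rinv_l by lra. lra. }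
  repeat split.
  - apply Rmult_le_pos; lra.
  - apply Rle_trans with (c * 1); [|lra]. apply Rmult_le_compat_l; lra.
  - apply Rmult_le_compat_l; [lra|]. apply Rmult_le_compat_l; [lra|]. apply Rinv_le_contravar; lra.
  - cont. lra.
Qed.

(** * Strong continuity on rays away from the boundary *)

Section Interior.

Variables (f : C -> C) (y be dl B : R).
Hypotheses (Hy : 0 <= y) (Hdl : 0 < dl) (Hbe : y + dl <= be) (Hbe2 : be + dl <= PI).
Hypothesis Hf : in_sec (- be) be (holo f).
Hypothesis HB : forall a, - be <= a <= be -> rayL1 f a B.

Let g := gap dl.

Lemma gap_facts : 0 < g <= 1 /\ dl <= PI.
Proof. generalize (gap_pos dl) (gap_le_1 dl) PI_RGT_0. unfold g. intros. split; [split; auto; apply H|]; lra. Qed.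

Lemma dist_outer s r th a : 0 <= s -> 0 <= r -> Rabs th <= y -> a = - be \/ a = be -> g * (s + r) <= Cmod (polar s a - polar r th).
Proof.
  intros Hs Hr Hth Ha. apply Rabs_le_between in Hth. destruct gap_facts.
  apply dist_rays; try lra. destruct Ha; subst a; [rewrite Rabs_left1|rewrite Rabs_pos_eq]; lra.
Qed.

(* The factor [z (w + c) / (w (z + c))] is 1 at [z = w] and makes the Cauchy kernel vanish at [z = 0];
   otherwise the integral of the kernel in [t] diverges logarithmically as [z -> 0]. *)
Lemma path_start_bound (w : R -> C) (r0 t1 t2 eps : R) : 0 <= r0 -> 0 < t1 <= t2 -> 0 < eps ->
  cont_on w t1 t2 ->
  (forall t, t1 <= t <= t2 -> exists r th, Rabs th <= y /\ w t = polar r th /\ g * (t + r0) <= r <= t + r0) ->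
  exists a b, 0 < a /\ a <= b /\
    2 * PI * RInt (fun t => Cmod (f (w t))) t1 t2 <=
      RInt (fun s => Cmod (f (polar s (- be))) * rise_weight (2 / g ^ 4) t2 s) a b
      + RInt (fun s => Cmod (f (polar s be)) * rise_weight (2 / g ^ 4) t2 s) a b + eps.
Proof.
  intros Hr0 Ht Heps Cw Hw. destruct gap_facts as [Hg Hdl2]. assert (HPI := PI_RGT_0).
  assert (Hg4 : 0 < g ^ 4) by (apply pow_lt; lra).
  (* Here c = t + r0 is comparable with |w t|, so [A] is bounded at all scales; its pole at - c has
     direction pi, at angle at least [dl] from the sector. *)
  set (A := fun (t : R) (z : C) => (z * (w t + RtoC (t + r0)) / (w t * (z + RtoC (t + r0))))%C).
  assert (Neg : forall s a c, 0 < s -> 0 < c -> - be <= a <= be -> g * (s + c) <= Cmod (polar s a + RtoC c)).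
  { intros s a c Hs Hc Ha. replace (polar s a + RtoC c)%C with (polar s a - polar c PI)%C.
    2:{ unfold polar. rewrite cos_PI, sin_PI. apply C_eq; simpl; ring. }
    apply dist_rays; try lra. rewrite Rabs_left1; lra. }
  assert (Neg0 : forall s a c, 0 < s -> 0 < c -> - be <= a <= be -> (polar s a + RtoC c)%C <> 0).
  { intros s a c Hs Hc Ha E. generalize (Neg s a c Hs Hc Ha). rewrite E, Cmod_0. assert (0 < g * (s + c)) by nra. lra. }
  assert (MA : forall t s a, t1 <= t <= t2 -> 0 < s -> - be <= a <= be ->
      Cmod (A t (polar s a)) <= s / (g * (s + (t + r0))) * (2 / g)).
  { intros t s a Htt Hs Ha. destruct (Hw t Htt) as (r & th & Hth & E & Hr).
    assert (0 < g * (t + r0)) by (apply Rmult_lt_0_compat; lra).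
    assert (w t <> 0) by (rewrite E; apply polar_neq_0; lra).
    unfold A. rewrite Cmod_div by (apply Cmult_neq_0; auto; apply Neg0; lra).
    rewrite !Cmod_mult, E, !Cmod_polar by lra.
    assert (H1 : Cmod (polar r th + RtoC (t + r0)) <= r + (t + r0)).
    { eapply Rle_trans; [apply Cmod_triangle|]. rewrite Cmod_polar, Cmod_R, Rabs_pos_eq by lra. lra. }
    assert (H2 := Neg s a (t + r0) Hs ltac:(lra) Ha).
    assert (0 < g * (s + (t + r0))) by (apply Rmult_lt_0_compat; lra).
    replace (s * Cmod (polar r th + RtoC (t + r0)) / (r * Cmod (polar s a + RtoC (t + r0)))) with
      (s / Cmod (polar s a + RtoC (t + r0)) * (Cmod (polar r th + RtoC (t + r0)) / r)) by (field; split; lra).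
    apply Rmult_le_compat.
    - apply Rdiv_le_0_compat; lra.
    - apply Rdiv_le_0_compat. apply Cmod_ge_0. lra.
    - apply Rmult_le_compat_l. lra. apply Rinv_le_contravar; lra.
    - apply Rmult_le_reg_r with r. lra. unfold Rdiv at 1. rewrite Rmult_assoc, Rinv_l, Rmult_1_r by lra.
      eapply Rle_trans; [exact H1|]. apply Rle_trans with (2 * (t + r0)). lra.
      apply Rle_trans with (2 / g * (g * (t + r0))). right; field; lra.
      apply Rmult_le_compat_l. apply Rdiv_le_0_compat; lra. lra. }
  assert (Far : forall t s a, t1 <= t <= t2 -> 0 < s -> - be <= a <= be -> s <= g * t1 / 2 \/ 2 * (t2 + r0) <= s ->
      g * t1 / 2 <= Cmod (polar s a - w t)).
  { intros t s a Htt Hs Ha Hor. destruct (Hw t Htt) as (r & th & Hth & E & Hr). rewrite E.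
    assert (g * t1 <= g * (t + r0)) by (apply Rmult_le_compat_l; lra).
    assert (g * t1 <= 1 * t1) by (apply Rmult_le_compat_r; lra). assert (0 < g * t1) by nra.
    destruct Hor.
    - generalize (Cmod_sub_ge (polar r th) (polar s a)). rewrite Cmod_minus_sym, !Cmod_polar by lra. lra.
    - generalize (Cmod_sub_ge (polar s a) (polar r th)). rewrite !Cmod_polar by lra. lra. }
  assert (Near : forall t s a, t1 <= t <= t2 -> 0 < s -> a = - be \/ a = be -> g * g * (s + (t + r0)) <= Cmod (polar s a - w t)).
  { intros t s a Htt Hs Ha. destruct (Hw t Htt) as (r & th & Hth & E & Hr). rewrite E.
    assert (0 < g * (t + r0)) by (apply Rmult_lt_0_compat; lra).
    eapply Rle_trans; [|apply dist_outer; auto; lra]. rewrite Rmult_assoc. apply Rmult_le_compat_l; nra. }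
  set (m := g * t1 / 2) in *. assert (Hm : 0 < m) by (unfold m; nra).
  assert (Pos : forall t s a, t1 <= t <= t2 -> 0 < s -> - be <= a <= be ->
     s <= m \/ 2 * (t2 + r0) <= s \/ a = - be \/ a = be -> 0 < Cmod (polar s a - w t)).
  { intros t s a Htt Hs Ha Hor. assert (Q : (s <= m \/ 2 * (t2 + r0) <= s) \/ (a = - be \/ a = be)) by tauto.
    destruct Q as [Q|Q]. eapply Rlt_le_trans; [|apply Far; eauto]; lra.
    eapply Rlt_le_trans; [|apply Near; eauto]. apply Rmult_lt_0_compat; [nra|lra]. }
  assert (KM : forall t s a, 0 < Cmod (polar s a - w t) -> Cmod (A t (polar s a) / (polar s a - w t)) = Cmod (A t (polar s a)) / Cmod (polar s a - w t)).
  { intros t s a H. apply Cmod_div. intros E. rewrite E, Cmod_0 in H. lra. }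
  assert (RAYK : forall a, a = - be \/ a = be -> forall s t, 0 < s -> t1 <= t <= t2 ->
     continuity_2d_pt (fun s t => 2 * s / g ^ 4 / ((s + r0 + t) * (s + r0 + t))) s t /\
     Cmod (A t (polar s a) / (polar s a - w t)) <= 2 * s / g ^ 4 / ((s + r0 + t) * (s + r0 + t))).
  { intros a Ha s t Hs Htt. assert (- be <= a <= be) by (destruct Ha; lra). split.
    - apply continuous_2d. cont; simpl. simpl in Hg4; lra. apply Rmult_integral_contrapositive_currified; lra.
    - rewrite KM by (apply Pos; auto). 
      assert (N := Near t s a Htt Hs Ha). assert (M := MA t s a Htt Hs ltac:(auto)).
      assert (0 < g * g * (s + (t + r0))) by (apply Rmult_lt_0_compat; [nra|lra]).
      apply Rle_trans with (s / (g * (s + (t + r0))) * (2 / g) * / (g * g * (s + (t + r0)))).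
      + apply Rmult_le_compat; auto. apply Cmod_ge_0. left; apply Rinv_0_lt_compat; lra. apply Rinv_le_contravar; lra.
      + right; field; split; lra. }
  (* The factor s gained from [A] makes the t-integral of s / (s + r0 + t)^2 at most t2 / (s + t2),
     which is small when t2 is small against s. *)
  assert (RAYW : forall s, 0 < s -> continuous (rise_weight (2 / g ^ 4) t2) s /\
     RInt (fun t => 2 * s / g ^ 4 / ((s + r0 + t) * (s + r0 + t))) t1 t2 <= rise_weight (2 / g ^ 4) t2 s).
  { intros s Hs. split. apply rise_weight_bounds; try lra. apply Rdiv_le_0_compat; lra.
    rewrite RInt_inv_sqr_eq by lra. unfold rise_weight.
    replace (2 * s / g ^ 4 / (s + r0 + t1) - 2 * s / g ^ 4 / (s + r0 + t2)) with
      (2 / g ^ 4 * ((t2 - t1) / (s + r0 + t1) * (s / (s + r0 + t2)))) by (field; repeat split; lra).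
    apply Rmult_le_compat_l. apply Rdiv_le_0_compat; lra.
    replace (t2 / (s + t2)) with (t2 / s * (s / (s + t2))) by (field; lra).
    apply Rmult_le_compat; try (apply Rdiv_le_0_compat; lra).
    - apply Rmult_le_compat; try lra. left; apply Rinv_0_lt_compat; lra. apply Rinv_le_contravar; lra.
    - apply Rmult_le_compat_l; [lra|]. apply Rinv_le_contravar; lra. }
  apply (sector_kernel_bound f (fun t z => A t z / (z - w t))%C (fun t => f (w t)) (- be) be B t1 t2 m (2 * (t2 + r0))
    (/ g * (2 / g) / m) (fun s t => 2 * s / g ^ 4 / ((s + r0 + t) * (s + r0 + t))) (fun s t => 2 * s / g ^ 4 / ((s + r0 + t) * (s + r0 + t)))
    (rise_weight (2 / g ^ 4) t2) (rise_weight (2 / g ^ 4) t2)); auto; try lra.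
  - unfold m. nra.
  - apply Rdiv_le_0_compat; auto. apply Rmult_le_pos. left; apply Rinv_0_lt_compat; lra. apply Rdiv_le_0_compat; lra.
  - intros r a Hr Ha. apply ex_derive_C_continuous, Hf; auto.
  - intros t Htt a b Ha Hb. destruct (Hw t Htt) as (r & th & Hth & E & Hr). apply Rabs_le_between in Hth.
    assert (g * t1 <= g * (t + r0)) by (apply Rmult_le_compat_l; lra). assert (0 < g * t1) by nra. unfold m in Ha.
    rewrite E. apply sector_cauchy; try lra; auto.
    + unfold A. intros s c Hs Hc. Holo. apply Cmult_neq_0. rewrite E; apply polar_neq_0; lra. apply Neg0; lra.
    + unfold A. rewrite E. field. split. apply Neg0; lra. apply polar_neq_0; lra.
  - intros t Htt r a Hr Ha Hor. assert (P := Pos t r a Htt Hr Ha Hor).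
    destruct (Hw t Htt) as (r' & th & Hth & E & Hr'). assert (0 < g * (t + r0)) by (apply Rmult_lt_0_compat; lra).
    unfold A. cont. apply Cmult_neq_0. rewrite E; apply polar_neq_0; lra. apply Neg0; lra.
    intros E'. rewrite E', Cmod_0 in P. lra.
  - intros t Htt r a Hr Ha Hor. rewrite KM. 2: apply Pos; tauto.
    assert (F := Far t r a Htt Hr Ha Hor). assert (M := MA t r a Htt Hr Ha).
    apply Rmult_le_compat. apply Cmod_ge_0. left; apply Rinv_0_lt_compat; lra. 
    + eapply Rle_trans; [exact M|]. apply Rmult_le_compat_r. apply Rdiv_le_0_compat; lra.
      replace (r / (g * (r + (t + r0)))) with (/ g * (r / (r + (t + r0)))) by (field; lra).
      apply Rle_trans with (/ g * 1); [|lra]. apply Rmult_le_compat_l. left; apply Rinv_0_lt_compat; lra.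
      apply Rmult_le_reg_r with (r + (t + r0)). lra. unfold Rdiv. rewrite Rmult_assoc, Rinv_l by lra. lra.
    + apply Rinv_le_contravar; lra.
  - intros t Htt. destruct (Hw t Htt) as (r & th & Hth & E & Hr). apply Rabs_le_between in Hth.
    apply (continuous_Ccomp f w). apply Cw; auto. rewrite E. apply ex_derive_C_continuous, Hf; try lra.
    assert (0 < g * (t + r0)) by (apply Rmult_lt_0_compat; lra). lra.
Qed.

(** The Cauchy kernels at w t and at polar t phi differ by a multiple of rho / (s + t)^2.
    Integrating from t = rho on gives rho / (s + rho), which remains bounded for small s; the piece
    t < rho is left to [path_start_bound]. *)
Lemma path_difference_bound (w : R -> C) (rho phi t2 eps : R) : 0 < rho <= t2 -> 0 < eps -> Rabs phi <= y ->
  cont_on w rho t2 ->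
  (forall t, rho <= t <= t2 -> Cmod (w t - polar t phi) <= rho /\ exists r th, Rabs th <= y /\ w t = polar r th /\ g * t <= r <= t + rho) ->
  exists a b, 0 < a /\ a <= b /\
    2 * PI * RInt (fun t => Cmod (f (w t) - f (polar t phi))) rho t2 <=
      RInt (fun s => Cmod (f (polar s (- be))) * rise_weight (/ g ^ 3) rho s) a b
      + RInt (fun s => Cmod (f (polar s be)) * rise_weight (/ g ^ 3) rho s) a b + eps.
Proof.
  intros Hrho Heps Hphi Cw Hw. destruct gap_facts as [Hg Hdl2]. assert (HPI := PI_RGT_0).
  assert (Hg3 : 0 < g ^ 3) by (apply pow_lt; lra).
  assert (Hin : forall t, rho <= t <= t2 -> exists r th, - y <= th <= y /\ w t = polar r th /\ 0 < g * rho <= g * t /\ g * t <= r <= t + rho /\ g * rho <= rho).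
  { intros t Ht. destruct (Hw t Ht) as (_ & r & th & Hth & E & Hr). exists r, th. apply Rabs_le_between in Hth.
    assert (g * rho <= g * t) by (apply Rmult_le_compat_l; lra). assert (0 < g * rho) by nra.
    assert (g * rho <= 1 * rho) by (apply Rmult_le_compat_r; lra). repeat split; try lra; auto. }
  assert (Hphi' := proj1 (Rabs_le_between _ _) Hphi).
  set (m := g * rho / 2). assert (Hm : 0 < m <= rho / 2) by (unfold m; split; nra).
  assert (Far : forall t s a, rho <= t <= t2 -> 0 < s -> s <= m \/ 2 * (t2 + rho) <= s ->
      m <= Cmod (polar s a - w t) /\ m <= Cmod (polar s a - polar t phi)).
  { intros t s a Ht Hs Hor. destruct (Hin t Ht) as (r & th & Hth & E & H1 & Hr & H2). rewrite E. unfold m in *.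
    destruct Hor; split.
    - generalize (Cmod_sub_ge (polar r th) (polar s a)). rewrite Cmod_minus_sym, !Cmod_polar by lra. lra.
    - generalize (Cmod_sub_ge (polar t phi) (polar s a)). rewrite Cmod_minus_sym, !Cmod_polar by lra. lra.
    - generalize (Cmod_sub_ge (polar s a) (polar r th)). rewrite !Cmod_polar by lra. lra.
    - generalize (Cmod_sub_ge (polar s a) (polar t phi)). rewrite !Cmod_polar by lra. lra. }
  assert (Near : forall t s a, rho <= t <= t2 -> 0 < s -> a = - be \/ a = be ->
      g * g * (s + t) <= Cmod (polar s a - w t) /\ g * (s + t) <= Cmod (polar s a - polar t phi)).
  { intros t s a Ht Hs Ha. destruct (Hin t Ht) as (r & th & Hth & E & H1 & Hr & H2). rewrite E. split.
    - eapply Rle_trans; [|apply dist_outer; auto; try lra; apply Rabs_le; lra]. rewrite Rmult_assoc. apply Rmult_le_compat_l; nra.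
    - apply dist_outer; auto; lra. }
  assert (Pos : forall t s a, rho <= t <= t2 -> 0 < s -> - be <= a <= be -> 
     s <= m \/ 2 * (t2 + rho) <= s \/ a = - be \/ a = be -> 0 < Cmod (polar s a - w t) /\ 0 < Cmod (polar s a - polar t phi)).
  { intros t s a Ht Hs Ha Hor. assert (Q : (s <= m \/ 2 * (t2 + rho) <= s) \/ (a = - be \/ a = be)) by tauto.
    destruct Q as [Q|Q]. destruct (Far t s a Ht Hs Q); lra. destruct (Near t s a Ht Hs Q).
    assert (0 < g * (s + t)) by (apply Rmult_lt_0_compat; lra). assert (0 < g * g * (s + t)) by (apply Rmult_lt_0_compat; nra). lra. }
  assert (Nz : forall z : C, 0 < Cmod z -> z <> 0) by (intros z Hz; apply Cmod_gt_0; auto).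
  set (K := fun (t : R) (z : C) => (1 / (z - w t) - 1 / (z - polar t phi))%C).
  assert (MK : forall t z, rho <= t <= t2 -> 0 < Cmod (z - w t) -> 0 < Cmod (z - polar t phi) ->
      Cmod (K t z) <= rho * / (Cmod (z - w t) * Cmod (z - polar t phi))).
  { intros t z Ht H1 H2. unfold K.
    replace (1 / (z - w t) - 1 / (z - polar t phi))%C with ((w t - polar t phi) / ((z - w t) * (z - polar t phi)))%C by (field; split; apply Nz; auto).
    rewrite Cmod_div by (apply Cmult_neq_0; apply Nz; auto). rewrite Cmod_mult. apply Rmult_le_compat_r.
    left; apply Rinv_0_lt_compat, Rmult_lt_0_compat; auto. apply Hw; auto. }
  assert (KC : forall t s a, rho <= t <= t2 -> 0 < s -> - be <= a <= be -> 
     s <= m \/ 2 * (t2 + rho) <= s \/ a = - be \/ a = be -> continuous (K t) (polar s a) /\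
     continuous (fun z => 1 / (z - w t))%C (polar s a) /\ continuous (fun z => 1 / (z - polar t phi))%C (polar s a)).
  { intros t s a Ht Hs Ha Hor. destruct (Pos t s a Ht Hs Ha Hor) as [H1 H2]. unfold K. repeat split; cont; apply Nz; auto. }
  assert (RAYK : forall a, a = - be \/ a = be -> forall s t, 0 < s -> rho <= t <= t2 ->
     continuity_2d_pt (fun s t => rho / g ^ 3 / ((s + t) * (s + t))) s t /\
     Cmod (K t (polar s a)) <= rho / g ^ 3 / ((s + t) * (s + t))).
  { intros a Ha s t Hs Ht. assert (- be <= a <= be) by (destruct Ha; lra). split.
    - apply continuous_2d. cont; simpl. apply Rmult_integral_contrapositive_currified; lra.
    - destruct (Pos t s a) as [H1 H2]; auto. destruct (Near t s a Ht Hs Ha) as [N1 N2].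
      eapply Rle_trans; [apply MK; auto|].
      replace (rho / g ^ 3 / ((s + t) * (s + t))) with (rho * / (g * g * (s + t) * (g * (s + t)))) by (field; split; lra).
      assert (0 < g * (s + t)) by (apply Rmult_lt_0_compat; lra). assert (0 < g * g * (s + t)) by (apply Rmult_lt_0_compat; nra).
      apply Rmult_le_compat_l. lra. apply Rinv_le_contravar. apply Rmult_lt_0_compat; lra. apply Rmult_le_compat; lra. }
  assert (RAYW : forall s, 0 < s -> continuous (rise_weight (/ g ^ 3) rho) s /\
     RInt (fun t => rho / g ^ 3 / ((s + t) * (s + t))) rho t2 <= rise_weight (/ g ^ 3) rho s).
  { intros s Hs. split. apply rise_weight_bounds; try lra. left; apply Rinv_0_lt_compat; lra.
    eapply Rle_trans. apply RInt_inv_sqr; try lra. apply Rdiv_le_0_compat; lra. unfold rise_weight. right; field; split; lra. }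
  apply (sector_kernel_bound f K (fun t => f (w t) - f (polar t phi))%C (- be) be B rho t2 m (2 * (t2 + rho))
    (rho * / (m * m)) (fun s t => rho / g ^ 3 / ((s + t) * (s + t))) (fun s t => rho / g ^ 3 / ((s + t) * (s + t)))
    (rise_weight (/ g ^ 3) rho) (rise_weight (/ g ^ 3) rho)); auto; try lra.
  - apply Rmult_le_pos. lra. left; apply Rinv_0_lt_compat; nra.
  - intros r a Hr Ha. apply ex_derive_C_continuous, Hf; auto.
  - intros t Ht a b Ha Hb. destruct (Hin t Ht) as (r & th & Hth & E & H1 & Hr & H2).
    assert (S : forall r th, - y <= th <= y -> a < r < b -> Gam (fun z => f z * (1 / (z - polar r th)))%C a b (- be) be = (2 * PI * Ci * f (polar r th))%C).
    { intros r' th' Hth' Hr'. apply (sector_cauchy f (fun _ => RtoC 1)); try lra; auto. intros s c _ _. Holo. }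
    assert (S1 := S r th Hth ltac:(unfold m in *; lra)). assert (S2 := S t phi Hphi' ltac:(lra)). rewrite <- E in S1.
    replace (2 * PI * Ci * (f (w t) - f (polar t phi)))%C with (2 * PI * Ci * f (w t) - 2 * PI * Ci * f (polar t phi))%C by ring.
    rewrite <- S1, <- S2. unfold Gam. rewrite <- rect_minus.
    + apply f_equal with (f := fun h => rect h (ln a) (ln b) (- be) be). extensionality z. unfold K. ring.
    + destruct (Req_dec a b); [lra|]. left; apply ln_increasing; lra.
    + lra.
    + intros x c Hx Hc Hor. assert (B1 : a <= exp x <= b).
      { rewrite <- (exp_ln a), <- (exp_ln b) by lra. split; apply exp_le_exp; lra. }
      assert (B2 : exp x <= m \/ 2 * (t2 + rho) <= exp x \/ c = - be \/ c = be).
      { destruct Hor as [-> |[-> |Hor]]; [left|right;left|tauto]; rewrite exp_ln; lra. }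
      assert (CE : continuous Cexp (x, c)) by (eapply is_derive_C_continuous, cderiv_Cexp).
      cont; auto. apply (continuous_Ccomp f Cexp); auto. apply ex_derive_C_continuous, Hf; auto; apply exp_pos.
      destruct (Pos t (exp x) c Ht (exp_pos x) Hc B2) as [P1 P2]. apply Nz. exact P1.
    + intros x c Hx Hc Hor. assert (B1 : a <= exp x <= b).
      { rewrite <- (exp_ln a), <- (exp_ln b) by lra. split; apply exp_le_exp; lra. }
      assert (B2 : exp x <= m \/ 2 * (t2 + rho) <= exp x \/ c = - be \/ c = be).
      { destruct Hor as [-> |[-> |Hor]]; [left|right;left|tauto]; rewrite exp_ln; lra. }
      assert (CE : continuous Cexp (x, c)) by (eapply is_derive_C_continuous, cderiv_Cexp).
      cont; auto. apply (continuous_Ccomp f Cexp); auto. apply ex_derive_C_continuous, Hf; auto; apply exp_pos.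
      destruct (Pos t (exp x) c Ht (exp_pos x) Hc B2) as [P1 P2]. apply Nz. exact P2.
  - intros t Ht r a Hr Ha Hor. exact (proj1 (KC t r a Ht Hr Ha Hor)).
  - intros t Ht r a Hr Ha Hor. destruct (Far t r a Ht Hr Hor). eapply Rle_trans; [apply MK; auto; lra|].
    apply Rmult_le_compat_l. lra. apply Rinv_le_contravar. nra. apply Rmult_le_compat; lra.
  - intros t Ht. destruct (Hin t Ht) as (r & th & Hth & E & H1 & Hr & H2). 
    assert (Cf : forall r th, 0 < r -> - y <= th <= y -> continuous f (polar r th)) by (intros; apply ex_derive_C_continuous, Hf; lra).
    cont. apply (continuous_Ccomp f w). apply Cw; auto. rewrite E. apply Cf; lra.
    apply (continuous_Ccomp f (fun t => polar t phi)). cont. apply Cf; lra.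
Qed.

End Interior.

(** Once a truncated integral is within [eps] of the improper one, at most [eps] of mass lies to its
    left. *)
Lemma small_start (h : R -> R) (B eps : R) : (forall t, 0 < t -> continuous h t) -> (forall t, 0 < t -> 0 <= h t) ->
  (forall a b, 0 < a -> a <= b -> RInt h a b <= B) -> 0 < eps ->
  exists d, 0 < d /\ forall a b, 0 < a -> a <= b <= d -> RInt h a b <= eps.
Proof.
  intros Hc Hp HB Heps.
  destruct (is_RInt_gen_of_bounded h Hc Hp B HB) as (l & Hl & _).
  assert (Hup := is_RInt_gen_upper h Hc Hp l Hl).
  assert (E : exists u v, 0 < u /\ u <= v /\ l - eps < RInt h u v).
  { apply NNPP. intros N. 
    destruct (Hl (fun x => l - eps < x)) as [Q S HQ HS HP].
    - exists (mkposreal eps Heps). intros z Hz. apply Rabs_def2 in Hz. unfold minus, plus, opp in Hz; simpl in Hz. lra.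
    - destruct HQ as [d HQ]. destruct HS as [M HS]. assert (Hd := cond_pos d).
      destruct (HP (d / 2) (Rmax M (d / 2) + 1)) as (v & Hv & Hvl).
      + apply HQ; [|lra]. unfold ball; simpl. unfold AbsRing_ball, abs, minus, plus, opp; simpl. rewrite Rabs_pos_eq; lra.
      + apply HS. generalize (Rmax_l M (d / 2)); lra.
      + apply N. exists (d / 2), (Rmax M (d / 2) + 1). split; [lra|]. split. generalize (Rmax_r M (d / 2)); lra.
        apply (is_RInt_unique (V := R_CompleteNormedModule)) in Hv. simpl in Hv. rewrite <- Hv in Hvl. exact Hvl. }
  destruct E as (u & v & Hu & Huv & E). exists u. split; auto. intros a b Ha Hab.
  assert (X : forall p q, 0 < p -> p <= q -> ex_RInt h p q).
  { intros p q Hp' Hpq. apply ex_RInt_cont; auto. intros; apply Hc; lra. }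
  assert (S1 := RInt_sub_le h a a b u ltac:(lra) ltac:(lra) ltac:(lra)).
  assert (S2 := Hup a v Ha ltac:(lra)). rewrite (RInt_split h a u v) in S2 by (apply X; lra).
  apply Rle_trans with (RInt h a u). apply S1; intros; [apply Hc|apply Hp]; lra. lra.
Qed.

(** Dominated convergence made explicit. Below some d0 the weight is at most c and the mass is
    small; above d0 the weight is at most c rho / d0. The predicate [P] lets one threshold serve a
    whole family of rays. *)
Lemma rise_small (P : R -> Prop) (h : R -> R -> R) (B c eps : R) :
  (forall x t, P x -> 0 < t -> continuous (h x) t) -> (forall x t, P x -> 0 < t -> 0 <= h x t) ->
  (forall x a b, P x -> 0 < a -> a <= b -> RInt (h x) a b <= B) ->
  (forall e, 0 < e -> exists d, 0 < d /\ forall x a b, P x -> 0 < a -> a <= b <= d -> RInt (h x) a b <= e) ->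
  0 <= c -> 0 <= B -> 0 < eps ->
  exists d, 0 < d /\ forall x rho a b, P x -> 0 < rho < d -> 0 < a -> a <= b -> RInt (fun s => h x s * rise_weight c rho s) a b <= eps.
Proof.
  intros Hc' Hp' HB' Hs' Hc0 HB0 Heps.
  destruct (Hs' (eps / (2 * (c + 1)))) as (d0 & Hd0 & H0'). apply Rdiv_lt_0_compat; lra.
  exists (d0 * (eps / (2 * (c * B + 1)))). assert (HcB : 0 <= c * B) by (apply Rmult_le_pos; auto).
  split. apply Rmult_lt_0_compat; auto. apply Rdiv_lt_0_compat; lra.
  intros x rho a b Hx. assert (Hc := fun t => Hc' x t Hx). assert (Hp := fun t => Hp' x t Hx). assert (HB := fun a b => HB' x a b Hx).
  assert (H0 := fun a b => H0' x a b Hx). clear Hc' Hp' HB' Hs' H0'. set (k := h x) in *. clearbody k. clear h. rename k into h.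
  intros Hrho Ha Hab.
  assert (W : forall s, 0 < s -> 0 <= rise_weight c rho s <= c /\ rise_weight c rho s <= c * (rho / s) /\ continuous (rise_weight c rho) s).
  { intros; apply rise_weight_bounds; lra. }
  assert (X : forall p q, 0 < p -> p <= q -> ex_RInt h p q).
  { intros p q Hp' Hpq. apply ex_RInt_cont; auto. intros; apply Hc; lra. }
  assert (CW : forall s, 0 < s -> continuous (fun s => h s * rise_weight c rho s) s).
  { intros s Hs. apply continuous_Rmult. apply Hc; auto. apply W; auto. }
  assert (XW : forall p q, 0 < p -> p <= q -> ex_RInt (fun s => h s * rise_weight c rho s) p q).
  { intros p q Hp' Hpq. apply ex_RInt_cont; auto. intros; apply CW; lra. }
  set (u := Rmin a d0). set (v := Rmax b d0).
  assert (Hu : 0 < u /\ u <= a /\ u <= d0). { unfold u. split. apply Rmin_pos; auto. split. apply Rmin_l. apply Rmin_r. }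
  assert (Hv : b <= v /\ d0 <= v) by (split; [apply Rmax_l|apply Rmax_r]).
  apply Rle_trans with (RInt (fun s => h s * rise_weight c rho s) u v).
  { apply RInt_sub_le; try lra; intros s Hs. apply CW; lra. apply Rmult_le_pos. apply Hp; lra. apply W; lra. }
  rewrite (RInt_split _ u d0 v) by (apply XW; lra).
  assert (A1 : RInt (fun s => h s * rise_weight c rho s) u d0 <= c * RInt h u d0).
  { rewrite <- RInt_Rscal by (apply X; lra). apply RInt_mono; try lra. apply XW; lra. apply ex_RInt_Rscal, X; lra.
    intros s Hs. rewrite (Rmult_comm c). apply Rmult_le_compat_l. apply Hp; lra. apply W; lra. }
  assert (A2 : RInt (fun s => h s * rise_weight c rho s) d0 v <= c * (rho / d0) * RInt h d0 v).
  { rewrite <- RInt_Rscal by (apply X; lra). apply RInt_mono; try lra. apply XW; lra. apply ex_RInt_Rscal, X; lra.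
    intros s Hs. rewrite (Rmult_comm (c * _)). apply Rmult_le_compat_l. apply Hp; lra.
    eapply Rle_trans; [apply W; lra|]. apply Rmult_le_compat_l; auto. apply Rmult_le_compat_l. lra. apply Rinv_le_contravar; lra. }
  assert (A3 := H0 u d0 ltac:(lra) ltac:(lra)). assert (A4 := HB d0 v ltac:(lra) ltac:(lra)).
  assert (A5 : c * RInt h u d0 <= eps / 2).
  { apply Rle_trans with (c * (eps / (2 * (c + 1)))). apply Rmult_le_compat_l; auto.
    apply Rle_trans with (eps / 2 * (c / (c + 1))). right; field; lra.
    apply Rle_trans with (eps / 2 * 1); [|lra]. apply Rmult_le_compat_l. lra.
    apply Rmult_le_reg_r with (c + 1). lra. unfold Rdiv. rewrite Rmult_assoc, Rinv_l; lra. }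
  assert (A6 : c * (rho / d0) * RInt h d0 v <= eps / 2).
  { apply Rle_trans with (c * (rho / d0) * B). apply Rmult_le_compat_l; auto. apply Rmult_le_pos; auto. apply Rdiv_le_0_compat; lra.
    replace (c * (rho / d0) * B) with (rho * (c * B / d0)) by (field; lra).
    apply Rle_trans with (d0 * (eps / (2 * (c * B + 1))) * (c * B / d0)). apply Rmult_le_compat_r. apply Rdiv_le_0_compat; lra. lra.
    apply Rle_trans with (eps / 2 * (c * B / (c * B + 1))). right; field; lra.
    apply Rle_trans with (eps / 2 * 1); [|lra]. apply Rmult_le_compat_l. lra.
    apply Rmult_le_reg_r with (c * B + 1). lra. unfold Rdiv. rewrite Rmult_assoc, Rinv_l; lra. }
  lra.
Qed.

Section Interior.

Variables (psi : R) (f : C -> C) (B : R).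
Hypothesis Hpsi : 0 < psi < PI.
Hypothesis Hf : holo_on psi f.
Hypothesis HB : forall a, Rabs a < psi -> rayL1 f a B.

Lemma sector_ray_continuous a t : Rabs a < psi -> 0 < t -> continuous (fun t => f (polar t a)) t.
Proof. intros. apply continuous_ray, (holo_on_continuous psi); auto. apply sector_polar; auto. Qed.

Lemma L1_bound_nonneg : 0 <= B.
Proof. eapply Rle_trans; [|apply (HB 0 ltac:(rewrite Rabs_R0; lra) 1 1); lra]. rewrite RInt_point. apply Rle_refl. Qed.

Lemma sector_ray_rise_small (be c eps : R) : 0 <= be < psi -> 0 <= c -> 0 < eps ->
  exists d, 0 < d /\ forall phi rho a b, phi = - be \/ phi = be -> 0 < rho < d -> 0 < a -> a <= b ->
    RInt (fun s => Cmod (f (polar s phi)) * rise_weight c rho s) a b <= eps.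
Proof.
  intros Hbe Hc Heps.
  apply (rise_small (fun phi => phi = - be \/ phi = be) (fun phi s => Cmod (f (polar s phi))) B); auto.
  - intros phi t Hphi Ht. cont. apply sector_ray_continuous; auto. apply Rabs_def1; destruct Hphi; lra.
  - intros. apply Cmod_ge_0.
  - intros phi a b Hphi Ha Hab. apply HB; auto. apply Rabs_def1; destruct Hphi; lra.
  - intros e He.
    assert (G : forall phi, Rabs phi < psi -> exists d, 0 < d /\ forall a b, 0 < a -> a <= b <= d -> RInt (fun s => Cmod (f (polar s phi))) a b <= e).
    { intros phi Hphi. apply (small_start (fun s => Cmod (f (polar s phi))) B); auto.
      - intros t Ht. cont. apply sector_ray_continuous; auto.
      - intros. apply Cmod_ge_0.
      - intros; apply HB; auto. }
    destruct (G (- be)) as (d1 & Hd1 & H1). apply Rabs_def1; lra.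
    destruct (G be) as (d2 & Hd2 & H2). apply Rabs_def1; lra.
    exists (Rmin d1 d2). split. apply Rmin_pos; auto. generalize (Rmin_l d1 d2) (Rmin_r d1 d2). intros L1 L2.
    intros phi a b [-> | ->] Ha Hab; [apply H1|apply H2]; lra.
  - apply L1_bound_nonneg.
Qed.

Lemma inner_rays (y : R) : 0 <= y < psi -> exists be dl, 0 < dl /\ y + dl <= be /\ be + dl <= psi /\ be < psi /\
  in_sec (- be) be (holo f) /\ (forall a, - be <= a <= be -> rayL1 f a B).
Proof.
  intros Hy. exists ((y + psi) / 2), ((psi - y) / 2). repeat split; try lra.
  - intros r th Hr Hth. apply Hf, sector_polar; auto. apply Rabs_def1; lra.
  - intros a Ha. apply HB, Rabs_def1; lra.
Qed.

(** [path_start_bound] along the ray itself, with r0 = 0, controls the mass up to [b] by weighted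
    masses on two fixed outer rays; this is where uniformity in [phi] comes from. *)
Lemma uniform_small_start (y eps : R) : 0 <= y < psi -> 0 < eps -> exists d, 0 < d /\
  forall phi a b, Rabs phi <= y -> 0 < a -> a <= b <= d -> RInt (fun t => Cmod (f (polar t phi))) a b <= eps.
Proof.
  intros Hy Heps. destruct (inner_rays y Hy) as (be & dl & Hdl & H1 & H2 & H3 & Hfb & HBb).
  assert (HPI := PI2_1). assert (Hg := gap_pos dl ltac:(lra)). assert (Hg1 := gap_le_1 dl).
  assert (Hg4 : 0 < gap dl ^ 4) by (apply pow_lt; lra).
  destruct (sector_ray_rise_small be (2 / gap dl ^ 4) eps ltac:(lra)) as (d & Hd & H); auto. apply Rdiv_le_0_compat; lra.
  exists (d / 2). split. lra. intros phi a b Hphi Ha Hab.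
  destruct (path_start_bound f y be dl B ltac:(lra) Hdl H1 ltac:(lra) Hfb HBb (fun t => polar t phi) 0 a b eps) as (u & v & Hu & Huv & E); try lra.
  - intros t Ht. cont.
  - intros t Ht. exists t, phi. split; auto. split; auto. split; [|lra]. nra.
  - assert (E1 := H (- be) b u v ltac:(auto) ltac:(lra) Hu Huv). assert (E2 := H be b u v ltac:(auto) ltac:(lra) Hu Huv).
    set (I := RInt (fun t => Cmod (f (polar t phi))) a b) in *.
    apply Rmult_le_reg_l with (2 * PI). lra. nra.
Qed.

Lemma uniform_rise_small (y c eps : R) : 0 <= y < psi -> 0 <= c -> 0 < eps ->
  exists d, 0 < d /\ forall phi rho a b, Rabs phi <= y -> 0 < rho < d -> 0 < a -> a <= b ->
    RInt (fun s => Cmod (f (polar s phi)) * rise_weight c rho s) a b <= eps.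
Proof.
  intros Hy Hc Heps.
  apply (rise_small (fun phi => Rabs phi <= y) (fun phi s => Cmod (f (polar s phi))) B); auto.
  - intros phi t Hphi Ht. cont. apply sector_ray_continuous; auto. lra.
  - intros. apply Cmod_ge_0.
  - intros phi a b Hphi Ha Hab. apply HB; auto. lra.
  - intros e He. apply uniform_small_start; auto.
  - apply L1_bound_nonneg.
Qed.

(** The integral is split at t = rho. Below, f (z + tau) and f z are each small by
    [path_start_bound]; above, [path_difference_bound] applies. These are the three shares of [eps].
    The condition on [y + th0] keeps |z + tau| comparable with t + rho. *)
Lemma interior_continuity (y th0 eps : R) : 0 <= th0 <= y -> y < psi -> y + th0 < PI -> 0 < eps -> exists d, 0 < d /\
  forall phi rho th a b, Rabs phi <= y -> Rabs th <= th0 -> 0 < rho < d -> 0 < a -> a <= b ->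
    RInt (fun t => Cmod (f (polar t phi + polar rho th) - f (polar t phi))) a b <= eps.
Proof.
  intros Hth0 Hy Hyth Heps. destruct (inner_rays y ltac:(lra)) as (be & dl0 & Hdl0 & H1' & H2' & H3 & Hfb & HBb).
  set (dl := Rmin dl0 (PI - (y + th0))).
  assert (Hdl : 0 < dl /\ dl <= dl0 /\ dl <= PI - (y + th0)).
  { unfold dl. split. apply Rmin_pos; lra. split. apply Rmin_l. apply Rmin_r. }
  assert (H1 : y + dl <= be) by lra. assert (H2 : be + dl <= PI) by lra.
  assert (HPI := PI2_1). assert (Hg := gap_pos dl ltac:(lra)). assert (Hg1 := gap_le_1 dl).
  assert (Hg4 : 0 < gap dl ^ 4) by (apply pow_lt; lra). assert (Hg3 : 0 < gap dl ^ 3) by (apply pow_lt; lra).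
  set (e := eps / 3). assert (He : 0 < e) by (unfold e; lra).
  destruct (sector_ray_rise_small be (2 / gap dl ^ 4) e ltac:(lra)) as (d1 & Hd1 & W1); auto. apply Rdiv_le_0_compat; lra.
  destruct (sector_ray_rise_small be (/ gap dl ^ 3) e ltac:(lra)) as (d2 & Hd2 & W2); auto. left; apply Rinv_0_lt_compat; lra.
  exists (Rmin d1 d2). split. apply Rmin_pos; auto. generalize (Rmin_l d1 d2) (Rmin_r d1 d2). intros L1 L2.
  intros phi rho th a b Hphi Hth Hrho Ha Hab.
  assert (Hphi' := proj1 (Rabs_le_between _ _) Hphi). assert (Hth' := proj1 (Rabs_le_between _ _) Hth).
  set (w := fun t => (polar t phi + polar rho th)%C).
  assert (Cw : forall t, continuous w t) by (intros; unfold w; cont).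
  assert (Pw : forall t, 0 < t -> exists r th', Rabs th' <= y /\ w t = polar r th' /\ gap dl * (t + rho) <= r <= t + rho).
  { intros t Ht. destruct (polar_add_between t phi rho th) as (r & th' & Hr & Hth2 & E); try lra. apply Rabs_def1; lra.
    exists r, th'. split; [|split; [exact E|]].
    - apply Rabs_le.
      assert (- y <= Rmin th phi) by (apply Rmin_glb; lra). assert (Rmax th phi <= y) by (apply Rmax_lub; lra). lra.
    - assert (Er : r = Cmod (w t)) by (unfold w; rewrite E, Cmod_polar; lra). rewrite Er. split.
      + replace (Cmod (w t)) with (Cmod (RtoC t + polar rho (th - phi))). apply Cmod_add_polar; lra.
        replace (w t) with ((RtoC t + polar rho (th - phi)) * polar 1 phi)%C. rewrite Cmod_mult, Cmod_polar by lra. ring.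
        unfold w. rewrite Cmult_plus_distr_r, polar_rotate. replace (th - phi + phi) with th by ring. apply f_equal2; auto. Csolve.
      + unfold w. eapply Rle_trans; [apply Cmod_triangle|]. rewrite !Cmod_polar; lra. }
  assert (Cf : forall r th, 0 < r -> Rabs th <= y -> continuous f (polar r th)).
  { intros r c Hr Hc. apply (holo_on_continuous psi); auto. apply sector_polar; auto. lra. }
  assert (Cfw : forall t, 0 < t -> continuous (fun t => f (w t)) t).
  { intros t Ht. apply (continuous_Ccomp f w); auto. destruct (Pw t Ht) as (r & th' & Hth2 & E & Hr). rewrite E. apply Cf; auto. nra. }
  assert (Cfz : forall t, 0 < t -> continuous (fun t => f (polar t phi)) t) by (intros; apply sector_ray_continuous; auto; lra).
  set (D := fun t => Cmod (f (w t) - f (polar t phi))). change (RInt D a b <= eps).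
  assert (CD : forall t, 0 < t -> continuous D t) by (intros; unfold D; cont; auto).
  set (u := Rmin a (rho / 2)). set (v := Rmax b rho).
  assert (Hu : 0 < u /\ u <= a /\ u <= rho / 2). { unfold u. split. apply Rmin_pos; lra. split. apply Rmin_l. apply Rmin_r. }
  assert (Hv : b <= v /\ rho <= v) by (split; [apply Rmax_l|apply Rmax_r]).
  assert (X : forall (h : R -> R) p q, (forall t, 0 < t -> continuous h t) -> 0 < p -> p <= q -> ex_RInt h p q).
  { intros h p q Hh Hp Hpq. apply ex_RInt_cont; auto. intros; apply Hh; lra. }
  apply Rle_trans with (RInt D u v).
  { apply RInt_sub_le; try lra; intros s Hs. apply CD; lra. apply Cmod_ge_0. }
  rewrite (RInt_split D u rho v) by (apply X; auto; lra).
  assert (X1 : ex_RInt (fun t => Cmod (f (w t))) u rho) by (apply X; try lra; intros; cont; auto).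
  assert (X2 : ex_RInt (fun t => Cmod (f (polar t phi))) u rho) by (apply X; try lra; intros; cont; auto).
  assert (A0 : RInt D u rho <= RInt (fun t => Cmod (f (w t))) u rho + RInt (fun t => Cmod (f (polar t phi))) u rho).
  { rewrite <- RInt_Rplus by auto. apply RInt_mono; try lra. apply X; auto; lra. apply ex_RInt_Rplus; auto.
    intros t _. unfold D. eapply Rle_trans; [apply Cmod_triangle|]. rewrite Cmod_opp. lra. }
  assert (S : forall w' r0, 0 <= r0 -> (forall t, continuous w' t) -> (forall t, 0 < t -> exists r th', Rabs th' <= y /\ w' t = polar r th' /\ gap dl * (t + r0) <= r <= t + r0) ->
     RInt (fun t => Cmod (f (w' t))) u rho <= e).
  { intros w' r0 Hr0 Cw' Pw'.
    destruct (path_start_bound f y be dl B ltac:(lra) ltac:(lra) H1 H2 Hfb HBb w' r0 u rho e) as (p & q & Hp & Hpq & E); try lra.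
    - intros t _; auto. 
    - intros t Ht. apply Pw'; lra.
    - assert (E1 := W1 (- be) rho p q ltac:(auto) ltac:(lra) Hp Hpq). assert (E2 := W1 be rho p q ltac:(auto) ltac:(lra) Hp Hpq).
      set (I := RInt (fun t => Cmod (f (w' t))) u rho) in *.
      apply Rmult_le_reg_l with (2 * PI). lra. nra. }
  assert (A1 := S w rho ltac:(lra) Cw Pw).
  assert (A2 := S (fun t => polar t phi) 0 ltac:(lra)). 
  specialize (A2 ltac:(intros; cont)).
  specialize (A2 ltac:(intros t Ht; exists t, phi; repeat split; auto; nra)).
  assert (A3 : RInt D rho v <= e).
  { destruct (path_difference_bound f y be dl B ltac:(lra) ltac:(lra) H1 H2 Hfb HBb w rho phi v e) as (p & q & Hp & Hpq & E); try lra; auto.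
    - intros t _; auto.
    - intros t Ht. split.
      + unfold w. replace (polar t phi + polar rho th - polar t phi)%C with (polar rho th) by ring. rewrite Cmod_polar; lra.
      + destruct (Pw t ltac:(lra)) as (r & th' & Hth2 & E & Hr). exists r, th'. repeat split; auto; nra.
    - assert (E1 := W2 (- be) rho p q ltac:(auto) ltac:(lra) Hp Hpq). assert (E2 := W2 be rho p q ltac:(auto) ltac:(lra) Hp Hpq).
      fold D in E. set (I := RInt D rho v) in *.
      apply Rmult_le_reg_l with (2 * PI). lra. nra. }
  unfold e in *. lra.
Qed.

(** The triangle inequality replaces the reference angle of [boundary_convergence] by any larger
    one, so it may be prescribed to lie beyond [y0]. *)
Lemma boundary_cauchy (y0 eps : R) : 0 < y0 < psi -> 0 < eps -> exists y, y0 <= y < psi /\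
  forall phi a b, y <= phi < psi -> 0 < a -> a <= b ->
    RInt (fun t => Cmod (polar 1 phi * f (polar t phi) - polar 1 y * f (polar t y))) a b <= eps.
Proof.
  intros Hy0 Heps. destruct (boundary_convergence psi f B (eps / 2) Hpsi Hf HB) as (y1 & Hy1 & H). lra.
  exists (Rmax y0 y1). assert (Hy : y0 <= Rmax y0 y1 /\ y1 <= Rmax y0 y1 /\ Rmax y0 y1 < psi).
  { split. apply Rmax_l. split. apply Rmax_r. apply Rmax_lub_lt; lra. }
  set (y := Rmax y0 y1) in *. split. lra. intros phi a b Hphi Ha Hab.
  assert (X : forall u v, 0 < u < psi -> 0 < v < psi -> ex_RInt (fun t => Cmod (polar 1 u * f (polar t u) - polar 1 v * f (polar t v))) a b).
  { intros u v Hu Hv. apply ex_RInt_cont; auto. intros t Ht. cont; apply sector_ray_continuous; try lra; apply Rabs_def1; lra. }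
  assert (X1 := X phi y1 ltac:(lra) ltac:(lra)). assert (X2 := X y y1 ltac:(lra) ltac:(lra)).
  replace eps with (eps / 2 + eps / 2) by field.
  eapply Rle_trans; [|apply Rplus_le_compat; [apply (H phi a b)|apply (H y a b)]; auto; lra].
  rewrite <- RInt_Rplus by auto. apply RInt_mono; auto. apply X; lra. apply ex_RInt_Rplus; auto.
  intros t _. generalize (polar 1 phi * f (polar t phi))%C (polar 1 y * f (polar t y))%C (polar 1 y1 * f (polar t y1))%C. intros p q r.
  replace (p - q)%C with ((p - r) + - (q - r))%C by ring. eapply Rle_trans; [apply Cmod_triangle|]. rewrite Cmod_opp. lra.
Qed.

End Interior.

Lemma ray_triangle (u v w : R -> C) (a b : R) : a <= b ->
  (forall t, a <= t <= b -> continuous u t) -> (forall t, a <= t <= b -> continuous v t) ->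
  (forall t, a <= t <= b -> continuous w t) -> (forall t, Cmod (u t) <= Cmod (v t) + Cmod (w t)) ->
  RInt (fun t => Cmod (u t)) a b <= RInt (fun t => Cmod (v t)) a b + RInt (fun t => Cmod (w t)) a b.
Proof.
  intros Hab Cu Cv Cw H.
  assert (Xv : ex_RInt (fun t => Cmod (v t)) a b) by (apply ex_RInt_Cmod; auto).
  assert (Xw : ex_RInt (fun t => Cmod (w t)) a b) by (apply ex_RInt_Cmod; auto).
  rewrite <- (RInt_Rplus _ _ _ _ Xv Xw). apply RInt_mono; auto. apply ex_RInt_Cmod; auto. apply ex_RInt_Rplus; auto.
Qed.

(** * Strong continuity uniformly up to the boundary *)

Section Continuity.

Variables (psi psi' : R) (f : C -> C) (B : R).
Hypothesis Hpsi : 0 < psi < PI.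
Hypothesis Hpsi' : 0 <= psi' < Rmin psi (PI - psi).
Hypothesis Hf : holo_on psi f.
Hypothesis HB : forall a, Rabs a < psi -> rayL1 f a B.

Let fc := sector_ray_continuous psi f Hf.

(** The uniform shift estimate is applied to g z = f z - e^(i sg) f (z e^(i sg)). On the ray [phi]
    its Poisson part sees the small L^1 norm of g, and on the outer ray, which is interior, the
    weight is small. The factor e^(i sg) is the one with which rays converge at the boundary. *)
Lemma rotated_difference_bound (sg phi rho th dl e : R) a b : 0 < dl -> psi' + 4 * dl <= Rmin psi (PI - psi) ->
  - dl <= sg <= 0 -> psi' < phi < psi -> Rabs th <= psi' -> 0 < rho -> 0 < e -> 0 < a -> a <= b ->
  (forall x u v, Rabs x <= psi' + 2 * dl -> 0 < u -> u <= v -> RInt (fun s => Cmod (f (polar s x)) * rise_weight (2 / gap dl ^ 4) rho s) u v <= e) ->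
  (forall u v, 0 < u -> u <= v -> RInt (fun t => Cmod (f (polar t phi) - polar 1 sg * f (polar t (phi + sg)))) u v <= e) ->
  RInt (fun t => Cmod (f (polar t phi + polar rho th) - polar 1 sg * f ((polar t phi + polar rho th) * polar 1 sg))%C) a b <= 2 * e.
Proof.
  intros Hdl Hdl2 Hsg Hphi Hth Hrho He Ha Hab HW HD. assert (HPI := PI2_1).
  assert (L1 := Rmin_l psi (PI - psi)). assert (L2 := Rmin_r psi (PI - psi)). apply Rabs_le_between in Hth.
  set (g := fun z => (f z - polar 1 sg * f (z * polar 1 sg))%C).
  assert (Eg : forall s x, g (polar s x) = (f (polar s x) - polar 1 sg * f (polar s (x + sg)))%C) by (intros; unfold g; rewrite polar_rotate; auto).
  (* Both [al] and [al + sg] stay within psi' + 2 dl in modulus, where the weighted bound is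
     assumed. *)
  set (al := - (psi' + dl)).
  assert (Hal : forall x, al <= x <= phi -> Rabs x < psi /\ Rabs (x + sg) < psi) by (unfold al; intros; split; apply Rabs_def1; lra).
  assert (Cg : forall x t, al <= x <= phi -> 0 < t -> continuous (fun t => g (polar t x)) t).
  { intros x t Hx Ht. destruct (Hal x Hx) as [Hx1 Hx2]. assert (C1 := fc x t Hx1 Ht). assert (C2 := fc (x + sg) t Hx2 Ht).
    apply (continuous_ext (fun t => (f (polar t x) - polar 1 sg * f (polar t (x + sg)))%C)). intros; rewrite Eg; auto. cont; auto. }
  destruct (shift_ray_below g al phi (2 * B) rho th dl a b e) as (u & v & Hu & Huv & E); auto; try (unfold al; lra).
  - intros r x Hr Hx. unfold g. destruct (Hal x Hx). Holo.
    + apply Hf, sector_polar; auto.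
    + apply (holo_comp f (fun z => z * polar 1 sg)%C). rewrite polar_rotate. apply Hf, sector_polar; auto. Holo.
  - intros x Hx u v Hu Huv. destruct (Hal x Hx) as [Hx1 Hx2]. replace (2 * B) with (B + B) by ring.
    eapply Rle_trans; [|apply Rplus_le_compat; [apply (HB x Hx1 u v)|apply (HB (x + sg) Hx2 u v)]; auto].
    apply (ray_triangle (fun t => g (polar t x)) (fun t => f (polar t x)) (fun t => f (polar t (x + sg)))); auto.
    + intros t Ht. apply Cg; auto; lra.
    + intros t Ht. apply fc; auto; lra.
    + intros t Ht. apply fc; auto; lra.
    + intros t. rewrite Eg. eapply Rle_trans; [apply Cmod_triangle|]. rewrite Cmod_opp, Cmod_mult, Cmod_polar by lra. lra.
  - fold (g). set (I := RInt (fun t => Cmod (g (polar t phi + polar rho th)%C)) a b) in *. change (I <= 2 * e).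
    assert (Wc : forall s, 0 < s -> continuous (shift_weight dl rho) s /\ 0 <= shift_weight dl rho s).
    { intros s Hs. split. apply (rise_weight_bounds (2 / gap dl ^ 4) rho s); auto.
      apply Rdiv_le_0_compat. lra. apply pow_lt, gap_pos; lra. apply shift_weight_bounds; lra. }
    destruct (Hal al ltac:(unfold al; lra)) as [Ha1 Ha2]. destruct (Hal phi ltac:(unfold al; lra)) as [Hp1 Hp2].
    assert (X : forall x, Rabs x < psi -> ex_RInt (fun s => Cmod (f (polar s x)) * shift_weight dl rho s) u v).
    { intros x Hx. apply ex_RInt_cont; auto. intros s Hs. apply continuous_Rmult. cont. apply fc; auto; lra. apply Wc; lra. }
    assert (A1 : RInt (fun s => Cmod (g (polar s al)) * shift_weight dl rho s) u v <= 2 * e).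
    { replace (2 * e) with (e + e) by ring.
      eapply Rle_trans; [|apply Rplus_le_compat; [apply (HW al u v)|apply (HW (al + sg) u v)]; auto; apply Rabs_le; unfold al; lra].
      change (rise_weight (2 / gap dl ^ 4)) with (shift_weight dl).
      rewrite <- (RInt_Rplus _ _ _ _ (X al Ha1) (X (al + sg) Ha2)). apply RInt_mono; auto.
      - apply ex_RInt_cont; auto. intros s Hs. apply continuous_Rmult. cont. apply Cg; unfold al; lra. apply Wc; lra.
      - apply ex_RInt_Rplus; apply X; auto.
      - intros s Hs. rewrite <- Rmult_plus_distr_r. apply Rmult_le_compat_r. apply Wc; lra.
        rewrite Eg. eapply Rle_trans; [apply Cmod_triangle|]. rewrite Cmod_opp, Cmod_mult, Cmod_polar by lra. lra. }
    assert (Xp : ex_RInt (fun s => Cmod (g (polar s phi))) u v).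
    { apply ex_RInt_Cmod; auto. intros s Hs. apply Cg; unfold al; lra. }
    assert (A2 : RInt (fun s => Cmod (g (polar s phi)) * (2 * PI)) u v <= 2 * PI * e).
    { rewrite (RInt_eq (fun s => Cmod (g (polar s phi)) * (2 * PI)) (fun s => (2 * PI) * Cmod (g (polar s phi)))) by (try lra; intros; ring).
      rewrite (RInt_Rscal _ _ _ _ Xp). apply Rmult_le_compat_l. lra.
      rewrite (RInt_eq (fun s => Cmod (g (polar s phi))) (fun t => Cmod (f (polar t phi) - polar 1 sg * f (polar t (phi + sg))))); auto.
      intros t _. rewrite Eg. auto. }
    apply Rmult_le_reg_l with (2 * PI). lra. nra.
Qed.

(** Beyond the reference angle [y], rotate z and tau together by sg = y - phi. With g as in
    [rotated_difference_bound], f (z + tau) - f z is g (z + tau) - g z plus the rotated copy of the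
    same difference on the ray [y], which is interior. *)
Lemma upper_continuity (eps : R) : 0 < eps -> exists d, 0 < d /\
  forall phi rho th a b, 0 <= phi < psi -> Rabs th <= psi' -> 0 < rho < d -> 0 < a -> a <= b ->
    RInt (fun t => Cmod (f (polar t phi + polar rho th) - f (polar t phi))) a b <= eps.
Proof.
  intros Heps. set (e := eps / 4). assert (He : 0 < e) by (unfold e; lra). assert (HPI := PI2_1).
  assert (L1 := Rmin_l psi (PI - psi)). assert (L2 := Rmin_r psi (PI - psi)).
  set (psi0 := Rmin psi (PI - psi)) in *. set (dl := (psi0 - psi') / 4).
  assert (Hdl : 0 < dl /\ psi' + 4 * dl = psi0) by (unfold dl; lra).
  assert (Hg4 : 0 < gap dl ^ 4) by (apply pow_lt, gap_pos; lra).
  (* A reference angle beyond psi - dl keeps the rotation below [dl], so the rotated tau has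
     argument at most psi' + dl in modulus, still admissible. *)
  destruct (boundary_cauchy psi f B Hpsi Hf HB (psi - dl) e) as (y & Hy & Hyb); try lra.
  destruct (uniform_rise_small psi f B Hpsi Hf HB (psi' + 2 * dl) (2 / gap dl ^ 4) e) as (d1 & Hd1 & HW); try lra.
  { apply Rdiv_le_0_compat; lra. }
  destruct (interior_continuity psi f B Hpsi Hf HB y (psi' + dl) e) as (d2 & Hd2 & HI); try lra.
  exists (Rmin d1 d2). split. apply Rmin_pos; auto. generalize (Rmin_l d1 d2) (Rmin_r d1 d2). intros M1 M2.
  intros phi rho th a b Hphi Hth Hrho Ha Hab.
  destruct (Rle_lt_dec phi y) as [Hle|Hgt].
  { apply Rle_trans with e; [|unfold e; lra]. apply HI; try lra. rewrite Rabs_pos_eq; lra. }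
  set (sg := y - phi).
  assert (Csg : forall s x, Rabs x < psi -> 0 < s -> continuous f (polar s x)).
  { intros s x Hx Hs. apply (holo_on_continuous psi); auto. apply sector_polar; auto. }
  assert (Hth' := proj1 (Rabs_le_between _ _) Hth).
  assert (HR := rotated_difference_bound sg phi rho th dl e a b ltac:(lra) ltac:(fold psi0; lra) ltac:(unfold sg; lra) ltac:(lra) Hth ltac:(lra) He Ha Hab).
  specialize (HR ltac:(intros x u v Hx Hu Huv; apply HW; auto; lra)).
  assert (HD : forall u v, 0 < u -> u <= v -> RInt (fun t => Cmod (f (polar t phi) - polar 1 sg * f (polar t (phi + sg)))) u v <= e).
  { intros u v Hu Huv. replace (phi + sg) with y by (unfold sg; ring).
    rewrite (RInt_eq _ (fun t => Cmod (polar 1 phi * f (polar t phi) - polar 1 y * f (polar t y)))); auto. apply Hyb; lra.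
    intros t _. replace (polar 1 y) with (polar 1 sg * polar 1 phi)%C by (rewrite polar_rotate; f_equal; unfold sg; ring).
    generalize (f (polar t phi)) (f (polar t y)). intros p q.
    replace (polar 1 phi * p - polar 1 sg * polar 1 phi * q)%C with (polar 1 phi * (p - polar 1 sg * q))%C by ring.
    rewrite Cmod_mult, Cmod_polar by lra. ring. }
  specialize (HR HD). specialize (HD a b Ha Hab).
  assert (Hth2 : Rabs (th + sg) <= psi' + dl) by (apply Rabs_le; unfold sg; lra).
  assert (HI' := HI y rho (th + sg) a b ltac:(rewrite Rabs_pos_eq; lra) Hth2 ltac:(lra) Ha Hab).
  assert (Ez : forall t, ((polar t phi + polar rho th) * polar 1 sg)%C = (polar t y + polar rho (th + sg))%C).
  { intros t. rewrite Cmult_plus_distr_r, !polar_rotate. replace (phi + sg) with y by (unfold sg; ring). auto. }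
  assert (Ey : phi + sg = y) by (unfold sg; ring). rewrite Ey in HD.
  assert (Arc : forall t x c, 0 < t -> Rabs x < psi -> Rabs c <= psi' + dl -> continuous f (polar t x + polar rho c)%C).
  { intros t x c Ht Hx Hc. apply (holo_on_continuous psi); auto. apply sector_plus; auto; apply sector_polar; try lra; auto. fold psi0. lra. }
  assert (Hap : Rabs phi < psi) by (apply Rabs_def1; lra). assert (Hay : Rabs y < psi) by (apply Rabs_def1; lra).
  assert (CW : forall x c t, continuous (fun t => (polar t x + polar rho c)%C) t) by (intros; cont).
  assert (CF : forall x c, Rabs x < psi -> Rabs c <= psi' + dl -> forall t, a <= t <= b -> continuous (fun t => f (polar t x + polar rho c)%C) t).
  { intros x c Hx Hc t Ht. apply (continuous_Ccomp f (fun t => polar t x + polar rho c)%C); auto. apply Arc; auto; lra. }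
  assert (CF0 : forall x, Rabs x < psi -> forall t, a <= t <= b -> continuous (fun t => f (polar t x)) t).
  { intros x Hx t Ht. apply fc; auto; lra. }
  set (P := fun t => f (polar t phi + polar rho th)%C). set (Q := fun t => f (polar t phi)).
  set (P' := fun t => f (polar t y + polar rho (th + sg))%C). set (Q' := fun t => f (polar t y)).
  assert (CP : forall t, a <= t <= b -> continuous P t) by (apply CF; auto; lra).
  assert (CQ : forall t, a <= t <= b -> continuous Q t) by (apply CF0; auto).
  assert (CP' : forall t, a <= t <= b -> continuous P' t) by (apply CF; auto).
  assert (CQ' : forall t, a <= t <= b -> continuous Q' t) by (apply CF0; auto).
  assert (HR' : RInt (fun t => Cmod (P t - polar 1 sg * P' t)) a b <= 2 * e).
  { eapply Rle_trans; [right|exact HR]. apply RInt_eq; auto. intros t _. unfold P, P'. rewrite Ez. reflexivity. }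
  change (RInt (fun t => Cmod (P t - Q t)) a b <= eps).
  change (RInt (fun t => Cmod (Q t - polar 1 sg * Q' t)) a b <= e) in HD.
  change (RInt (fun t => Cmod (P' t - Q' t)) a b <= e) in HI'.
  clearbody P Q P' Q'.
  assert (T1 := ray_triangle (fun t => (P t - Q t)%C) (fun t => (P t - polar 1 sg * P' t)%C) (fun t => (Q t - polar 1 sg * P' t)%C) a b Hab).
  specialize (T1 ltac:(intros; cont; auto) ltac:(intros; cont; auto) ltac:(intros; cont; auto)).
  specialize (T1 ltac:(intros t; cbv beta; replace (P t - Q t)%C with ((P t - polar 1 sg * P' t) + - (Q t - polar 1 sg * P' t))%C by ring;
     eapply Rle_trans; [apply Cmod_triangle|]; rewrite Cmod_opp; lra)).
  assert (T2 := ray_triangle (fun t => (Q t - polar 1 sg * P' t)%C) (fun t => (Q t - polar 1 sg * Q' t)%C) (fun t => (P' t - Q' t)%C) a b Hab).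
  specialize (T2 ltac:(intros; cont; auto) ltac:(intros; cont; auto) ltac:(intros; cont; auto)).
  specialize (T2 ltac:(intros t; cbv beta; replace (Q t - polar 1 sg * P' t)%C with ((Q t - polar 1 sg * Q' t) + - (polar 1 sg * (P' t - Q' t)))%C by ring;
     eapply Rle_trans; [apply Cmod_triangle|]; rewrite Cmod_opp, Cmod_mult, (Cmod_polar 1) by lra; rewrite Rmult_1_l; lra)).
  cbv beta in T1, T2. unfold e in *. lra.
Qed.

End Continuity.

Lemma strong_continuity (psi psi' : R) (f : C -> C) (B eps : R) : 0 < psi < PI -> 0 <= psi' < Rmin psi (PI - psi) ->
  holo_on psi f -> (forall a, Rabs a < psi -> rayL1 f a B) -> 0 < eps ->
  exists d, 0 < d /\ forall tau, csector psi' tau -> Cmod tau < d ->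
    forall phi, Rabs phi < psi -> rayL1 (fun z => shift tau f z - f z)%C phi eps.
Proof.
  intros Hpsi Hpsi' Hf HB Heps.
  destruct (upper_continuity psi psi' f B Hpsi Hpsi' Hf HB eps Heps) as (d1 & Hd1 & H1).
  destruct (upper_continuity psi psi' (mirror f) B Hpsi Hpsi') with (eps := eps) as (d2 & Hd2 & H2); auto.
  { intros z (r & a & Hr & Ha & ->). apply holo_mirror. rewrite polar_conj. apply Hf, sector_polar; auto. rewrite Rabs_Ropp; auto. }
  { intros a Ha. apply rayL1_mirror, HB. rewrite Rabs_Ropp; auto. }
  exists (Rmin d1 d2). split. apply Rmin_pos; auto. generalize (Rmin_l d1 d2) (Rmin_r d1 d2). intros M1 M2.
  intros tau (rho & th & Hrho & Hth & ->) Ht phi Hphi a b Ha Hab. rewrite Cmod_polar in Ht by lra. apply Rabs_def2 in Hphi.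
  destruct (Rle_lt_dec 0 phi).
  - apply H1; lra.
  - eapply Rle_trans; [right|apply (H2 (- phi) rho (- th) a b); try rewrite Rabs_Ropp; lra].
    apply RInt_eq; auto. intros t _. unfold shift, mirror.
    rewrite <- Cmod_conj. apply f_equal. 
    replace (Cconj (polar t (- phi) + polar rho (- th))) with (polar t phi + polar rho th)%C.
    2:{ rewrite <- !polar_conj. Csolve. }
    rewrite (polar_conj t), Ropp_involutive.
    generalize (f (polar t phi + polar rho th)%C) (f (polar t phi)). intros p q. Csolve.
Qed.

(** * The semigroups *)

(** The Cauchy integrals once more, now with a supremum bound over a perimeter 8 l; the square of
    half side l lies in the disc of radius 2 l. *)
Lemma cauchy_square (f : C -> C) (p : C) (l S : R) : 0 < l ->
  (forall w, Cmod (w - p) <= 2 * l -> holo f w /\ Cmod (f w) <= S) ->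
  Cmod (C_derive f p) <= 2 / l * S /\
  forall k, Cmod k <= l / 2 -> Cmod (f (p + k)%C - f p - k * C_derive f p) <= 4 * (Cmod k * Cmod k) / (l * l) * S.
Proof.
  intros Hl Hf. destruct p as [u v]. set (p := (u, v) : C) in *. assert (HPI := PI2_1).
  assert (Q : forall x y, u - l <= x <= u + l -> v - l <= y <= v + l -> holo f (x, y) /\ Cmod (f (x, y)) <= S).
  { intros x y Hx Hy. apply Hf. eapply Rle_trans; [apply Cmod_le_sum|]. simpl.
    replace (2 * l) with (l + l) by ring. apply Rplus_le_compat; apply Rabs_le; lra. }
  assert (Hol : on_rect (holo f) (u - l) (u + l) (v - l) (v + l)) by (intros x y Hx Hy; apply Q; auto).
  assert (Hd : dist_bd p l (u - l) (u + l) (v - l) (v + l)) by (unfold dist_bd, p; simpl; lra).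
  assert (HS : 0 <= S). { eapply Rle_trans; [apply Cmod_ge_0|apply (Q u v)]; lra. }
  set (A := arect (fun z : C => Cmod (f z)) (u - l) (u + l) (v - l) (v + l)).
  assert (HA : A <= 8 * l * S).
  { assert (I : forall (gm : R -> C) a b, a <= b -> b - a = 2 * l -> (forall t, continuous gm t) ->
      (forall t, a <= t <= b -> holo f (gm t) /\ Cmod (f (gm t)) <= S) -> RInt (fun t => Cmod (f (gm t))) a b <= 2 * l * S).
    { intros gm a b Hab Hl' Cgm Hgm. rewrite <- Hl', <- RInt_Rconst. apply RInt_mono; auto.
      apply ex_RInt_Cmod; auto. intros t Ht. apply (continuous_Ccomp f gm); auto. apply ex_derive_C_continuous, Hgm; auto.
      apply ex_RInt_const. intros t Ht; apply Hgm; auto. }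
    unfold A, arect. replace (8 * l * S) with (2 * l * S + 2 * l * S + 2 * l * S + 2 * l * S) by ring.
    repeat apply Rplus_le_compat.
    - apply (I (fun x => (x, v - l))); try lra. intros; cont. intros; apply Q; lra.
    - apply (I (fun y => (u + l, y))); try lra. intros; cont. intros; apply Q; lra.
    - apply (I (fun x => (x, v + l))); try lra. intros; cont. intros; apply Q; lra.
    - apply (I (fun y => (u - l, y))); try lra. intros; cont. intros; apply Q; lra. }
  assert (HD : C_derive f p = cauchy_D1 f (u - l) (u + l) (v - l) (v + l) p).
  { apply C_derive_eq. apply (cauchy_D1_deriv _ _ _ _ _ _ l); auto. }
  assert (K : forall c, 0 <= c -> / (2 * PI) * (c * A) <= 2 * c * l * S).
  { intros c Hc. apply Rmult_le_reg_l with (2 * PI). lra. rewrite <- Rmult_assoc, Rinv_r, Rmult_1_l by lra.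
    apply Rle_trans with (c * (8 * l * S)). apply Rmult_le_compat_l; auto.
    assert (0 <= c * l * S) by (apply Rmult_le_pos; auto; apply Rmult_le_pos; lra).
    replace (c * (8 * l * S)) with (4 * (2 * c * l * S)) by ring. apply Rmult_le_compat_r; lra. }
  rewrite HD. split.
  - eapply Rle_trans; [apply (cauchy_D1_bound _ _ _ _ _ Hol p l Hl Hd)|]. fold A.
    eapply Rle_trans; [apply K; left; apply Rinv_0_lt_compat; nra|]. right; field; lra.
  - intros k Hk. eapply Rle_trans; [apply (cauchy_D1_taylor _ _ _ _ _ Hol p k l Hl Hd Hk)|]. fold A.
    assert (Hk0 := Cmod_ge_0 k).
    eapply Rle_trans; [apply K; apply Rdiv_le_0_compat; [nra|apply Rmult_lt_0_compat; [nra|lra]]|]. right; field; lra.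
Qed.

Lemma ray_variation (psi : R) (g h : C -> C) (phi e a b : R) :
  (forall z, sector psi z -> cderiv g z (h z)) -> (forall z, sector psi z -> continuous h z) ->
  Rabs phi < psi -> rayL1 h phi e -> 0 < a -> a <= b -> Cmod (g (polar b phi) - g (polar a phi)) <= e.
Proof.
  intros Hg Ch Hphi He Ha Hab.
  assert (E : forall t, (0 + RtoC t * polar 1 phi)%C = polar t phi) by (intros; Csolve).
  assert (F := CInt_FTC_line g h 0 (polar 1 phi) a b Hab).
  rewrite !E in F. rewrite <- F.
  - rewrite Cmod_mult, Cmod_polar, Rmult_1_l by lra.
    rewrite (CInt_eq _ (fun t => h (polar t phi))); auto. 2: intros t _; rewrite E; auto.
    eapply Rle_trans; [apply Cmod_CInt_le; auto|apply He; auto].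
    intros t Ht. apply (continuous_on_sector_ray psi); auto; lra.
  - intros t Ht. rewrite E. apply Hg, sector_polar; auto; lra.
  - intros t Ht. rewrite E. apply Ch, sector_polar; auto; lra.
Qed.

(** Scaling from t = 1: the distance of a point of the ray to the boundary is proportional to its
    modulus. *)
Lemma sector_ball (psi phi : R) : 0 < psi < PI -> Rabs phi < psi -> exists c, 0 < c /\
  forall t w, 0 < t -> Cmod (w - polar t phi) < c * t -> sector psi w.
Proof.
  intros Hpsi Hphi. destruct (sector_open psi (polar 1 phi) Hpsi) as (c & Hc & H). apply sector_polar; auto; lra.
  exists c. split; auto. intros t w Ht Hw.
  destruct (H (w / RtoC t)%C) as (r & th & Hr & Hth & E).
  - assert (Nt : RtoC t <> 0) by (intros E; injection E; lra).
    replace (w / RtoC t - polar 1 phi)%C with ((w - polar t phi) / RtoC t)%C.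
    2:{ replace (polar t phi) with (RtoC t * polar 1 phi)%C by Csolve. field; auto. }
    rewrite Cmod_div, Cmod_R, Rabs_pos_eq by (auto; lra). apply Rmult_lt_reg_r with t; auto.
    unfold Rdiv. rewrite Rmult_assoc, Rinv_l; lra.
  - exists (t * r), th. split. nra. split; auto.
    replace (polar (t * r) th) with (RtoC t * polar r th)%C by Csolve. rewrite <- E. field. intros E'; injection E'; lra.
Qed.

(** A function bounded by S on a disc of radius proportional to t has derivative O(S / t) at its
    centre, so a fixed shift changes it by O(|tau| S / t). *)
Lemma shift_difference_decay (psi : R) (f : C -> C) (S : R) (tau : C) (phi eta : R) : 0 < psi < PI -> holo_on psi f ->
  (forall z, sector psi z -> Cmod (f z) <= S) -> Rabs phi < psi -> 0 < eta ->
  exists T, 0 < T /\ forall t, T <= t -> Cmod (shift tau f (polar t phi) - f (polar t phi)) <= eta.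
Proof.
  intros Hpsi Hf HS Hphi Heta. destruct (sector_ball psi phi Hpsi Hphi) as (c & Hc & Hball).
  assert (HS0 : 0 <= S). { eapply Rle_trans; [apply Cmod_ge_0|apply (HS (polar 1 phi)), sector_polar; auto; lra]. }
  assert (Ht0 := Cmod_ge_0 tau). set (q := Cmod tau) in *.
  (* For l >= m, the shift is at most l / 2, as Cauchy's estimate requires, and 4 S q / l <= eta. *)
  set (m := 2 * q + 4 * S * q / eta + 1).
  assert (Hq : 0 <= 4 * S * q / eta) by (apply Rdiv_le_0_compat; auto; apply Rmult_le_pos; lra).
  exists (4 / c * m). split. { apply Rmult_lt_0_compat. apply Rdiv_lt_0_compat; lra. unfold m; lra. }
  intros t Ht. assert (Ht2 : 0 < t). { eapply Rlt_le_trans; [|exact Ht]. apply Rmult_lt_0_compat. apply Rdiv_lt_0_compat; lra. unfold m; lra. }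
  set (l := c * t / 4). assert (Hl : m <= l).
  { unfold l. apply Rle_trans with (c * (4 / c * m) / 4). right; field; lra. apply Rmult_le_compat_r. lra. apply Rmult_le_compat_l; lra. }
  assert (Hl0 : 0 < l) by (unfold l; nra).
  destruct (cauchy_square f (polar t phi) l S Hl0) as [D1 D2].
  { intros w Hw. assert (sector psi w). { apply (Hball t); auto. unfold l in Hw. nra. } split; auto. }
  specialize (D2 tau ltac:(fold q; unfold m in Hl; lra)). fold q in D2.
  unfold shift. set (X := (f (polar t phi + tau) - f (polar t phi) - tau * C_derive f (polar t phi))%C) in *.
  replace (f (polar t phi + tau) - f (polar t phi))%C with (X + tau * C_derive f (polar t phi))%C by (unfold X; ring).
  eapply Rle_trans; [apply Cmod_triangle|]. rewrite Cmod_mult. fold q.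
  assert (Hx : q / l <= 1 / 2).
  { apply Rmult_le_reg_r with l; auto. unfold Rdiv at 1. rewrite Rmult_assoc, Rinv_l by lra. unfold m in Hl; lra. }
  assert (Hx0 : 0 <= q / l) by (apply Rdiv_le_0_compat; lra).
  assert (B1 : q * Cmod (C_derive f (polar t phi)) <= 2 * S * (q / l)).
  { eapply Rle_trans; [apply Rmult_le_compat_l; [auto|exact D1]|]. right; field; lra. }
  assert (B2 : 4 * (q * q) / (l * l) * S <= 2 * S * (q / l)).
  { replace (4 * (q * q) / (l * l) * S) with (4 * S * (q / l) * (q / l)) by (field; lra).
    apply Rle_trans with (4 * S * (q / l) * (1 / 2)). apply Rmult_le_compat_l; auto. apply Rmult_le_pos; lra. right; field; lra. }
  assert (B3 : 4 * S * (q / l) <= eta).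
  { apply Rmult_le_reg_r with (l / eta). apply Rdiv_lt_0_compat; lra.
    replace (4 * S * (q / l) * (l / eta)) with (4 * S * q / eta) by (field; lra).
    replace (eta * (l / eta)) with l by (field; lra). unfold m in Hl; lra. }
  lra.
Qed.

Lemma supnorm_of_bound (psi : R) (f : C -> C) (S : R) : 0 < psi -> (forall z, sector psi z -> Cmod (f z) <= S) ->
  is_finite (supnorm_bar psi f) /\ 0 <= real (supnorm_bar psi f) <= S.
Proof.
  intros Hpsi HS. unfold supnorm_bar.
  set (E := fun x : R => exists z : C, sector psi z /\ x = Cmod (f z)).
  destruct (Lub_Rbar_correct E) as [H1 H2].
  assert (U : Rbar_le (Lub_Rbar E) S) by (apply H2; intros x (z & Hz & ->); apply HS; auto).
  assert (L : Rbar_le (Cmod (f (polar 1 0))) (Lub_Rbar E)).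
  { apply H1. exists (polar 1 0). split; auto. apply sector_polar. lra. rewrite Rabs_R0; auto. }
  destruct (Lub_Rbar E); simpl in *; try tauto. split. reflexivity. generalize (Cmod_ge_0 (f (polar 1 0))). lra.
Qed.

Lemma supnorm_ge (psi : R) (f : C -> C) (z : C) : is_finite (supnorm_bar psi f) -> sector psi z -> Cmod (f z) <= real (supnorm_bar psi f).
Proof.
  intros Hfin Hz. unfold supnorm_bar in *. set (E := fun x : R => exists z : C, sector psi z /\ x = Cmod (f z)) in *.
  destruct (Lub_Rbar_correct E) as [H1 _]. 
  assert (L : Rbar_le (Cmod (f z)) (Lub_Rbar E)) by (apply H1; exists z; auto).
  rewrite <- Hfin in L. exact L.
Qed.

Lemma rayL1_ext (psi : R) (g h : C -> C) (phi B : R) : (forall z, sector psi z -> g z = h z) -> Rabs phi < psi -> rayL1 g phi B -> rayL1 h phi B.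
Proof.
  intros E Hphi H a b Ha Hab. rewrite (RInt_eq (fun t => Cmod (h (polar t phi))) (fun t => Cmod (g (polar t phi)))); auto.
  intros t Ht. rewrite E; auto. apply sector_polar; auto; lra.
Qed.

Section Norms.

Variable psi : R.
Hypothesis Hpsi : 0 < psi < PI.

Lemma H1norm_nonneg (f : C -> C) : inH1 psi f -> 0 <= H1norm psi f.
Proof.
  intros [Hf Hfin]. assert (R0 : Rabs 0 < psi) by (rewrite Rabs_R0; lra).
  eapply Rle_trans; [|apply (H1_ray psi f 0 Hf Hfin R0 1 1); lra]. rewrite RInt_point. apply Rle_refl.
Qed.

Lemma inH1_of_rays (f : C -> C) (B : R) : holo_on psi f -> (forall phi, Rabs phi < psi -> rayL1 f phi B) ->
  inH1 psi f /\ 0 <= H1norm psi f <= 2 * B.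
Proof.
  intros Hf HB. destruct (H1norm_of_rays psi f B) as [H1 H2]; auto. lra. apply holo_on_continuous; auto. repeat split; auto; lra.
Qed.

Lemma inHpsi_of_bounds (f g : C -> C) (S B : R) : (forall z, sector psi z -> cderiv f z (g z)) ->
  (forall z, sector psi z -> Cmod (f z) <= S) -> (forall phi, Rabs phi < psi -> rayL1 g phi B) ->
  inHpsi psi f /\ 0 <= Hpsinorm psi f <= S + 2 * B.
Proof.
  intros Hg HS HB. assert (Hf : holo_on psi f) by (intros z Hz; exists (g z); apply Hg; auto).
  destruct (supnorm_of_bound psi f S) as [H1 H2]; auto; try lra.
  destruct (inH1_of_rays (C_derive f) B) as [H3 H4]. apply holo_on_derive; auto.
  - intros phi Hphi. apply (rayL1_ext psi g); auto. intros z Hz. symmetry. apply C_derive_eq, Hg; auto.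
  - split. split; auto. unfold Hpsinorm. lra.
Qed.

Lemma inHpsi_bounds (f : C -> C) : inHpsi psi f -> holo_on psi f /\ 0 <= Hpsinorm psi f /\
  (forall z, sector psi z -> Cmod (f z) <= Hpsinorm psi f) /\ holo_on psi (C_derive f) /\
  (forall phi, Rabs phi < psi -> rayL1 (C_derive f) phi (Hpsinorm psi f)).
Proof.
  intros (Hf & Hs & H1). assert (N := H1norm_nonneg _ H1). destruct H1 as [Hd Hfin]. unfold Hpsinorm.
  assert (HS : forall z, sector psi z -> Cmod (f z) <= real (supnorm_bar psi f)) by (intros; apply supnorm_ge; auto).
  assert (HS0 : 0 <= real (supnorm_bar psi f)).
  { eapply Rle_trans; [apply Cmod_ge_0|apply (HS (polar 1 0)), sector_polar]. lra. rewrite Rabs_R0; lra. }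
  repeat split; auto; try lra.
  - intros z Hz. specialize (HS z Hz). lra.
  - intros phi Hphi a b Ha Hab. generalize (H1_ray psi _ phi Hd Hfin Hphi a b Ha Hab). lra.
Qed.

Lemma cderiv_shift_on (f : C -> C) (tau z : C) : holo_on psi f -> sector (Rmin psi (PI - psi)) tau -> sector psi z ->
  cderiv (shift tau f) z (shift tau (C_derive f) z).
Proof. intros Hf Ht Hz. apply cderiv_shift, C_derive_holo, Hf, sector_plus; auto. Qed.

End Norms.

Section Semigroup.

Variable psi : R.
Hypothesis Hpsi : 0 < psi < PI.
Let psi0 := Rmin psi (PI - psi).

Lemma shift_plus (tau1 tau2 : C) (f : C -> C) : shift (tau1 + tau2) f = shift tau1 (shift tau2 f).
Proof. extensionality z. unfold shift. f_equal. ring. Qed.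

Definition quotient (tau h : C) (f g : C -> C) : C -> C :=
  fun z => ((shift (tau + h) f z - shift tau f z) / h - g z)%C.

Lemma cderiv_quotient (tau h : C) (f g g' : C -> C) (z : C) : holo_on psi f -> sector psi0 tau -> sector psi0 (tau + h) ->
  sector psi z -> cderiv g z (g' z) -> cderiv (quotient tau h f g) z (quotient tau h (C_derive f) g' z).
Proof.
  intros Hf Ht Hth Hz Hg. unfold quotient.
  apply (is_derive_Cminus (fun z => (shift (tau + h) f z - shift tau f z) / h)%C g); auto.
  replace ((shift (tau + h) (C_derive f) z - shift tau (C_derive f) z) / h)%C with
    ((shift (tau + h) (C_derive f) z - shift tau (C_derive f) z) * / h + (shift (tau + h) f z - shift tau f z) * 0)%C by (unfold Cdiv; ring).
  apply (is_derive_Cmult (fun z => (shift (tau + h) f z - shift tau f z)%C) (fun _ => (/ h)%C)).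
  apply is_derive_Cminus; apply (cderiv_shift_on psi); auto. apply is_derive_Cconst.
Qed.

Lemma zero_on_sector_rays (g : C -> C) phi : (forall z, sector psi z -> g z = 0) -> Rabs phi < psi -> rayL1 g phi 0.
Proof.
  intros Hg Hphi. apply (rayL1_ext psi (fun _ => 0)); auto. intros z Hz; rewrite Hg; auto.
  intros a b Ha Hab. rewrite Cmod_0, RInt_Rconst. lra.
Qed.

(** Nothing is known of [g] outside the sector, so the derivative is found from vanishing on a disc
    inside it. *)
Lemma cderiv_zero_on_sector (g : C -> C) z : (forall z, sector psi z -> g z = 0) -> sector psi z -> cderiv g z (RtoC 0).
Proof.
  intros Hg Hz. destruct (sector_open psi z Hpsi Hz) as (r & Hr & H). apply is_derive_C_eps. intros e He.
  exists r. split; auto. intros w Hw. rewrite (Hg w), (Hg z); auto.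
  replace (0 - 0 - 0 * (w - z))%C with (RtoC 0) by ring. rewrite Cmod_0. apply Rmult_le_pos. lra. apply Cmod_ge_0.
Qed.

(** [C_derive] is additive only where the functions are differentiable, so linearity of the
    derivative operator holds on the sector and is expressed by a defect of norm 0. *)
Lemma shift_derive_linear (tau : C) (f g : C -> C) (a z : C) : holo_on psi f -> holo_on psi g -> sector psi0 tau -> sector psi z ->
  (shift tau (C_derive (fun w => f w + a * g w)) z - (shift tau (C_derive f) z + a * shift tau (C_derive g) z))%C = 0.
Proof.
  intros Hf Hg Ht Hz. unfold shift. assert (Hz' := sector_plus psi z tau Hpsi Hz Ht).
  rewrite (C_derive_eq (fun w => f w + a * g w)%C (z + tau) (C_derive f (z + tau) + (0 * g (z + tau) + a * C_derive g (z + tau)))%C). ring.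
  apply is_derive_Cplus. apply C_derive_holo, Hf; auto.
  apply (is_derive_Cmult (fun _ => a) g). apply is_derive_Cconst. apply C_derive_holo, Hg; auto.
Qed.

Lemma H1_semigroup : bounded_holo_C0_shift_semigroup psi0 (inH1 psi) (H1norm psi).
Proof.
  assert (P0 := psi0_bounds psi Hpsi). fold psi0 in P0.
  assert (RB : forall f, inH1 psi f -> forall a, Rabs a < psi -> rayL1 f a (H1norm psi f)) by (intros f [Hf Hfin] a Ha; apply H1_ray; auto).
  assert (SB : forall psi' f tau, 0 <= psi' < psi0 -> csector psi' tau -> inH1 psi f ->
     inH1 psi (shift tau f) /\ H1norm psi (shift tau f) <= 2 * shift_const psi psi' * H1norm psi f).
  { intros psi' f tau Hpsi' Ht Hf. destruct (inH1_of_rays psi Hpsi (shift tau f) (shift_const psi psi' * H1norm psi f)) as [A1 A2].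
    - apply holo_on_shift; auto. apply Hf. apply (csector_sector psi'); auto; apply Hpsi'.
    - intros phi Hphi. apply shift_bounded; auto. apply Hf.
    - split; auto. lra. }
  split; [|split; [|split]].
  (* A single tau of the open sector lies in some closed subsector, where [shift_const] applies. *)
  - intros tau Ht. destruct (sector_margin psi0 tau ltac:(lra) Ht) as (psi' & r & Hpsi' & Hr & Hb).
    assert (Hc : csector psi' tau). { apply Hb. replace (tau - tau)%C with (RtoC 0) by ring. rewrite Cmod_0; auto. }
    split. intros f Hf. apply (SB psi'); auto. exists (2 * shift_const psi psi'). intros f Hf. apply SB; auto.
  - intros. apply shift_plus.
  (* The derivative of the semigroup at tau0. [C_derive f] itself need not lie in the space, but its
     shift does, by Cauchy's estimates in the shift variable. *)
  - intros tau0 Ht. exists (fun f => shift tau0 (C_derive f)).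
    destruct (shift_quotient_bound psi Hpsi tau0 Ht) as (C0 & d & HC0 & Hd & Hsec & HQ).
    assert (HA : forall f, inH1 psi f -> inH1 psi (shift tau0 (C_derive f)) /\ 0 <= H1norm psi (shift tau0 (C_derive f)) <= 2 * (C0 * H1norm psi f)).
    { intros f Hf. apply inH1_of_rays; auto. apply holo_on_shift; auto. apply holo_on_derive; auto; apply Hf.
      intros phi Hphi. exact (proj1 (HQ f _ (proj1 Hf) (RB f Hf) phi Hphi)). }
    split; [|split; [|split]].
    + intros f Hf. apply HA; auto.
    + intros f g a Hf Hg. set (D := fun z => _).
      assert (HD : forall z, sector psi z -> D z = 0) by (intros z Hz; exact (shift_derive_linear tau0 f g a z (proj1 Hf) (proj1 Hg) Ht Hz)).
      destruct (inH1_of_rays psi Hpsi D 0) as [_ E].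
      * intros z Hz. exists (RtoC 0). apply cderiv_zero_on_sector; auto.
      * intros phi Hphi. apply zero_on_sector_rays; auto.
      * lra.
    + exists (2 * C0). intros f Hf. generalize (HA f Hf). lra.
    + intros eps Heps. exists (Rmin d (eps / (2 * C0))). split. apply Rmin_pos; auto. apply Rdiv_lt_0_compat; lra.
      intros h Hh Hth f Hf. assert (Hh1 : Cmod h < d) by (eapply Rlt_le_trans; [apply Hh|apply Rmin_l]).
      assert (Hh2 : Cmod h < eps / (2 * C0)) by (eapply Rlt_le_trans; [apply Hh|apply Rmin_r]).
      assert (N := H1norm_nonneg psi Hpsi f Hf).
      destruct (inH1_of_rays psi Hpsi (quotient tau0 h f (shift tau0 (C_derive f))) (C0 * Cmod h * H1norm psi f)) as [_ E].
      * intros z Hz. eexists. apply (cderiv_quotient tau0 h f (shift tau0 (C_derive f)) (shift tau0 (C_derive (C_derive f)))); auto. apply Hf.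
        apply (cderiv_shift_on psi); auto. apply holo_on_derive; auto; apply Hf.
      * intros phi Hphi. apply (proj2 (HQ f (H1norm psi f) (proj1 Hf) (RB f Hf) phi Hphi)). split; auto. apply Hh.
      * unfold quotient in E. eapply Rle_trans; [apply E|]. rewrite <- Rmult_assoc. apply Rmult_le_compat_r; auto.
        apply Rle_trans with (2 * (C0 * (eps / (2 * C0)))). apply Rmult_le_compat_l. lra. apply Rmult_le_compat_l; lra. right; field; lra.
  - intros psi' Hpsi'. split.
    + exists (2 * shift_const psi psi'). intros tau Ht f Hf. apply SB; auto. lra.
    + intros f Hf eps Heps.
      destruct (strong_continuity psi psi' f (H1norm psi f) (eps / 2) Hpsi) as (d & Hd & H); auto; try lra. fold psi0; lra. apply Hf.
      exists d. split; auto. intros tau Ht Htd.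
      destruct (inH1_of_rays psi Hpsi (fun z => shift tau f z - f z)%C (eps / 2)) as [_ E]; auto.
      * intros z Hz. eexists. apply is_derive_Cminus. apply (cderiv_shift_on psi); auto. apply Hf. apply (csector_sector psi'); auto; apply Hpsi'.
        apply C_derive_holo, Hf; auto.
      * lra.
Qed.

Lemma Hpsi_semigroup : bounded_holo_C0_shift_semigroup psi0 (inHpsi psi) (Hpsinorm psi).
Proof.
  assert (P0 := psi0_bounds psi Hpsi). fold psi0 in P0.
  assert (SB : forall psi' f tau, 0 <= psi' < psi0 -> csector psi' tau -> inHpsi psi f ->
     inHpsi psi (shift tau f) /\ Hpsinorm psi (shift tau f) <= (1 + 2 * shift_const psi psi') * Hpsinorm psi f).
  { intros psi' f tau Hpsi' Ht Hf. destruct (inHpsi_bounds psi Hpsi f Hf) as (Hh & HN & HS & Hh' & HR).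
    assert (Hs : sector psi0 tau) by (apply (csector_sector psi'); auto; apply Hpsi').
    destruct (inHpsi_of_bounds psi Hpsi (shift tau f) (shift tau (C_derive f)) (Hpsinorm psi f) (shift_const psi psi' * Hpsinorm psi f)) as [A1 A2].
    - intros z Hz. apply (cderiv_shift_on psi); auto.
    - intros z Hz. apply HS, sector_plus; auto.
    - intros phi Hphi. apply shift_bounded; auto.
    - split; auto. lra. }
  split; [|split; [|split]].
  - intros tau Ht. destruct (sector_margin psi0 tau ltac:(lra) Ht) as (psi' & r & Hpsi' & Hr & Hb).
    assert (Hc : csector psi' tau). { apply Hb. replace (tau - tau)%C with (RtoC 0) by ring. rewrite Cmod_0; auto. }
    split. intros f Hf. apply (SB psi'); auto. exists (1 + 2 * shift_const psi psi'). intros f Hf. apply SB; auto.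
  - intros. apply shift_plus.
  - intros tau0 Ht. exists (fun f => shift tau0 (C_derive f)).
    destruct (shift_quotient_bound psi Hpsi tau0 Ht) as (C0 & d & HC0 & Hd & Hsec & HQ).
    (* The disc of radius 2 l around z + tau0 used by [cauchy_square] then consists of admissible
       shifts of z, for every z in the sector. *)
    set (l := d / 4). assert (Hl : 0 < l) by (unfold l; lra).
    assert (Sq : forall f, inHpsi psi f -> forall z, sector psi z -> Cmod (C_derive f (z + tau0)) <= 2 / l * Hpsinorm psi f /\
       forall k, Cmod k <= l / 2 -> Cmod (f (z + tau0 + k)%C - f (z + tau0)%C - k * C_derive f (z + tau0)%C) <= 4 * (Cmod k * Cmod k) / (l * l) * Hpsinorm psi f).
    { intros f Hf z Hz. destruct (inHpsi_bounds psi Hpsi f Hf) as (Hh & HN & HS & _). apply cauchy_square; auto.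
      intros w Hw. assert (sector psi w).
      { replace w with (z + (tau0 + (w - (z + tau0))))%C by ring. apply sector_plus; auto. apply Hsec. unfold l in *; lra. }
      split; auto. }
    assert (HA : forall f, inHpsi psi f -> inHpsi psi (shift tau0 (C_derive f)) /\
       0 <= Hpsinorm psi (shift tau0 (C_derive f)) <= 2 / l * Hpsinorm psi f + 2 * (C0 * Hpsinorm psi f)).
    { intros f Hf. destruct (inHpsi_bounds psi Hpsi f Hf) as (Hh & HN & HS & Hh' & HR).
      apply (inHpsi_of_bounds psi Hpsi (shift tau0 (C_derive f)) (shift tau0 (C_derive (C_derive f)))).
      - intros z Hz. apply (cderiv_shift_on psi); auto.
      - intros z Hz. exact (proj1 (Sq f Hf z Hz)).
      - intros phi Hphi. exact (proj1 (HQ (C_derive f) _ Hh' HR phi Hphi)). }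
    split; [|split; [|split]].
    + intros f Hf. apply HA; auto.
    + intros f g a Hf Hg. set (D := fun z => _).
      assert (HD : forall z, sector psi z -> D z = 0) by (intros z Hz; exact (shift_derive_linear tau0 f g a z (proj1 Hf) (proj1 Hg) Ht Hz)).
      destruct (inHpsi_of_bounds psi Hpsi D (fun _ => 0) 0 0) as [_ E].
      * intros z Hz. apply cderiv_zero_on_sector; auto.
      * intros z Hz. rewrite HD, Cmod_0 by auto. lra.
      * intros phi Hphi. apply zero_on_sector_rays; auto.
      * lra.
    + exists (2 / l + 2 * C0). intros f Hf. generalize (HA f Hf). lra.
    (* First summand: Taylor remainder of f in the supremum norm. Second: twice the ray bound for
       the quotient of [C_derive f]. *)
    + intros eps Heps. set (K := 4 / (l * l) + 2 * C0).
      assert (HK : 0 < 4 / (l * l)) by (apply Rdiv_lt_0_compat; nra). 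
      exists (Rmin (l / 2) (eps / K)). split. apply Rmin_pos. lra. apply Rdiv_lt_0_compat; unfold K; lra.
      intros h Hh Hth f Hf. assert (Hh1 : Cmod h < l / 2) by (eapply Rlt_le_trans; [apply Hh|apply Rmin_l]).
      assert (Hh2 : Cmod h < eps / K) by (eapply Rlt_le_trans; [apply Hh|apply Rmin_r]).
      destruct (inHpsi_bounds psi Hpsi f Hf) as (Hhf & HN & HS & Hh' & HR).
      destruct (inHpsi_of_bounds psi Hpsi (quotient tau0 h f (shift tau0 (C_derive f))) (quotient tau0 h (C_derive f) (shift tau0 (C_derive (C_derive f))))
         (4 / (l * l) * Cmod h * Hpsinorm psi f) (C0 * Cmod h * Hpsinorm psi f)) as [_ E].
      * intros z Hz. apply cderiv_quotient; auto. apply (cderiv_shift_on psi); auto.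
      * intros z Hz. unfold quotient, shift. assert (Nh : h <> 0) by (apply Cmod_gt_0; apply Hh).
        destruct (Sq f Hf z Hz) as [_ Q]. specialize (Q h ltac:(lra)). 
        replace (z + (tau0 + h))%C with (z + tau0 + h)%C by ring.
        replace ((f (z + tau0 + h) - f (z + tau0)) / h - C_derive f (z + tau0))%C with
          ((f (z + tau0 + h) - f (z + tau0) - h * C_derive f (z + tau0)) / h)%C by (field; auto).
        rewrite Cmod_div by auto. apply Rmult_le_reg_r with (Cmod h). apply Hh.
        unfold Rdiv at 1. rewrite Rmult_assoc, Rinv_l, Rmult_1_r by lra.
        eapply Rle_trans; [exact Q|]. right; field; lra.
      * intros phi Hphi. apply (proj2 (HQ (C_derive f) (Hpsinorm psi f) Hh' HR phi Hphi)). split. apply Hh. unfold l in *; lra.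
      * unfold quotient in E. eapply Rle_trans; [apply E|].
        replace (4 / (l * l) * Cmod h * Hpsinorm psi f + 2 * (C0 * Cmod h * Hpsinorm psi f)) with (Cmod h * K * Hpsinorm psi f) by (unfold K; field; lra).
        apply Rmult_le_compat_r; auto.
        apply Rle_trans with (eps / K * K). apply Rmult_le_compat_r; unfold K in *; lra. right; field; unfold K; lra.
  - intros psi' Hpsi'. split.
    + exists (1 + 2 * shift_const psi psi'). intros tau Ht f Hf. apply SB; auto. lra.
    + intros f Hf eps Heps. destruct (inHpsi_bounds psi Hpsi f Hf) as (Hhf & HN & HS & Hh' & HR).
      destruct (strong_continuity psi psi' (C_derive f) (Hpsinorm psi f) (eps / 4) Hpsi) as (d & Hd & H); auto; try lra. fold psi0; lra.
      exists d. split; auto. intros tau Ht Htd.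
      assert (Hs : sector psi0 tau) by (apply (csector_sector psi'); auto; apply Hpsi').
      set (g := fun z => (shift tau f z - f z)%C). set (g' := fun z => (shift tau (C_derive f) z - C_derive f z)%C).
      assert (Dg : forall z, sector psi z -> cderiv g z (g' z)).
      { intros z Hz. apply is_derive_Cminus. apply (cderiv_shift_on psi); auto. apply C_derive_holo, Hhf; auto. }
      assert (Cg : forall z, sector psi z -> continuous g' z).
      { intros z Hz. assert (Hc1 := holo_on_continuous psi _ (holo_on_shift psi Hpsi _ tau Hh' Hs) z Hz).
        assert (Hc2 := holo_on_continuous psi _ Hh' z Hz). apply (continuous_Cminus (shift tau (C_derive f)) (C_derive f)); auto. }
      destruct (inHpsi_of_bounds psi Hpsi g g' (eps / 4) (eps / 4)) as [_ E]; auto.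
      (* Follow the ray of z outwards until the difference is at most [eta]; on the way it varies by
         at most the L^1 norm of its derivative, which is at most eps / 4. *)
      * intros z (r & phi & Hr & Hphi & ->). apply le_epsilon. intros eta Heta.
        destruct (shift_difference_decay psi f (Hpsinorm psi f) tau phi eta Hpsi Hhf HS Hphi Heta) as (T & HT & HTd).
        assert (V := ray_variation psi g g' phi (eps / 4) r (Rmax r T) Dg Cg Hphi (H tau Ht Htd phi Hphi) Hr (Rmax_l _ _)).
        specialize (HTd (Rmax r T) (Rmax_r _ _)). change (Cmod (g (polar (Rmax r T) phi)) <= eta) in HTd.
        generalize (Cmod_sub_ge (g (polar r phi)) (g (polar (Rmax r T) phi))). rewrite Cmod_minus_sym. lra.
      * exact (H tau Ht Htd).
      * lra.
Qed.

End Semigroup.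

Theorem theorem11p5 (psi : R) (Hpsi : 0 < psi < PI) :
  bounded_holo_C0_shift_semigroup (Rmin psi (PI - psi)) (inH1 psi) (H1norm psi) /\
  bounded_holo_C0_shift_semigroup (Rmin psi (PI - psi)) (inHpsi psi) (Hpsinorm psi).
Proof. split; [apply H1_semigroup|apply Hpsi_semigroup]; exact Hpsi. Qed.
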